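(* Let $T>0$, $r\ge0$, $\rho\in[-1,1]$, functions $\mu(S,t),\sigma(S,t),a(H,t),b(H,t)$ and a payoff $g$ satisfy the standing assumptions in the context. For $\alpha\ge0$ let $P^\alpha$ be the solution on $G=(0,\infty)^2\times[0,T]$ of $$P_t+\tilde\mu(S,H,t)SP_S+rHP_H+\tfrac12\sigma^2S^2P_{SS}+\rho\sigma bSHP_{SH}+\tfrac12b^2H^2P_{HH}-rP=-\alpha\sqrt{1-\rho^2}\,\sigma(S,t)S|P_S|,\quad P(S,H,T)=g(S),$$ where $\tilde\mu(S,H,t)=\mu(S,t)-(a(H,t)-r)\rho\sigma(S,t)/b(H,t)$. If $0\le\alpha_1<\alpha_2$, then $P^{\alpha_1}\le P^{\alpha_2}$ on $G$.
   Context: Model: non-traded asset $dS=\mu(S,t)Sdt+\sigma(S,t)SdZ$, traded asset $dH=a(H,t)Hdt+b(H,t)HdW$, with $Z,W$ Brownian motions of correlation $\rho$; $\alpha$ is the writer's instantaneous Sharpe ratio. Solutions are continuous viscosity solutions in the class $\mathcal C$ of locally bounded $u$ on $G$ with $u/(1+(|\ln S|+|\ln H|)^k)\to0$ uniformly in $t$ as $|\ln S|+|\ln H|\to\infty$ for some $k>0$. Standing assumptions: (1) there are $C_1,\dots,C_4>0$ with $|\sigma(S_1,t)-\sigma(S_2,t)|\le C_1|\ln S_1-\ln S_2|$, $\sigma(S,t)\le C_2\sqrt{S(1+\ln S)}$, $|b(H_1,t)-b(H_2,t)|\le C_3|\ln H_1-\ln H_2|$, $b(H,t)\le C_4\sqrt{H(1+\ln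 H)}$, $\sigma,b$ differentiable in their first variable; (2) there are $K,C_5>0$ with $|\tilde\mu|\le K(1+|\ln S|+|\ln H|)$, $|\tilde\mu(S_1,H_1,t)-\tilde\mu(S_2,H_2,t)|\le C_5|\ln S_1-\ln S_2|$, $\tilde\mu$ differentiable in its first two variables; (3) $g(S)\le L(1+(\ln S)^{2\lambda})$ for some $L>0,\lambda\ge1$; (4) $\mu,\sigma,a,b$ bounded; (5) there is $\delta>0$ with $\sigma^2(e^x,t)\xi_1^2+2\rho\sigma(e^x,t)b(e^y,t)\xi_1\xi_2+b^2(e^y,t)\xi_2^2\ge\delta\sqrt{\xi_1^2+\xi_2^2}$ for all $\xi\in\mathbb R^2$.
   Formalization: Volatility σ>0 is assumed; (5) is read with δ(ξ1²+ξ2²), as the bound with the root is unsatisfiable for bounded σ, b; the bounds in (1) are read as C√(1+|ln S|), C√(1+|ln H|); the Lipschitz bound on μ̃ also allows a |ln H1−ln H2| term. *)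

(* Defs.v *)
From Stdlib Require Import Reals Lra.
From Coquelicot Require Import Coquelicot.
Open Scope R_scope.

(* Real power x^y for x >= 0, with the convention 0^y = 0 (y > 0). *)
Definition rpow (x y : R) : R := if Rle_dec x 0 then 0 else Rpower x y.

Definition inG (T S H t : R) : Prop := 0 < S /\ 0 < H /\ 0 <= t <= T.
Definition inGo (T S H t : R) : Prop := 0 < S /\ 0 < H /\ 0 < t < T.

Definition mut (r rho : R) (mu sigma a b : R -> R -> R) (S H t : R) : R :=
  mu S t - (a H t - r) * rho * sigma S t / b H t.

Definition dS (f : R -> R -> R -> R) (s h t : R) := Derive (fun x => f x h t) s.
Definition dH (f : R -> R -> R -> R) (s h t : R) := Derive (fun y => f s y t) h.
Definition dt (f : R -> R -> R -> R) (s h t : R) := Derive (fun z => f s h z) t.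
Definition dSS f (s h t : R) := Derive (fun x => dS f x h t) s.
Definition dSH f (s h t : R) := Derive (fun y => dS f s y t) h.
Definition dHH f (s h t : R) := Derive (fun y => dH f s y t) h.

Definition cont3 (f : R -> R -> R -> R) : Prop :=
  forall s h t eps, 0 < eps -> exists del, 0 < del /\
    forall s' h' t', Rabs (s' - s) < del -> Rabs (h' - h) < del ->
      Rabs (t' - t) < del -> Rabs (f s' h' t' - f s h t) < eps.

Definition C21 (phi : R -> R -> R -> R) : Prop :=
  (forall s h t,
      ex_derive (fun x => phi x h t) s /\ ex_derive (fun y => phi s y t) h /\
      ex_derive (fun z => phi s h z) t /\
      ex_derive (fun x => dS phi x h t) s /\ ex_derive (fun y => dS phi s y t) h /\
      ex_derive (fun y => dH phi s y t) h) /\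
  cont3 phi /\ cont3 (dS phi) /\ cont3 (dH phi) /\ cont3 (dt phi) /\
  cont3 (dSS phi) /\ cont3 (dSH phi) /\ cont3 (dHH phi).

(* The PDE written as  F = 0  with
   F = -P_t - (mu~ S P_S + r H P_H + 1/2 s^2 S^2 P_SS + rho s b S H P_SH
               + 1/2 b^2 H^2 P_HH) + r P - alpha sqrt(1-rho^2) s S |P_S|,
   which is equivalent to the equation of the paper; F is proper and
   degenerate elliptic (Crandall-Ishii-Lions convention). *)
Definition Fop (r rho : R) (mu sigma a b : R -> R -> R) (alpha : R)
    (S H t p pt pS pH pSS pSH pHH : R) : R :=
  - pt
  - (mut r rho mu sigma a b S H t * S * pS + r * H * pH
     + / 2 * (sigma S t) ^ 2 * S ^ 2 * pSS
     + rho * sigma S t * b H t * S * H * pSH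
     + / 2 * (b H t) ^ 2 * H ^ 2 * pHH)
  + r * p
  - alpha * sqrt (1 - rho ^ 2) * sigma S t * S * Rabs pS.

Definition FopPhi r rho mu sigma a b alpha (phi : R -> R -> R -> R) (p S H t : R) :=
  Fop r rho mu sigma a b alpha S H t p (dt phi S H t) (dS phi S H t) (dH phi S H t)
      (dSS phi S H t) (dSH phi S H t) (dHH phi S H t).

Definition loc_max (T : R) (u phi : R -> R -> R -> R) (S0 H0 t0 : R) : Prop :=
  exists del, 0 < del /\ forall S H t, inGo T S H t ->
    Rabs (S - S0) < del -> Rabs (H - H0) < del -> Rabs (t - t0) < del ->
    u S H t - phi S H t <= u S0 H0 t0 - phi S0 H0 t0.
Definition loc_min (T : R) (u phi : R -> R -> R -> R) (S0 H0 t0 : R) : Prop :=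
  exists del, 0 < del /\ forall S H t, inGo T S H t ->
    Rabs (S - S0) < del -> Rabs (H - H0) < del -> Rabs (t - t0) < del ->
    u S0 H0 t0 - phi S0 H0 t0 <= u S H t - phi S H t.

Definition contG (T : R) (u : R -> R -> R -> R) : Prop :=
  forall s h t, inG T s h t -> forall eps, 0 < eps -> exists del, 0 < del /\
    forall s' h' t', inG T s' h' t' -> Rabs (s' - s) < del -> Rabs (h' - h) < del ->
      Rabs (t' - t) < del -> Rabs (u s' h' t' - u s h t) < eps.

Definition visc_solution (T r rho : R) (mu sigma a b : R -> R -> R) (g : R -> R)
    (alpha : R) (u : R -> R -> R -> R) : Prop :=
  contG T u /\
  (forall phi S0 H0 t0, C21 phi -> inGo T S0 H0 t0 -> loc_max T u phi S0 H0 t0 ->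
     FopPhi r rho mu sigma a b alpha phi (u S0 H0 t0) S0 H0 t0 <= 0) /\
  (forall phi S0 H0 t0, C21 phi -> inGo T S0 H0 t0 -> loc_min T u phi S0 H0 t0 ->
     0 <= FopPhi r rho mu sigma a b alpha phi (u S0 H0 t0) S0 H0 t0) /\
  (forall S H, 0 < S -> 0 < H -> u S H T = g S).

Definition loc_bdd (T : R) (u : R -> R -> R -> R) : Prop :=
  forall s h t, inG T s h t -> exists del M, 0 < del /\
    forall s' h' t', inG T s' h' t' -> Rabs (s' - s) < del -> Rabs (h' - h) < del ->
      Rabs (t' - t) < del -> Rabs (u s' h' t') <= M.

Definition classC (T : R) (u : R -> R -> R -> R) : Prop :=
  loc_bdd T u /\
  exists k, 0 < k /\ forall eps, 0 < eps -> exists M, forall S H t, inG T S H t ->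
    M <= Rabs (ln S) + Rabs (ln H) ->
    Rabs (u S H t) / (1 + rpow (Rabs (ln S) + Rabs (ln H)) k) <= eps.

Definition standing (T r rho : R) (mu sigma a b : R -> R -> R) (g : R -> R) : Prop :=
  (exists C1 C2 C3 C4, 0 < C1 /\ 0 < C2 /\ 0 < C3 /\ 0 < C4 /\
    (forall S1 S2 t, 0 < S1 -> 0 < S2 -> 0 <= t <= T ->
       Rabs (sigma S1 t - sigma S2 t) <= C1 * Rabs (ln S1 - ln S2)) /\
    (forall S t, 0 < S -> 0 <= t <= T -> sigma S t <= C2 * sqrt (1 + Rabs (ln S))) /\
    (forall H1 H2 t, 0 < H1 -> 0 < H2 -> 0 <= t <= T ->
       Rabs (b H1 t - b H2 t) <= C3 * Rabs (ln H1 - ln H2)) /\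
    (forall H t, 0 < H -> 0 <= t <= T -> b H t <= C4 * sqrt (1 + Rabs (ln H))) /\
    (forall S t, 0 < S -> 0 <= t <= T -> ex_derive (fun x => sigma x t) S) /\
    (forall H t, 0 < H -> 0 <= t <= T -> ex_derive (fun y => b y t) H)) /\
  (exists K C5, 0 < K /\ 0 < C5 /\
    (forall S H t, inG T S H t ->
       Rabs (mut r rho mu sigma a b S H t) <= K * (1 + Rabs (ln S) + Rabs (ln H))) /\
    (forall S1 H1 S2 H2 t, inG T S1 H1 t -> inG T S2 H2 t ->
       Rabs (mut r rho mu sigma a b S1 H1 t - mut r rho mu sigma a b S2 H2 t)
         <= C5 * (Rabs (ln S1 - ln S2) + Rabs (ln H1 - ln H2))) /\
    (forall S H t, inG T S H t ->
       ex_derive (fun x => mut r rho mu sigma a b x H t) S /\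
       ex_derive (fun y => mut r rho mu sigma a b S y t) H)) /\
  (exists L lam, 0 < L /\ 1 <= lam /\
    forall S, 0 < S -> g S <= L * (1 + rpow ((ln S) ^ 2) lam)) /\
  (exists M, 0 < M /\ forall S H t, inG T S H t ->
     Rabs (mu S t) <= M /\ Rabs (sigma S t) <= M /\
     Rabs (a H t) <= M /\ Rabs (b H t) <= M) /\
  (exists delta, 0 < delta /\ forall S H t xi1 xi2, inG T S H t ->
     (sigma S t) ^ 2 * xi1 ^ 2 + 2 * rho * sigma S t * b H t * xi1 * xi2
       + (b H t) ^ 2 * xi2 ^ 2 >= delta * (xi1 ^ 2 + xi2 ^ 2)).

(* Main.v *)
Require Import Defs.
From Stdlib Require Import Reals Lra Lia List Classical ClassicalEpsilon Cantor.
From Coquelicot Require Import Coquelicot.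
Open Scope R_scope.

(** In the coordinates [x = ln S], [y = ln H], and after discounting, [P1] is a
    subsolution of the equation with [alpha2], so the claim is a comparison
    principle.  The coefficients may depend on [t] in a completely arbitrary
    (even non-measurable) way, which rules out doubling the time variable and
    the theorem on sums; instead a sub- and a supersolution are compared with
    one and the same smooth function over a short time step [tau].

    The data at the end of the step are replaced by a trigonometric polynomial,
    and the coefficients by their values at a fixed point in space, constant on
    the cells of a finite partition of the step into sets of times; on each set
    the polynomial evolves by an explicit Gaussian convolution.  That an
    arbitrary set of times may be treated as if it were measurable rests on a
    fact about continuous functions of time: if [M] has touching slopes from
    above [<= C] everywhere and [<= 0] on a set [Z], then [M b - M a] is at most
    [C] times the measure of the part of [[a, b]] on which [Z] does not have
    full outer measure.  Freezing costs [sqrt tau] times the time integral of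
    the second derivatives of the convolution.

    If second differences of the solution at distance [d] are [O(d ^ gam)], this
    cost is [O(tau ^ ((1 + gam) / 2))], and comparing second differences of the
    solution with those of the convolution improves [gam] to
    [2 (1 + gam) / 3].  Starting from a Hoelder estimate with [gam = 1/4], two
    improvements give [gam = 11/9 > 1], hence an error [O(tau ^ (10/9))] for one
    step.  It sums to [0] over [1 / tau] steps. *)

(** * Touching slopes of continuous functions *)

(** One function can serve both sides because freezing makes the equation linear up to a function of
    time: [|w_x|] is evaluated on the smooth function at the centre [(x0, y0)] and integrated into a
    scalar [N], the second-order part evolves the Gaussian covariance, and the rest is error. Adding
    the two one-sided estimates therefore eliminates the unknown [V + N]. Trigonometric polynomials
    are used because Gaussian convolution only multiplies their coefficients by exponentials, so the
    evolution is explicit and smooth in all variables; its bounds come from a random walk, which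
    avoids integrals over the plane. Uniform ellipticity enters twice: through the lower bound of
    the covariance, which controls the second derivatives of [V], and through a lower bound on
    [|b|], which makes the drift bounded. Exponents in the code refer to squared distances:
    [h = gam / 2] runs through 1/8, 5/12, 11/18, and the threshold is 1/2, where the error
    [tau ^ (h + 1/2)] of a step becomes [o(tau)]. *)

Definition infon (g : R -> R) (a b : R) : R :=
  real (Glb_Rbar (fun v => exists x, a <= x <= b /\ v = g x)).

Lemma infon_spec (g : R -> R) (a b m : R) :
  a <= b -> (forall x, a <= x <= b -> m <= g x) ->
  (forall x, a <= x <= b -> infon g a b <= g x) /\
  (forall k, (forall x, a <= x <= b -> k <= g x) -> k <= infon g a b).
Proof.
  intros Hab Hm. unfold infon.
  destruct (Glb_Rbar_correct (fun v => exists x, a <= x <= b /\ v = g x)) as [H1 H2].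
  destruct (Glb_Rbar (fun v => exists x, a <= x <= b /\ v = g x)) as [l| |].
  - split.
    + intros x Hx. apply (H1 (g x)). exists x; auto.
    + intros k Hk. apply (H2 (Finite k)). intros v (x & Hx & ->). simpl. auto.
  - exfalso. apply (H1 (g a)). exists a; split; [lra|auto].
  - exfalso. assert (Hc := H2 (Finite m)). simpl in Hc. apply Hc.
    intros v (x & Hx & ->). simpl. auto.
Qed.

Definition expands (Phi : R -> R) (x y : R) : Prop :=
  forall u v, x <= u -> u <= v -> v <= y -> v - u <= Phi v - Phi u.

(** [Phi] is a monotone witness that [Z] has small Lebesgue outer measure: it
    grows at least at unit speed near every point of [Z], so that its total
    variation bounds the measure of an open set containing [Z]. *)
Definition cover (Z : R -> Prop) (a b : R) (Phi : R -> R) : Prop :=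
  (forall x y, a <= x -> x <= y -> y <= b -> Phi x <= Phi y) /\
  (forall s, a <= s <= b -> Z s -> exists r, 0 < r /\
     forall x y, a <= x -> s - r < x -> x <= y -> y <= b -> y < s + r ->
       y - x <= Phi y - Phi x).

Definition clamp (a b x : R) : R := Rmax a (Rmin b x).

Lemma clamp_in (a b x : R) : a <= b -> a <= clamp a b x <= b.
Proof.
  intros H. unfold clamp. split. apply Rmax_l.
  apply Rmax_lub; auto. apply Rmin_l.
Qed.

Lemma clamp_id (a b x : R) : a <= x <= b -> clamp a b x = x.
Proof.
  intros H. unfold clamp. rewrite Rmin_right by lra. apply Rmax_right; lra.
Qed.

Lemma clamp_lip (a b x y : R) : Rabs (clamp a b x - clamp a b y) <= Rabs (x - y).
Proof.
  unfold clamp, Rmax, Rmin.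
  destruct (Rle_dec b x), (Rle_dec b y); repeat destruct (Rle_dec _ _);
    unfold Rabs; repeat destruct (Rcase_abs _); lra.
Qed.

(** The infimal convolution [inf_{s' <= s} E s' + c (s - s')] has slope [c] near
    every point where [E] has a steeper chord to the left. *)
Lemma left_cover (E : R -> R) (a b c : R) (Z : R -> Prop) :
  a <= b -> 0 < c ->
  (forall x y, a <= x -> x <= y -> y <= b -> E x <= E y) ->
  (forall s, a <= s <= b -> Z s -> exists s' r, a <= s' /\ 0 < r /\ s' <= s - r /\
     forall z, a <= z <= b -> Rabs (z - s) < r -> E s' - c * s' <= E z - c * z) ->
  exists Phi, cover Z a b Phi /\ Phi b - Phi a <= (E b - E a) / c /\
    (forall x, continuity_pt Phi x).
Proof.
  intros Hab Hc HE HZ.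
  set (g := fun s => E s - c * s).
  assert (Hinf : forall s, a <= s <= b ->
    (forall x, a <= x <= s -> infon g a s <= g x) /\
    (forall k, (forall x, a <= x <= s -> k <= g x) -> k <= infon g a s)).
  { intros s Hs. apply (infon_spec g a s (E a - c * b)); [lra|].
    intros x Hx. unfold g. assert (E a <= E x) by (apply HE; lra). nra. }
  set (K := fun s => infon g a s + c * s).
  assert (Kmono : forall x y, a <= x -> x <= y -> y <= b ->
     K x <= K y <= K x + c * (y - x)).
  { intros x y Hx Hxy Hy. unfold K.
    destruct (Hinf x) as [H1 H2]; [lra|]. destruct (Hinf y) as [H3 H4]; [lra|]. split.
    - assert (infon g a x + c * x - c * y <= infon g a y); [|lra].
      apply H4. intros z Hz. destruct (Rle_dec z x) as [Hzx|Hzx].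
      + specialize (H1 z (conj (proj1 Hz) Hzx)). nra.
      + specialize (H1 x (conj Hx (Rle_refl x))). unfold g in *.
        assert (E x <= E z) by (apply HE; lra). nra.
    - assert (infon g a y <= infon g a x); [|lra].
      apply H2. intros z Hz. apply H3. lra. }
  exists (fun s => K (clamp a b s) / c). split; [split|split].
  - intros x y Hx Hxy Hy. rewrite !clamp_id by lra.
    apply Rmult_le_compat_r. left; apply Rinv_0_lt_compat; auto.
    apply Kmono; auto.
  - intros s Hs Zs. destruct (HZ s Hs Zs) as (s' & r & Hs' & Hr & Hsr & Hz).
    exists r. split; auto. intros x y Hx Hsx Hxy Hy Hys.
    rewrite !clamp_id by lra.
    assert (infon g a x <= infon g a y).
    { destruct (Hinf x) as [H1 H2]; [lra|]. destruct (Hinf y) as [H3 H4]; [lra|].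
      apply H4. intros z Hzz. destruct (Rle_dec z x) as [Hzx|Hzx].
      - apply H1; lra.
      - apply Rle_trans with (g s'). apply H1; lra. unfold g. apply Hz. lra.
        apply Rabs_def1; lra. }
    apply Rmult_le_reg_r with c; auto.
    replace ((K y / c - K x / c) * c) with (K y - K x) by (field; lra).
    unfold K. lra.
  - rewrite !clamp_id by lra.
    replace (K b / c - K a / c) with ((K b - K a) / c) by (field; lra).
    apply Rmult_le_compat_r. left; apply Rinv_0_lt_compat; auto.
    destruct (Hinf a) as [H1 H2]; [lra|]. destruct (Hinf b) as [H3 H4]; [lra|].
    assert (infon g a b <= g b) by (apply H3; lra).
    assert (g a <= infon g a a).
    { apply H2. intros x Hx. replace x with a by lra. lra. }
    unfold K, g in *. lra.
  - intros x eps Heps. exists eps. split; auto. intros y [_ Hy].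
    simpl in *. unfold R_dist in *.
    assert (Hcl := clamp_lip a b y x).
    assert (Hy' := clamp_in a b y Hab). assert (Hx' := clamp_in a b x Hab).
    assert (HK : Rabs (K (clamp a b y) - K (clamp a b x)) <= c * Rabs (clamp a b y - clamp a b x)).
    { destruct (Rle_dec (clamp a b x) (clamp a b y)) as [h|h].
      - destruct (Kmono (clamp a b x) (clamp a b y)); try lra.
        rewrite !Rabs_pos_eq; lra.
      - destruct (Kmono (clamp a b y) (clamp a b x)); try lra.
        rewrite (Rabs_left1 (clamp a b y - _)) by lra. rewrite Rabs_left1; lra. }
    replace (K (clamp a b y) / c - K (clamp a b x) / c)
      with ((K (clamp a b y) - K (clamp a b x)) * / c) by (field; lra).
    rewrite Rabs_mult. rewrite (Rabs_pos_eq (/ c)).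
    2: left; apply Rinv_0_lt_compat; auto.
    apply Rle_lt_trans with (Rabs (clamp a b y - clamp a b x)); [|lra].
    apply Rmult_le_reg_r with c; auto. rewrite Rmult_assoc, Rinv_l by lra. lra.
Qed.

Lemma cont_ed (f : R -> R) (x eps : R) : continuity_pt f x -> 0 < eps ->
  exists d, 0 < d /\ forall y, Rabs (y - x) < d -> Rabs (f y - f x) < eps.
Proof.
  intros H He. destruct (H eps He) as (d & Hd & H1). exists d. split; auto.
  intros y Hy. destruct (Req_dec y x) as [->|Hn].
  - rewrite Rminus_diag, Rabs_R0. auto.
  - apply H1. split. split. exact I. auto. exact Hy.
Qed.

(** One step of F. Riesz's argument: where the right slopes of a monotone [F] are
    below [kap] and its left slopes above [c > kap], a cover can be improved by
    the factor [kap / c]. *)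
Lemma riesz_shrink (F Phi : R -> R) (a b kap c : R) (N : R -> Prop) :
  a < b -> 0 < kap -> 0 < c ->
  (forall x y, a <= x -> x <= y -> y <= b -> F x <= F y) ->
  (forall x, continuity_pt F x) ->
  (forall s, N s -> a < s < b) ->
  (forall s, N s -> forall d, 0 < d -> exists s', s < s' < s + d /\ F s' - F s < kap * (s' - s)) ->
  (forall s, N s -> forall d, 0 < d -> exists s', s - d < s' < s /\ F s - F s' > c * (s - s')) ->
  cover N a b Phi -> (forall x, continuity_pt Phi x) ->
  exists Phi', cover N a b Phi' /\ (forall x, continuity_pt Phi' x) /\
     Phi' b - Phi' a <= kap / c * (Phi b - Phi a).
Proof.
  intros Hab Hk Hc HF FC HN NR NL [PM PZ] PC.
  set (G := fun s => F s - kap * Phi s).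
  assert (GC : forall x, continuity_pt G x).
  { intros x. apply continuity_pt_minus. apply FC.
    apply (continuity_pt_scal Phi kap). apply PC. }
  assert (Hinf : forall s, a <= s <= b ->
    (forall x, s <= x <= b -> infon G s b <= G x) /\
    (forall k, (forall x, s <= x <= b -> k <= G x) -> k <= infon G s b)).
  { intros s Hs. apply (infon_spec G s b (F a - kap * Phi b)); [lra|].
    intros x Hx. unfold G. assert (F a <= F x) by (apply HF; lra).
    assert (Phi x <= Phi b) by (apply PM; lra). nra. }
  (* By the choice of [G], the total growth of [E] is at most [kap] times that of [Phi]. Near a
     point of [N] the infimum of [G] over the points to the right is locally constant, because some
     later point has a smaller value of [G]; so [E] has the increments of [F] there and keeps its
     steep left chords. *)
  set (E := fun s => F s - infon G s b).
  destruct (left_cover E a b c N) as (Phi' & H1 & H2 & H3); try lra.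
  - intros x y Hx Hxy Hy. unfold E.
    assert (infon G y b - (F y - F x) <= infon G x b); [|lra].
    destruct (Hinf x) as [I1 I2]; [lra|]. destruct (Hinf y) as [I3 I4]; [lra|].
    apply I2. intros z Hz. assert (F x <= F y) by (apply HF; lra).
    destruct (Rle_dec y z).
    + specialize (I3 z). lra.
    + assert (Hy1 := I3 y). unfold G in *. assert (F x <= F z) by (apply HF; lra).
      assert (Phi z <= Phi y) by (apply PM; lra). nra.
  - intros s Hs Ns. destruct (HN s Ns) as [Hs1 Hs2].
    destruct (PZ s Hs Ns) as (r0 & Hr0 & Hexp).
    assert (Hd1 : 0 < Rmin r0 (b - s)) by (apply Rmin_glb_lt; lra).
    destruct (NR s Ns _ Hd1) as (s1 & [Hs1a Hs1b] & Hs1c).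
    assert (Hm1 := Rmin_l r0 (b - s)). assert (Hm2 := Rmin_r r0 (b - s)).
    assert (HG : G s1 < G s).
    { unfold G. assert (s1 - s <= Phi s1 - Phi s) by (apply Hexp; lra). nra. }
    destruct (cont_ed G s (G s - G s1) (GC s)) as (d1 & Hd1' & Hd1c); [lra|].
    set (r1 := Rmin d1 (Rmin (s1 - s) (s - a))).
    assert (Hr1 : 0 < r1) by (unfold r1; repeat apply Rmin_glb_lt; lra).
    assert (Hr1a : r1 <= d1) by apply Rmin_l.
    assert (Hr1b : r1 <= s1 - s) by (eapply Rle_trans; [apply Rmin_r|apply Rmin_l]).
    assert (Hr1c : r1 <= s - a) by (eapply Rle_trans; [apply Rmin_r|apply Rmin_r]).
    assert (Hflat : forall x y, s - r1 < x -> x <= y -> y < s + r1 ->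
               infon G x b = infon G y b).
    { intros x y Hx Hxy Hy.
      destruct (Hinf x) as [I1 I2]; [lra|]. destruct (Hinf y) as [I3 I4]; [lra|].
      apply Rle_antisym.
      - apply I4. intros z Hz. apply I1. lra.
      - apply I2. intros z Hz. destruct (Rle_dec y z). apply I3; lra.
        apply Rle_trans with (G s1). apply I3; lra.
        assert (Hz1 : Rabs (z - s) < d1) by (apply Rabs_def1; lra).
        apply Hd1c in Hz1. apply Rabs_def2 in Hz1. lra. }
    destruct (NL s Ns r1 Hr1) as (s2 & [Hs2a Hs2b] & Hs2c).
    set (g := fun z => F z - c * z).
    assert (gC : continuity_pt g s).
    { apply continuity_pt_minus. apply FC. apply (continuity_pt_scal (fun x => x) c).
      apply continuity_pt_id. }
    destruct (cont_ed g s (g s - g s2) gC) as (d2 & Hd2 & Hd2c); [unfold g; lra|].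
    set (r2 := Rmin d2 (Rmin (s - s2) r1)).
    assert (Hr2 : 0 < r2) by (unfold r2; repeat apply Rmin_glb_lt; lra).
    assert (Hr2a : r2 <= d2) by apply Rmin_l.
    assert (Hr2b : r2 <= s - s2) by (eapply Rle_trans; [apply Rmin_r|apply Rmin_l]).
    assert (Hr2c : r2 <= r1) by (eapply Rle_trans; [apply Rmin_r|apply Rmin_r]).
    exists s2, r2. split; [lra|]. split; auto. split; [lra|].
    intros z Hz Hzs. assert (Hz' := Rabs_def2 _ _ Hzs).
    assert (Hz2 := Hd2c z). apply Rabs_def2 in Hz2; [|lra].
    unfold E. unfold g in *.
    assert (infon G s2 b = infon G z b) by (apply Hflat; lra). lra.
  - exists Phi'. split; auto. split; auto.
    eapply Rle_trans; [exact H2|].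
    unfold Rdiv. rewrite (Rmult_comm kap), Rmult_assoc, (Rmult_comm (E b - E a)).
    apply Rmult_le_compat_l. left; apply Rinv_0_lt_compat; auto.
    destruct (Hinf a) as [I1 I2]; [lra|]. destruct (Hinf b) as [I3 I4]; [lra|].
    assert (infon G a b <= G a) by (apply I1; lra).
    assert (G b <= infon G b b).
    { apply I4. intros x Hx. replace x with b by lra. lra. }
    unfold E, G in *. lra.
Qed.

Definition runsup (g : R -> R) (t : R) : R := - infon (fun x => - g x) 0 (Rmax 0 t).

Lemma runsup_spec (g : R -> R) (t : R) : (forall x, continuity_pt g x) ->
  (forall x, 0 <= x <= Rmax 0 t -> g x <= runsup g t) /\
  (forall k, (forall x, 0 <= x <= Rmax 0 t -> g x <= k) -> runsup g t <= k).
Proof.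
  intros Hg. unfold runsup.
  assert (H0 : 0 <= Rmax 0 t) by apply Rmax_l.
  destruct (continuity_ab_maj g 0 (Rmax 0 t) H0) as (m & Hm & _).
  { intros; apply Hg. }
  destruct (infon_spec (fun x => - g x) 0 (Rmax 0 t) (- g m) H0) as [H1 H2].
  { intros x Hx. apply Ropp_le_contravar. apply Hm; auto. }
  split.
  - intros x Hx. specialize (H1 x Hx). lra.
  - intros k Hk. assert (- k <= infon (fun x => - g x) 0 (Rmax 0 t)); [|lra].
    apply H2. intros x Hx. specialize (Hk x Hx). lra.
Qed.

Lemma runsup_mono (g : R -> R) (s t : R) : (forall x, continuity_pt g x) ->
  s <= t -> runsup g s <= runsup g t.
Proof.
  intros Hg H. destruct (runsup_spec g s Hg) as [_ H2]. destruct (runsup_spec g t Hg) as [H1 _].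
  apply H2. intros x Hx. apply H1. assert (Rmax 0 s <= Rmax 0 t) by (apply Rle_max_compat_l; auto). lra.
Qed.

Lemma runsup_cont (g : R -> R) (t : R) : (forall x, continuity_pt g x) ->
  continuity_pt (runsup g) t.
Proof.
  intros Hg. intros eps Heps.
  destruct (cont_ed g (Rmax 0 t) (eps / 4) (Hg _)) as (d & Hd & Hd1); [lra|].
  exists d. split; auto. intros y [_ Hy]. simpl in *. unfold R_dist in *.
  assert (Hmx : Rabs (Rmax 0 y - Rmax 0 t) < d).
  { apply Rle_lt_trans with (Rabs (y - t)); auto. unfold Rmax.
    repeat destruct (Rle_dec _ _); unfold Rabs; repeat destruct (Rcase_abs _); lra. }
  destruct (runsup_spec g t Hg) as [A1 A2]. destruct (runsup_spec g y Hg) as [B1 B2].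
  assert (Ht0 : 0 <= Rmax 0 t) by apply Rmax_l. assert (Hy0 : 0 <= Rmax 0 y) by apply Rmax_l.
  apply Rabs_def2 in Hmx.
  assert (runsup g y <= runsup g t + eps / 4).
  { apply B2. intros x Hx. destruct (Rle_dec x (Rmax 0 t)).
    - specialize (A1 x). lra.
    - assert (Rabs (g x - g (Rmax 0 t)) < eps / 4) by (apply Hd1; apply Rabs_def1; lra).
      apply Rabs_def2 in H. specialize (A1 (Rmax 0 t)). lra. }
  assert (runsup g t <= runsup g y + eps / 2).
  { apply A2. intros x Hx. destruct (Rle_dec x (Rmax 0 y)).
    - specialize (B1 x). lra.
    - assert (Rabs (g x - g (Rmax 0 t)) < eps / 4) by (apply Hd1; apply Rabs_def1; lra).
      assert (Rabs (g (Rmax 0 y) - g (Rmax 0 t)) < eps / 4) by (apply Hd1; apply Rabs_def1; lra).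
      apply Rabs_def2 in H0, H1. specialize (B1 (Rmax 0 y)). lra. }
  apply Rabs_def1; lra.
Qed.

(** The touching function is C^1, not merely differentiable, because it later becomes the time part
    of a test function in the class [C21]. *)
Definition touch (M psi dpsi : R -> R) (s : R) : Prop :=
  (forall x, is_derive psi x (dpsi x)) /\ (forall x, continuity_pt dpsi x) /\
  exists del, 0 < del /\
    forall x, Rabs (x - s) < del -> M x - psi x <= M s - psi s.

Lemma continuity_pt_opp_arg (f : R -> R) (x : R) :
  continuity_pt f (- x) -> continuity_pt (fun y => f (- y)) x.
Proof.
  intros H. apply (continuity_pt_comp (fun y => - y) f); auto.
  apply continuity_pt_opp. apply continuity_pt_id.
Qed.

(** [Psi r = int_0^(2r) S] with [S] the running supremum of the relative error
    [(M (s+r) - M s - p r)^+ / r]; the factor 2 makes [Psi r >= r * S r]. *)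
Lemma C1_touch (M : R -> R) (s p : R) :
  (forall x, continuity_pt M x) ->
  (forall eps, 0 < eps -> exists d, 0 < d /\ forall x, Rabs (x - s) < d ->
     M x <= M s + p * (x - s) + eps * Rabs (x - s)) ->
  exists psi dpsi, touch M psi dpsi s /\ dpsi s = p.
Proof.
  intros MC Ho.
  set (e := fun r => Rmax 0 (M (s + r) - M s - p * r)).
  set (q := fun r => e r / Rabs r).
  assert (e0 : forall r, 0 <= e r) by (intros; apply Rmax_l).
  assert (q0 : q 0 = 0).
  { unfold q, e. replace (M (s + 0) - M s - p * 0) with 0 by (rewrite Rplus_0_r; ring).
    rewrite Rmax_left by lra. unfold Rdiv; ring. }
  assert (qpos : forall r, 0 <= q r).
  { intros r. unfold q. destruct (Req_dec r 0) as [->|Hr].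
    - change (0 <= q 0). rewrite q0; lra.
    - apply Rmult_le_pos; auto. left. apply Rinv_0_lt_compat. apply Rabs_pos_lt; auto. }
  assert (eC : forall r, continuity_pt e r).
  { intros r. unfold e.
    assert (Hin : continuity_pt (fun r => M (s + r) - M s - p * r) r).
    { apply continuity_pt_minus. apply continuity_pt_minus.
      apply (continuity_pt_comp (fun r => s + r) M). apply continuity_pt_plus.
      apply continuity_pt_const; intros ? ?; auto. apply continuity_pt_id. apply MC.
      apply continuity_pt_const; intros ? ?; auto.
      apply (continuity_pt_scal (fun r => r) p). apply continuity_pt_id. }
    intros eps Heps. destruct (Hin eps Heps) as (d & Hd & H). exists d; split; auto.
    intros x Hx. specialize (H x Hx). simpl in *. unfold R_dist in *.
    eapply Rle_lt_trans; [|exact H]. unfold Rmax.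
    repeat destruct (Rle_dec _ _); unfold Rabs; repeat destruct (Rcase_abs _); lra. }
  assert (qC : forall r, continuity_pt q r).
  { intros r. destruct (Req_dec r 0) as [->|Hr].
    - intros eps Heps. destruct (Ho (eps / 2)) as (d & Hd & H); [lra|].
      exists d; split; auto. intros x [[_ Hx1] Hx2]. simpl in *. unfold R_dist in *.
      rewrite q0, Rminus_0_r, Rabs_pos_eq by auto. rewrite Rminus_0_r in Hx2.
      assert (Hx : 0 < Rabs x) by (apply Rabs_pos_lt; auto).
      unfold q. apply Rmult_lt_reg_r with (Rabs x); auto. unfold Rdiv.
      rewrite Rmult_assoc, Rinv_l, Rmult_1_r by lra.
      apply Rle_lt_trans with (eps / 2 * Rabs x); [|nra]. unfold e. apply Rmax_lub.
      + nra.
      + specialize (H (s + x)). replace (s + x - s) with x in H by ring.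
        specialize (H Hx2). lra.
    - apply continuity_pt_div. apply eC. apply Rcontinuity_abs. apply Rabs_no_R0; auto. }
  set (q2 := fun r => q r + q (- r)).
  assert (q2C : forall r, continuity_pt q2 r).
  { intros r. apply continuity_pt_plus. apply qC. apply continuity_pt_opp_arg, qC. }
  set (S := runsup q2).
  assert (SC : forall r, continuity_pt S r) by (intros; apply runsup_cont; auto).
  (* [S] vanishes on the negative half-line, so [Sd] is its odd extension and the primitive [Psi] is
     even: one function bounds the error on both sides of [s]. *)
  set (Sd := fun r => S r - S (- r)).
  assert (SdC : forall r, continuity_pt Sd r).
  { intros r. apply continuity_pt_minus. apply SC. apply continuity_pt_opp_arg, SC. }
  assert (S0 : forall r, r <= 0 -> S r = 0).
  { intros r Hr. destruct (runsup_spec q2 r q2C) as [H1 H2]. unfold S.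
    rewrite Rmax_left in H1, H2 by auto.
    assert (q2 0 = 0) by (unfold q2; rewrite Ropp_0, q0; ring).
    apply Rle_antisym.
    - apply H2. intros x Hx. replace x with 0 by lra. lra.
    - rewrite <- H. apply H1. lra. }
  assert (Sq : forall r, 0 <= r -> q r <= S r /\ q (- r) <= S r).
  { intros r Hr. destruct (runsup_spec q2 r q2C) as [H1 _].
    assert (q2 r <= S r). { apply H1. rewrite Rmax_right; lra. }
    unfold q2 in H. assert (A := qpos r). assert (B := qpos (- r)). lra. }
  assert (Sdint : forall u v, ex_RInt Sd u v).
  { intros u v. apply (ex_RInt_continuous Sd). intros z _. apply continuity_pt_filterlim. apply SdC. }
  set (Psi := fun r => RInt Sd 0 (2 * r)).
  assert (PsiD : forall r, is_derive Psi r (2 * Sd (2 * r))).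
  { intros r. unfold Psi.
    apply (is_derive_comp (fun z => RInt Sd 0 z) (fun r => 2 * r)).
    - apply (is_derive_RInt Sd (fun z => RInt Sd 0 z) 0).
      + exists (mkposreal 1 Rlt_0_1). intros y _. apply (RInt_correct Sd). apply Sdint.
      + apply continuity_pt_filterlim. apply SdC.
    - auto_derive; auto. lra. }
  assert (Psi0 : Psi 0 = 0).
  { unfold Psi. replace (2 * 0) with 0 by ring. apply (RInt_point 0 Sd). }
  assert (Psipos : forall r, 0 <= r -> r * S r <= Psi r).
  { intros r Hr. unfold Psi.
    rewrite <- (RInt_Chasles Sd 0 r (2 * r)) by auto.
    assert (A : 0 <= RInt Sd 0 r).
    { apply RInt_ge_0; auto. intros x Hx. unfold Sd. rewrite (S0 (- x)) by lra.
      rewrite <- (S0 0) by lra. assert (S 0 <= S x) by (apply runsup_mono; auto; lra). rewrite (S0 0) in *; lra. }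
    assert (B : RInt (fun _ => S r) r (2 * r) <= RInt Sd r (2 * r)).
    { apply RInt_le; auto; [lra|apply ex_RInt_const|]. intros x Hx. unfold Sd.
      rewrite (S0 (- x)) by lra. assert (S r <= S x) by (apply runsup_mono; auto; lra). lra. }
    rewrite RInt_const in B. unfold scal in B; simpl in B; unfold mult in B; simpl in B.
    unfold plus; simpl. lra. }
  assert (Psieven : forall r, Psi (- r) = Psi r).
  { intros r. unfold Psi. replace (2 * - r) with (- (2 * r)) by ring.
    assert (H := RInt_comp_lin Sd (-1) 0 0 (2 * r)).
    replace (-1 * 0 + 0) with 0 in H by ring.
    replace (-1 * (2 * r) + 0) with (- (2 * r)) in H by ring.
    rewrite <- H by auto.
    apply RInt_ext. intros x _. unfold Sd, scal; simpl. unfold mult; simpl.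
    replace (-1 * x + 0) with (- x) by ring. rewrite Ropp_involutive. ring. }
  exists (fun x => p * (x - s) + Psi (x - s)), (fun x => p + 2 * Sd (2 * (x - s))).
  split; [split; [|split]|].
  - intros x. apply (is_derive_plus (fun x => p * (x - s)) (fun x => Psi (x - s))).
    + auto_derive; auto. ring.
    + replace (2 * Sd (2 * (x - s))) with (1 * (2 * Sd (2 * (x - s)))) by ring.
      apply (is_derive_comp Psi (fun x => x - s)). apply PsiD. auto_derive; auto.
  - intros x. apply continuity_pt_plus. apply continuity_pt_const; intros ? ?; auto.
    apply (continuity_pt_scal (fun x => Sd (2 * (x - s))) 2).
    apply (continuity_pt_comp (fun x => 2 * (x - s)) Sd); [|apply SdC].
    apply (continuity_pt_scal (fun x => x - s) 2). apply continuity_pt_minus.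
    apply continuity_pt_id. apply continuity_pt_const; intros ? ?; auto.
  - exists 1. split; [lra|]. intros x _.
    replace (s - s) with 0 by ring. rewrite Psi0, Rmult_0_r, Rplus_0_l, Rminus_0_r.
    set (r := x - s). assert (e r <= Psi r).
    { destruct (Req_dec r 0) as [->|Hr].
      - rewrite Psi0. unfold e. replace (M (s + 0) - M s - p * 0) with 0 by (rewrite Rplus_0_r; ring).
        rewrite Rmax_left; lra.
      - assert (Hr' : 0 < Rabs r) by (apply Rabs_pos_lt; auto).
        assert (He : e r = Rabs r * q r) by (unfold q; field; lra).
        rewrite He. destruct (Rle_dec 0 r) as [h|h].
        + rewrite Rabs_pos_eq by auto. destruct (Sq r h). specialize (Psipos r h). nra.
        + rewrite Rabs_left in * by lra. destruct (Sq (- r)) as [_ H]; [lra|].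
          rewrite Ropp_involutive in H. specialize (Psipos (- r)). rewrite Psieven in Psipos. nra. }
    assert (M x - M s - p * r <= e r).
    { unfold e. replace (s + r) with x by (unfold r; ring). apply Rmax_r. }
    lra.
  - replace (2 * (s - s)) with 0 by ring. unfold Sd. rewrite Ropp_0. ring.
Qed.

(** Powers of the positive part provide C^1 and C^2 functions that vanish on a half-line: the
    penalty in [touch_upper_lip] and the correction in [ln_extension]. *)
Lemma is_derive_pospow (n : nat) (x : R) :
  is_derive (fun x => (Rmax 0 x) ^ (S (S n))) x (INR (S (S n)) * (Rmax 0 x) ^ (S n)).
Proof.
  destruct (Rtotal_order x 0) as [Hx|[->|Hx]].
  - rewrite Rmax_left by lra. rewrite pow_i by lia. rewrite Rmult_0_r.
    apply is_derive_ext_loc with (fun _ => 0).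
    + exists (mkposreal (- x) ltac:(lra)). intros y Hy.
      change (Rabs (y - x) < - x) in Hy.
      apply Rabs_def2 in Hy. rewrite Rmax_left by lra. simpl; ring.
    + apply (is_derive_const 0).
  - rewrite Rmax_left by lra. rewrite pow_i by lia. rewrite Rmult_0_r.
    apply is_derive_Reals. intros eps Heps.
    assert (Hd : 0 < Rmin eps 1) by (apply Rmin_glb_lt; lra).
    exists (mkposreal _ Hd). intros h Hh Hh1. simpl in Hh1.
    assert (H1 := Rmin_l eps 1). assert (H2 := Rmin_r eps 1).
    rewrite Rplus_0_l, (Rmax_left 0 0), (pow_i (S (S n))), !Rminus_0_r by (lia || lra).
    unfold Rdiv. rewrite Rabs_mult.
    assert (Ha : 0 < Rabs h) by (apply Rabs_pos_lt; auto).
    rewrite Rabs_inv. apply Rmult_lt_reg_r with (Rabs h); auto.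
    rewrite Rmult_assoc, Rinv_l, Rmult_1_r by lra.
    assert (Hm : 0 <= Rmax 0 h <= Rabs h).
    { split. apply Rmax_l. apply Rmax_lub. lra. apply RRle_abs. }
    assert (Hp : 0 <= Rmax 0 h ^ n <= 1).
    { split. apply pow_le; lra. rewrite <- (pow1 n). apply pow_incr; lra. }
    rewrite Rabs_pos_eq by (apply pow_le; lra). simpl.
    assert (Rmax 0 h * Rmax 0 h ^ n <= Rmax 0 h) by nra.
    assert (0 <= Rmax 0 h * Rmax 0 h ^ n) by nra. nra.
  - rewrite Rmax_right by lra.
    apply is_derive_ext_loc with (fun x => x ^ (S (S n))).
    + exists (mkposreal x Hx). intros y Hy.
      change (Rabs (y - x) < x) in Hy.
      apply Rabs_def2 in Hy. rewrite Rmax_right by lra. auto.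
    + apply is_derive_Reals. exact (derivable_pt_lim_pow x (S (S n))).
Qed.

Lemma continuity_pt_Rmax0 (x : R) : continuity_pt (fun x => Rmax 0 x) x.
Proof.
  intros eps Heps. exists eps; split; auto. intros y [_ Hy]. simpl in *. unfold R_dist in *.
  eapply Rle_lt_trans; [|exact Hy]. unfold Rmax.
  repeat destruct (Rle_dec _ _); unfold Rabs; repeat destruct (Rcase_abs _); lra.
Qed.

(** A chord of slope above [C] would allow a line of an intermediate slope [C'], bent upwards near
    the right end, to touch from above; bending only increases the slope, so the touching slope
    would exceed [C]. *)
Lemma touch_upper_lip (M : R -> R) (a b C : R) :
  (forall x, continuity_pt M x) ->
  (forall s psi dpsi, a < s < b -> touch M psi dpsi s -> dpsi s <= C) ->
  forall x y, a <= x -> x <= y -> y <= b -> M y - M x <= C * (y - x).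
Proof.
  intros MC HT x y Hx Hxy Hy.
  destruct (Rle_dec (M y - M x) (C * (y - x))) as [h|h]; auto. exfalso.
  apply Rnot_le_lt in h.
  assert (Hlt : x < y). { destruct Hxy; auto. subst y. lra. }
  set (C' := ((M y - M x) / (y - x) + C) / 2).
  assert (HC' : C < C' /\ C' * (y - x) < M y - M x).
  { assert (C < (M y - M x) / (y - x)).
    { apply Rmult_lt_reg_r with (y - x); [lra|]. unfold Rdiv. rewrite Rmult_assoc, Rinv_l; lra. }
    assert ((M y - M x) / (y - x) * (y - x) = M y - M x) by (field; lra).
    split; unfold C'; nra. }
  set (h0 := fun s => M s - M x - C' * (s - x)).
  assert (hC : forall s, continuity_pt h0 s).
  { intros s. unfold h0. apply continuity_pt_minus. apply continuity_pt_minus. apply MC.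
    apply continuity_pt_const; intros ? ?; auto.
    apply (continuity_pt_scal (fun s => s - x) C'). apply continuity_pt_minus.
    apply continuity_pt_id. apply continuity_pt_const; intros ? ?; auto. }
  assert (hy : 0 < h0 y) by (unfold h0; lra).
  assert (hx : h0 x = 0) by (unfold h0; ring).
  destruct (cont_ed h0 y (h0 y) (hC y) hy) as (d & Hd & Hd1).
  set (x1 := Rmax ((x + y) / 2) (y - d / 2)).
  assert (Hx1 : x < x1 < y /\ y - x1 < d).
  { unfold x1, Rmax. destruct (Rle_dec _ _); lra. }
  assert (hx1 : 0 < h0 x1).
  { assert (H := Hd1 x1). apply Rabs_def2 in H. lra. apply Rabs_def1; lra. }
  destruct (continuity_ab_maj h0 x y) as (mx & Hmx & Hmxi); [lra|intros; apply hC|].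
  (* At [y] the penalty exceeds the maximum of [h0] by 1, so [M - psi] is negative there, zero at
     [x] and positive at [x1]: its maximum is interior. *)
  set (A := (h0 mx + 1) / (y - x1) ^ 2).
  assert (HA : 0 < A /\ A * (y - x1) ^ 2 = h0 mx + 1).
  { assert (h0 y <= h0 mx) by (apply Hmx; lra).
    assert (0 < (y - x1) ^ 2) by (apply pow_lt; lra). split.
    - apply Rdiv_lt_0_compat; lra.
    - unfold A; field; lra. }
  set (psi := fun s => M x + C' * (s - x) + A * (Rmax 0 (s - x1)) ^ 2).
  set (dpsi := fun s => C' + A * (2 * Rmax 0 (s - x1))).
  assert (psiD : forall s, is_derive psi s (dpsi s)).
  { intros s. unfold psi, dpsi.
    apply (is_derive_plus (fun s => M x + C' * (s - x)) (fun s => A * Rmax 0 (s - x1) ^ 2)).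
    - auto_derive; auto; ring.
    - apply (is_derive_scal (fun s => Rmax 0 (s - x1) ^ 2) s A).
      replace (2 * Rmax 0 (s - x1)) with (1 * (INR 2 * Rmax 0 (s - x1) ^ 1)) by (simpl; ring).
      apply (is_derive_comp (fun z => Rmax 0 z ^ 2) (fun s => s - x1)).
      apply is_derive_pospow. auto_derive; auto. }
  assert (dC : forall s, continuity_pt dpsi s).
  { intros s. unfold dpsi. apply continuity_pt_plus. apply continuity_pt_const; intros ? ?; auto.
    apply (continuity_pt_scal (fun s => 2 * Rmax 0 (s - x1)) A).
    apply (continuity_pt_scal (fun s => Rmax 0 (s - x1)) 2).
    apply (continuity_pt_comp (fun s => s - x1) (fun z => Rmax 0 z)); [|apply continuity_pt_Rmax0].
    apply continuity_pt_minus. apply continuity_pt_id. apply continuity_pt_const; intros ? ?; auto. }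
  destruct (continuity_ab_maj (fun s => M s - psi s) x y) as (z & Hz & Hzi); [lra| |].
  { intros s _. apply continuity_pt_minus. apply MC. apply derivable_continuous_pt.
    exists (dpsi s). apply is_derive_Reals. apply psiD. }
  assert (Vx1 : M x1 - psi x1 = h0 x1).
  { unfold psi, h0. rewrite Rmax_left by lra. simpl; ring. }
  assert (Vx : M x - psi x = 0).
  { unfold psi. rewrite Rmax_left by lra. simpl; ring. }
  assert (Vy : M y - psi y < 0).
  { unfold psi. rewrite Rmax_right by lra. 
    assert (h0 y <= h0 mx) by (apply Hmx; lra). unfold h0 in *; lra. }
  assert (Hzx1 := Hz x1 ltac:(lra)).
  assert (Hzin : x < z < y).
  { destruct Hzi. split.
    - destruct (Req_dec z x) as [->|]; [|lra]. lra.
    - destruct (Req_dec z y) as [->|]; [|lra]. lra. }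
  assert (HT1 := HT z psi dpsi ltac:(lra)). 
  assert (dpsi z <= C).
  { apply HT1. split; auto. split; auto. exists (Rmin (z - x) (y - z)).
    split. apply Rmin_glb_lt; lra. intros w Hw.
    assert (B1 := Rmin_l (z - x) (y - z)). assert (B2 := Rmin_r (z - x) (y - z)).
    apply Rabs_def2 in Hw. apply Hz. lra. }
  unfold dpsi in H. assert (0 <= Rmax 0 (z - x1)) by apply Rmax_l. nra.
Qed.

Lemma cover_or (Z1 Z2 : R -> Prop) (a b : R) (P1 P2 : R -> R) :
  cover Z1 a b P1 -> cover Z2 a b P2 ->
  cover (fun s => Z1 s \/ Z2 s) a b (fun s => P1 s + P2 s).
Proof.
  intros [A1 A2] [B1 B2]. split.
  - intros x y Hx Hxy Hy. apply Rplus_le_compat; auto.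
  - intros s Hs [H|H].
    + destruct (A2 s Hs H) as (r & Hr & H1). exists r; split; auto.
      intros x y Hx Hsx Hxy Hy Hys. specialize (H1 x y Hx Hsx Hxy Hy Hys).
      assert (P2 x <= P2 y) by auto. lra.
    + destruct (B2 s Hs H) as (r & Hr & H1). exists r; split; auto.
      intros x y Hx Hsx Hxy Hy Hys. specialize (H1 x y Hx Hsx Hxy Hy Hys).
      assert (P1 x <= P1 y) by auto. lra.
Qed.

Lemma cover_sub (Z1 Z2 : R -> Prop) (a b : R) (P : R -> R) :
  (forall s, a <= s <= b -> Z1 s -> Z2 s) -> cover Z2 a b P -> cover Z1 a b P.
Proof. intros H [A1 A2]. split; auto. Qed.

Lemma cover_endpoints (a b eta : R) : a < b -> 0 < eta ->
  exists P, cover (fun s => s = a \/ s = b) a b P /\ P b - P a <= 2 * eta.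
Proof.
  intros Hab He. exists (fun s => Rmin (s - a) eta + Rmax 0 (s - (b - eta))). split; [split|].
  - intros x y Hx Hxy Hy. apply Rplus_le_compat.
    + unfold Rmin. repeat destruct (Rle_dec _ _); lra.
    + apply Rle_max_compat_l. lra.
  - intros s Hs H. exists eta. split; auto. intros x y Hx Hsx Hxy Hy Hys.
    unfold Rmin, Rmax. destruct H; subst; repeat destruct (Rle_dec _ _); lra.
  - unfold Rmin, Rmax. repeat destruct (Rle_dec _ _); lra.
Qed.

Definition null (Z : R -> Prop) (a b : R) : Prop :=
  forall eps, 0 < eps -> exists P, cover Z a b P /\ P b - P a <= eps.

(** Covers of size [eps / 2^(i+1)] are summed: the sum of the series expands wherever one of its
    terms does. *)
Lemma null_countable (Z : nat -> R -> Prop) (a b : R) : a < b ->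
  (forall i, null (Z i) a b) -> null (fun s => exists i, Z i s) a b.
Proof.
  intros Hab HZ eps Heps.
  assert (Hch : forall i, exists P, cover (Z i) a b P /\ P b - P a <= eps / 2 * (/ 2) ^ i).
  { intros i. apply HZ. apply Rmult_lt_0_compat. lra. apply pow_lt. lra. }
  set (P := fun i => proj1_sig (constructive_indefinite_description _ (Hch i))).
  assert (HP : forall i, cover (Z i) a b (P i) /\ P i b - P i a <= eps / 2 * (/ 2) ^ i).
  { intros i. unfold P. exact (proj2_sig (constructive_indefinite_description _ (Hch i))). }
  (* Normalised to vanish at [a], the covers are bounded by their total growths, which are
     summable. *)
  set (Q := fun s i => P i s - P i a).
  assert (HQ : forall x y i, a <= x -> x <= y -> y <= b -> 0 <= Q x i <= Q y i /\ Q y i <= eps / 2 * (/ 2) ^ i).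
  { intros x y i Hx Hxy Hy. destruct (HP i) as [[A1 A2] A3]. unfold Q.
    assert (P i a <= P i x) by (apply A1; lra). assert (P i x <= P i y) by (apply A1; lra).
    assert (P i y <= P i b) by (apply A1; lra). lra. }
  assert (Geo : is_series (fun i => eps / 2 * (/ 2) ^ i) eps).
  { assert (Hg : Rabs (/ 2) < 1) by (rewrite Rabs_pos_eq; lra).
    assert (H := is_series_scal (eps / 2) _ _ (is_series_geom (/ 2) Hg)).
    assert (E : eps / 2 * (/ (1 - / 2)) = eps) by field.
    exact (eq_ind _ (fun l : R => is_series (fun i => eps / 2 * (/ 2) ^ i) l) H _ E). }
  assert (Qs : forall x, a <= x <= b -> ex_series (Q x)).
  { intros x Hx. apply (ex_series_le (Q x) (fun i => eps / 2 * (/ 2) ^ i)).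
    - intros n. destruct (HQ x x n) as [H1 H2]; try lra.
      change (Rabs (Q x n) <= eps / 2 * (/ 2) ^ n). rewrite Rabs_pos_eq; lra.
    - exists eps; auto. }
  assert (Qle : forall x y i, a <= x -> x <= y -> y <= b -> Q y i - Q x i <= Series (Q y) - Series (Q x)).
  { intros x y i Hx Hxy Hy. rewrite <- Series_minus by (apply Qs; lra).
    assert (Hnn : forall n, 0 <= Q y n - Q x n) by (intros n; destruct (HQ x y n) as [H1 H2]; lra).
    assert (Hex : ex_series (fun n => Q y n - Q x n)).
    { apply (ex_series_minus (Q y) (Q x)); apply Qs; lra. }
    (* Termwise comparison with a series having a single nonzero term shows that the sum grows at
       least as fast as its [i]-th term. *)
    set (e := fun n => if Nat.eq_dec n i then Q y i - Q x i else 0).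
    assert (He : is_series e (Q y i - Q x i)).
    { assert (Hs : forall n, sum_n e (i + n) = Q y i - Q x i).
      { assert (H0 : forall k, (k < i)%nat -> sum_n e k = 0).
        { induction k; intros Hk.
          - rewrite sum_O. unfold e. destruct (Nat.eq_dec 0 i); auto. lia.
          - rewrite sum_Sn. rewrite IHk by lia. unfold e at 1. destruct (Nat.eq_dec (S k) i); try lia.
            unfold plus; simpl; ring. }
        induction n.
        - rewrite Nat.add_0_r. destruct i.
          + rewrite sum_O. unfold e. destruct (Nat.eq_dec 0 0); auto. lia.
          + rewrite sum_Sn, H0 by lia. unfold e. destruct (Nat.eq_dec (S i) (S i)); try lia.
            unfold plus; simpl; ring.
        - rewrite Nat.add_succ_r, sum_Sn, IHn. unfold e. destruct (Nat.eq_dec (S (i + n)) i); try lia.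
          unfold plus; simpl; ring. }
      change (is_lim_seq (sum_n e) (Q y i - Q x i)).
      apply (is_lim_seq_ext_loc (fun _ => Q y i - Q x i)); [|apply is_lim_seq_const].
      exists i. intros n Hn. rewrite <- (Hs (n - i)%nat). f_equal. lia. }
    rewrite <- (is_series_unique _ _ He). apply Series_le; auto.
    intros n. unfold e. destruct (Nat.eq_dec n i). subst; split; [apply Hnn|lra]. split; [lra|apply Hnn]. }
  exists (fun s => Series (Q s)). split; [split|].
  - intros x y Hx Hxy Hy. specialize (Qle x y O Hx Hxy Hy).
    destruct (HQ x y O) as [H1 H2]; lra.
  - intros s Hs [i Hi]. destruct (HP i) as [[A1 A2] A3].
    destruct (A2 s Hs Hi) as (r & Hr & H). exists r; split; auto.
    intros x y Hx Hsx Hxy Hy Hys. specialize (Qle x y i Hx Hxy Hy).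
    specialize (H x y Hx Hsx Hxy Hy Hys). unfold Q in Qle at 1 2. lra.
  - assert (Series (Q b) <= eps).
    { rewrite <- (is_series_unique _ _ Geo). apply Series_le.
      - intros n. destruct (HQ b b n); lra.
      - exists eps; auto. }
    assert (Series (Q a) = 0).
    { rewrite (Series_ext (Q a) (fun n => 0 * 0)).
      rewrite Series_scal_l. ring. intros n. unfold Q. ring. }
    lra.
Qed.

(** Bounds on Dini derivates, expressed through chords arbitrarily close to [s] instead of lower and
    upper limits. *)
Definition left_slope_lt (M : R -> R) (s q : R) : Prop :=
  forall d, 0 < d -> exists s', s - d < s' < s /\ M s - M s' < q * (s - s').
Definition right_slope_gt (M : R -> R) (s r : R) : Prop :=
  forall d, 0 < d -> exists s', s < s' < s + d /\ M s' - M s > r * (s' - s).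

Lemma cover_id (Z : R -> Prop) (a b : R) : cover Z a b (fun s => s).
Proof.
  split; intros; auto. exists 1; split; [lra|]. intros; lra.
Qed.

(** The function [C s - M s] is monotone; near a point of the set it has right chords of slope below
    [C - r] and left chords of slope above [C - q]. Each application of [riesz_shrink] multiplies
    the size of a cover by [rho < 1]. *)
Lemma null_slopes (M : R -> R) (a b C q r : R) : a < b ->
  (forall x, continuity_pt M x) ->
  (forall x y, a <= x -> x <= y -> y <= b -> M y - M x <= C * (y - x)) ->
  q < r ->
  null (fun s => a < s < b /\ right_slope_gt M s r /\ left_slope_lt M s q) a b.
Proof.
  intros Hab MC HL Hqr.
  set (N := fun s => a < s < b /\ right_slope_gt M s r /\ left_slope_lt M s q).
  destruct (classic (exists s, N s)) as [[s0 (Hs0 & HR0 & _)]|Hno].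
  2:{ intros eps Heps. exists (fun _ => 0). split; [split|lra].
      - intros; lra.
      - intros s _ Hs. exfalso. apply Hno. exists s; auto. }
  (* A point of the set yields [r < C], so that [kap = C - r] is positive in [riesz_shrink]; the
     empty set was covered by a constant. *)
  assert (HrC : r < C).
  { destruct (HR0 (b - s0)) as (s' & H1 & H2); [lra|].
    assert (M s' - M s0 <= C * (s' - s0)) by (apply HL; lra). nra. }
  set (F := fun s => C * s - M s).
  set (rho := (C - r) / (C - q)).
  assert (Hrho : 0 < rho < 1).
  { unfold rho. split. apply Rdiv_lt_0_compat; lra.
    apply Rmult_lt_reg_r with (C - q); [lra|]. unfold Rdiv. rewrite Rmult_assoc, Rinv_l; lra. }
  assert (It : forall n, exists P, cover N a b P /\ (forall x, continuity_pt P x) /\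
             P b - P a <= rho ^ n * (b - a)).
  { induction n as [|n (P & HP & PC & Pb)].
    - exists (fun s => s). split; [apply cover_id|]. split. intros; apply continuity_pt_id. simpl; lra.
    - destruct (riesz_shrink F P a b (C - r) (C - q) N) as (P' & H1 & H2 & H3); auto; try lra.
      + intros x y Hx Hxy Hy. unfold F. specialize (HL x y Hx Hxy Hy). lra.
      + intros x. unfold F. apply continuity_pt_minus.
        apply (continuity_pt_scal (fun x => x) C). apply continuity_pt_id. apply MC.
      + intros s [Hs _]; auto.
      + intros s (Hs & HR & _) d Hd. destruct (HR d Hd) as (s' & H1 & H2).
        exists s'. split; auto. unfold F. nra.
      + intros s (Hs & _ & HLs) d Hd. destruct (HLs d Hd) as (s' & H1 & H2).
        exists s'. split; auto. unfold F. nra.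
      + exists P'. split; auto. split; auto. fold rho in H3.
        eapply Rle_trans; [exact H3|]. simpl. rewrite Rmult_assoc.
        apply Rmult_le_compat_l; lra. }
  intros eps Heps.
  destruct (pow_lt_1_zero rho) with (y := eps / (b - a)) as (n & Hn).
  { rewrite Rabs_pos_eq; lra. } { apply Rdiv_lt_0_compat; lra. }
  destruct (It n) as (P & HP & _ & Pb). exists P; split; auto.
  specialize (Hn n (le_n n)). rewrite Rabs_pos_eq in Hn by (apply pow_le; lra).
  eapply Rle_trans; [exact Pb|]. left.
  replace eps with (eps / (b - a) * (b - a)) by (field; lra).
  apply Rmult_lt_compat_r; lra.
Qed.

(** An enumeration, by the Cantor pairing, of pairs of nonnegative rationals with a common
    denominator. Nonnegative values suffice, since they are only placed above a positive left
    slope. *)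
Definition frac_pair (i : nat) : R * R :=
  let (k, mn) := of_nat i in let (m, n) := of_nat mn in
  (INR m / INR (S k), INR n / INR (S k)).

Lemma frac_pair_between (p q : R) : 0 <= p -> p < q ->
  exists i, p < fst (frac_pair i) /\ fst (frac_pair i) < snd (frac_pair i) /\
    snd (frac_pair i) <= q.
Proof.
  intros Hp Hpq.
  destruct (archimed_cor1 ((q - p) / 2)) as (k & Hk & Hk0); [lra|].
  destruct k as [|k]; [lia|].
  assert (HK : 0 < INR (S k)) by (apply lt_0_INR; lia).
  destruct (nfloor_ex (p * INR (S k))) as (m & Hm1 & Hm2). nra.
  exists (to_nat (k, to_nat (S m, S (S m)))).
  unfold frac_pair. rewrite cancel_of_to, cancel_of_to. cbn [fst snd].
  assert (Hk' : 2 < (q - p) * INR (S k)).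
  { apply Rmult_lt_reg_r with (/ INR (S k)). apply Rinv_0_lt_compat; auto.
    rewrite Rmult_assoc, Rinv_r; lra. }
  assert (E1 := S_INR m). assert (E2 := S_INR (S m)).
  split; [|split].
  - apply Rmult_lt_reg_r with (INR (S k)); auto. unfold Rdiv. rewrite Rmult_assoc, Rinv_l; lra.
  - apply Rmult_lt_compat_r. apply Rinv_0_lt_compat; auto. lra.
  - apply Rmult_le_reg_r with (INR (S k)); auto. unfold Rdiv. rewrite Rmult_assoc, Rinv_l; lra.
Qed.

(** [d] stands for the length of the part of [[a, b]] that [Z] misses in the sense of outer measure;
    only there may [M] grow, at rate [C]. *)
Definition slope_bound (Z : R -> Prop) (a b d : R) : Prop :=
  forall (M : R -> R) (C : R), (forall x, continuity_pt M x) -> 0 < C ->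
    (forall s psi dpsi, a < s < b -> touch M psi dpsi s ->
       dpsi s <= C /\ (Z s -> dpsi s <= 0)) ->
    M b - M a <= C * d.

(** Almost every point either has a left slope [<= 0] or can be touched from above
    with a positive slope; the latter is excluded on [Z]. *)
Lemma cover_slope_bound (Z : R -> Prop) (a b d : R) : a < b ->
  (forall P, cover Z a b P -> b - a - d <= P b - P a) -> slope_bound Z a b d.
Proof.
  intros Hab Hcov M C MC HC HT.
  assert (HL : forall x y, a <= x -> x <= y -> y <= b -> M y - M x <= C * (y - x)).
  { apply touch_upper_lip; auto. intros s psi dpsi Hs Ht. destruct (HT s psi dpsi Hs Ht); auto. }
  (* A rational pair separates a smaller left slope from a larger right slope. Off [N], the right
     slopes do not exceed the lower left slope when the latter is nonnegative. *)
  set (N := fun s => exists i, a < s < b /\ right_slope_gt M s (snd (frac_pair i)) /\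
        left_slope_lt M s (fst (frac_pair i)) /\ fst (frac_pair i) < snd (frac_pair i)).
  assert (HN : null N a b).
  { apply (null_countable (fun i s => a < s < b /\ right_slope_gt M s (snd (frac_pair i)) /\
        left_slope_lt M s (fst (frac_pair i)) /\ fst (frac_pair i) < snd (frac_pair i))); auto.
    intros i. destruct (Rlt_dec (fst (frac_pair i)) (snd (frac_pair i))) as [h|h].
    - intros eps Heps. destruct (null_slopes M a b C _ _ Hab MC HL h eps Heps) as (P & HP & HP1).
      exists P; split; auto. eapply cover_sub; [|exact HP]. simpl. tauto.
    - intros eps Heps. exists (fun _ => 0). split; [split|lra].
      + intros; lra.
      + intros s _ Hs. exfalso. tauto. }
  assert (Key : forall eps, 0 < eps -> eps < C -> forall eta, 0 < eta ->
     b - a - d <= (C * (b - a) - (M b - M a)) / (C - eps) + 3 * eta).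
  { intros eps He HeC eta Heta.
    (* Points with a left chord of slope below [eps] are covered at the cost
       [(C (b - a) - (M b - M a)) / (C - eps)]: the more [M] grows, the smaller this cover is. *)
    set (Z0 := fun s => a < s < b /\ exists s', a <= s' < s /\ M s - M s' < eps * (s - s')).
    destruct (left_cover (fun s => C * s - M s) a b (C - eps) Z0) as (P1 & HP1 & HP1b & _); try lra.
    - intros x y Hx Hxy Hy. specialize (HL x y Hx Hxy Hy). lra.
    - intros s Hs [Hs1 (s' & Hs' & HM)].
      set (g := fun z => C * z - M z - (C - eps) * z).
      assert (gC : continuity_pt g s).
      { unfold g. apply continuity_pt_minus. apply continuity_pt_minus.
        apply (continuity_pt_scal (fun x => x) C). apply continuity_pt_id. apply MC.
        apply (continuity_pt_scal (fun x => x) (C - eps)). apply continuity_pt_id. }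
      destruct (cont_ed g s (g s - g s') gC) as (r & Hr & Hg); [unfold g; lra|].
      exists s', (Rmin r (s - s')).
      assert (B1 := Rmin_l r (s - s')). assert (B2 := Rmin_r r (s - s')).
      split; [lra|]. split. apply Rmin_glb_lt; lra. split; [lra|].
      intros z Hz Hzs. assert (Hz2 := Hg z ltac:(lra)). apply Rabs_def2 in Hz2.
      unfold g in Hz2. lra.
    - destruct (HN eta Heta) as (P2 & HP2 & HP2b).
      destruct (cover_endpoints a b eta Hab Heta) as (P3 & HP3 & HP3b).
      assert (Hc : cover Z a b (fun s => P1 s + (P2 s + P3 s))).
      { eapply cover_sub; [|apply (cover_or _ _ a b _ _ HP1 (cover_or _ _ a b _ _ HP2 HP3))].
        intros s Hs Zs. simpl.
        destruct (classic (Z0 s)) as [h|hZ0]; auto.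
        destruct (classic (N s)) as [h|hN]; auto.
        destruct (classic (s = a \/ s = b)) as [h|hab]; auto. exfalso.
        assert (Hsab : a < s < b).
        { split; apply Rnot_le_lt; intros ?; apply hab; lra. }
        assert (Le : ~ left_slope_lt M s eps).
        { intros Hl. destruct (Hl (s - a)) as (s' & H1 & H2); [lra|].
          apply hZ0. split; auto. exists s'; split; [lra|auto]. }
        assert (Lmono : forall q q', q <= q' -> left_slope_lt M s q -> left_slope_lt M s q').
        { intros q q' Hq Hl d0 Hd0. destruct (Hl d0 Hd0) as (s' & H1 & H2). exists s'; split; auto. nra. }
        assert (LC : left_slope_lt M s (C + 1)).
        { intros d0 Hd0. set (s' := Rmax a (s - d0 / 2)).
          assert (a <= s' < s /\ s - d0 < s') by (unfold s', Rmax; destruct (Rle_dec _ _); lra).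
          exists s'; split; [lra|]. assert (M s - M s' <= C * (s - s')) by (apply HL; lra). nra. }
        (* [p] is the lower left Dini derivative. Outside [Z0] it is at least [eps], and outside [N]
           it bounds the right slopes as well, so [C1_touch] yields a touching slope [p > 0], which
           is forbidden on [Z]. *)
        destruct (completeness (fun q => ~ left_slope_lt M s q)) as (p & Hp1 & Hp2).
        { exists (C + 1). intros q Hq. apply Rnot_lt_le. intros Hlt. apply Hq.
          apply (Lmono (C + 1)); auto; lra. }
        { exists eps; auto. }
        assert (Hpe : eps <= p) by (apply Hp1; auto).
        assert (Hup : forall q, p < q -> left_slope_lt M s q).
        { intros q Hq. apply NNPP. intros Hn. assert (q <= p) by (apply Hp1; auto). lra. }
        assert (Hlo : forall q, q < p -> ~ left_slope_lt M s q).
        { intros q Hq Hl. assert (p <= q); [|lra]. apply Hp2. intros q' Hq'.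
          apply Rnot_lt_le. intros Hlt. apply Hq'. apply (Lmono q); auto; lra. }
        destruct (C1_touch M s p MC) as (psi & dpsi & Ht & Hdp).
        { intros e Hee.
          assert (exists d1, 0 < d1 /\ forall x, s < x < s + d1 -> M x - M s <= (p + e) * (x - s)) as (d1 & Hd1 & HR).
          { apply NNPP. intros Hn. 
            destruct (frac_pair_between p (p + e)) as (i & I1 & I2 & I3); try lra.
            apply hN. exists i. split; auto. split; [|split; auto].
            intros d1 Hd1. apply NNPP. intros Hn1. apply Hn. exists d1; split; auto.
            intros x Hx. apply Rnot_lt_le. intros Hlt. apply Hn1. exists x; split; auto.
            nra. }
          assert (exists d2, 0 < d2 /\ forall x, s - d2 < x < s -> M s - M x >= (p - e) * (s - x)) as (d2 & Hd2 & HLl).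
          { apply NNPP. intros Hn. apply (Hlo (p - e)); [lra|].
            intros d2 Hd2. apply NNPP. intros Hn1. apply Hn. exists d2; split; auto.
            intros x Hx. apply Rnot_gt_ge. intros Hlt. apply Hn1. exists x; split; auto. }
          exists (Rmin d1 d2). assert (B1 := Rmin_l d1 d2). assert (B2 := Rmin_r d1 d2).
          split. apply Rmin_glb_lt; auto. intros x Hx. apply Rabs_def2 in Hx.
          destruct (Rtotal_order x s) as [h|[->|h]].
          - rewrite Rabs_left by lra. specialize (HLl x). nra.
          - replace (s - s) with 0 by ring. rewrite Rabs_R0. lra.
          - rewrite Rabs_right by lra. specialize (HR x). nra. }
        destruct (HT s psi dpsi Hsab Ht) as [_ H0]. specialize (H0 Zs). lra. }
      specialize (Hcov _ Hc). simpl in Hcov.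
      replace (C * (b - a) - (M b - M a)) with (C * b - M b - (C * a - M a)) by ring. lra. }
  set (X := C * (b - a) - (M b - M a)) in *.
  apply Rle_plus_epsilon. intros e He.
  set (W := Rabs (b - a - d) + 1).
  assert (HW : 1 <= W /\ b - a - d <= W).
  { unfold W. assert (H1 := Rabs_pos (b - a - d)). assert (H2 := RRle_abs (b - a - d)). lra. }
  set (eps := Rmin (C / 2) (e / (2 * W))).
  assert (Heps : 0 < eps /\ eps <= C / 2 /\ eps * W <= e / 2).
  { split. apply Rmin_glb_lt. lra. apply Rdiv_lt_0_compat; lra.
    split. apply Rmin_l. apply Rle_trans with (e / (2 * W) * W).
    apply Rmult_le_compat_r; [lra|apply Rmin_r]. right; field; lra. }
  set (eta := e / (6 * C)).
  assert (Heta : 0 < eta /\ 3 * eta * C = e / 2).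
  { split. apply Rdiv_lt_0_compat; lra. unfold eta; field; lra. }
  specialize (Key eps ltac:(lra) ltac:(lra) eta ltac:(lra)).
  assert (K2 : (b - a - d) * (C - eps) <= X + 3 * eta * (C - eps)).
  { replace X with (X / (C - eps) * (C - eps)) by (field; lra).
    rewrite <- Rmult_plus_distr_r. apply Rmult_le_compat_r; lra. }
  unfold X in K2. assert (eps * (b - a - d) <= e / 2) by nra. nra.
Qed.

(** * Outer measure and finite density partitions *)

Inductive Part (leaf : R -> R -> R -> Prop) : R -> R -> R -> Prop :=
| Part_leaf a b d : a <= b -> leaf a b d -> Part leaf a b d
| Part_node a c b d1 d2 : Part leaf a c d1 -> Part leaf c b d2 -> Part leaf a b (d1 + d2).

Lemma Part_le (leaf : R -> R -> R -> Prop) (a b d : R) : Part leaf a b d -> a <= b.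
Proof. induction 1; lra. Qed.

Lemma Part_refine (A B : R -> R -> R -> Prop) (a b e : R) :
  (forall x y d, x <= y -> A x y d -> forall eps, 0 < eps ->
     exists e', e' <= d + eps /\ Part B x y e') ->
  Part A a b e -> forall eps, 0 < eps -> exists e', e' <= e + eps /\ Part B a b e'.
Proof.
  intros H HP. induction HP as [a b d Hab Hl|a c b d1 d2 H1 IH1 H2 IH2]; intros eps He.
  - apply H; auto.
  - destruct (IH1 (eps / 2)) as (e1 & E1 & P1); [lra|].
    destruct (IH2 (eps / 2)) as (e2 & E2 & P2); [lra|].
    exists (e1 + e2). split; [lra|]. eapply Part_node; eauto.
Qed.

(** The Lebesgue outer measure of [Z] in [[a, b]]: the measure of an open superset up to [x] is a
    cover, and any cover grows by at least the measure of a relatively open superset. *)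
Definition lam (Z : R -> Prop) (a b : R) : R :=
  real (Glb_Rbar (fun L => exists P, cover Z a b P /\ L = P b - P a)).

Lemma lam_spec (Z : R -> Prop) (a b : R) : a <= b ->
  (forall P, cover Z a b P -> lam Z a b <= P b - P a) /\
  (forall k, (forall P, cover Z a b P -> k <= P b - P a) -> k <= lam Z a b).
Proof.
  intros Hab. unfold lam. set (S := fun L => _).
  destruct (Glb_Rbar_correct S) as [H1 H2].
  destruct (Glb_Rbar S) as [l| |].
  - split.
    + intros P HP. apply (H1 (P b - P a)). exists P; auto.
    + intros k Hk. apply (H2 (Finite k)). intros v (P & HP & ->). simpl. auto.
  - exfalso. apply (H1 (b - a)). exists (fun s => s). split; [apply cover_id|auto].
  - exfalso. assert (Hc := H2 (Finite 0)). simpl in Hc. apply Hc.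
    intros v (P & [HP _] & ->). simpl. assert (P a <= P b) by (apply HP; lra). lra.
Qed.

Lemma lam_approx (Z : R -> Prop) (a b eps : R) : a <= b -> 0 < eps ->
  exists P, cover Z a b P /\ P b - P a <= lam Z a b + eps.
Proof.
  intros Hab He. apply NNPP. intros Hn. destruct (lam_spec Z a b Hab) as [_ H].
  assert (lam Z a b + eps <= lam Z a b); [|lra].
  apply H. intros P HP. apply Rnot_lt_le. intros Hlt. apply Hn. exists P; split; auto. lra.
Qed.

Lemma lam_bounds (Z : R -> Prop) (a b : R) : a <= b -> 0 <= lam Z a b <= b - a.
Proof.
  intros Hab. destruct (lam_spec Z a b Hab) as [H1 H2]. split.
  - apply H2. intros P [HP _]. assert (P a <= P b) by (apply HP; lra). lra.
  - apply (H1 (fun s => s)). apply cover_id.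
Qed.

Lemma cover_restrict (Z : R -> Prop) (a b x y : R) (P : R -> R) :
  a <= x -> y <= b -> cover Z a b P -> cover Z x y P.
Proof.
  intros Hx Hy [H1 H2]. split.
  - intros u v Hu Huv Hv. apply H1; lra.
  - intros s Hs Zs. destruct (H2 s) as (r & Hr & H); [lra|auto|].
    exists r; split; auto. intros; apply H; lra.
Qed.

Lemma lam_superadd (Z : R -> Prop) (a c b : R) : a <= c -> c <= b ->
  lam Z a c + lam Z c b <= lam Z a b.
Proof.
  intros Hac Hcb. destruct (lam_spec Z a b) as [_ H]; [lra|]. apply H. intros P HP.
  destruct (lam_spec Z a c Hac) as [H1 _]. destruct (lam_spec Z c b Hcb) as [H2 _].
  specialize (H1 P (cover_restrict Z a b a c P ltac:(lra) Hcb HP)).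
  specialize (H2 P (cover_restrict Z a b c b P Hac ltac:(lra) HP)). lra.
Qed.

Lemma lam_subadd (Z : R -> Prop) (a c b : R) : a <= c -> c <= b ->
  lam Z a b <= lam Z a c + lam Z c b.
Proof.
  intros Hac Hcb. apply Rle_plus_epsilon. intros eps He.
  destruct (lam_approx Z a c (eps / 2) Hac) as (P & [P1 P2] & Pe); [lra|].
  destruct (lam_approx Z c b (eps / 2) Hcb) as (Q & [Q1 Q2] & Qe); [lra|].
  (* The second cover is shifted to agree with the first at [c], so that short intervals straddling
     [c] are expanded as well. *)
  set (W := fun s => if Rle_dec s c then P s else P c + Q s - Q c).
  assert (Wl : forall s, s <= c -> W s = P s).
  { intros s Hs. unfold W. destruct (Rle_dec s c); auto; lra. }
  assert (Wr : forall s, c <= s -> W s = P c + Q s - Q c).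
  { intros s Hs. unfold W. destruct (Rle_dec s c); auto. replace s with c by lra. lra. }
  destruct (lam_spec Z a b) as [H _]; [lra|].
  assert (Hc : cover Z a b W).
  { split.
    - intros x y Hx Hxy Hy. destruct (Rle_dec y c).
      + rewrite !Wl by lra. apply P1; lra.
      + destruct (Rle_dec x c).
        * rewrite (Wl x), (Wr y) by lra. assert (P x <= P c) by (apply P1; lra).
          assert (Q c <= Q y) by (apply Q1; lra). lra.
        * rewrite !Wr by lra. assert (Q x <= Q y) by (apply Q1; lra). lra.
    - intros s Hs Zs. destruct (Rtotal_order s c) as [h|[h|h]].
      + destruct (P2 s) as (r & Hr & Hp); [lra|auto|]. exists (Rmin r (c - s)).
        assert (B1 := Rmin_l r (c - s)). assert (B2 := Rmin_r r (c - s)).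
        split. apply Rmin_glb_lt; lra. intros x y Hx Hsx Hxy Hy Hys.
        rewrite !Wl by lra. apply Hp; lra.
      + subst s. destruct (P2 c) as (r & Hr & Hp); [lra|auto|].
        destruct (Q2 c) as (r' & Hr' & Hq); [lra|auto|]. exists (Rmin r r').
        assert (B1 := Rmin_l r r'). assert (B2 := Rmin_r r r').
        split. apply Rmin_glb_lt; lra. intros x y Hx Hsx Hxy Hy Hys.
        destruct (Rle_dec y c).
        * rewrite !Wl by lra. apply Hp; lra.
        * destruct (Rle_dec x c).
          -- rewrite (Wl x), (Wr y) by lra. assert (c - x <= P c - P x) by (apply Hp; lra).
             assert (y - c <= Q y - Q c) by (apply Hq; lra). lra.
          -- rewrite !Wr by lra. assert (y - x <= Q y - Q x) by (apply Hq; lra). lra.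
      + destruct (Q2 s) as (r & Hr & Hp); [lra|auto|]. exists (Rmin r (s - c)).
        assert (B1 := Rmin_l r (s - c)). assert (B2 := Rmin_r r (s - c)).
        split. apply Rmin_glb_lt; lra. intros x y Hx Hsx Hxy Hy Hys.
        rewrite !Wr by lra. assert (y - x <= Q y - Q x) by (apply Hp; lra). lra. }
  specialize (H W Hc). rewrite (Wl a), (Wr b) in H by lra. lra.
Qed.

(** [L] is the total length of finitely many successive subintervals that [Phi] expands. In the form
    of a tree, a packing can be cut at any point by induction. *)
Inductive pack (Phi : R -> R) : R -> R -> R -> Prop :=
| pack_nil x y : x <= y -> pack Phi x y 0
| pack_exp x y : x <= y -> expands Phi x y -> pack Phi x y (y - x)
| pack_cat x c y L1 L2 : pack Phi x c L1 -> pack Phi c y L2 -> pack Phi x y (L1 + L2).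

Lemma pack_le (Phi : R -> R) (x y L : R) : pack Phi x y L -> x <= y /\ 0 <= L <= y - x.
Proof. induction 1; lra. Qed.

Lemma pack_Phi (Phi : R -> R) (a b x y L : R) :
  (forall x y, a <= x -> x <= y -> y <= b -> Phi x <= Phi y) ->
  pack Phi x y L -> a <= x -> y <= b -> L <= Phi y - Phi x.
Proof.
  intros HM H. induction H as [x y Hxy|x y Hxy He|x c y L1 L2 H1 IH1 H2 IH2]; intros Hx Hy.
  - assert (Phi x <= Phi y) by (apply HM; lra). lra.
  - apply He; lra.
  - apply pack_le in H1. apply pack_le in H2. specialize (IH1 Hx ltac:(lra)).
    specialize (IH2 ltac:(lra) Hy). lra.
Qed.

Lemma pack_split (Phi : R -> R) (x y L : R) : pack Phi x y L ->
  forall c, x <= c -> c <= y -> exists L1 L2, pack Phi x c L1 /\ pack Phi c y L2 /\ L = L1 + L2.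
Proof.
  induction 1 as [x y Hxy|x y Hxy He|x m y L1 L2 H1 IH1 H2 IH2]; intros c Hxc Hcy.
  - exists 0, 0. split; [|split]; try (constructor; lra). lra.
  - exists (c - x), (y - c). split; [|split]; [| |lra].
    + apply pack_exp; auto. intros u v Hu Huv Hv. apply He; lra.
    + apply pack_exp; auto. intros u v Hu Huv Hv. apply He; lra.
  - destruct (Rle_dec c m).
    + destruct (IH1 c) as (A & B & HA & HB & E); try lra.
      exists A, (B + L2). split; auto. split; [|lra]. eapply pack_cat; eauto.
    + destruct (IH2 c) as (A & B & HA & HB & E); try lra.
      exists (L1 + A), B. split; [eapply pack_cat; eauto|]. split; auto. lra.
Qed.

(** The measure of the open set on which [Phi] expands. *)
Definition packsup (Phi : R -> R) (x y : R) : R := real (Lub_Rbar (pack Phi x y)).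

Lemma packsup_spec (Phi : R -> R) (x y : R) : x <= y ->
  (forall L, pack Phi x y L -> L <= packsup Phi x y) /\
  (forall k, (forall L, pack Phi x y L -> L <= k) -> packsup Phi x y <= k).
Proof.
  intros Hxy. unfold packsup.
  destruct (Lub_Rbar_correct (pack Phi x y)) as [H1 H2].
  destruct (Lub_Rbar (pack Phi x y)) as [l| |].
  - split.
    + intros L HL. apply (H1 L); auto.
    + intros k Hk. apply (H2 (Finite k)). intros L HL. simpl. auto.
  - exfalso. assert (Hc := H2 (Finite (y - x))). simpl in Hc. apply Hc.
    intros L HL. simpl. apply pack_le in HL. lra.
  - exfalso. apply (H1 0). constructor; auto.
Qed.

Lemma packsup_add (Phi : R -> R) (x c y : R) : x <= c -> c <= y ->
  packsup Phi x y = packsup Phi x c + packsup Phi c y.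
Proof.
  intros Hxc Hcy.
  destruct (packsup_spec Phi x y ltac:(lra)) as [A1 A2].
  destruct (packsup_spec Phi x c Hxc) as [B1 B2].
  destruct (packsup_spec Phi c y Hcy) as [C1 C2].
  apply Rle_antisym.
  - apply A2. intros L HL. destruct (pack_split Phi x y L HL c Hxc Hcy) as (L1 & L2 & H1 & H2 & ->).
    specialize (B1 L1 H1). specialize (C1 L2 H2). lra.
  - assert (packsup Phi x c <= packsup Phi x y - packsup Phi c y); [|lra].
    apply B2. intros L1 H1.
    assert (packsup Phi c y <= packsup Phi x y - L1); [|lra].
    apply C2. intros L2 H2.
    assert (L1 + L2 <= packsup Phi x y); [|lra]. apply A1. eapply pack_cat; eauto.
Qed.

Lemma packsup_bounds (Phi : R -> R) (x y : R) : x <= y -> 0 <= packsup Phi x y <= y - x.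
Proof.
  intros Hxy. destruct (packsup_spec Phi x y Hxy) as [A1 A2]. split.
  - apply A1. constructor; auto.
  - apply A2. intros L HL. apply pack_le in HL. lra.
Qed.

(** As a function of its right end, [packsup Phi x] is itself a cover: a small interval around a
    point of [Z] is expanded by [Phi] and so counts with its full length. *)
Lemma lam_le_packsup (Z : R -> Prop) (a b x y : R) (Phi : R -> R) :
  a <= x -> x <= y -> y <= b -> cover Z a b Phi -> lam Z x y <= packsup Phi x y.
Proof.
  intros Hx Hxy Hy [P1 P2].
  assert (E0 : packsup Phi x x = 0).
  { destruct (packsup_bounds Phi x x (Rle_refl x)). lra. }
  destruct (lam_spec Z x y Hxy) as [H _].
  replace (packsup Phi x y) with (packsup Phi x y - packsup Phi x x) by lra.
  apply (H (fun s => packsup Phi x s)). split.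
  - intros u v Hu Huv Hv. rewrite (packsup_add Phi x u v) by lra.
    destruct (packsup_bounds Phi u v Huv). lra.
  - intros s Hs Zs. destruct (P2 s ltac:(lra) Zs) as (r & Hr & He). exists r; split; auto.
    intros u v Hu Hsu Huv Hv Hvs. rewrite (packsup_add Phi x u v) by lra.
    destruct (packsup_spec Phi u v Huv) as [A1 _].
    assert (v - u <= packsup Phi u v); [|lra]. apply A1. apply pack_exp; auto.
    intros u' v' Hu' Huv' Hv'. apply He; lra.
Qed.

(** Lebesgue density in finite form: up to a small error, [[a, b]] splits into
    finitely many cells in which [Z] has full, respectively zero, outer measure. *)
Lemma density_partition (Z : R -> Prop) (a b eps : R) : a <= b -> 0 < eps ->
  exists e, e <= eps /\
    Part (fun x y d => y - x - lam Z x y <= d \/ lam Z x y <= d) a b e.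
Proof.
  intros Hab He.
  destruct (lam_approx Z a b (eps / 2) Hab) as (Phi & HP & HPb); [lra|].
  assert (HP' := HP). destruct HP' as [P1 P2].
  set (leaf := fun x y d => y - x - lam Z x y <= d \/ lam Z x y <= d).
  (* Gaps of the packing become cells with defect [lam], at most their [packsup]; expanded intervals
     become cells whose defect is their length minus [lam]. For an almost optimal [Phi] and a
     packing almost as long as [packsup], the sum is small. *)
  assert (Ind : forall x y L, pack Phi x y L -> a <= x -> y <= b ->
    exists e, Part leaf x y e /\ e <= 2 * packsup Phi x y - L - lam Z x y).
  { intros x y L H. induction H as [x y Hxy|x y Hxy Hexp|x c y L1 L2 H1 IH1 H2 IH2]; intros Hx Hy.
    - exists (lam Z x y). split. apply Part_leaf; auto. right; lra.
      assert (lam Z x y <= packsup Phi x y) by (apply (lam_le_packsup Z a b); auto; split; auto). lra.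
    - exists (y - x - lam Z x y). split. apply Part_leaf; auto. left; lra.
      destruct (packsup_spec Phi x y Hxy) as [A1 _].
      assert (y - x <= packsup Phi x y) by (apply A1; apply pack_exp; auto). lra.
    - assert (B1 := pack_le _ _ _ _ H1). assert (B2 := pack_le _ _ _ _ H2).
      destruct IH1 as (e1 & E1 & E1b); try lra. destruct IH2 as (e2 & E2 & E2b); try lra.
      exists (e1 + e2). split. eapply Part_node; eauto.
      rewrite (packsup_add Phi x c y) by lra.
      assert (lam Z x y <= lam Z x c + lam Z c y) by (apply lam_subadd; lra). lra. }
  destruct (packsup_spec Phi a b Hab) as [A1 A2].
  assert (exists L, pack Phi a b L /\ packsup Phi a b - eps / 2 <= L) as (L & HL & HLb).
  { apply NNPP. intros Hn. assert (packsup Phi a b <= packsup Phi a b - eps / 2); [|lra].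
    apply A2. intros L HL. apply Rnot_lt_le. intros Hlt. apply Hn. exists L; split; auto; lra. }
  destruct (Ind a b L HL) as (e & E1 & E2); try lra.
  exists e. split; auto.
  assert (packsup Phi a b <= Phi b - Phi a).
  { apply A2. intros L' HL'. apply (pack_Phi Phi a b a b L'); auto; lra. }
  lra.
Qed.

Definition slam (l : list (R -> Prop)) (a b : R) : R :=
  fold_right (fun Z acc => lam Z a b + acc) 0 l.

Lemma slam_superadd (l : list (R -> Prop)) (a c b : R) : a <= c -> c <= b ->
  slam l a c + slam l c b <= slam l a b.
Proof.
  intros H1 H2. induction l as [|Z l IH]; simpl. lra.
  assert (H := lam_superadd Z a c b H1 H2). lra.
Qed.

Lemma slam_pos (l : list (R -> Prop)) (a b : R) : a <= b -> 0 <= slam l a b.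
Proof.
  intros H. induction l as [|Z l IH]; simpl. lra.
  destruct (lam_bounds Z a b H). lra.
Qed.

(** The sets are treated one at a time: a cell in which all sets treated so far are small is split
    again by the next one. Superadditivity of [slam] keeps the defects under control in the
    subdivision. *)
Lemma density_partition_list (l : list (R -> Prop)) : forall (a b eps : R),
  a <= b -> 0 < eps ->
  exists e, e <= eps /\
    Part (fun x y d => (exists Z, In Z l /\ y - x - lam Z x y <= d) \/ slam l x y <= d) a b e.
Proof.
  induction l as [|Z l IH]; intros a b eps Hab He.
  - exists 0. split; [lra|]. apply Part_leaf; auto. right. simpl. lra.
  - destruct (IH a b (eps / 2) Hab) as (e & E1 & E2); [lra|].
    set (leaf' := fun x y d => (exists Z', In Z' (Z :: l) /\ y - x - lam Z' x y <= d) \/ slam (Z :: l) x y <= d).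
    assert (HH : forall x y d, x <= y ->
      (exists Z, In Z l /\ y - x - lam Z x y <= d) \/ slam l x y <= d ->
      forall eps, 0 < eps -> exists e', e' <= d + eps /\ Part leaf' x y e').
    { intros x y d Hxy [(Z' & HZ' & Hd)|Hd] eps' He'.
      * exists d. split; [lra|]. apply Part_leaf; auto. left. exists Z'. split; auto. right; auto.
      * destruct (density_partition Z x y eps' Hxy He') as (d' & D1 & D2).
        assert (Hx : exists e'', e'' <= d' + slam l x y /\ Part leaf' x y e'').
        { clear - D2. induction D2 as [x y d Hxy Hl|x c y d1 d2 H1 IH1 H2 IH2].
          - destruct Hl as [Hl|Hl].
            + exists d. split. assert (H := slam_pos l x y Hxy). lra.
              apply Part_leaf; auto. left. exists Z. split; auto. left; auto.
            + exists (d + slam l x y). split. lra. apply Part_leaf; auto. right. simpl. lra.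
          - destruct IH1 as (e1 & E1 & P1). destruct IH2 as (e2 & E2 & P2).
            exists (e1 + e2). split; [|eapply Part_node; eauto].
            assert (B1 := Part_le _ _ _ _ P1). assert (B2 := Part_le _ _ _ _ P2).
            assert (H := slam_superadd l x c y B1 B2). lra. }
        destruct Hx as (e'' & H1 & H2). exists e''. split; auto. lra. }
    destruct (Part_refine _ leaf' a b e HH E2 (eps / 2)) as (e' & F1 & F2); [lra|].
    exists e'. split; [lra|auto].
Qed.

(** A form of Heine-Borel: the supremum of the points up to which the bound holds lies inside an
    expanded interval, so it can be passed unless it is [b]. *)
Lemma cover_all_length (a b : R) (P : R -> R) : a <= b ->
  cover (fun _ => True) a b P -> b - a <= P b - P a.
Proof.
  intros Hab [P1 P2].
  set (E := fun x => a <= x <= b /\ x - a <= P x - P a).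
  destruct (completeness E) as (m & Hm1 & Hm2).
  { exists b. intros x [Hx _]. lra. }
  { exists a. unfold E. lra. }
  assert (Ham : a <= m). { apply Hm1. unfold E. lra. }
  assert (Hmb : m <= b). { apply Hm2. intros x [Hx _]; lra. }
  destruct (P2 m ltac:(lra) I) as (r & Hr & H).
  assert (exists x, E x /\ m - r < x) as (x & [Hx Hx1] & Hxr).
  { apply NNPP. intros Hn. assert (m <= m - r); [|lra]. apply Hm2. intros x Ex.
    apply Rnot_lt_le. intros Hlt. apply Hn. exists x; auto. }
  assert (Hxm : x <= m). { apply Hm1. split; auto. }
  set (y := Rmin b (m + r / 2)).
  assert (Hy : m <= y /\ y <= b /\ y < m + r /\ (y = b \/ m < y)).
  { unfold y, Rmin. destruct (Rle_dec _ _); lra. }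
  assert (Ey : E y).
  { split; [lra|]. specialize (H x y). lra. }
  assert (y <= m) by (apply Hm1; auto).
  destruct Ey. replace b with y by lra. lra.
Qed.

Lemma slam_cover (l : list (R -> Prop)) (a b : R) : a <= b ->
  (forall s, exists Z, In Z l /\ Z s) -> b - a <= slam l a b.
Proof.
  intros Hab Hl. apply Rle_plus_epsilon. intros eps He.
  assert (H : forall eps, 0 < eps -> exists P, cover (fun s => exists Z, In Z l /\ Z s) a b P /\
             P b - P a <= slam l a b + eps).
  { clear - Hab. induction l as [|Z l IH]; intros eps He.
    - exists (fun _ => 0). split; [|simpl; lra]. split. intros; lra.
      intros s _ (Z & [] & _).
    - destruct (IH (eps / 2)) as (P & HP & HPb); [lra|].
      destruct (lam_approx Z a b (eps / 2) Hab) as (Q & HQ & HQb); [lra|].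
      exists (fun s => Q s + P s). split; [|simpl; lra].
      eapply cover_sub; [|apply (cover_or _ _ a b _ _ HQ HP)].
      intros s _ (Z' & [<-|HZ'] & Hs); auto. right. exists Z'; auto. }
  destruct (H eps He) as (P & HP & HPb).
  assert (b - a <= P b - P a); [|lra]. apply cover_all_length; auto.
  eapply cover_sub; [|exact HP]. intros; apply Hl.
Qed.

Theorem slope_partition (l : list (R -> Prop)) (a b eps : R) :
  a <= b -> 0 < eps -> (forall s, exists Z, In Z l /\ Z s) ->
  exists e, e <= eps /\
    Part (fun x y d => 0 <= d /\ exists Z, In Z l /\ (x < y -> slope_bound Z x y d)) a b e.
Proof.
  intros Hab He Hl.
  destruct (density_partition_list l a b (eps / 2) Hab) as (e & E1 & E2); [lra|].
  eapply Part_refine with (eps := eps / 2) in E2; [|clear E1 E2|lra].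
  - destruct E2 as (e' & F1 & F2). exists e'. split; [lra|exact F2].
  - intros x y d Hxy Hleaf eps' He'. exists d. split; [lra|]. apply Part_leaf; auto.
    (* If all sets of the list are small in the cell, the cell itself is no longer than [d], because
       together they cover it; any member then serves. *)
    assert (exists Z, In Z l /\ y - x - lam Z x y <= d) as (Z & HZ & Hd).
    { destruct Hleaf as [H|H]; auto. destruct (Hl 0) as (Z & HZ & _). exists Z; split; auto.
      assert (B := slam_cover l x y Hxy Hl). destruct (lam_bounds Z x y Hxy). lra. }
    destruct (lam_bounds Z x y Hxy). split; [lra|]. exists Z; split; auto.
    intros Hlt. apply cover_slope_bound; auto. intros P HP.
    destruct (lam_spec Z x y Hxy) as [B _]. specialize (B P HP). lra.
Qed.

(** * Gaussian smoothing of trigonometric polynomials *)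

(** Expectation over a simple symmetric random walk of [n] steps. Gaussian means are obtained as
    limits of such finite averages. *)
Fixpoint Ew (n : nat) (g : R -> R) : R :=
  match n with
  | O => g 0
  | S n => (Ew n (fun z => g (z + 1)) + Ew n (fun z => g (z - 1))) / 2
  end.

Lemma Ew_ext (n : nat) : forall f g, (forall z, f z = g z) -> Ew n f = Ew n g.
Proof.
  induction n; intros f g H; simpl; auto.
  rewrite (IHn _ (fun z => g (z + 1))), (IHn (fun z => f (z - 1)) (fun z => g (z - 1))); auto.
Qed.

Lemma Ew_lin (n : nat) : forall a b f g,
  Ew n (fun z => a * f z + b * g z) = a * Ew n f + b * Ew n g.
Proof.
  induction n; intros a b f g; simpl; auto. rewrite !IHn. field.
Qed.

Lemma Ew_scal (n : nat) (a : R) (f : R -> R) : Ew n (fun z => a * f z) = a * Ew n f.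
Proof.
  rewrite (Ew_ext n _ (fun z => a * f z + 0 * f z)) by (intros; ring).
  rewrite Ew_lin. ring.
Qed.

Lemma Ew_plus (n : nat) (f g : R -> R) : Ew n (fun z => f z + g z) = Ew n f + Ew n g.
Proof.
  rewrite (Ew_ext n _ (fun z => 1 * f z + 1 * g z)) by (intros; ring).
  rewrite Ew_lin. ring.
Qed.

Lemma Ew_le (n : nat) : forall f g, (forall z, f z <= g z) -> Ew n f <= Ew n g.
Proof.
  induction n; intros f g H; simpl; auto.
  assert (H1 := IHn (fun z => f (z + 1)) (fun z => g (z + 1)) (fun z => H _)).
  assert (H2 := IHn (fun z => f (z - 1)) (fun z => g (z - 1)) (fun z => H _)). lra.
Qed.

Lemma Ew_const (n : nat) (c : R) : Ew n (fun _ => c) = c.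
Proof. induction n; simpl; auto. rewrite IHn. field. Qed.

Lemma Ew_neg (n : nat) : forall g, Ew n (fun z => g (- z)) = Ew n g.
Proof.
  induction n; intros g; simpl. f_equal; ring.
  rewrite <- (IHn (fun z => g (z + 1))), <- (IHn (fun z => g (z - 1))).
  rewrite (Ew_ext n (fun z => g (- (z + 1))) (fun z => g (- z - 1))) by (intros; f_equal; ring).
  rewrite (Ew_ext n (fun z => g (- (z - 1))) (fun z => g (- z + 1))) by (intros; f_equal; ring).
  field.
Qed.

Lemma Ew_sq (n : nat) : forall c, Ew n (fun z => (z + c) ^ 2) = INR n + c ^ 2.
Proof.
  induction n; intros c.
  - simpl; ring.
  - rewrite S_INR. cbn [Ew].
    rewrite (Ew_ext n _ (fun z => (z + (c + 1)) ^ 2)) by (intros; ring).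
    rewrite (Ew_ext n (fun z => (z - 1 + c) ^ 2) (fun z => (z + (c - 1)) ^ 2)) by (intros; ring).
    rewrite !IHn. field.
Qed.

Lemma Ew_4 (n : nat) : forall c,
  Ew n (fun z => (z + c) ^ 4) = 3 * INR n ^ 2 - 2 * INR n + 6 * INR n * c ^ 2 + c ^ 4.
Proof.
  induction n; intros c.
  - simpl; ring.
  - rewrite S_INR. cbn [Ew].
    rewrite (Ew_ext n _ (fun z => (z + (c + 1)) ^ 4)) by (intros; ring).
    rewrite (Ew_ext n (fun z => (z - 1 + c) ^ 4) (fun z => (z + (c - 1)) ^ 4)) by (intros; ring).
    rewrite !IHn. field.
Qed.

Lemma Ew_cos (n : nat) (k : R) : forall p, Ew n (fun z => cos (k * z + p)) = cos k ^ n * cos p.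
Proof.
  induction n; intros p; cbn [Ew].
  - rewrite Rmult_0_r, Rplus_0_l. simpl; ring.
  - rewrite (Ew_ext n _ (fun z => cos (k * z + (p + k)))) by (intros; f_equal; ring).
    rewrite (Ew_ext n (fun z => cos (k * (z - 1) + p)) (fun z => cos (k * z + (p - k)))) by (intros; f_equal; ring).
    rewrite !IHn, cos_plus, cos_minus. simpl; field.
Qed.

Lemma cos_shift_sin (x : R) : sin x = cos (x + - (PI / 2)).
Proof. rewrite cos_plus, cos_neg, sin_neg, cos_PI2, sin_PI2. ring. Qed.

Lemma pow_pred_mul (n : nat) (c : R) : INR n * c ^ (pred n) * c = INR n * c ^ n.
Proof. destruct n; simpl. ring. ring. Qed.

(** The derivative of [Ew_cos] in [k], up to a quarter shift of the phase. At [n = 0] the factor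
    [INR n] hides the truncated exponent. *)
Lemma Ew_zcos (n : nat) (k : R) : forall p,
  Ew n (fun z => z * cos (k * z + p)) = - INR n * sin k * cos k ^ (pred n) * sin p.
Proof.
  induction n; intros p.
  - simpl; ring.
  - cbn [Ew].
    rewrite (Ew_ext n _ (fun z => z * cos (k * z + (p + k)) + cos (k * z + (p + k)))).
    2: { intros. replace (k * (z + 1) + p) with (k * z + (p + k)) by ring. ring. }
    rewrite (Ew_ext n (fun z => (z - 1) * cos (k * (z - 1) + p))
       (fun z => 1 * (z * cos (k * z + (p - k))) + (-1) * cos (k * z + (p - k)))).
    2: { intros. replace (k * (z - 1) + p) with (k * z + (p - k)) by ring. ring. }
    rewrite Ew_plus, Ew_lin, !IHn, !Ew_cos, S_INR.
    rewrite sin_plus, sin_minus, cos_plus, cos_minus. cbn [pred].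
    assert (H := pow_pred_mul n (cos k)).
    transitivity (- sin k * sin p * (INR n * cos k ^ pred n * cos k) - cos k ^ n * sin p * sin k).
    field. rewrite H. ring.
Qed.

Lemma Ew_zsin (n : nat) (k p : R) :
  Ew n (fun z => z * sin (k * z + p)) = INR n * sin k * cos k ^ (pred n) * cos p.
Proof.
  rewrite (Ew_ext n _ (fun z => z * cos (k * z + (p + - (PI / 2))))).
  - rewrite Ew_zcos, sin_plus, cos_neg, sin_neg, cos_PI2, sin_PI2. ring.
  - intros. rewrite cos_shift_sin. do 2 f_equal; ring.
Qed.

Lemma pow_pred2_mul (n : nat) (c : R) :
  INR n * (INR n - 1) * c ^ (pred (pred n)) * c = INR n * (INR n - 1) * c ^ (pred n).
Proof. destruct n as [|[|n]]; simpl; ring. Qed.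

Lemma Ew_z2cos (n : nat) (k : R) : forall p,
  Ew n (fun z => z ^ 2 * cos (k * z + p)) =
  (INR n * cos k ^ n - INR n * (INR n - 1) * sin k ^ 2 * cos k ^ (pred (pred n))) * cos p.
Proof.
  induction n; intros p.
  - simpl; ring.
  - cbn [Ew].
    rewrite (Ew_ext n _ (fun z => z ^ 2 * cos (k * z + (p + k)) +
       (2 * (z * cos (k * z + (p + k))) + 1 * cos (k * z + (p + k))))).
    2: { intros. replace (k * (z + 1) + p) with (k * z + (p + k)) by ring. ring. }
    rewrite (Ew_ext n (fun z => (z - 1) ^ 2 * cos (k * (z - 1) + p))
       (fun z => z ^ 2 * cos (k * z + (p - k)) +
       ((-2) * (z * cos (k * z + (p - k))) + 1 * cos (k * z + (p - k))))).
    2: { intros. replace (k * (z - 1) + p) with (k * z + (p - k)) by ring. ring. }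
    rewrite !Ew_plus, !Ew_scal, !IHn, !Ew_zcos, !Ew_cos, S_INR.
    rewrite sin_plus, sin_minus, cos_plus, cos_minus. cbn [pred].
    assert (H := pow_pred2_mul n (cos k)).
    transitivity (INR n * cos k ^ n * cos k * cos p -
      sin k ^ 2 * cos p * (INR n * (INR n - 1) * cos k ^ pred (pred n) * cos k)
      - 2 * INR n * sin k ^ 2 * cos k ^ pred n * cos p + cos k ^ n * cos p * cos k).
    field. rewrite H. simpl (cos k ^ S n). ring.
Qed.

(** Two independent walks with [m^2] steps of size [1/m], approximately a standard
    Gaussian vector for large [m]. *)
Definition E2 (m : nat) (G : R -> R -> R) : R :=
  Ew (m * m) (fun z1 => Ew (m * m) (fun z2 => G (z1 / INR m) (z2 / INR m))).

Lemma E2_ext (m : nat) (F G : R -> R -> R) : (forall x y, F x y = G x y) -> E2 m F = E2 m G.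
Proof. intros H. unfold E2. apply Ew_ext. intros. apply Ew_ext. auto. Qed.

Lemma E2_lin (m : nat) (a b : R) (F G : R -> R -> R) :
  E2 m (fun x y => a * F x y + b * G x y) = a * E2 m F + b * E2 m G.
Proof.
  unfold E2. rewrite <- Ew_lin. apply Ew_ext. intros.
  apply (Ew_lin (m * m) a b (fun z2 => F (z / INR m) (z2 / INR m)) (fun z2 => G (z / INR m) (z2 / INR m))).
Qed.

Lemma E2_le (m : nat) (F G : R -> R -> R) : (forall x y, F x y <= G x y) -> E2 m F <= E2 m G.
Proof. intros H. unfold E2. apply Ew_le. intros. apply Ew_le. auto. Qed.

Lemma E2_abs (m : nat) (F G : R -> R -> R) : (forall x y, Rabs (F x y) <= G x y) ->
  Rabs (E2 m F) <= E2 m G.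
Proof.
  intros H. apply Rabs_le. split.
  - assert (H1 := E2_le m (fun x y => (-1) * G x y + 0 * G x y) F).
    rewrite E2_lin in H1.
    assert (-1 * E2 m G + 0 * E2 m G <= E2 m F); [|lra]. apply H1.
    intros x y. specialize (H x y). apply Rabs_le_between in H. lra.
  - apply E2_le. intros x y. specialize (H x y). apply Rabs_le_between in H. lra.
Qed.

Lemma E2_neg (m : nat) (G : R -> R -> R) : E2 m (fun x y => G (- x) (- y)) = E2 m G.
Proof.
  unfold E2.
  rewrite <- (Ew_neg (m * m) (fun z1 => Ew (m * m) (fun z2 => G (z1 / INR m) (z2 / INR m)))).
  apply Ew_ext. intros z.
  rewrite <- (Ew_neg (m * m) (fun z2 => G (- z / INR m) (z2 / INR m))).
  apply Ew_ext. intros w. f_equal; unfold Rdiv; ring.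
Qed.

Lemma Ew_sq0 (n : nat) : Ew n (fun z => z ^ 2) = INR n.
Proof.
  rewrite (Ew_ext n _ (fun z => (z + 0) ^ 2)) by (intros; ring). rewrite Ew_sq. ring.
Qed.

Lemma Ew_40 (n : nat) : Ew n (fun z => z ^ 4) = 3 * INR n ^ 2 - 2 * INR n.
Proof.
  rewrite (Ew_ext n _ (fun z => (z + 0) ^ 4)) by (intros; ring). rewrite Ew_4. ring.
Qed.

(** Fourth moment of a coordinate of the rescaled walk for [m > 0]; it increases to the Gaussian
    value 3. *)
Definition kurt (m : nat) : R := 3 - 2 / INR m ^ 2.

Lemma Ew_poly (m : nat) (c0 c1 c2 : R) : (0 < m)%nat ->
  Ew (m * m) (fun z => c0 + c1 * (z / INR m) ^ 2 + c2 * (z / INR m) ^ 4) = c0 + c1 + c2 * kurt m.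
Proof.
  intros Hm. assert (H : 0 < INR m) by (apply lt_0_INR; auto).
  rewrite (Ew_ext _ _ (fun z => c0 + ((c1 / INR m ^ 2) * z ^ 2 + (c2 / INR m ^ 4) * z ^ 4))).
  - rewrite Ew_plus, Ew_const, Ew_lin, Ew_sq0, Ew_40, mult_INR. unfold kurt. field. lra.
  - intros. field. lra.
Qed.

Lemma E2_poly (m : nat) (c0 c1 c2 c3 c4 c5 : R) : (0 < m)%nat ->
  E2 m (fun x y => c0 + c1 * x ^ 2 + c2 * y ^ 2 + c3 * x ^ 4 + c4 * (x ^ 2 * y ^ 2) + c5 * y ^ 4) =
  c0 + c1 + c2 + c4 + (c3 + c5) * kurt m.
Proof.
  intros Hm. unfold E2.
  rewrite (Ew_ext _ _ (fun z => (c0 + c2 + c5 * kurt m) + (c1 + c4) * (z / INR m) ^ 2 + c3 * (z / INR m) ^ 4)).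
  - rewrite Ew_poly by auto. ring.
  - intros z.
    rewrite (Ew_ext _ _ (fun w => (c0 + c1 * (z / INR m) ^ 2 + c3 * (z / INR m) ^ 4) +
        (c2 + c4 * (z / INR m) ^ 2) * (w / INR m) ^ 2 + c5 * (w / INR m) ^ 4)) by (intros; ring).
    rewrite Ew_poly by auto. ring.
Qed.

Lemma kurt_le (m : nat) : (0 < m)%nat -> kurt m <= 3.
Proof.
  intros Hm. unfold kurt. assert (H : 0 < INR m) by (apply lt_0_INR; auto).
  assert (0 < 2 / INR m ^ 2). apply Rdiv_lt_0_compat. lra. apply pow_lt; auto. lra.
Qed.

Lemma exp_neg_le (y : R) : 0 <= y -> exp (- y) <= 1 - y + y ^ 2 / 2.
Proof.
  intros Hy. assert (H := exp_ge_taylor y 2 Hy). simpl in H.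
  assert (H1 : 1 + y + y ^ 2 / 2 <= exp y) by (simpl; lra).
  rewrite exp_Ropp. apply Rmult_le_reg_l with (exp y). apply exp_pos.
  rewrite Rinv_r by (apply Rgt_not_eq, exp_pos).
  assert (0 < 1 - y + y ^ 2 / 2) by nra.
  apply Rle_trans with ((1 + y + y ^ 2 / 2) * (1 - y + y ^ 2 / 2)); [|nra].
  assert (0 <= y ^ 4) by (apply pow_le; auto). nra.
Qed.

(** Both functions agree with [1 - x^2 / 2] up to terms of fourth order. *)
Lemma cos_exp_close (x : R) : Rabs x <= 1 -> Rabs (cos x - exp (- (x ^ 2 / 2))) <= x ^ 4.
Proof.
  intros Hx. apply Rabs_le_between in Hx.
  destruct (pre_cos_bound x 0) as [H1 H2]; try lra.
  unfold cos_approx, cos_term in *. simpl in H1, H2.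
  assert (H3 : 0 <= x ^ 2 / 2) by nra.
  assert (H4 := exp_neg_le (x ^ 2 / 2) H3).
  assert (H5 := exp_ineq1_le (- (x ^ 2 / 2))).
  apply Rabs_le. simpl in *. split; nra.
Qed.

Lemma pow_diff_le (n : nat) (a b : R) : Rabs a <= 1 -> Rabs b <= 1 ->
  Rabs (a ^ n - b ^ n) <= INR n * Rabs (a - b).
Proof.
  intros Ha Hb. induction n.
  - simpl. rewrite Rminus_diag, Rabs_R0. lra.
  - rewrite S_INR. simpl.
    replace (a * a ^ n - b * b ^ n) with (a * (a ^ n - b ^ n) + (a - b) * b ^ n) by ring.
    eapply Rle_trans; [apply Rabs_triang|]. rewrite !Rabs_mult.
    assert (Rabs (b ^ n) <= 1).
    { rewrite <- RPow_abs. rewrite <- (pow1 n). apply pow_incr. split; auto. apply Rabs_pos. }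
    assert (A := Rabs_pos (a ^ n - b ^ n)). assert (B := Rabs_pos (a - b)).
    assert (C := Rabs_pos a). assert (D := Rabs_pos (b ^ n)). nra.
Qed.

Lemma exp_pow (x : R) (n : nat) : exp x ^ n = exp (INR n * x).
Proof.
  induction n. simpl. rewrite Rmult_0_l, exp_0; auto.
  rewrite S_INR. simpl. rewrite IHn, <- exp_plus. f_equal; ring.
Qed.

Lemma lim_inv_INR (k : R) : is_lim_seq (fun m => k / INR m) 0.
Proof.
  replace (Finite 0) with (Rbar_mult k 0) by (simpl; f_equal; ring).
  apply (is_lim_seq_scal_l (fun m => / INR m) k 0).
  apply (is_lim_seq_inv _ p_infty). apply is_lim_seq_INR. easy.
Qed.

(** The central limit theorem for characteristic functions: replacing the [m^2] factors one at a
    time costs at most [m^2 (k / m)^4], which tends to 0. *)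
Lemma lim_cos_pow (k : R) :
  is_lim_seq (fun m => cos (k / INR m) ^ (m * m)) (exp (- (k ^ 2 / 2))).
Proof.
  apply is_lim_seq_le_le_loc with
    (fun m => exp (- (k ^ 2 / 2)) - k ^ 2 * (k / INR m * (k / INR m)))
    (fun m => exp (- (k ^ 2 / 2)) + k ^ 2 * (k / INR m * (k / INR m))).
  - destruct (nfloor_ex (Rabs k)) as (N & _ & HN). apply Rabs_pos.
    exists (S N). intros m Hm.
    assert (Hm0 : 0 < INR m) by (apply lt_0_INR; lia).
    assert (Hkm : Rabs k <= INR m).
    { apply le_INR in Hm. rewrite S_INR in Hm. lra. }
    assert (Hx : Rabs (k / INR m) <= 1).
    { unfold Rdiv. rewrite Rabs_mult, Rabs_inv, (Rabs_pos_eq (INR m)) by lra.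
      apply Rmult_le_reg_r with (INR m); auto. rewrite Rmult_assoc, Rinv_l; lra. }
    assert (E : exp (- (k ^ 2 / 2)) = exp (- ((k / INR m) ^ 2 / 2)) ^ (m * m)).
    { rewrite exp_pow, mult_INR. f_equal. field. lra. }
    assert (He : Rabs (exp (- ((k / INR m) ^ 2 / 2))) <= 1).
    { rewrite Rabs_pos_eq by (left; apply exp_pos).
      rewrite <- exp_0. destruct (Req_dec ((k / INR m) ^ 2) 0) as [h|h].
      rewrite h. right; f_equal; field. left. apply exp_increasing.
      assert (0 <= (k / INR m) ^ 2) by apply pow2_ge_0. lra. }
    assert (Hc : Rabs (cos (k / INR m)) <= 1) by (apply Rabs_le, COS_bound).
    assert (H := pow_diff_le (m * m) _ _ Hc He). rewrite <- E in H.
    assert (H2 := cos_exp_close _ Hx). rewrite mult_INR in H.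
    assert (H3 : Rabs (cos (k / INR m) ^ (m * m) - exp (- (k ^ 2 / 2))) <= k ^ 2 * (k / INR m * (k / INR m))).
    { eapply Rle_trans; [exact H|].
      apply Rle_trans with (INR m * INR m * (k / INR m) ^ 4).
      apply Rmult_le_compat_l; nra. right. field. lra. }
    apply Rabs_le_between in H3. lra.
  - replace (Finite (exp (- (k ^ 2 / 2)))) with
      (Rbar_minus (exp (- (k ^ 2 / 2))) (Rbar_mult (k ^ 2) (Rbar_mult 0 0))) by (simpl; f_equal; ring).
    apply is_lim_seq_minus'. apply is_lim_seq_const.
    apply (is_lim_seq_scal_l (fun m => k / INR m * (k / INR m)) (k ^ 2) (Rbar_mult 0 0)).
    apply is_lim_seq_mult'; apply lim_inv_INR.
  - replace (Finite (exp (- (k ^ 2 / 2)))) with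
      (Rbar_plus (exp (- (k ^ 2 / 2))) (Rbar_mult (k ^ 2) (Rbar_mult 0 0))) by (simpl; f_equal; ring).
    apply is_lim_seq_plus'. apply is_lim_seq_const.
    apply (is_lim_seq_scal_l (fun m => k / INR m * (k / INR m)) (k ^ 2) (Rbar_mult 0 0)).
    apply is_lim_seq_mult'; apply lim_inv_INR.
Qed.

Lemma lim_cos_one (k : R) : is_lim_seq (fun m => cos (k / INR m)) 1.
Proof.
  rewrite <- cos_0. apply (is_lim_seq_continuous cos); [|apply lim_inv_INR].
  apply continuity_cos.
Qed.

Lemma lim_msin (k : R) : is_lim_seq (fun m => INR m * sin (k / INR m)) k.
Proof.
  destruct (Req_dec k 0) as [->|Hk].
  - apply is_lim_seq_ext with (fun _ => 0); [|apply is_lim_seq_const].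
    intros n. unfold Rdiv. rewrite Rmult_0_l, sin_0. ring.
  - apply is_lim_seq_ext_loc with (fun m => k * (sin (k / INR m) / (k / INR m))).
    + exists 1%nat. intros m Hm. assert (0 < INR m) by (apply lt_0_INR; lia).
      field. split; lra.
    + replace (Finite k) with (Rbar_mult k 1) by (simpl; f_equal; ring).
      apply (is_lim_seq_scal_l (fun m => sin (k / INR m) / (k / INR m)) k 1).
      apply (is_lim_comp_seq (fun x => sin x / x) (fun m => k / INR m) 0 1).
      * apply is_lim_sinc_0.
      * exists 1%nat. intros m Hm He. injection He as He.
        assert (0 < INR m) by (apply lt_0_INR; lia).
        assert (k = 0 * INR m) by (rewrite <- He; field; lra). lra.
      * apply lim_inv_INR.
Qed.

Lemma lim_cos_pred (k : R) :
  is_lim_seq (fun m => cos (k / INR m) ^ (pred (m * m))) (exp (- (k ^ 2 / 2))) /\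
  is_lim_seq (fun m => cos (k / INR m) ^ (pred (pred (m * m)))) (exp (- (k ^ 2 / 2))).
Proof.
  assert (H := lim_cos_one k).
  assert (Hev : eventually (fun m => / 2 < cos (k / INR m))).
  { assert (Hl : Rbar_locally (Finite 1) (fun y => / 2 < y)).
    { exists (mkposreal (/ 2) ltac:(lra)). intros y Hy.
      change (Rabs (y - 1) < / 2) in Hy. apply Rabs_def2 in Hy. lra. }
    exact (H _ Hl). }
  destruct Hev as (N & HN).
  assert (H1 : is_lim_seq (fun m => cos (k / INR m) ^ (pred (m * m))) (exp (- (k ^ 2 / 2)))).
  { apply is_lim_seq_ext_loc with (fun m => cos (k / INR m) ^ (m * m) / cos (k / INR m)).
    - exists (N + 1)%nat. intros m Hm. specialize (HN m ltac:(lia)).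
      assert (exists n, (m * m = S n)%nat) as (n & ->) by (destruct m; [lia|]; simpl; eexists; eauto).
      simpl. field. lra.
    - replace (Finite (exp (- (k ^ 2 / 2)))) with (Rbar_div (exp (- (k ^ 2 / 2))) 1) by (simpl; f_equal; field).
      apply is_lim_seq_div'; auto using lim_cos_pow; try lra. }
  split; auto.
  apply is_lim_seq_ext_loc with (fun m => cos (k / INR m) ^ (pred (m * m)) / cos (k / INR m)).
  - exists (N + 2)%nat. intros m Hm. specialize (HN m ltac:(lia)).
    assert (exists n, (m * m = S (S n))%nat) as (n & ->).
    { exists (m * m - 2)%nat. assert (2 * 2 <= m * m)%nat by (apply Nat.mul_le_mono; lia). lia. }
    simpl. field. lra.
  - replace (Finite (exp (- (k ^ 2 / 2)))) with (Rbar_div (exp (- (k ^ 2 / 2))) 1) by (simpl; f_equal; field).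
    apply is_lim_seq_div'; auto; try lra.
Qed.

Lemma lim_E2_cos (k1 k2 p : R) :
  is_lim_seq (fun m => E2 m (fun x y => cos (k1 * x + k2 * y + p)))
    (exp (- (k1 ^ 2 / 2)) * exp (- (k2 ^ 2 / 2)) * cos p).
Proof.
  apply is_lim_seq_ext with
    (fun m => cos (k1 / INR m) ^ (m * m) * cos (k2 / INR m) ^ (m * m) * cos p).
  - intros m. unfold E2. symmetry.
    rewrite (Ew_ext _ _ (fun z => cos (k2 / INR m) ^ (m * m) * cos (k1 / INR m * z + p))).
    + rewrite Ew_scal, Ew_cos. ring.
    + intros z. rewrite <- Ew_cos. apply Ew_ext. intros w. f_equal. unfold Rdiv; ring.
  - apply is_lim_seq_mult'; [|apply is_lim_seq_const].
    apply is_lim_seq_mult'; apply lim_cos_pow.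
Qed.

Lemma lim_sin2 (k : R) :
  is_lim_seq (fun m => (INR m ^ 2 - 1) * sin (k / INR m) ^ 2 * cos (k / INR m) ^ (pred (pred (m * m))))
     (k ^ 2 * exp (- (k ^ 2 / 2))).
Proof.
  apply is_lim_seq_mult'; [|apply lim_cos_pred].
  apply is_lim_seq_ext_loc with
    (fun m => (INR m * sin (k / INR m)) * (INR m * sin (k / INR m)) * (1 - (1 / INR m) * (1 / INR m))).
  - exists 1%nat. intros m Hm. assert (0 < INR m) by (apply lt_0_INR; lia). field. lra.
  - replace (k ^ 2) with (k * k * (1 - 0 * 0)) by ring.
    apply is_lim_seq_mult'. apply is_lim_seq_mult'; apply lim_msin.
    apply is_lim_seq_minus'. apply is_lim_seq_const.
    apply is_lim_seq_mult'; apply lim_inv_INR.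
Qed.

Lemma Ew_z2m1 (m : nat) (k p : R) : (0 < m)%nat ->
  Ew (m * m) (fun z => ((z / INR m) ^ 2 - 1) * cos (k / INR m * z + p)) =
  - ((INR m ^ 2 - 1) * sin (k / INR m) ^ 2 * cos (k / INR m) ^ (pred (pred (m * m)))) * cos p.
Proof.
  intros Hm. assert (0 < INR m) by (apply lt_0_INR; lia).
  rewrite (Ew_ext _ _ (fun z => (/ INR m ^ 2) * (z ^ 2 * cos (k / INR m * z + p)) + (-1) * cos (k / INR m * z + p))).
  - rewrite Ew_lin, Ew_z2cos, Ew_cos, mult_INR. field. lra.
  - intros. field. lra.
Qed.

(** [x^2 - 1], [x y] and [y^2 - 1] are Hermite polynomials: integration by parts against the
    Gaussian turns these weights into second derivatives. Here this appears as the limit of exact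
    identities for the walk. *)
Lemma lim_E2_x2 (k1 k2 p : R) :
  is_lim_seq (fun m => E2 m (fun x y => (x ^ 2 - 1) * cos (k1 * x + k2 * y + p)))
    (- (k1 ^ 2 * exp (- (k1 ^ 2 / 2))) * exp (- (k2 ^ 2 / 2)) * cos p).
Proof.
  apply is_lim_seq_ext_loc with
    (fun m => - ((INR m ^ 2 - 1) * sin (k1 / INR m) ^ 2 * cos (k1 / INR m) ^ (pred (pred (m * m))))
       * cos (k2 / INR m) ^ (m * m) * cos p).
  - exists 1%nat. intros m Hm. unfold E2. symmetry.
    rewrite (Ew_ext _ _ (fun z => cos (k2 / INR m) ^ (m * m) * (((z / INR m) ^ 2 - 1) * cos (k1 / INR m * z + p)))).
    + rewrite Ew_scal, Ew_z2m1 by lia. ring.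
    + intros z. rewrite Ew_scal.
      rewrite (Ew_ext _ _ (fun w => cos (k2 / INR m * w + (k1 / INR m * z + p)))).
      rewrite Ew_cos. ring. intros w. f_equal. unfold Rdiv; ring.
  - apply is_lim_seq_mult'; [|apply is_lim_seq_const].
    apply is_lim_seq_mult'; [|apply lim_cos_pow].
    apply (is_lim_seq_opp _ (k1 ^ 2 * exp (- (k1 ^ 2 / 2)))). apply lim_sin2.
Qed.

Lemma E2_swap_y2 (m : nat) (k1 k2 p : R) : (0 < m)%nat ->
  E2 m (fun x y => (y ^ 2 - 1) * cos (k1 * x + k2 * y + p)) =
  E2 m (fun x y => (x ^ 2 - 1) * cos (k2 * x + k1 * y + p)).
Proof.
  intros Hm. unfold E2.
  transitivity (- ((INR m ^ 2 - 1) * sin (k2 / INR m) ^ 2 * cos (k2 / INR m) ^ (pred (pred (m * m))))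
       * (cos (k1 / INR m) ^ (m * m) * cos p)).
  - rewrite <- Ew_cos, <- Ew_scal. apply Ew_ext. intros z. rewrite <- Ew_z2m1 by auto.
    apply Ew_ext. intros w. do 2 f_equal. unfold Rdiv; ring.
  - symmetry. rewrite (Ew_ext _ _ (fun z => cos (k1 / INR m) ^ (m * m) * (((z / INR m) ^ 2 - 1) * cos (k2 / INR m * z + p)))).
    + rewrite Ew_scal, Ew_z2m1 by lia. ring.
    + intros z. rewrite Ew_scal.
      rewrite (Ew_ext _ _ (fun w => cos (k1 / INR m * w + (k2 / INR m * z + p)))).
      rewrite Ew_cos. ring. intros w. f_equal. unfold Rdiv; ring.
Qed.

Lemma lim_E2_y2 (k1 k2 p : R) :
  is_lim_seq (fun m => E2 m (fun x y => (y ^ 2 - 1) * cos (k1 * x + k2 * y + p)))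
    (- (k2 ^ 2 * exp (- (k2 ^ 2 / 2))) * exp (- (k1 ^ 2 / 2)) * cos p).
Proof.
  apply is_lim_seq_ext_loc with (fun m => E2 m (fun x y => (x ^ 2 - 1) * cos (k2 * x + k1 * y + p))).
  - exists 1%nat. intros m Hm. symmetry. apply E2_swap_y2. lia.
  - apply lim_E2_x2.
Qed.

Lemma lim_E2_xy (k1 k2 p : R) :
  is_lim_seq (fun m => E2 m (fun x y => (x * y) * cos (k1 * x + k2 * y + p)))
    (- (k1 * exp (- (k1 ^ 2 / 2))) * (k2 * exp (- (k2 ^ 2 / 2))) * cos p).
Proof.
  apply is_lim_seq_ext_loc with
    (fun m => - ((INR m * sin (k1 / INR m)) * cos (k1 / INR m) ^ (pred (m * m)))
       * ((INR m * sin (k2 / INR m)) * cos (k2 / INR m) ^ (pred (m * m))) * cos p).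
  - exists 1%nat. intros m Hm. assert (0 < INR m) by (apply lt_0_INR; lia).
    unfold E2. symmetry.
    rewrite (Ew_ext _ _ (fun z => (- sin (k2 / INR m) * cos (k2 / INR m) ^ (pred (m * m))) *
       (z * sin (k1 / INR m * z + p)))).
    + rewrite Ew_scal, Ew_zsin, mult_INR. ring.
    + intros z.
      rewrite (Ew_ext _ _ (fun w => (z / INR m / INR m) * (w * cos (k2 / INR m * w + (k1 / INR m * z + p))))).
      * rewrite Ew_scal, Ew_zcos, mult_INR. field. lra.
      * intros w. replace (k1 * (z / INR m) + k2 * (w / INR m) + p) with
          (k2 / INR m * w + (k1 / INR m * z + p)) by (unfold Rdiv; ring). field. lra.
  - apply is_lim_seq_mult'; [|apply is_lim_seq_const].
    apply is_lim_seq_mult'.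
    + apply (is_lim_seq_opp _ (k1 * exp (- (k1 ^ 2 / 2)))).
      apply is_lim_seq_mult'. apply lim_msin. apply lim_cos_pred.
    + apply is_lim_seq_mult'. apply lim_msin. apply lim_cos_pred.
Qed.

(** The term [ta * cos (tk * x + tl * y + tp)] of a trigonometric polynomial. *)
Record tm := Tm { ta : R; tk : R; tl : R; tp : R }.

Definition ang (e : tm) (x y : R) : R := tk e * x + tl e * y + tp e.

Definition wsum (c : tm -> R) (tr : R -> R) (l : list tm) (x y : R) : R :=
  fold_right (fun e acc => ta e * c e * tr (ang e x y) + acc) 0 l.

Definition ev (l : list tm) (x y : R) : R := wsum (fun _ => 1) cos l x y.

(** [hf] is the characteristic function of the centred Gaussian at the frequency of the term [e]. *)
Definition qform (q1 q2 q3 : R) (e : tm) : R :=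
  q1 * tk e ^ 2 + 2 * q2 * tk e * tl e + q3 * tl e ^ 2.
Definition hf (q1 q2 q3 : R) (e : tm) : R := exp (- (qform q1 q2 q3 e / 2)).

(** Convolution of [ev l] with the centred Gaussian of covariance
    [[q1, q2], [q2, q3]], and its derivatives. *)
Definition V q1 q2 q3 := wsum (hf q1 q2 q3) cos.
Definition Vx q1 q2 q3 := wsum (fun e => - tk e * hf q1 q2 q3 e) sin.
Definition Vy q1 q2 q3 := wsum (fun e => - tl e * hf q1 q2 q3 e) sin.
Definition Vxx q1 q2 q3 := wsum (fun e => - tk e ^ 2 * hf q1 q2 q3 e) cos.
Definition Vxy q1 q2 q3 := wsum (fun e => - (tk e * tl e) * hf q1 q2 q3 e) cos.
Definition Vyy q1 q2 q3 := wsum (fun e => - tl e ^ 2 * hf q1 q2 q3 e) cos.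

Lemma wsum_lin (a b : R) (c d : tm -> R) (tr : R -> R) (l : list tm) (x y : R) :
  wsum (fun e => a * c e + b * d e) tr l x y = a * wsum c tr l x y + b * wsum d tr l x y.
Proof. unfold wsum. induction l; simpl. ring. rewrite IHl. ring. Qed.

Lemma wsum_ext (c d : tm -> R) (tr : R -> R) (l : list tm) (x y : R) :
  (forall e, c e = d e) -> wsum c tr l x y = wsum d tr l x y.
Proof. intros H. unfold wsum. induction l; simpl; auto. rewrite IHl, H. auto. Qed.

(** The covariance is comparable to [s] times the identity; [s] plays the role of the accumulated
    diffusion time. *)
Definition Qb (lamb Lam s q1 q2 q3 : R) : Prop :=
  forall u v, lamb * s * (u ^ 2 + v ^ 2) <= q1 * u ^ 2 + 2 * q2 * u * v + q3 * v ^ 2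
    <= Lam * s * (u ^ 2 + v ^ 2).

(** The Cholesky factor writes the Gaussian as a linear image of two independent standard ones.
    Testing the form at [(1, 0)] and at [(- q2 / q1, 1)], where it equals the Schur complement,
    bounds the pivots from below. *)
Lemma Qb_cholesky (lamb Lam s q1 q2 q3 : R) : 0 < lamb -> 0 < s -> Qb lamb Lam s q1 q2 q3 ->
  exists a b c, 0 < a /\ 0 < c /\ q1 = a * a /\ q2 = a * b /\ q3 = b * b + c * c /\
    lamb * s <= a * a <= Lam * s /\ lamb * s <= c * c <= Lam * s /\ b * b <= Lam * s.
Proof.
  intros Hl Hs H.
  assert (H1 : lamb * s <= q1 <= Lam * s).
  { specialize (H 1 0). lra. }
  assert (H3 : lamb * s <= q3 <= Lam * s).
  { specialize (H 0 1). lra. }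
  assert (Hls : 0 < lamb * s) by nra.
  assert (Hd : lamb * s <= q3 - q2 * q2 / q1).
  { destruct (H (- (q2 / q1)) 1) as [H2 _].
    replace (q1 * (- (q2 / q1)) ^ 2 + 2 * q2 * - (q2 / q1) * 1 + q3 * 1 ^ 2)
      with (q3 - q2 * q2 / q1) in H2 by (field; lra).
    assert (0 <= (- (q2 / q1)) ^ 2) by apply pow2_ge_0. nra. }
  assert (Hq : 0 <= q2 * q2 / q1).
  { apply Rmult_le_pos. nra. left; apply Rinv_0_lt_compat; lra. }
  set (a := sqrt q1). assert (Ha : 0 < a) by (apply sqrt_lt_R0; lra).
  assert (Haa : a * a = q1) by (apply sqrt_sqrt; lra).
  set (c := sqrt (q3 - q2 * q2 / q1)). assert (Hc : 0 < c) by (apply sqrt_lt_R0; lra).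
  assert (Hcc : c * c = q3 - q2 * q2 / q1) by (apply sqrt_sqrt; lra).
  exists a, (q2 / a), c.
  assert (Hb : q2 / a * (q2 / a) = q2 * q2 / q1) by (rewrite <- Haa; field; lra).
  repeat split; auto; try lra. field; lra.
Qed.

Lemma ang_shift (e : tm) (x y a b c u v : R) :
  ang e (x + u * a) (y + (u * b + v * c)) =
  (tk e * a + tl e * b) * u + (tl e * c) * v + ang e x y.
Proof. unfold ang. ring. Qed.

Lemma lim_E2_wsum (w : R -> R -> R) (co : tm -> R) (l : list tm) (x y a b c : R) :
  (forall e, is_lim_seq (fun m => E2 m (fun u v => w u v *
      cos ((tk e * a + tl e * b) * u + (tl e * c) * v + ang e x y))) (co e * cos (ang e x y))) ->
  is_lim_seq (fun m => E2 m (fun u v => w u v * ev l (x + u * a) (y + (u * b + v * c))))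
    (wsum co cos l x y).
Proof.
  intros H. unfold ev. induction l as [|e l IH].
  - simpl. apply is_lim_seq_ext with (fun _ => 0); [|apply is_lim_seq_const].
    intros m. unfold E2. rewrite (Ew_ext _ _ (fun _ => 0)). rewrite Ew_const; auto.
    intros. rewrite (Ew_ext _ _ (fun _ => 0)). apply Ew_const. intros; ring.
  - apply is_lim_seq_ext with (fun m => ta e * E2 m (fun u v => w u v *
      cos ((tk e * a + tl e * b) * u + (tl e * c) * v + ang e x y)) +
      1 * E2 m (fun u v => w u v * wsum (fun _ => 1) cos l (x + u * a) (y + (u * b + v * c)))).
    + intros m. rewrite <- E2_lin. apply E2_ext. intros u v. simpl. rewrite ang_shift. ring.
    + simpl wsum. replace (ta e * co e * cos (ang e x y) + wsum co cos l x y) with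
        (ta e * (co e * cos (ang e x y)) + 1 * wsum co cos l x y) by ring.
      apply is_lim_seq_plus'; apply is_lim_seq_mult'; try apply is_lim_seq_const; auto.
Qed.

Lemma hf_split (q1 q2 q3 a b c : R) (e : tm) : q1 = a * a -> q2 = a * b -> q3 = b * b + c * c ->
  exp (- ((tk e * a + tl e * b) ^ 2 / 2)) * exp (- ((tl e * c) ^ 2 / 2)) = hf q1 q2 q3 e.
Proof.
  intros -> -> ->. rewrite <- exp_plus. unfold hf, qform. f_equal. field.
Qed.

Lemma lim_le_const (u : nat -> R) (l K : R) :
  (forall m, (0 < m)%nat -> Rabs (u m) <= K) -> is_lim_seq u l -> Rabs l <= K.
Proof.
  intros H Hl. apply (is_lim_seq_abs u l) in Hl.
  assert (Hle : Rbar_le (Rabs l) K); [|exact Hle].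
  apply is_lim_seq_le_loc with (u := fun m => Rabs (u m)) (v := fun _ => K); auto.
  exists 1%nat. intros; apply H; lia. apply is_lim_seq_const.
Qed.

Section Smoothing.
Variables (lamb Lam s q1 q2 q3 : R) (l : list tm) (x y A B : R).
Hypotheses (Hl : 0 < lamb) (Hs : 0 < s) (HQ : Qb lamb Lam s q1 q2 q3).

Lemma shift_norm (a b c u v : R) : a * a <= Lam * s -> b * b <= Lam * s -> c * c <= Lam * s ->
  (u * a) ^ 2 + (u * b + v * c) ^ 2 <= 3 * (Lam * s) * (u ^ 2 + v ^ 2).
Proof.
  intros Ha Hb Hc. assert (0 <= u ^ 2) by apply pow2_ge_0. assert (0 <= v ^ 2) by apply pow2_ge_0.
  assert ((u * b + v * c) ^ 2 <= 2 * (u ^ 2 * (b * b)) + 2 * (v ^ 2 * (c * c))).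
  { assert (0 <= (u * b - v * c) ^ 2) by apply pow2_ge_0. nra. }
  replace ((u * a) ^ 2) with (u ^ 2 * (a * a)) by ring.
  assert (u ^ 2 * (a * a) <= u ^ 2 * (Lam * s)) by (apply Rmult_le_compat_l; auto).
  assert (u ^ 2 * (b * b) <= u ^ 2 * (Lam * s)) by (apply Rmult_le_compat_l; auto).
  assert (v ^ 2 * (c * c) <= v ^ 2 * (Lam * s)) by (apply Rmult_le_compat_l; auto).
  assert (0 <= Lam * s) by nra. nra.
Qed.

Lemma lim_E2_V (a b c : R) : q1 = a * a -> q2 = a * b -> q3 = b * b + c * c ->
  is_lim_seq (fun m => E2 m (fun u v => 1 * ev l (x + u * a) (y + (u * b + v * c))))
    (V q1 q2 q3 l x y).
Proof.
  intros E1 E2' E3. apply (lim_E2_wsum (fun _ _ => 1)). intros e.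
  rewrite <- (hf_split _ _ _ a b c e E1 E2' E3).
  eapply is_lim_seq_ext; [|apply (lim_E2_cos (tk e * a + tl e * b) (tl e * c))].
  intros m. apply E2_ext. intros; ring.
Qed.

(** A parabola below the data passes to the convolution. The 6 is the factor 3 of [shift_norm] times
    the mean 2 of [u^2 + v^2]. *)
Lemma V_lower (c0 D : R) : 0 <= D ->
  (forall u v, c0 - D * (u ^ 2 + v ^ 2) <= ev l (x + u) (y + v)) ->
  c0 - 6 * D * (Lam * s) <= V q1 q2 q3 l x y.
Proof.
  intros HD H.
  destruct (Qb_cholesky _ _ _ _ _ _ Hl Hs HQ) as (a & b & c & Ha & Hc & E1 & E2' & E3 & Ba & Bc & Bb).
  assert (HL := lim_E2_V a b c E1 E2' E3).
  assert (Hle : Rbar_le (c0 - 6 * D * (Lam * s)) (V q1 q2 q3 l x y)); [|exact Hle].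
  apply is_lim_seq_le_loc with (u := fun _ => c0 - 6 * D * (Lam * s)) (3 := HL); [|apply is_lim_seq_const].
  exists 1%nat. intros m Hm.
  assert (Hp := E2_poly m c0 (- (3 * D * (Lam * s))) (- (3 * D * (Lam * s))) 0 0 0 ltac:(lia)).
  apply Rle_trans with (c0 + - (3 * D * (Lam * s)) + - (3 * D * (Lam * s)) + 0 + (0 + 0) * kurt m); [right; ring|].
  rewrite <- Hp. apply E2_le. intros u v.
  assert (Hn := shift_norm a b c u v (proj2 Ba) Bb (proj2 Bc)).
  specialize (H (u * a) (u * b + v * c)). nra.
Qed.

Lemma V_upper (c0 D : R) : 0 <= D ->
  (forall u v, ev l (x + u) (y + v) <= c0 + D * (u ^ 2 + v ^ 2)) ->
  V q1 q2 q3 l x y <= c0 + 6 * D * (Lam * s).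
Proof.
  intros HD H.
  destruct (Qb_cholesky _ _ _ _ _ _ Hl Hs HQ) as (a & b & c & Ha & Hc & E1 & E2' & E3 & Ba & Bc & Bb).
  assert (HL := lim_E2_V a b c E1 E2' E3).
  assert (Hle : Rbar_le (V q1 q2 q3 l x y) (c0 + 6 * D * (Lam * s))); [|exact Hle].
  apply is_lim_seq_le_loc with (v := fun _ => c0 + 6 * D * (Lam * s)) (2 := HL); [|apply is_lim_seq_const].
  exists 1%nat. intros m Hm.
  assert (Hp := E2_poly m c0 (3 * D * (Lam * s)) (3 * D * (Lam * s)) 0 0 0 ltac:(lia)).
  apply Rle_trans with (c0 + (3 * D * (Lam * s)) + (3 * D * (Lam * s)) + 0 + (0 + 0) * kurt m); [|right; ring].
  rewrite <- Hp. apply E2_le. intros u v.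
  assert (Hn := shift_norm a b c u v (proj2 Ba) Bb (proj2 Bc)).
  specialize (H (u * a) (u * b + v * c)). nra.
Qed.

Hypotheses (HA : 0 <= A) (HB : 0 <= B).
Hypothesis (Hf : forall u v,
  Rabs (ev l (x + u) (y + v) + ev l (x - u) (y - v) - 2 * ev l x y) <= A + B * (u ^ 2 + v ^ 2)).

(** Symmetrisation: for an even weight of mean zero only second differences matter. *)
Lemma E2_even_weight (m : nat) (w : R -> R -> R) (a b c w0 : R) :
  (0 < m)%nat -> a * a <= Lam * s -> b * b <= Lam * s -> c * c <= Lam * s ->
  (forall u v, w (- u) (- v) = w u v) -> E2 m w = w0 ->
  Rabs (E2 m (fun u v => w u v * ev l (x + u * a) (y + (u * b + v * c))) - w0 * ev l x y) <=
  / 2 * E2 m (fun u v => Rabs (w u v) * (A + B * (3 * (Lam * s) * (u ^ 2 + v ^ 2)))).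
Proof.
  intros Hm Ha Hb Hc Hw Hw0.
  set (G := fun u v => w u v * ev l (x + u * a) (y + (u * b + v * c))).
  assert (E : E2 m G - w0 * ev l x y =
    / 2 * E2 m (fun u v => w u v * (ev l (x + u * a) (y + (u * b + v * c)) +
       ev l (x - u * a) (y - (u * b + v * c)) - 2 * ev l x y))).
  { rewrite (E2_ext m (fun u v => w u v * (_ + _ - _)) (fun u v => 1 * (1 * G u v + 1 * G (- u) (- v)) + (-2 * ev l x y) * w u v)).
    - rewrite E2_lin, (E2_lin m 1 1 G (fun u v => G (- u) (- v))), (E2_neg m G), Hw0. field.
    - intros u v. unfold G. rewrite Hw.
      replace (x + - u * a) with (x - u * a) by ring.
      replace (y + (- u * b + - v * c)) with (y - (u * b + v * c)) by ring. ring. }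
  rewrite E, Rabs_mult, (Rabs_pos_eq (/ 2)) by lra.
  apply Rmult_le_compat_l; [lra|]. apply E2_abs. intros u v. rewrite Rabs_mult.
  apply Rmult_le_compat_l. apply Rabs_pos.
  eapply Rle_trans; [apply Hf|]. apply Rplus_le_compat_l. apply Rmult_le_compat_l; auto.
  apply shift_norm; auto.
Qed.

Lemma V_close : Rabs (V q1 q2 q3 l x y - ev l x y) <= / 2 * (A + 6 * B * (Lam * s)).
Proof.
  destruct (Qb_cholesky _ _ _ _ _ _ Hl Hs HQ) as (a & b & c & Ha & Hc & E1 & E2' & E3 & Ba & Bc & Bb).
  assert (HL := lim_E2_V a b c E1 E2' E3).
  apply (lim_le_const (fun m => E2 m (fun u v => 1 * ev l (x + u * a) (y + (u * b + v * c))) - ev l x y)).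
  - intros m Hm.
    assert (H1 : E2 m (fun _ _ => 1) = 1).
    { unfold E2. rewrite (Ew_ext _ _ (fun _ => 1)). apply Ew_const. intros; apply Ew_const. }
    assert (HE := E2_even_weight m (fun _ _ => 1) a b c 1 Hm (proj2 Ba) Bb (proj2 Bc) (fun _ _ => eq_refl) H1).
    cbv beta in HE. rewrite (Rmult_1_l (ev l x y)) in HE.
    eapply Rle_trans; [exact HE|].
    + apply Rmult_le_compat_l; [lra|].
      rewrite (E2_ext m _ (fun u v => A + 3 * B * (Lam * s) * u ^ 2 + 3 * B * (Lam * s) * v ^ 2 + 0 * u ^ 4 + 0 * (u ^ 2 * v ^ 2) + 0 * v ^ 4)).
      rewrite E2_poly by auto. right; ring. intros. rewrite Rabs_R1. ring.
  - apply is_lim_seq_minus'; auto. apply is_lim_seq_const.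
Qed.

(** The weight has mean zero and quadratic growth, so the bound of [E2_even_weight] involves fourth
    moments of the walk, which [kurt_le] bounds uniformly in [m]. *)
Lemma W_bound (w : R -> R -> R) (co : tm -> R) (a b c : R) :
  a * a <= Lam * s -> b * b <= Lam * s -> c * c <= Lam * s ->
  (forall u v, w (- u) (- v) = w u v) -> (forall m, (0 < m)%nat -> E2 m w = 0) ->
  (forall u v, Rabs (w u v) <= 1 + u ^ 2 \/ Rabs (w u v) <= 1 + v ^ 2) ->
  (forall e, is_lim_seq (fun m => E2 m (fun u v => w u v *
      cos ((tk e * a + tl e * b) * u + (tl e * c) * v + ang e x y))) (co e * cos (ang e x y))) ->
  Rabs (wsum co cos l x y) <= 2 * (A + 12 * B * (Lam * s)).
Proof.
  intros Ha Hb Hc Hw Hw0 Hwb Hlim.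
  apply (lim_le_const _ _ _) with (2 := lim_E2_wsum w co l x y a b c Hlim).
  intros m Hm.
  assert (HE := E2_even_weight m w a b c 0 Hm Ha Hb Hc Hw (Hw0 m Hm)).
  rewrite Rmult_0_l, Rminus_0_r in HE. eapply Rle_trans; [exact HE|].
  apply Rle_trans with (/ 2 * (A + (A + 3 * B * (Lam * s)) + (A + 3 * B * (Lam * s)) + 6 * B * (Lam * s)
     + (3 * B * (Lam * s) + 3 * B * (Lam * s)) * kurt m)).
  - apply Rmult_le_compat_l; [lra|].
    rewrite <- E2_poly by auto. apply E2_le. intros u v.
    assert (0 <= u ^ 2) by apply pow2_ge_0. assert (0 <= v ^ 2) by apply pow2_ge_0.
    assert (H2 : Rabs (w u v) <= 1 + u ^ 2 + v ^ 2) by (destruct (Hwb u v); lra).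
    assert (0 <= Lam * s) by nra.
    assert (HBL : 0 <= B * (Lam * s)) by nra.
    assert (0 <= A + B * (3 * (Lam * s) * (u ^ 2 + v ^ 2))) by nra.
    apply Rle_trans with ((1 + u ^ 2 + v ^ 2) * (A + B * (3 * (Lam * s) * (u ^ 2 + v ^ 2)))).
    + apply Rmult_le_compat_r; auto.
    + right. ring.
  - assert (0 <= B * (Lam * s)) by (apply Rmult_le_pos; auto; nra).
    assert (Hk := kurt_le m Hm). nra.
Qed.

(** The three Hermite weights give the second derivatives along the columns of the Cholesky factor:
    [(a dx + b dy)^2], [(a dx + b dy) c dy] and [(c dy)^2]. This triangular system is solved for
    [yy], [xy] and [xx] in this order; its pivots [c^2], [a c], [a^2] are at least [lamb * s], and
    [R0] bounds [|b| / a]. *)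
Lemma D2V_bound :
  let X := 2 * (A + 12 * B * (Lam * s)) / (lamb * s) in let R0 := Lam / lamb in
  Rabs (Vxx q1 q2 q3 l x y) <= 2 * (1 + R0) ^ 2 * X /\
  Rabs (Vxy q1 q2 q3 l x y) <= 2 * (1 + R0) ^ 2 * X /\
  Rabs (Vyy q1 q2 q3 l x y) <= 2 * (1 + R0) ^ 2 * X.
Proof.
  intros X R0.
  destruct (Qb_cholesky _ _ _ _ _ _ Hl Hs HQ) as (a & b & c & Ha & Hc & E1 & E2' & E3 & Ba & Bc & Bb).
  set (K := 2 * (A + 12 * B * (Lam * s))) in *.
  set (xx := Vxx q1 q2 q3 l x y). set (xy := Vxy q1 q2 q3 l x y). set (yy := Vyy q1 q2 q3 l x y).
  assert (W1 : Rabs (a * a * xx + 2 * (a * b) * xy + b * b * yy) <= K).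
  { assert (E : a * a * xx + 2 * (a * b) * xy + b * b * yy =
      wsum (fun e => - ((tk e * a + tl e * b) ^ 2 * exp (- ((tk e * a + tl e * b) ^ 2 / 2))) *
         exp (- ((tl e * c) ^ 2 / 2))) cos l x y).
    { rewrite (wsum_ext _ (fun e => 1 * (a * a * (- tk e ^ 2 * hf q1 q2 q3 e) + 2 * (a * b) * (- (tk e * tl e) * hf q1 q2 q3 e))
          + b * b * (- tl e ^ 2 * hf q1 q2 q3 e))).
      - rewrite wsum_lin, wsum_lin. unfold xx, xy, yy, Vxx, Vxy, Vyy. ring.
      - intros e. rewrite <- (hf_split _ _ _ a b c e E1 E2' E3). ring. }
    rewrite E. apply (W_bound (fun u v => u ^ 2 - 1) _ a b c); try lra.
    - intros; ring.
    - intros m Hm. rewrite (E2_ext m _ (fun u v => -1 + 1 * u ^ 2 + 0 * v ^ 2 + 0 * u ^ 4 + 0 * (u ^ 2 * v ^ 2) + 0 * v ^ 4)) by (intros; ring).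
      rewrite E2_poly by auto. ring.
    - intros u v. left. assert (0 <= u ^ 2) by apply pow2_ge_0. apply Rabs_le; lra.
    - intros e. apply lim_E2_x2. }
  assert (W2 : Rabs (c * c * yy) <= K).
  { assert (E : c * c * yy =
      wsum (fun e => - ((tl e * c) ^ 2 * exp (- ((tl e * c) ^ 2 / 2))) *
         exp (- ((tk e * a + tl e * b) ^ 2 / 2))) cos l x y).
    { rewrite (wsum_ext _ (fun e => c * c * (- tl e ^ 2 * hf q1 q2 q3 e) + 0 * (- tl e ^ 2 * hf q1 q2 q3 e))).
      - rewrite wsum_lin. unfold yy, Vyy. ring.
      - intros e. rewrite <- (hf_split _ _ _ a b c e E1 E2' E3). ring. }
    rewrite E. apply (W_bound (fun u v => v ^ 2 - 1) _ a b c); try lra.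
    - intros; ring.
    - intros m Hm. rewrite (E2_ext m _ (fun u v => -1 + 0 * u ^ 2 + 1 * v ^ 2 + 0 * u ^ 4 + 0 * (u ^ 2 * v ^ 2) + 0 * v ^ 4)) by (intros; ring).
      rewrite E2_poly by auto. ring.
    - intros u v. right. assert (0 <= v ^ 2) by apply pow2_ge_0. apply Rabs_le; lra.
    - intros e. apply lim_E2_y2. }
  assert (W3 : Rabs (a * c * xy + b * c * yy) <= K).
  { assert (E : a * c * xy + b * c * yy =
      wsum (fun e => - ((tk e * a + tl e * b) * exp (- ((tk e * a + tl e * b) ^ 2 / 2))) *
         ((tl e * c) * exp (- ((tl e * c) ^ 2 / 2)))) cos l x y).
    { rewrite (wsum_ext _ (fun e => a * c * (- (tk e * tl e) * hf q1 q2 q3 e) + b * c * (- tl e ^ 2 * hf q1 q2 q3 e))).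
      - rewrite wsum_lin. unfold xy, yy, Vxy, Vyy. ring.
      - intros e. rewrite <- (hf_split _ _ _ a b c e E1 E2' E3). ring. }
    rewrite E. apply (W_bound (fun u v => u * v) _ a b c); try lra.
    - intros; ring.
    - intros m Hm. unfold E2.
      rewrite (Ew_ext _ _ (fun _ => 0)). apply Ew_const. intros z.
      rewrite (Ew_ext _ _ (fun w => z / INR m * / INR m * (w * cos (0 * w + 0)))).
      rewrite Ew_scal, Ew_zcos, sin_0. ring.
      intros w. rewrite Rmult_0_l, Rplus_0_r, cos_0. unfold Rdiv. ring.
    - intros u v. assert (0 <= u ^ 2) by apply pow2_ge_0. assert (0 <= v ^ 2) by apply pow2_ge_0.
      destruct (Rle_dec (v ^ 2) (u ^ 2)); [left|right];
      (apply Rabs_le; split; [assert (0 <= (u + v) ^ 2) by apply pow2_ge_0|assert (0 <= (u - v) ^ 2) by apply pow2_ge_0]; nra).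
    - intros e. apply lim_E2_xy. }
  assert (Hls : 0 < lamb * s) by nra.
  assert (HLs : 0 < Lam * s) by lra.
  assert (HK : 0 <= K) by (unfold K; assert (0 <= B * (Lam * s)) by nra; lra).
  assert (HX : 0 <= X) by (unfold X; apply Rmult_le_pos; [auto|left; apply Rinv_0_lt_compat; auto]).
  assert (HR : 1 <= R0).
  { unfold R0. apply Rmult_le_reg_r with (lamb * s); auto.
    replace (Lam / lamb * (lamb * s)) with (Lam * s) by (field; lra). lra. }
  assert (HKX : K = X * (lamb * s)) by (unfold X; field; split; nra).
  assert (HLR : Lam * s = R0 * (lamb * s)) by (unfold R0; field; lra).
  assert (Hbr : Rabs b <= R0 * a).
  { apply Rsqr_incr_0; [|apply Rabs_pos|nra]. rewrite <- Rsqr_abs. unfold Rsqr.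
    assert (b * b <= R0 * (a * a)) by nra. nra. }
  assert (Hyy : Rabs yy <= X).
  { rewrite Rabs_mult, (Rabs_pos_eq (c * c)) in W2 by nra.
    apply Rmult_le_reg_l with (lamb * s); auto. assert (0 <= Rabs yy) by apply Rabs_pos. nra. }
  assert (Hac : lamb * s <= a * c).
  { apply Rsqr_incr_0; [unfold Rsqr|lra|nra].
    replace (a * c * (a * c)) with ((a * a) * (c * c)) by ring. nra. }
  assert (Hxy : Rabs xy <= (1 + R0) * X).
  { assert (H1 : a * c * Rabs xy <= K + R0 * (a * c) * Rabs yy).
    { replace (a * c * Rabs xy) with (Rabs ((a * c * xy + b * c * yy) - b * c * yy)).
      2: { replace (a * c * xy + b * c * yy - b * c * yy) with (a * c * xy) by ring.
           rewrite Rabs_mult, (Rabs_pos_eq (a * c)); nra. }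
      eapply Rle_trans; [apply Rabs_triang|]. rewrite Rabs_Ropp.
      apply Rplus_le_compat; auto. rewrite !Rabs_mult, (Rabs_pos_eq c) by lra.
      apply Rmult_le_compat_r. apply Rabs_pos. nra. }
    apply Rmult_le_reg_l with (a * c); [lra|].
    eapply Rle_trans; [exact H1|]. rewrite HKX. 
    assert (X * (lamb * s) <= X * (a * c)) by (apply Rmult_le_compat_l; auto).
    assert (0 <= R0 * (a * c)) by nra.
    assert (R0 * (a * c) * Rabs yy <= R0 * (a * c) * X) by (apply Rmult_le_compat_l; auto). lra. }
  assert (Hxx : Rabs xx <= 2 * (1 + R0) ^ 2 * X).
  { assert (H1 : a * a * Rabs xx <= K + 2 * (R0 * (a * a)) * Rabs xy + R0 * (a * a) * Rabs yy).
    { replace (a * a * Rabs xx) with (Rabs ((a * a * xx + 2 * (a * b) * xy + b * b * yy) + - (2 * (a * b) * xy) + - (b * b * yy))).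
      2: { replace (a * a * xx + 2 * (a * b) * xy + b * b * yy + - (2 * (a * b) * xy) + - (b * b * yy)) with (a * a * xx) by ring.
           rewrite Rabs_mult, (Rabs_pos_eq (a * a)); nra. }
      eapply Rle_trans; [apply Rabs_triang|]. apply Rplus_le_compat.
      eapply Rle_trans; [apply Rabs_triang|]. apply Rplus_le_compat; auto.
      - rewrite Rabs_Ropp, !Rabs_mult, (Rabs_pos_eq 2), (Rabs_pos_eq a) by lra.
        apply Rmult_le_compat_r. apply Rabs_pos. nra.
      - rewrite Rabs_Ropp, Rabs_mult, (Rabs_pos_eq (b * b)) by nra.
        apply Rmult_le_compat_r. apply Rabs_pos. nra. }
    assert (Haa : 0 < a * a) by nra.
    apply Rmult_le_reg_l with (a * a); auto.
    eapply Rle_trans; [exact H1|].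
    assert (K <= X * (a * a)) by (rewrite HKX; apply Rmult_le_compat_l; lra).
    assert (0 <= R0 * (a * a)) by nra.
    assert (R0 * (a * a) * Rabs yy <= R0 * (a * a) * X) by (apply Rmult_le_compat_l; auto).
    assert (2 * (R0 * (a * a)) * Rabs xy <= 2 * (R0 * (a * a)) * ((1 + R0) * X)) by (apply Rmult_le_compat_l; lra).
    assert (0 <= a * a * X) by nra.
    replace (a * a * (2 * (1 + R0) ^ 2 * X)) with ((a * a * X) * (2 * (1 + R0) ^ 2)) by ring.
    apply Rle_trans with ((a * a * X) * (1 + 2 * R0 * (1 + R0) + R0)); [lra|].
    apply Rmult_le_compat_l; nra. }
  split; auto. split.
  - eapply Rle_trans; [exact Hxy|]. apply Rmult_le_compat_r; auto. nra.
  - eapply Rle_trans; [exact Hyy|]. replace X with (1 * X) at 1 by ring.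
    apply Rmult_le_compat_r; auto. nra.
Qed.
End Smoothing.

(** * Trigonometric approximation *)

Definition is_trig (f : R -> R -> R) : Prop := exists l, forall x y, f x y = ev l x y.

Lemma is_trig_const (c : R) : is_trig (fun _ _ => c).
Proof.
  exists (Tm c 0 0 0 :: nil). intros x y. unfold ev, wsum, ang. simpl.
  rewrite !Rmult_0_l, !Rplus_0_r, cos_0. ring.
Qed.

Lemma ev_app (l1 l2 : list tm) (x y : R) : ev (l1 ++ l2) x y = ev l1 x y + ev l2 x y.
Proof.
  unfold ev. induction l1 as [|e l1 IH]; simpl. ring. rewrite IH. ring.
Qed.

Lemma is_trig_plus (f g : R -> R -> R) : is_trig f -> is_trig g -> is_trig (fun x y => f x y + g x y).
Proof.
  intros [l1 H1] [l2 H2]. exists (l1 ++ l2). intros x y. rewrite H1, H2, ev_app. auto.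
Qed.

Lemma is_trig_cos_mult (a k l p : R) (f : R -> R -> R) : is_trig f ->
  is_trig (fun x y => a * cos (k * x + l * y + p) * f x y).
Proof.
  intros [L H].
  exists (flat_map (fun e => Tm (a * ta e / 2) (k + tk e) (l + tl e) (p + tp e) ::
                    Tm (a * ta e / 2) (k - tk e) (l - tl e) (p - tp e) :: nil) L).
  intros x y. rewrite H. clear H. unfold ev. induction L as [|e L IH]; simpl. ring.
  rewrite <- IH. unfold ang; simpl.
  replace ((k + tk e) * x + (l + tl e) * y + (p + tp e)) with
    ((k * x + l * y + p) + (tk e * x + tl e * y + tp e)) by ring.
  replace ((k - tk e) * x + (l - tl e) * y + (p - tp e)) with
    ((k * x + l * y + p) - (tk e * x + tl e * y + tp e)) by ring.
  rewrite (cos_plus (k * x + l * y + p)), cos_minus. field.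
Qed.

Lemma is_trig_ext (f g : R -> R -> R) : (forall x y, f x y = g x y) -> is_trig f -> is_trig g.
Proof. intros H [l Hl]. exists l. intros. rewrite <- H. auto. Qed.

Lemma is_trig_scal (a : R) (f : R -> R -> R) : is_trig f -> is_trig (fun x y => a * f x y).
Proof.
  intros H. apply (is_trig_ext (fun x y => a * cos (0 * x + 0 * y + 0) * f x y)).
  - intros. rewrite !Rmult_0_l, !Rplus_0_r, cos_0. ring.
  - apply is_trig_cos_mult; auto.
Qed.

Lemma is_trig_sin_mult (k l : R) (f : R -> R -> R) : is_trig f ->
  is_trig (fun x y => sin (k * x + l * y) * f x y).
Proof.
  intros H. apply (is_trig_ext (fun x y => 1 * cos (k * x + l * y + - (PI / 2)) * f x y)).
  - intros. rewrite (cos_shift_sin (k * x + l * y)). ring.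
  - apply is_trig_cos_mult; auto.
Qed.

(** Bernstein operator: expectation of [g] over [k] plus a binomial([n], [q]) variable. *)
Fixpoint Bn (n : nat) (q : R) (g : nat -> R) (k : nat) : R :=
  match n with
  | O => g k
  | S n => q * Bn n q g (S k) + (1 - q) * Bn n q g k
  end.

Lemma Bn_le (n : nat) (q : R) (f g : nat -> R) : 0 <= q <= 1 ->
  forall k, (forall i, (i <= n + k)%nat -> f i <= g i) -> Bn n q f k <= Bn n q g k.
Proof.
  intros Hq. induction n; intros k H; simpl.
  - apply H; lia.
  - assert (H1 : Bn n q f (S k) <= Bn n q g (S k)) by (apply IHn; intros; apply H; lia).
    assert (H2 : Bn n q f k <= Bn n q g k) by (apply IHn; intros; apply H; lia).
    apply Rplus_le_compat; apply Rmult_le_compat_l; lra.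
Qed.

Lemma Bn_quad (n : nat) (q a b c : R) : forall k,
  Bn n q (fun i => a + b * (INR i - c) ^ 2) k =
  a + b * ((INR k + INR n * q - c) ^ 2 + INR n * (q * (1 - q))).
Proof.
  induction n; intros k; cbn [Bn].
  - simpl INR. ring.
  - rewrite !IHn, !S_INR. ring.
Qed.

(** Bernstein's argument: the squared deviation of the frequency [i / n] from [q] averages to the
    variance [q (1 - q) / n], at most [1 / (4 n)]. *)
Lemma Bn_abs (n : nat) (q G a b : R) (g : nat -> R) : 0 <= q <= 1 -> 0 <= b -> (0 < n)%nat ->
  (forall i, (i <= n)%nat -> Rabs (g i - G) <= a + b * (INR i / INR n - q) ^ 2) ->
  Rabs (Bn n q g 0 - G) <= a + b / (4 * INR n).
Proof.
  intros Hq Hb Hn H.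
  assert (HN : 0 < INR n) by (apply lt_0_INR; auto).
  assert (E : forall s G', Bn n q (fun i => G' + s * (b / INR n ^ 2) * (INR i - INR n * q) ^ 2) 0 =
     G' + s * b / INR n * (q * (1 - q))).
  { intros s G'. rewrite Bn_quad. simpl INR. field. lra. }
  assert (Hq2 : q * (1 - q) <= / 4) by (assert (0 <= (q - / 2) ^ 2) by apply pow2_ge_0; nra).
  assert (Hb2 : b / INR n * (q * (1 - q)) <= b / (4 * INR n)).
  { replace (b / (4 * INR n)) with (b / INR n * / 4) by (field; lra).
    apply Rmult_le_compat_l; auto. apply Rmult_le_pos; auto. left; apply Rinv_0_lt_compat; auto. }
  apply Rabs_le. split.
  - assert (H1 := E (-1) (G - a)).
    assert (Bn n q (fun i => G - a + -1 * (b / INR n ^ 2) * (INR i - INR n * q) ^ 2) 0 <= Bn n q g 0).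
    { apply Bn_le; auto. intros i Hi. specialize (H i ltac:(lia)). apply Rabs_le_between in H.
      replace (b / INR n ^ 2 * (INR i - INR n * q) ^ 2) with (b * (INR i / INR n - q) ^ 2) by (field; lra).
      replace (-1 * (b / INR n ^ 2) * (INR i - INR n * q) ^ 2) with (- (b * (INR i / INR n - q) ^ 2)) by (field; lra).
      lra. }
    replace (-1 * b / INR n * (q * (1 - q))) with (- (b / INR n * (q * (1 - q)))) in H1 by (field; lra). lra.
  - assert (H1 := E 1 (G + a)).
    assert (Bn n q g 0 <= Bn n q (fun i => G + a + 1 * (b / INR n ^ 2) * (INR i - INR n * q) ^ 2) 0).
    { apply Bn_le; auto. intros i Hi. specialize (H i ltac:(lia)). apply Rabs_le_between in H.
      replace (1 * (b / INR n ^ 2) * (INR i - INR n * q) ^ 2) with (b * (INR i / INR n - q) ^ 2) by (field; lra).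
      lra. }
    replace (1 * b / INR n * (q * (1 - q))) with (b / INR n * (q * (1 - q))) in H1 by (field; lra). lra.
Qed.

Lemma Bn_const (n : nat) (q c : R) : forall k, Bn n q (fun _ => c) k = c.
Proof. induction n; intros k; simpl; auto. rewrite !IHn. ring. Qed.

(** The success probability is an affine function of a sine, so the Bernstein recursion stays within
    trigonometric polynomials. *)
Lemma is_trig_Bn (n : nat) (k l : R) (F : nat -> R -> R -> R) : (forall i, is_trig (F i)) ->
  forall j, is_trig (fun x y => Bn n (/ 2 + / 2 * sin (k * x + l * y)) (fun i => F i x y) j).
Proof.
  intros HF. induction n; intros j; simpl. apply HF.
  set (q := fun x y => / 2 + / 2 * sin (k * x + l * y)).
  set (A := fun x y => Bn n (q x y) (fun i => F i x y) (S j)).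
  set (B := fun x y => Bn n (q x y) (fun i => F i x y) j).
  apply (is_trig_ext (fun x y => (/ 2 * A x y + / 2 * (sin (k * x + l * y) * A x y)) +
     (/ 2 * B x y + (- / 2) * (sin (k * x + l * y) * B x y)))).
  - intros x y. fold (q x y). fold (A x y). fold (B x y). unfold q. field.
  - apply is_trig_plus; apply is_trig_plus; apply is_trig_scal; try apply is_trig_sin_mult; apply IHn.
Qed.

(** A difference of sines is [2 sin d cos m], with half difference [d] and mean [m]; on this range
    [cos m >= sin d >= d / 3], which gives [2 (d / 3)^2]. *)
Lemma sin_sep (al be : R) : - (PI / 2) <= al <= PI / 2 -> - (PI / 2) <= be <= PI / 2 ->
  (al - be) ^ 2 / 18 <= Rabs (sin al - sin be).
Proof.
  assert (Main : forall al be, - (PI / 2) <= al <= PI / 2 -> - (PI / 2) <= be <= PI / 2 ->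
     be <= al -> (al - be) ^ 2 / 18 <= sin al - sin be).
  { clear al be. intros al be Ha Hb Hab. rewrite form4.
    set (d := (al - be) / 2). set (m := (al + be) / 2).
    assert (Hd : 0 <= d <= PI / 2) by (unfold d; lra).
    assert (Hm : Rabs m <= PI / 2 - d) by (unfold m, d; apply Rabs_le; lra).
    assert (Hsd : d / 3 <= sin d).
    { assert (H4 := PI_4). destruct (pre_sin_bound d 0) as [H1 _]; try lra.
      unfold sin_approx, sin_term in H1. simpl in H1. assert (H := PI_4).
      assert (d * d <= 4) by nra. 
      assert (d * (d * (d * 1)) <= 4 * d) by nra. nra. }
    assert (Hcm : sin d <= cos m).
    { rewrite <- (cos_shift d).
      replace (cos m) with (cos (Rabs m)) by (unfold Rabs; destruct (Rcase_abs m); auto using cos_neg).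
      assert (0 <= Rabs m) by apply Rabs_pos. assert (H0 := PI_RGT_0).
      apply cos_decr_1; lra. }
    assert ((al - be) ^ 2 / 18 = 2 * (d / 3) * (d / 3)) by (unfold d; field).
    rewrite H. nra. }
  intros Ha Hb. destruct (Rle_dec be al) as [h|h].
  - rewrite Rabs_pos_eq; [auto|]. assert (H := Main al be Ha Hb h).
    assert (0 <= (al - be) ^ 2) by apply pow2_ge_0. lra.
  - assert (H := Main be al Hb Ha ltac:(lra)).
    assert (0 <= (be - al) ^ 2) by apply pow2_ge_0.
    rewrite Rabs_left1 by lra. replace ((al - be) ^ 2) with ((be - al) ^ 2) by ring. lra.
Qed.

(** A Bernstein polynomial in [(1 + sin (c x)) / 2] for each variable; as [c * rad = PI / 2], the
    substitution maps [[- rad, rad]] monotonically onto [[0, 1]]. Being an average of values of [U]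
    in the square, it is bounded by [C] on the whole plane, and the Gaussian convolution sees the
    whole plane. *)
Lemma trig_approx (U : R -> R -> R) (rad C eps : R) : 0 < rad -> 0 < eps -> 0 <= C ->
  (forall x y, Rabs x <= rad -> Rabs y <= rad -> Rabs (U x y) <= C) ->
  (forall e, 0 < e -> exists d, 0 < d /\ forall x y x' y',
     Rabs x <= rad -> Rabs y <= rad -> Rabs x' <= rad -> Rabs y' <= rad ->
     Rabs (x' - x) < d -> Rabs (y' - y) < d -> Rabs (U x' y' - U x y) < e) ->
  exists l, (forall x y, Rabs (ev l x y) <= C) /\
    forall x y, Rabs x <= rad -> Rabs y <= rad -> Rabs (ev l x y - U x y) <= eps.
Proof.
  intros HR He HC HU Huc.
  destruct (Huc (eps / 2)) as (d & Hd & Hud); [lra|].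
  assert (HPI := PI_RGT_0).
  set (c := PI / (2 * rad)). assert (Hc : 0 < c) by (apply Rdiv_lt_0_compat; lra).
  assert (HcR : c * rad = PI / 2) by (unfold c; field; lra).
  (* By [sin_sep], points at distance [d] have parameters [q] at least [dq] apart; [b] is chosen so
     that the quadratic term is then at least [2 C], the trivial bound for the error. *)
  set (dq := c ^ 2 * d ^ 2 / 36).
  assert (Hdq : 0 < dq). { unfold dq. assert (0 < c ^ 2) by (apply pow_lt; auto). assert (0 < d ^ 2) by (apply pow_lt; auto). nra. }
  set (b := 2 * C / dq ^ 2).
  assert (Hdq2 : 0 < dq ^ 2) by (apply pow_lt; auto).
  assert (Hb : 0 <= b). { apply Rmult_le_pos. lra. left; apply Rinv_0_lt_compat; auto. }
  destruct (nfloor_ex (b / eps)) as (N & _ & HN).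
  { apply Rmult_le_pos; auto. left; apply Rinv_0_lt_compat; auto. }
  set (n := S N). assert (Hn : 0 < INR n) by (apply lt_0_INR; unfold n; lia).
  assert (HbN : b / (4 * INR n) <= eps / 4).
  { assert (HN' : b / eps < INR n) by (unfold n; rewrite S_INR; auto).
    apply Rmult_le_reg_r with (4 * INR n); [lra|]. unfold Rdiv at 1. rewrite Rmult_assoc, Rinv_l by lra.
    assert (b = b / eps * eps) by (field; lra). nra. }
  set (q := fun x => / 2 + / 2 * sin (c * x)).
  assert (Hq : forall x, 0 <= q x <= 1).
  { intros x. unfold q. assert (H := SIN_bound (c * x)). lra. }
  set (node := fun i => asin (2 * (INR i / INR n) - 1) / c).
  assert (Hin : forall i, (i <= n)%nat -> -1 <= 2 * (INR i / INR n) - 1 <= 1).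
  { intros i Hi. apply le_INR in Hi. assert (0 <= INR i) by apply pos_INR.
    assert (INR i / INR n * INR n = INR i) by (field; lra). nra. }
  assert (Hnode : forall i, Rabs (node i) <= rad).
  { intros i. unfold node. assert (H := asin_bound (2 * (INR i / INR n) - 1)).
    apply Rabs_le. assert (E : asin (2 * (INR i / INR n) - 1) = asin (2 * (INR i / INR n) - 1) / c * c) by (field; lra).
    split; nra. }
  assert (Hfar : forall x i, Rabs x <= rad -> (i <= n)%nat -> d <= Rabs (node i - x) ->
     1 <= (INR i / INR n - q x) ^ 2 / dq ^ 2).
  { intros x i Hx Hi Hdx.
    assert (Hs := sin_sep (c * node i) (c * x)).
    assert (Ecn : c * node i = asin (2 * (INR i / INR n) - 1)) by (unfold node; field; lra).
    assert (Hcx : - (PI / 2) <= c * x <= PI / 2).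
    { apply Rabs_le_between in Hx. rewrite <- HcR. split; nra. }
    specialize (Hs ltac:(rewrite Ecn; apply asin_bound) Hcx).
    rewrite Ecn in Hs at 2. rewrite sin_asin in Hs by (apply Hin; auto).
    assert (H1 : dq <= Rabs (INR i / INR n - q x)).
    { replace (INR i / INR n - q x) with (/ 2 * (2 * (INR i / INR n) - 1 - sin (c * x))) by (unfold q; field; lra).
      rewrite Rabs_mult, (Rabs_pos_eq (/ 2)) by lra.
      assert (d ^ 2 <= (node i - x) ^ 2).
      { rewrite <- (pow2_abs (node i - x)). apply pow_incr. lra. }
      assert (c ^ 2 * d ^ 2 <= c ^ 2 * (node i - x) ^ 2).
      { apply Rmult_le_compat_l; auto. apply pow2_ge_0. }
      replace ((c * node i - c * x) ^ 2) with (c ^ 2 * (node i - x) ^ 2) in Hs by ring.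
      unfold dq. lra. }
    apply Rmult_le_reg_r with (dq ^ 2); auto.
    replace ((INR i / INR n - q x) ^ 2 / dq ^ 2 * dq ^ 2) with ((INR i / INR n - q x) ^ 2) by (field; lra).
    rewrite Rmult_1_l, <- (pow2_abs (INR i / INR n - q x)). apply pow_incr. lra. }
  destruct (is_trig_Bn n c 0 (fun i x y => Bn n (/ 2 + / 2 * sin (0 * x + c * y)) (fun j => U (node i) (node j)) 0)) with (j := 0%nat) as [l Hl].
  { intros i. apply (is_trig_Bn n 0 c (fun j x y => U (node i) (node j))). intros j. apply is_trig_const. }
  assert (Hl' : forall x y, ev l x y = Bn n (q x) (fun i => Bn n (q y) (fun j => U (node i) (node j)) 0) 0).
  { intros x y. rewrite <- Hl. unfold q. f_equal. do 3 f_equal. ring.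
    replace (0 * x + c * y) with (c * y) by ring. auto. }
  exists l. split.
  - intros x y. rewrite Hl'.
    assert (HUn : forall i j, - C <= U (node i) (node j) <= C).
    { intros i j. apply Rabs_le_between. apply HU; apply Hnode. }
    apply Rabs_le. split.
    + rewrite <- (Bn_const n (q x) (- C) 0). apply Bn_le; auto. intros i _.
      rewrite <- (Bn_const n (q y) (- C) 0). apply Bn_le; auto. intros j _. apply HUn.
    + rewrite <- (Bn_const n (q x) C 0). apply Bn_le; auto. intros i _.
      rewrite <- (Bn_const n (q y) C 0). apply Bn_le; auto. intros j _. apply HUn.
  - intros x y Hx Hy. rewrite Hl'.
    apply Rle_trans with ((eps / 2 + b / (4 * INR n)) + b / (4 * INR n)); [|lra].
    apply Bn_abs; auto. unfold n; lia. intros i Hi.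
    replace (eps / 2 + b / (4 * INR n) + b * (INR i / INR n - q x) ^ 2) with
      ((eps / 2 + b * (INR i / INR n - q x) ^ 2) + b / (4 * INR n)) by ring.
    apply Bn_abs; auto. unfold n; lia. intros j Hj.
    assert (HC2 : Rabs (U (node i) (node j) - U x y) <= 2 * C).
    { assert (A1 := HU (node i) (node j) (Hnode i) (Hnode j)). assert (A2 := HU x y Hx Hy).
      apply Rabs_le_between in A1. apply Rabs_le_between in A2. apply Rabs_le. lra. }
    assert (Hbx : forall t, b * t ^ 2 = 2 * C * (t ^ 2 / dq ^ 2)) by (intros; unfold b; field; lra).
    assert (Ht : forall t, 0 <= t ^ 2 / dq ^ 2).
    { intros. apply Rmult_le_pos. apply pow2_ge_0. left; apply Rinv_0_lt_compat; auto. }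
    rewrite !Hbx. assert (T1 := Ht (INR i / INR n - q x)). assert (T2 := Ht (INR j / INR n - q y)).
    destruct (Rlt_dec (Rabs (node i - x)) d) as [h1|h1].
    + destruct (Rlt_dec (Rabs (node j - y)) d) as [h2|h2].
      * assert (H := Hud x y (node i) (node j) Hx Hy (Hnode i) (Hnode j) h1 h2). nra.
      * assert (H := Hfar y j Hy Hj ltac:(lra)). nra.
    + assert (H := Hfar x i Hx Hi ltac:(lra)). nra.
Qed.

(** * Test functions and logarithmic coordinates *)

Lemma cont3_const (c : R) : cont3 (fun _ _ _ => c).
Proof.
  intros s h t eps He. exists 1. split; [lra|]. intros. rewrite Rminus_diag, Rabs_R0; auto.
Qed.

Lemma cont3_comp1 (h : R -> R) (f : R -> R -> R -> R) :
  (forall z, continuity_pt h z) -> cont3 f -> cont3 (fun x y t => h (f x y t)).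
Proof.
  intros Hh Hf x y t eps He.
  destruct (cont_ed h (f x y t) eps (Hh _) He) as (d & Hd & H1).
  destruct (Hf x y t d Hd) as (d' & Hd' & H2). exists d'. split; auto.
Qed.

Lemma cont3_x : cont3 (fun x _ _ => x).
Proof. intros s h t eps He. exists eps. auto. Qed.
Lemma cont3_y : cont3 (fun _ y _ => y).
Proof. intros s h t eps He. exists eps. auto. Qed.
Lemma cont3_t : cont3 (fun _ _ t => t).
Proof. intros s h t eps He. exists eps. auto. Qed.

Lemma cont3_plus (f g : R -> R -> R -> R) : cont3 f -> cont3 g -> cont3 (fun x y t => f x y t + g x y t).
Proof.
  intros Hf Hg x y t eps He.
  destruct (Hf x y t (eps / 2)) as (d1 & Hd1 & H1); [lra|].
  destruct (Hg x y t (eps / 2)) as (d2 & Hd2 & H2); [lra|].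
  exists (Rmin d1 d2). split. apply Rmin_glb_lt; auto.
  intros x' y' t' Hx Hy Ht.
  assert (B1 := Rmin_l d1 d2). assert (B2 := Rmin_r d1 d2).
  specialize (H1 x' y' t' ltac:(lra) ltac:(lra) ltac:(lra)).
  specialize (H2 x' y' t' ltac:(lra) ltac:(lra) ltac:(lra)).
  apply Rabs_def2 in H1. apply Rabs_def2 in H2. apply Rabs_def1; lra.
Qed.

Lemma cont3_mult (f g : R -> R -> R -> R) : cont3 f -> cont3 g -> cont3 (fun x y t => f x y t * g x y t).
Proof.
  intros Hf Hg.
  (* Polarisation: the product is a quarter of the difference of two squares, so sums and
     composition with functions of one variable suffice. *)
  assert (Hsq : forall z, continuity_pt (fun u => u * u) z).
  { intros z. apply continuity_pt_mult; apply continuity_pt_id. }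
  assert (Hsc : forall c z, continuity_pt (fun u => c * u) z).
  { intros c z. apply (continuity_pt_scal (fun u => u)). apply continuity_pt_id. }
  assert (H1 := cont3_comp1 _ _ Hsq (cont3_plus _ _ Hf Hg)).
  assert (H2 := cont3_comp1 _ _ Hsq (cont3_plus _ _ Hf (cont3_comp1 _ _ (Hsc (-1)) Hg))).
  assert (H3 := cont3_comp1 _ _ (Hsc (/ 4)) (cont3_plus _ _ H1 (cont3_comp1 _ _ (Hsc (-1)) H2))).
  cbv beta in H3. intros x y t eps He. destruct (H3 x y t eps He) as (d & Hd & H).
  exists d. split; auto. intros x' y' t' Hx Hy Ht. specialize (H x' y' t' Hx Hy Ht).
  replace (f x' y' t' * g x' y' t' - f x y t * g x y t) with
   (/ 4 *
      ((f x' y' t' + g x' y' t') * (f x' y' t' + g x' y' t') +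
       -1 * ((f x' y' t' + -1 * g x' y' t') * (f x' y' t' + -1 * g x' y' t'))) -
      / 4 *
      ((f x y t + g x y t) * (f x y t + g x y t) +
       -1 * ((f x y t + -1 * g x y t) * (f x y t + -1 * g x y t)))) by field. exact H.
Qed.

Lemma cont3_ext (f g : R -> R -> R -> R) : (forall x y t, f x y t = g x y t) -> cont3 f -> cont3 g.
Proof.
  intros E Hf x y t eps He. destruct (Hf x y t eps He) as (d & Hd & H). exists d; split; auto.
  intros. rewrite <- !E. auto.
Qed.

Lemma cont3_scal (c : R) (f : R -> R -> R -> R) : cont3 f -> cont3 (fun x y t => c * f x y t).
Proof. intros H. apply cont3_mult; auto. apply cont3_const. Qed.

Lemma cont3_args (F : R -> R -> R -> R) (c1 c2 c3 : R -> R) :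
  (forall z, continuity_pt c1 z) -> (forall z, continuity_pt c2 z) -> (forall z, continuity_pt c3 z) ->
  cont3 F -> cont3 (fun x y t => F (c1 x) (c2 y) (c3 t)).
Proof.
  intros H1 H2 H3 HF x y t eps He.
  destruct (HF (c1 x) (c2 y) (c3 t) eps He) as (d & Hd & H).
  destruct (cont_ed c1 x d (H1 _) Hd) as (d1 & Hd1 & E1).
  destruct (cont_ed c2 y d (H2 _) Hd) as (d2 & Hd2 & E2).
  destruct (cont_ed c3 t d (H3 _) Hd) as (d3 & Hd3 & E3).
  exists (Rmin d1 (Rmin d2 d3)). split. repeat apply Rmin_glb_lt; auto.
  assert (B1 := Rmin_l d1 (Rmin d2 d3)). assert (B2 := Rmin_r d1 (Rmin d2 d3)).
  assert (B3 := Rmin_l d2 d3). assert (B4 := Rmin_r d2 d3).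
  intros x' y' t' Hx Hy Ht. apply H; [apply E1|apply E2|apply E3]; lra.
Qed.

Lemma cont3_fx (h : R -> R) : (forall z, continuity_pt h z) -> cont3 (fun x _ _ => h x).
Proof. intros H. apply (cont3_comp1 h (fun x _ _ => x)); auto. apply cont3_x. Qed.
Lemma cont3_fy (h : R -> R) : (forall z, continuity_pt h z) -> cont3 (fun _ y _ => h y).
Proof. intros H. apply (cont3_comp1 h (fun _ y _ => y)); auto. apply cont3_y. Qed.
Lemma cont3_ft (h : R -> R) : (forall z, continuity_pt h z) -> cont3 (fun _ _ t => h t).
Proof. intros H. apply (cont3_comp1 h (fun _ _ t => t)); auto. apply cont3_t. Qed.

(** [C21] with its derivatives named: test functions can be combined and differentiated
    symbolically, and [smooth3_C21] returns to [Derive] at the end. *)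
Record smooth3 (F Fx Fy Ft Fxx Fxy Fyy : R -> R -> R -> R) : Prop := {
  sm_x : forall x y t, is_derive (fun x => F x y t) x (Fx x y t);
  sm_y : forall x y t, is_derive (fun y => F x y t) y (Fy x y t);
  sm_t : forall x y t, is_derive (fun t => F x y t) t (Ft x y t);
  sm_xx : forall x y t, is_derive (fun x => Fx x y t) x (Fxx x y t);
  sm_xy : forall x y t, is_derive (fun y => Fx x y t) y (Fxy x y t);
  sm_yy : forall x y t, is_derive (fun y => Fy x y t) y (Fyy x y t);
  sm_c : cont3 F; sm_cx : cont3 Fx; sm_cy : cont3 Fy; sm_ct : cont3 Ft;
  sm_cxx : cont3 Fxx; sm_cxy : cont3 Fxy; sm_cyy : cont3 Fyy }.

Lemma smooth3_lin (a b : R) F Fx Fy Ft Fxx Fxy Fyy G Gx Gy Gt Gxx Gxy Gyy :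
  smooth3 F Fx Fy Ft Fxx Fxy Fyy -> smooth3 G Gx Gy Gt Gxx Gxy Gyy ->
  smooth3 (fun x y t => a * F x y t + b * G x y t) (fun x y t => a * Fx x y t + b * Gx x y t)
   (fun x y t => a * Fy x y t + b * Gy x y t) (fun x y t => a * Ft x y t + b * Gt x y t)
   (fun x y t => a * Fxx x y t + b * Gxx x y t) (fun x y t => a * Fxy x y t + b * Gxy x y t)
   (fun x y t => a * Fyy x y t + b * Gyy x y t).
Proof.
  intros [] []; constructor; intros;
  try (apply cont3_plus; apply cont3_scal; auto; fail);
  cbv beta; match goal with |- is_derive (fun x => a * @?f x + b * @?g x) _ _ =>
    apply (is_derive_plus (fun x => a * f x) (fun x => b * g x));
    [apply (is_derive_scal f)|apply (is_derive_scal g)]; auto end.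
Qed.

Lemma derive_cont (f f' : R -> R) : (forall z, is_derive f z (f' z)) -> forall z, continuity_pt f z.
Proof.
  intros H z. apply derivable_continuous_pt. exists (f' z). apply is_derive_Reals. auto.
Qed.

(** Separated products; sums of these contain every test function used below. *)
Lemma smooth3_prod (p p' p'' q q' q'' a a' : R -> R) :
  (forall z, is_derive p z (p' z)) -> (forall z, is_derive p' z (p'' z)) -> (forall z, continuity_pt p'' z) ->
  (forall z, is_derive q z (q' z)) -> (forall z, is_derive q' z (q'' z)) -> (forall z, continuity_pt q'' z) ->
  (forall z, is_derive a z (a' z)) -> (forall z, continuity_pt a' z) ->
  smooth3 (fun x y t => p x * q y * a t) (fun x y t => p' x * q y * a t) (fun x y t => p x * q' y * a t)
    (fun x y t => p x * q y * a' t) (fun x y t => p'' x * q y * a t) (fun x y t => p' x * q' y * a t)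
    (fun x y t => p x * q'' y * a t).
Proof.
  intros P1 P2 P3 Q1 Q2 Q3 A1 A2.
  assert (Cp := derive_cont _ _ P1). assert (Cp' := derive_cont _ _ P2).
  assert (Cq := derive_cont _ _ Q1). assert (Cq' := derive_cont _ _ Q2).
  assert (Ca := derive_cont _ _ A1).
  assert (Dx : forall f f' c d x, is_derive f x (f' x) -> is_derive (fun x : R => f x * c * d) x (f' x * c * d)).
  { intros f f' c d x H. apply (is_derive_ext (fun x => (c * d) * f x)). intros z. change (c * d * f z = f z * c * d). ring.
    replace (f' x * c * d) with ((c * d) * f' x) by ring. apply is_derive_scal; auto. }
  assert (Dy : forall f f' c d x, is_derive f x (f' x) -> is_derive (fun x : R => c * f x * d) x (c * f' x * d)).
  { intros f f' c d x H. apply (is_derive_ext (fun x => (c * d) * f x)). intros z. change (c * d * f z = c * f z * d). ring.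
    replace (c * f' x * d) with ((c * d) * f' x) by ring. apply is_derive_scal; auto. }
  constructor; intros; cbv beta.
  - exact (Dx p p' (q y) (a t) x (P1 x)).
  - exact (Dy q q' (p x) (a t) y (Q1 y)).
  - exact (is_derive_scal a t (p x * q y) (a' t) (A1 t)).
  - exact (Dx p' p'' (q y) (a t) x (P2 x)).
  - exact (Dy q q' (p' x) (a t) y (Q1 y)).
  - exact (Dy q' q'' (p x) (a t) y (Q2 y)).
  - apply cont3_mult; [apply cont3_mult; [apply cont3_fx|apply cont3_fy]|apply cont3_ft]; auto.
  - apply cont3_mult; [apply cont3_mult; [apply cont3_fx|apply cont3_fy]|apply cont3_ft]; auto.
  - apply cont3_mult; [apply cont3_mult; [apply cont3_fx|apply cont3_fy]|apply cont3_ft]; auto.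
  - apply cont3_mult; [apply cont3_mult; [apply cont3_fx|apply cont3_fy]|apply cont3_ft]; auto.
  - apply cont3_mult; [apply cont3_mult; [apply cont3_fx|apply cont3_fy]|apply cont3_ft]; auto.
  - apply cont3_mult; [apply cont3_mult; [apply cont3_fx|apply cont3_fy]|apply cont3_ft]; auto.
  - apply cont3_mult; [apply cont3_mult; [apply cont3_fx|apply cont3_fy]|apply cont3_ft]; auto.
Qed.

Lemma smooth3_ext F Fx Fy Ft Fxx Fxy Fyy G Gx Gy Gt Gxx Gxy Gyy :
  (forall x y t, F x y t = G x y t) -> (forall x y t, Fx x y t = Gx x y t) ->
  (forall x y t, Fy x y t = Gy x y t) -> (forall x y t, Ft x y t = Gt x y t) ->
  (forall x y t, Fxx x y t = Gxx x y t) -> (forall x y t, Fxy x y t = Gxy x y t) ->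
  (forall x y t, Fyy x y t = Gyy x y t) ->
  smooth3 F Fx Fy Ft Fxx Fxy Fyy -> smooth3 G Gx Gy Gt Gxx Gxy Gyy.
Proof.
  intros E E1 E2 E3 E4 E5 E6 []; constructor;
    [ intros x y t; rewrite <- E1; apply (is_derive_ext (fun x => F x y t)); auto
    | intros x y t; rewrite <- E2; apply (is_derive_ext (fun y => F x y t)); auto
    | intros x y t; rewrite <- E3; apply (is_derive_ext (fun t => F x y t)); auto
    | intros x y t; rewrite <- E4; apply (is_derive_ext (fun x => Fx x y t)); auto
    | intros x y t; rewrite <- E5; apply (is_derive_ext (fun y => Fx x y t)); auto
    | intros x y t; rewrite <- E6; apply (is_derive_ext (fun y => Fy x y t)); auto
    | eapply cont3_ext; eauto .. ].
Qed.

Lemma smooth3_C21 F Fx Fy Ft Fxx Fxy Fyy : smooth3 F Fx Fy Ft Fxx Fxy Fyy ->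
  C21 F /\ forall x y t, dS F x y t = Fx x y t /\ dH F x y t = Fy x y t /\ dt F x y t = Ft x y t /\
    dSS F x y t = Fxx x y t /\ dSH F x y t = Fxy x y t /\ dHH F x y t = Fyy x y t.
Proof.
  intros [].
  assert (ES : forall x y t, dS F x y t = Fx x y t) by (intros; apply is_derive_unique; auto).
  assert (EH : forall x y t, dH F x y t = Fy x y t) by (intros; apply is_derive_unique; auto).
  assert (Et : forall x y t, dt F x y t = Ft x y t) by (intros; apply is_derive_unique; auto).
  assert (DSS : forall x y t, is_derive (fun x => dS F x y t) x (Fxx x y t)).
  { intros. apply (is_derive_ext (fun x => Fx x y t)); auto. }
  assert (DSH : forall x y t, is_derive (fun y => dS F x y t) y (Fxy x y t)).
  { intros. apply (is_derive_ext (fun y => Fx x y t)); auto. }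
  assert (DHH : forall x y t, is_derive (fun y => dH F x y t) y (Fyy x y t)).
  { intros. apply (is_derive_ext (fun y => Fy x y t)); auto. }
  assert (ESS : forall x y t, dSS F x y t = Fxx x y t) by (intros; apply is_derive_unique; auto).
  assert (ESH : forall x y t, dSH F x y t = Fxy x y t) by (intros; apply is_derive_unique; auto).
  assert (EHH : forall x y t, dHH F x y t = Fyy x y t) by (intros; apply is_derive_unique; auto).
  split.
  - split.
    + intros s h t. repeat split; eexists; eauto.
    + split; [auto|].
      split; [apply (cont3_ext Fx); auto|]. split; [apply (cont3_ext Fy); auto|].
      split; [apply (cont3_ext Ft); auto|]. split; [apply (cont3_ext Fxx); auto|].
      split; [apply (cont3_ext Fxy); auto|]. apply (cont3_ext Fyy); auto.
  - intros; repeat split; auto.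
Qed.

(** [C21] asks for regularity on all of [R], so [ln] must be extended past [0]. *)
Lemma ln_extension (S0 : R) : 0 < S0 -> exists chi chi' chi'' : R -> R,
  (forall z, is_derive chi z (chi' z)) /\ (forall z, is_derive chi' z (chi'' z)) /\
  (forall z, continuity_pt chi'' z) /\
  (forall z, S0 / 2 < z -> chi z = ln z /\ chi' z = / z /\ chi'' z = - / z ^ 2).
Proof.
  intros HS. set (a := S0 / 2). assert (Ha : 0 < a) by (unfold a; lra).
  (* [p] is C^2, equals [z] for [z >= a], and is positive everywhere: for [z < a] it is
     [a (1 - w + w^3)] with [w = (a - z) / a]. Hence [ln] can be composed with it. *)
  set (p := fun z => z + / a ^ 2 * (Rmax 0 (a - z)) ^ 3).
  set (p' := fun z => 1 + / a ^ 2 * (-3 * (Rmax 0 (a - z)) ^ 2)).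
  set (p'' := fun z => / a ^ 2 * (6 * Rmax 0 (a - z))).
  assert (Ha2 : 0 < / a ^ 2) by (apply Rinv_0_lt_compat, pow_lt; auto).
  assert (Dp : forall z, is_derive p z (p' z)).
  { intros z. unfold p, p'. apply (is_derive_plus (fun z => z) (fun z => / a ^ 2 * Rmax 0 (a - z) ^ 3)).
    apply (is_derive_id z). apply (is_derive_scal (fun z => Rmax 0 (a - z) ^ 3)).
    replace (-3 * Rmax 0 (a - z) ^ 2) with (-1 * (INR 3 * Rmax 0 (a - z) ^ 2)) by (simpl; ring).
    apply (is_derive_comp (fun u => Rmax 0 u ^ 3) (fun z => a - z)). apply is_derive_pospow.
    auto_derive; auto; ring. }
  assert (Dp' : forall z, is_derive p' z (p'' z)).
  { intros z. unfold p', p''. replace (/ a ^ 2 * (6 * Rmax 0 (a - z))) with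
      (0 + / a ^ 2 * (-3 * (-1 * (INR 2 * Rmax 0 (a - z) ^ 1)))) by (simpl; ring).
    apply (is_derive_plus (fun z => 1) (fun z => / a ^ 2 * (-3 * Rmax 0 (a - z) ^ 2))).
    apply (is_derive_const 1 z). apply (is_derive_scal (fun z => -3 * Rmax 0 (a - z) ^ 2)).
    apply (is_derive_scal (fun z => Rmax 0 (a - z) ^ 2)).
    apply (is_derive_comp (fun u => Rmax 0 u ^ 2) (fun z => a - z)). apply is_derive_pospow.
    auto_derive; auto; ring. }
  assert (Cp'' : forall z, continuity_pt p'' z).
  { intros z. apply (continuity_pt_scal (fun z => 6 * Rmax 0 (a - z))).
    apply (continuity_pt_scal (fun z => Rmax 0 (a - z))).
    apply (continuity_pt_comp (fun z => a - z) (fun z => Rmax 0 z)); [|apply continuity_pt_Rmax0].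
    apply continuity_pt_minus. apply continuity_pt_const; intros ? ?; auto. apply continuity_pt_id. }
  assert (Pp : forall z, 0 < p z).
  { intros z. unfold p. destruct (Rle_dec a z).
    - rewrite Rmax_left by lra. simpl. lra.
    - rewrite Rmax_right by lra. set (w := (a - z) / a).
      assert (Hw : 0 < w) by (apply Rdiv_lt_0_compat; lra).
      replace (z + / a ^ 2 * (a - z) ^ 3) with (a * (1 - w + w ^ 3)) by (unfold w; field; lra).
      apply Rmult_lt_0_compat; auto. destruct (Rle_dec 1 w).
      + assert (1 <= w ^ 2) by nra. nra.
      + assert (0 < w ^ 3) by (apply pow_lt; auto). lra. }
  exists (fun z => ln (p z)), (fun z => p' z / p z), (fun z => p'' z / p z - (p' z / p z) ^ 2).
  split; [|split; [|split]].
  - intros z. unfold Rdiv.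
    apply (is_derive_comp ln p z (/ p z) (p' z)). apply is_derive_Reals. apply derivable_pt_lim_ln. auto. auto.
  - intros z. assert (Hz := Pp z).
    replace (p'' z / p z - (p' z / p z) ^ 2) with ((p'' z * p z - p' z * p' z) / p z ^ 2) by (field; lra).
    apply (is_derive_div p' p z (p'' z) (p' z)); auto. lra.
  - intros z. assert (Hz := Pp z).
    assert (C1 := derive_cont _ _ Dp). assert (C2 := derive_cont _ _ Dp').
    assert (C3 : continuity_pt (fun z => p' z / p z) z) by (apply continuity_pt_div; auto; lra).
    apply continuity_pt_minus. apply continuity_pt_div; auto; lra.
    apply (continuity_pt_ext (fun z => (p' z / p z) * (p' z / p z))). intros; ring.
    apply continuity_pt_mult; auto.
  - intros z Hz. fold a in Hz. unfold p, p', p''. rewrite !Rmax_left by lra.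
    replace (z + / a ^ 2 * 0 ^ 3) with z by (simpl; ring).
    replace (1 + / a ^ 2 * (-3 * 0 ^ 2)) with 1 by (simpl; ring).
    split; auto. split. field; lra. field. split; lra.
Qed.

(** Viscosity subsolutions of
    [w_t + (A11 w_xx + 2 A12 w_xy + A22 w_yy) / 2 + m w_x + n w_y + kap |w_x| = 0]
    on [R^2 x (0, T)], in logarithmic coordinates. *)
Definition vsub (T : R) (A11 A12 A22 m n kap w : R -> R -> R -> R) : Prop :=
  forall F Fx Fy Ft Fxx Fxy Fyy x y t, smooth3 F Fx Fy Ft Fxx Fxy Fyy -> 0 < t < T ->
  (exists del, 0 < del /\ forall x' y' t', Rabs (x' - x) < del -> Rabs (y' - y) < del ->
     Rabs (t' - t) < del -> w x' y' t' - F x' y' t' <= w x y t - F x y t) ->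
  0 <= Ft x y t + / 2 * (A11 x y t * Fxx x y t + 2 * A12 x y t * Fxy x y t + A22 x y t * Fyy x y t)
       + m x y t * Fx x y t + n x y t * Fy x y t + kap x y t * Rabs (Fx x y t).

Lemma smooth3_log (r c : R) (ch1 ch1' ch1'' ch2 ch2' ch2'' : R -> R) G Gx Gy Gt Gxx Gxy Gyy :
  (forall z, is_derive ch1 z (ch1' z)) -> (forall z, is_derive ch1' z (ch1'' z)) -> (forall z, continuity_pt ch1'' z) ->
  (forall z, is_derive ch2 z (ch2' z)) -> (forall z, is_derive ch2' z (ch2'' z)) -> (forall z, continuity_pt ch2'' z) ->
  smooth3 G Gx Gy Gt Gxx Gxy Gyy ->
  smooth3 (fun x y t => exp (r * t) * (G (ch1 x) (ch2 y) t + c))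
    (fun x y t => exp (r * t) * (ch1' x * Gx (ch1 x) (ch2 y) t))
    (fun x y t => exp (r * t) * (ch2' y * Gy (ch1 x) (ch2 y) t))
    (fun x y t => exp (r * t) * (Gt (ch1 x) (ch2 y) t + r * (G (ch1 x) (ch2 y) t + c)))
    (fun x y t => exp (r * t) * (ch1' x * (ch1' x * Gxx (ch1 x) (ch2 y) t) + ch1'' x * Gx (ch1 x) (ch2 y) t))
    (fun x y t => exp (r * t) * (ch1' x * (ch2' y * Gxy (ch1 x) (ch2 y) t)))
    (fun x y t => exp (r * t) * (ch2' y * (ch2' y * Gyy (ch1 x) (ch2 y) t) + ch2'' y * Gy (ch1 x) (ch2 y) t)).
Proof.
  intros X1 X2 X3 Y1 Y2 Y3 [Dx Dy Dt Dxx Dxy Dyy Cg Cx Cy Ct Cxx Cxy Cyy].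
  assert (Cc1 := derive_cont _ _ X1). assert (Cc1' := derive_cont _ _ X2).
  assert (Cc2 := derive_cont _ _ Y1). assert (Cc2' := derive_cont _ _ Y2).
  assert (Ci : forall z, continuity_pt (fun t : R => t) z) by (intros; apply continuity_pt_id).
  assert (De : forall z, is_derive (fun t => exp (r * t)) z (exp (r * z) * r)).
  { intros z. auto_derive; auto. ring. }
  assert (CE : cont3 (fun _ _ t => exp (r * t))).
  { apply (cont3_ft (fun t => exp (r * t))). apply (derive_cont _ _ De). }
  assert (CA : forall F, cont3 F -> cont3 (fun x y t => F (ch1 x) (ch2 y) t)).
  { intros F HF. apply (cont3_args F ch1 ch2 (fun t => t)); auto. }
  assert (C1 : cont3 (fun x _ _ => ch1' x)) by (apply cont3_fx; auto).
  assert (C1' : cont3 (fun x _ _ => ch1'' x)) by (apply cont3_fx; auto).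
  assert (C2 : cont3 (fun _ y _ => ch2' y)) by (apply cont3_fy; auto).
  assert (C2' : cont3 (fun _ y _ => ch2'' y)) by (apply cont3_fy; auto).
  constructor; intros; cbv beta.
  - apply (is_derive_scal (fun x => G (ch1 x) (ch2 y) t + c)).
    replace (ch1' x * Gx (ch1 x) (ch2 y) t) with (ch1' x * Gx (ch1 x) (ch2 y) t + 0) by ring.
    apply (is_derive_plus (fun x => G (ch1 x) (ch2 y) t) (fun _ => c)); [|apply (is_derive_const c)].
    apply (is_derive_comp (fun u => G u (ch2 y) t) ch1); auto.
  - apply (is_derive_scal (fun y => G (ch1 x) (ch2 y) t + c)).
    replace (ch2' y * Gy (ch1 x) (ch2 y) t) with (ch2' y * Gy (ch1 x) (ch2 y) t + 0) by ring.
    apply (is_derive_plus (fun y => G (ch1 x) (ch2 y) t) (fun _ => c)); [|apply (is_derive_const c)].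
    apply (is_derive_comp (fun u => G (ch1 x) u t) ch2); auto.
  - replace (exp (r * t) * (Gt (ch1 x) (ch2 y) t + r * (G (ch1 x) (ch2 y) t + c))) with
      ((exp (r * t) * r) * (G (ch1 x) (ch2 y) t + c) + exp (r * t) * (Gt (ch1 x) (ch2 y) t + 0)) by ring.
    apply (is_derive_mult (fun t => exp (r * t)) (fun t => G (ch1 x) (ch2 y) t + c)); auto.
    apply (is_derive_plus (fun t => G (ch1 x) (ch2 y) t) (fun _ => c)); [|apply (is_derive_const c)]. auto.
    intros; apply Rmult_comm.
  - apply (is_derive_scal (fun x => ch1' x * Gx (ch1 x) (ch2 y) t)).
    rewrite Rplus_comm.
    apply (is_derive_mult ch1' (fun x => Gx (ch1 x) (ch2 y) t)); auto; [|intros; apply Rmult_comm].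
    apply (is_derive_comp (fun u => Gx u (ch2 y) t) ch1); auto.
  - apply (is_derive_scal (fun y => ch1' x * Gx (ch1 x) (ch2 y) t)).
    apply (is_derive_scal (fun y => Gx (ch1 x) (ch2 y) t)).
    apply (is_derive_comp (fun u => Gx (ch1 x) u t) ch2); auto.
  - apply (is_derive_scal (fun y => ch2' y * Gy (ch1 x) (ch2 y) t)).
    rewrite Rplus_comm.
    apply (is_derive_mult ch2' (fun y => Gy (ch1 x) (ch2 y) t)); auto; [|intros; apply Rmult_comm].
    apply (is_derive_comp (fun u => Gy (ch1 x) u t) ch2); auto.
  - apply cont3_mult; auto. apply cont3_plus; auto. apply cont3_const.
  - apply cont3_mult; auto. apply cont3_mult; auto.
  - apply cont3_mult; auto. apply cont3_mult; auto.
  - apply cont3_mult; auto. apply cont3_plus; auto. apply cont3_scal. apply cont3_plus; auto. apply cont3_const.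
  - apply cont3_mult; auto. apply cont3_plus; auto. apply cont3_mult; auto. apply cont3_mult; auto. apply cont3_mult; auto.
  - apply cont3_mult; auto. apply cont3_mult; auto. apply cont3_mult; auto.
  - apply cont3_mult; auto. apply cont3_plus; auto. apply cont3_mult; auto. apply cont3_mult; auto. apply cont3_mult; auto.
Qed.

(** Clamping the time extends the discounted function continuously to all of [R^3], as [cont3]
    demands. *)
Definition logw (T r : R) (P : R -> R -> R -> R) (x y t : R) : R :=
  exp (- r * clamp 0 T t) * P (exp x) (exp y) (clamp 0 T t).

Lemma exp_near (x del : R) : 0 < del -> exists d, 0 < d /\ d <= exp x / 2 /\
  forall S, Rabs (S - exp x) < d -> 0 < S /\ exp x / 2 < S /\ Rabs (ln S - x) < del.
Proof.
  intros Hd. assert (He := exp_pos x).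
  assert (Cl : continuity_pt ln (exp x)).
  { apply derivable_continuous_pt. exists (/ exp x). apply derivable_pt_lim_ln. auto. }
  destruct (cont_ed ln (exp x) del Cl Hd) as (d & Hd0 & H).
  exists (Rmin d (exp x / 2)). assert (B1 := Rmin_l d (exp x / 2)). assert (B2 := Rmin_r d (exp x / 2)).
  split. apply Rmin_glb_lt; lra. split; auto. intros S HS. specialize (H S ltac:(lra)).
  rewrite ln_exp in H. apply Rabs_def2 in HS. repeat split; auto; lra.
Qed.

Section Log.
Variables (T r rho alpha : R) (mu sigma a b : R -> R -> R) (U : R -> R -> R -> R).

(** The discount factor cancels the zero-order term [r p] only if the test function takes the value
    of the solution at the point; the constant [c] arranges this. *)
Lemma log_test G Gx Gy Gt Gxx Gxy Gyy (x y t c : R) :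
  smooth3 G Gx Gy Gt Gxx Gxy Gyy ->
  exists Phi, C21 Phi /\
   (forall S H t', exp x / 2 < S -> exp y / 2 < H -> Phi S H t' = exp (r * t') * (G (ln S) (ln H) t' + c)) /\
   FopPhi r rho mu sigma a b alpha Phi (exp (r * t) * (G x y t + c)) (exp x) (exp y) t =
   - exp (r * t) * (Gt x y t
     + / 2 * ((sigma (exp x) t) ^ 2 * Gxx x y t + 2 * (rho * sigma (exp x) t * b (exp y) t) * Gxy x y t
              + (b (exp y) t) ^ 2 * Gyy x y t)
     + (mut r rho mu sigma a b (exp x) (exp y) t - / 2 * (sigma (exp x) t) ^ 2) * Gx x y t
     + (r - / 2 * (b (exp y) t) ^ 2) * Gy x y t
     + alpha * sqrt (1 - rho ^ 2) * sigma (exp x) t * Rabs (Gx x y t)).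
Proof.
  intros HG.
  destruct (ln_extension (exp x) (exp_pos x)) as (c1 & c1' & c1'' & X1 & X2 & X3 & X4).
  destruct (ln_extension (exp y) (exp_pos y)) as (c2 & c2' & c2'' & Y1 & Y2 & Y3 & Y4).
  assert (HS := smooth3_log r c c1 c1' c1'' c2 c2' c2'' _ _ _ _ _ _ _ X1 X2 X3 Y1 Y2 Y3 HG).
  destruct (smooth3_C21 _ _ _ _ _ _ _ HS) as [HC HD].
  exists (fun S H t => exp (r * t) * (G (c1 S) (c2 H) t + c)). split; auto. split.
  - intros S H t' HSx HHy. destruct (X4 S HSx) as [-> _]. destruct (Y4 H HHy) as [-> _]. auto.
  - unfold FopPhi, Fop. destruct (HD (exp x) (exp y) t) as (E1 & E2 & E3 & E4 & E5 & E6).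
    rewrite E1, E2, E3, E4, E5, E6.
    assert (Hx := exp_pos x). assert (Hy := exp_pos y). assert (Ht := exp_pos (r * t)).
    destruct (X4 (exp x)) as (-> & -> & ->); [lra|]. destruct (Y4 (exp y)) as (-> & -> & ->); [lra|].
    rewrite !ln_exp.
    assert (EA : Rabs (exp (r * t) * (/ exp x * Gx x y t)) = exp (r * t) * / exp x * Rabs (Gx x y t)).
    { rewrite !Rabs_mult, Rabs_inv, (Rabs_pos_eq (exp (r * t))), (Rabs_pos_eq (exp x)) by lra. ring. }
    rewrite EA. field. split; lra.
Qed.

Lemma log_sub :
  (forall phi S0 H0 t0, C21 phi -> inGo T S0 H0 t0 -> loc_max T U phi S0 H0 t0 ->
     FopPhi r rho mu sigma a b alpha phi (U S0 H0 t0) S0 H0 t0 <= 0) ->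
  vsub T (fun x _ t => (sigma (exp x) t) ^ 2) (fun x y t => rho * sigma (exp x) t * b (exp y) t)
    (fun _ y t => (b (exp y) t) ^ 2)
    (fun x y t => mut r rho mu sigma a b (exp x) (exp y) t - / 2 * (sigma (exp x) t) ^ 2)
    (fun _ y t => r - / 2 * (b (exp y) t) ^ 2)
    (fun x _ t => alpha * sqrt (1 - rho ^ 2) * sigma (exp x) t) (logw T r U).
Proof.
  intros Hsub F Fx Fy Ft Fxx Fxy Fyy x y t HF Ht (del & Hdel & Htouch).
  set (c := logw T r U x y t - F x y t).
  destruct (log_test F Fx Fy Ft Fxx Fxy Fyy x y t c HF) as (Phi & HC & HPhi & HFop).
  assert (Hex := exp_pos x). assert (Hey := exp_pos y).
  assert (Val : forall x y t, 0 < t < T -> logw T r U x y t = exp (- r * t) * U (exp x) (exp y) t).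
  { intros x' y' t' Ht'. unfold logw. rewrite clamp_id; auto. lra. }
  assert (Ee : forall t, exp (r * t) * exp (- r * t) = 1).
  { intros. rewrite <- exp_plus. replace (r * t0 + - r * t0) with 0 by ring. apply exp_0. }
  assert (V0 : exp (r * t) * (F x y t + c) = U (exp x) (exp y) t).
  { unfold c. rewrite Val by auto. replace (F x y t + (exp (- r * t) * U (exp x) (exp y) t - F x y t)) with
      (exp (- r * t) * U (exp x) (exp y) t) by ring. rewrite <- Rmult_assoc, Ee. ring. }
  rewrite V0 in HFop.
  assert (H := Hsub Phi (exp x) (exp y) t HC).
  rewrite HFop in H. assert (Hg : inGo T (exp x) (exp y) t) by (repeat split; lra).
  assert (Hlm : loc_max T U Phi (exp x) (exp y) t).
  { destruct (exp_near x del Hdel) as (d1 & Hd1 & _ & H1).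
    destruct (exp_near y del Hdel) as (d2 & Hd2 & _ & H2).
    exists (Rmin del (Rmin d1 d2)). split. repeat apply Rmin_glb_lt; auto.
    assert (B1 := Rmin_l del (Rmin d1 d2)). assert (B2 := Rmin_r del (Rmin d1 d2)).
    assert (B3 := Rmin_l d1 d2). assert (B4 := Rmin_r d1 d2).
    intros S H' t' (HS & HH & Ht') HdS HdH Hdt.
    destruct (H1 S ltac:(lra)) as (_ & S1 & S2). destruct (H2 H' ltac:(lra)) as (_ & K1 & K2).
    rewrite (HPhi S H' t') by auto. rewrite (HPhi (exp x) (exp y) t) by lra. rewrite !ln_exp, V0.
    assert (Hto := Htouch (ln S) (ln H') t' S2 K2 ltac:(lra)). fold c in Hto.
    rewrite Val in Hto by auto. rewrite !exp_ln in Hto by auto.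
    assert (Hle : U S H' t' <= exp (r * t') * (F (ln S) (ln H') t' + c)); [|lra].
    replace (U S H' t') with (exp (r * t') * (exp (- r * t') * U S H' t')) by (rewrite <- Rmult_assoc, Ee; ring).
    apply Rmult_le_compat_l; [left; apply exp_pos|lra]. }
  specialize (H Hg Hlm). assert (Het := exp_pos (r * t)). nra.
Qed.

(** Negation preserves the linear part of the equation, while the term in [|w_x|] is even and
    changes its sign. *)
Lemma log_super :
  (forall phi S0 H0 t0, C21 phi -> inGo T S0 H0 t0 -> loc_min T U phi S0 H0 t0 ->
     0 <= FopPhi r rho mu sigma a b alpha phi (U S0 H0 t0) S0 H0 t0) ->
  vsub T (fun x _ t => (sigma (exp x) t) ^ 2) (fun x y t => rho * sigma (exp x) t * b (exp y) t)
    (fun _ y t => (b (exp y) t) ^ 2)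
    (fun x y t => mut r rho mu sigma a b (exp x) (exp y) t - / 2 * (sigma (exp x) t) ^ 2)
    (fun _ y t => r - / 2 * (b (exp y) t) ^ 2)
    (fun x _ t => - (alpha * sqrt (1 - rho ^ 2) * sigma (exp x) t)) (fun x y t => - logw T r U x y t).
Proof.
  intros Hsub F Fx Fy Ft Fxx Fxy Fyy x y t HF Ht (del & Hdel & Htouch).
  set (c := logw T r U x y t + F x y t).
  assert (HF' := smooth3_lin (-1) 0 _ _ _ _ _ _ _ _ _ _ _ _ _ _ HF HF).
  destruct (log_test _ _ _ _ _ _ _ x y t c HF') as (Phi & HC & HPhi & HFop).
  cbv beta in HPhi, HFop.
  assert (Hex := exp_pos x). assert (Hey := exp_pos y).
  assert (Val : forall x y t, 0 < t < T -> logw T r U x y t = exp (- r * t) * U (exp x) (exp y) t).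
  { intros x' y' t' Ht'. unfold logw. rewrite clamp_id; auto. lra. }
  assert (Ee : forall t, exp (r * t) * exp (- r * t) = 1).
  { intros. rewrite <- exp_plus. replace (r * t0 + - r * t0) with 0 by ring. apply exp_0. }
  assert (V0 : exp (r * t) * (-1 * F x y t + 0 * F x y t + c) = U (exp x) (exp y) t).
  { unfold c. rewrite Val by auto. replace (-1 * F x y t + 0 * F x y t + (exp (- r * t) * U (exp x) (exp y) t + F x y t)) with
      (exp (- r * t) * U (exp x) (exp y) t) by ring. rewrite <- Rmult_assoc, Ee. ring. }
  rewrite V0 in HFop.
  assert (H := Hsub Phi (exp x) (exp y) t HC).
  rewrite HFop in H. assert (Hg : inGo T (exp x) (exp y) t) by (repeat split; lra).
  assert (Hlm : loc_min T U Phi (exp x) (exp y) t).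
  { destruct (exp_near x del Hdel) as (d1 & Hd1 & _ & H1).
    destruct (exp_near y del Hdel) as (d2 & Hd2 & _ & H2).
    exists (Rmin del (Rmin d1 d2)). split. repeat apply Rmin_glb_lt; auto.
    assert (B1 := Rmin_l del (Rmin d1 d2)). assert (B2 := Rmin_r del (Rmin d1 d2)).
    assert (B3 := Rmin_l d1 d2). assert (B4 := Rmin_r d1 d2).
    intros S H' t' (HS & HH & Ht') HdS HdH Hdt.
    destruct (H1 S ltac:(lra)) as (_ & S1 & S2). destruct (H2 H' ltac:(lra)) as (_ & K1 & K2).
    rewrite (HPhi S H' t') by auto. rewrite (HPhi (exp x) (exp y) t) by lra. rewrite !ln_exp, V0.
    assert (Hto := Htouch (ln S) (ln H') t' S2 K2 ltac:(lra)).
    rewrite (Val (ln S)) in Hto by auto. rewrite !exp_ln in Hto by auto.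
    assert (Hle : exp (r * t') * (-1 * F (ln S) (ln H') t' + 0 * F (ln S) (ln H') t' + c) <= U S H' t'); [|lra].
    replace (U S H' t') with (exp (r * t') * (exp (- r * t') * U S H' t')) by (rewrite <- Rmult_assoc, Ee; ring).
    apply Rmult_le_compat_l; [left; apply exp_pos|unfold c; lra]. }
  specialize (H Hg Hlm). assert (Het := exp_pos (r * t)).
  replace (Rabs (-1 * Fx x y t + 0 * Fx x y t)) with (Rabs (Fx x y t)) in H.
  2: { replace (-1 * Fx x y t + 0 * Fx x y t) with (- Fx x y t) by ring. rewrite Rabs_Ropp; auto. }
  nra.
Qed.
End Log.

Lemma logw_cont (T r : R) (U : R -> R -> R -> R) : 0 < T -> contG T U -> cont3 (logw T r U).
Proof.
  intros HT HU. unfold logw.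
  assert (Cc : forall z, continuity_pt (clamp 0 T) z).
  { intros z eps He. exists eps. split; auto. intros u [_ Hu]. simpl in *. unfold R_dist in *.
    eapply Rle_lt_trans; [apply clamp_lip|auto]. }
  assert (Ce : forall z, continuity_pt exp z) by (intros; apply derivable_continuous_pt, derivable_pt_exp).
  apply cont3_mult.
  - apply (cont3_ft (fun t => exp (- r * clamp 0 T t))). intros z.
    apply (continuity_pt_comp (fun t => - r * clamp 0 T t) exp); auto.
    apply (continuity_pt_scal (clamp 0 T)); auto.
  - intros x y t eps He.
    assert (Hg : forall x y t, inG T (exp x) (exp y) (clamp 0 T t)).
    { intros. split. apply exp_pos. split. apply exp_pos. apply clamp_in. lra. }
    destruct (HU (exp x) (exp y) (clamp 0 T t) (Hg x y t) eps He) as (d & Hd & H).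
    destruct (cont_ed exp x d (Ce _) Hd) as (d1 & Hd1 & E1).
    destruct (cont_ed exp y d (Ce _) Hd) as (d2 & Hd2 & E2).
    exists (Rmin d (Rmin d1 d2)). split. repeat apply Rmin_glb_lt; auto.
    assert (B1 := Rmin_l d (Rmin d1 d2)). assert (B2 := Rmin_r d (Rmin d1 d2)).
    assert (B3 := Rmin_l d1 d2). assert (B4 := Rmin_r d1 d2).
    intros x' y' t' Hx Hy Ht. apply H; auto; [apply E1; lra|apply E2; lra|].
    eapply Rle_lt_trans; [apply clamp_lip|lra].
Qed.

(** * Compactness of intervals and boxes *)

Lemma interval_gauge (Q : R -> R -> Prop) (a b : R) :
  (forall x d d', 0 < d' <= d -> Q x d -> Q x d') ->
  (forall x, a <= x <= b -> exists d, 0 < d /\ forall x', Rabs (x' - x) < d -> Q x' d) ->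
  exists d, 0 < d /\ forall x, a <= x <= b -> Q x d.
Proof.
  intros HQ H. destruct (Rlt_dec b a) as [Hba|Hab].
  { exists 1. split; [lra|]. intros; lra. }
  apply Rnot_lt_le in Hab.
  set (E := fun z => a <= z <= b /\ exists d, 0 < d /\ forall x, a <= x <= z -> Q x d).
  destruct (completeness E) as (m & Hm1 & Hm2).
  { exists b. intros z [Hz _]; lra. }
  { exists a. split; [lra|]. destruct (H a) as (d & Hd & Hd1); [lra|]. exists d; split; auto.
    intros x Hx. apply Hd1. apply Rabs_def1; lra. }
  assert (Ham : a <= m).
  { apply Hm1. split; [lra|]. destruct (H a) as (d & Hd & Hd1); [lra|]. exists d; split; auto.
    intros x Hx. apply Hd1. apply Rabs_def1; lra. }
  assert (Hmb : m <= b) by (apply Hm2; intros z [Hz _]; lra).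
  destruct (H m) as (d & Hd & Hd1); [lra|].
  assert (exists z, E z /\ m - d < z) as (z & (Hz & d' & Hd' & Hd1') & Hzm).
  { apply NNPP. intros Hn. assert (m <= m - d); [|lra]. apply Hm2. intros z Ez.
    apply Rnot_lt_le. intros Hlt. apply Hn. exists z; auto. }
  set (y := Rmin b (m + d / 2)).
  assert (Hy : m <= y /\ y <= b /\ y < m + d /\ (y = b \/ m < y)).
  { unfold y, Rmin. destruct (Rle_dec _ _); lra. }
  assert (Hdd : 0 < Rmin d d') by (apply Rmin_glb_lt; auto).
  assert (B1 := Rmin_l d d'). assert (B2 := Rmin_r d d').
  assert (Ey : forall x, a <= x <= y -> Q x (Rmin d d')).
  { intros x Hx. destruct (Rle_dec x z).
    - apply (HQ x d'); [lra|]. apply Hd1'; lra.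
    - apply (HQ x d); [lra|]. apply Hd1. apply Rabs_def1; lra. }
  assert (y <= m).
  { apply Hm1. split; [lra|]. exists (Rmin d d'). split; auto. }
  exists (Rmin d d'). split; auto. intros x Hx. apply Ey. destruct Hy as (_ & _ & _ & [Hy|Hy]); lra.
Qed.

(** Heine-Borel in three variables, one coordinate at a time; monotonicity in [d] allows finitely
    many radii to be replaced by the least. *)
Lemma box_gauge (W : R -> R -> R -> R -> Prop) (a1 b1 a2 b2 a3 b3 : R) :
  (forall x y t d d', 0 < d' <= d -> W x y t d -> W x y t d') ->
  (forall x y t, a1 <= x <= b1 -> a2 <= y <= b2 -> a3 <= t <= b3 ->
     exists d, 0 < d /\ forall x' y' t', Rabs (x' - x) < d -> Rabs (y' - y) < d -> Rabs (t' - t) < d ->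
       W x' y' t' d) ->
  exists d, 0 < d /\ forall x y t, a1 <= x <= b1 -> a2 <= y <= b2 -> a3 <= t <= b3 -> W x y t d.
Proof.
  intros HW H.
  assert (H1 : forall x y, a1 <= x <= b1 -> a2 <= y <= b2 -> exists d, 0 < d /\
    forall t, a3 <= t <= b3 -> forall x' y', Rabs (x' - x) < d -> Rabs (y' - y) < d -> W x' y' t d).
  { intros x y Hx Hy.
    apply (interval_gauge (fun t d => forall x' y', Rabs (x' - x) < d -> Rabs (y' - y) < d -> W x' y' t d)).
    - intros t d d' Hd Hq x' y' Hx' Hy'. apply (HW _ _ _ d); auto. apply Hq; lra.
    - intros t Ht. destruct (H x y t Hx Hy Ht) as (d & Hd & Hd1). exists d; split; auto. }
  assert (H2 : forall x, a1 <= x <= b1 -> exists d, 0 < d /\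
    forall y, a2 <= y <= b2 -> forall x', Rabs (x' - x) < d -> forall t, a3 <= t <= b3 -> W x' y t d).
  { intros x Hx.
    apply (interval_gauge (fun y d => forall x', Rabs (x' - x) < d -> forall t, a3 <= t <= b3 -> W x' y t d)).
    - intros t d d' Hd Hq x' Hx' t' Ht'. apply (HW _ _ _ d); auto. apply Hq; auto; lra.
    - intros y Hy. destruct (H1 x y Hx Hy) as (d & Hd & Hd1). exists d; split; auto. }
  destruct (interval_gauge (fun x d => forall y, a2 <= y <= b2 -> forall t, a3 <= t <= b3 -> W x y t d) a1 b1)
    as (d & Hd & Hd1).
  - intros x d d' Hd Hq y Hy t Ht. apply (HW _ _ _ d); auto.
  - intros x Hx. destruct (H2 x Hx) as (d & Hd & Hd1). exists d; split; auto.
  - exists d; split; auto.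
Qed.

Lemma cont3_uniform (f : R -> R -> R -> R) (rad eps : R) : cont3 f -> 0 < eps ->
  exists d, 0 < d /\ forall x y t x' y' t', Rabs x <= rad -> Rabs y <= rad -> Rabs t <= rad ->
    Rabs (x' - x) < d -> Rabs (y' - y) < d -> Rabs (t' - t) < d -> Rabs (f x' y' t' - f x y t) < eps.
Proof.
  intros Hf He.
  destruct (box_gauge (fun x y t d => forall x' y' t', Rabs (x' - x) < d -> Rabs (y' - y) < d ->
    Rabs (t' - t) < d -> Rabs (f x' y' t' - f x y t) < eps) (- rad) rad (- rad) rad (- rad) rad)
    as (d & Hd & H).
  - intros x y t d d' Hd H x' y' t' Hx Hy Ht. apply H; lra.
  - intros x y t _ _ _. destruct (Hf x y t (eps / 2)) as (d & Hd & H); [lra|].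
    exists (d / 2). split; [lra|]. intros x1 y1 t1 Hx1 Hy1 Ht1 x' y' t' Hx Hy Ht.
    assert (E1 := H x1 y1 t1 ltac:(lra) ltac:(lra) ltac:(lra)).
    apply Rabs_def2 in Hx1, Hy1, Ht1, Hx, Hy, Ht.
    assert (E2 : Rabs (f x' y' t' - f x y t) < eps / 2) by (apply H; apply Rabs_def1; lra).
    apply Rabs_def2 in E1, E2. apply Rabs_def1; lra.
  - exists d; split; auto. intros x y t x' y' t' Hx Hy Ht. apply Rabs_le_between in Hx, Hy, Ht.
    apply H; auto.
Qed.

Lemma cont3_bounded (f : R -> R -> R -> R) (rad : R) : cont3 f ->
  exists C, 0 < C /\ forall x y t, Rabs x <= rad -> Rabs y <= rad -> Rabs t <= rad -> Rabs (f x y t) <= C.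
Proof.
  intros Hf.
  destruct (box_gauge (fun x y t d => Rabs (f x y t) <= / d) (- rad) rad (- rad) rad (- rad) rad)
    as (d & Hd & H).
  - intros x y t d d' Hd H. eapply Rle_trans; [exact H|]. apply Rinv_le_contravar; lra.
  - intros x y t _ _ _. destruct (Hf x y t 1) as (d & Hd & H); [lra|].
    set (c := Rabs (f x y t) + 1). assert (Hc : 1 <= c) by (assert (A := Rabs_pos (f x y t)); unfold c; lra).
    exists (Rmin d (/ c)). assert (B1 := Rmin_l d (/ c)). assert (B2 := Rmin_r d (/ c)).
    assert (Hp : 0 < Rmin d (/ c)) by (apply Rmin_glb_lt; auto; apply Rinv_0_lt_compat; lra).
    split; auto. intros x' y' t' Hx Hy Ht.
    specialize (H x' y' t' ltac:(lra) ltac:(lra) ltac:(lra)).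
    apply Rle_trans with c.
    + assert (A := Rabs_triang_inv (f x' y' t') (f x y t)). unfold c. lra.
    + rewrite <- (Rinv_inv c) at 1. apply Rinv_le_contravar; auto.
  - exists (/ d). split. apply Rinv_0_lt_compat; auto.
    intros x y t Hx Hy Ht. apply Rabs_le_between in Hx, Hy, Ht. apply H; auto.
Qed.

Definition inbox (x0 y0 x y : R) : Prop := Rabs (x - x0) <= 1 /\ Rabs (y - y0) <= 1.

Definition supbox (g : R -> R -> R -> R) (x0 y0 s : R) : R :=
  real (Lub_Rbar (fun v => exists x y, inbox x0 y0 x y /\ v = g x y s)).

Lemma inbox_center (x0 y0 : R) : inbox x0 y0 x0 y0.
Proof. unfold inbox. rewrite !Rminus_diag, Rabs_R0. lra. Qed.

Lemma inbox_radius (x0 y0 x y : R) : inbox x0 y0 x y ->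
  Rabs x <= Rabs x0 + Rabs y0 + 1 /\ Rabs y <= Rabs x0 + Rabs y0 + 1.
Proof.
  intros [Hx Hy]. assert (A := Rabs_triang (x - x0) x0). assert (B := Rabs_triang (y - y0) y0).
  replace (x - x0 + x0) with x in A by ring. replace (y - y0 + y0) with y in B by ring.
  assert (C := Rabs_pos x0). assert (D := Rabs_pos y0). lra.
Qed.

Lemma supbox_spec (g : R -> R -> R -> R) (x0 y0 s : R) : cont3 g ->
  (forall x y, inbox x0 y0 x y -> g x y s <= supbox g x0 y0 s) /\
  (exists x y, inbox x0 y0 x y /\ supbox g x0 y0 s = g x y s).
Proof.
  intros Hg.
  destruct (cont3_bounded g (Rabs x0 + Rabs y0 + 1 + Rabs s) Hg) as (C & HC & HCb).
  assert (HCx : forall x y, inbox x0 y0 x y -> Rabs (g x y s) <= C).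
  { intros x y Hxy. assert (H := inbox_radius _ _ _ _ Hxy).
    assert (A := Rabs_pos x0). assert (B := Rabs_pos y0). assert (D := Rabs_pos s). apply HCb; lra. }
  assert (Hspec : (forall x y, inbox x0 y0 x y -> g x y s <= supbox g x0 y0 s) /\
    (forall k, (forall x y, inbox x0 y0 x y -> g x y s <= k) -> supbox g x0 y0 s <= k)).
  { unfold supbox. set (S := fun v => _). destruct (Lub_Rbar_correct S) as [H1 H2].
    destruct (Lub_Rbar S) as [l| |].
    - split.
      + intros x y Hxy. apply (H1 (g x y s)). exists x, y; auto.
      + intros k Hk. apply (H2 (Finite k)). intros v (x & y & Hxy & ->). simpl. auto.
    - exfalso. assert (Hc := H2 (Finite C)). simpl in Hc. apply Hc.
      intros v (x & y & Hxy & ->). simpl. specialize (HCx x y Hxy). apply Rabs_le_between in HCx. lra.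
    - exfalso. apply (H1 (g x0 y0 s)). exists x0, y0. split; auto. apply inbox_center. }
  destruct Hspec as [H1 H2]. split; auto.
  apply NNPP. intros Hn. set (m := supbox g x0 y0 s) in *.
  assert (Hlt : forall x y, inbox x0 y0 x y -> g x y s < m).
  { intros x y Hxy. destruct (H1 x y Hxy) as [h|h]; auto. exfalso. apply Hn. exists x, y; auto. }
  destruct (box_gauge (fun x y _ d => inbox x0 y0 x y -> g x y s <= m - d) (x0 - 1) (x0 + 1) (y0 - 1) (y0 + 1) s s)
    as (d & Hd & H).
  - intros x y t d d' Hd H Hb. specialize (H Hb). lra.
  - intros x y t Hx Hy Ht.
    assert (Hb : inbox x0 y0 x y) by (split; apply Rabs_le; lra).
    specialize (Hlt x y Hb). set (e := (m - g x y s) / 2).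
    destruct (Hg x y s e) as (d & Hd & H); [unfold e; lra|].
    exists (Rmin d e). assert (B1 := Rmin_l d e). assert (B2 := Rmin_r d e).
    split. apply Rmin_glb_lt; auto; unfold e; lra.
    intros x' y' t' Hx' Hy' Ht' _. specialize (H x' y' s ltac:(lra) ltac:(lra)).
    rewrite Rminus_diag, Rabs_R0 in H. specialize (H Hd). apply Rabs_def2 in H. unfold e in *. lra.
  - assert (m <= m - d); [|lra]. apply H2. intros x y [Hx Hy].
    apply (H x y s); try (apply Rabs_le_between in Hx; apply Rabs_le_between in Hy; lra). split; auto.
Qed.

Lemma supbox_cont (g : R -> R -> R -> R) (x0 y0 s : R) : cont3 g ->
  continuity_pt (supbox g x0 y0) s.
Proof.
  intros Hg eps He.
  destruct (cont3_uniform g (Rabs x0 + Rabs y0 + 1 + Rabs s) eps Hg He) as (d & Hd & H).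
  exists d. split; auto. intros s' [_ Hs']. simpl in *. unfold R_dist in *.
  destruct (supbox_spec g x0 y0 s Hg) as [A1 (x1 & y1 & B1 & E1)].
  destruct (supbox_spec g x0 y0 s' Hg) as [A2 (x2 & y2 & B2 & E2)].
  assert (HH : forall x y, inbox x0 y0 x y -> Rabs (g x y s' - g x y s) < eps).
  { intros x y Hxy. assert (Hr := inbox_radius _ _ _ _ Hxy).
    assert (P := Rabs_pos x0). assert (P1 := Rabs_pos y0). assert (P2 := Rabs_pos s).
    apply H; try lra; rewrite Rminus_diag, Rabs_R0; auto. }
  assert (K1 := HH x1 y1 B1). assert (K2 := HH x2 y2 B2). apply Rabs_def2 in K1, K2.
  specialize (A1 x2 y2 B2). specialize (A2 x1 y1 B1). apply Rabs_def1; lra.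
Qed.

(** * Comparison over one time step *)

Lemma smooth3_zero : smooth3 (fun _ _ _ => 0) (fun _ _ _ => 0) (fun _ _ _ => 0) (fun _ _ _ => 0)
  (fun _ _ _ => 0) (fun _ _ _ => 0) (fun _ _ _ => 0).
Proof.
  constructor; intros; try apply cont3_const; apply (is_derive_const 0).
Qed.

Lemma smooth3_time (h h' : R -> R) : (forall z, is_derive h z (h' z)) -> (forall z, continuity_pt h' z) ->
  smooth3 (fun _ _ t => h t) (fun _ _ _ => 0) (fun _ _ _ => 0) (fun _ _ t => h' t)
  (fun _ _ _ => 0) (fun _ _ _ => 0) (fun _ _ _ => 0).
Proof.
  intros H1 H2. constructor; intros; try apply cont3_const; try apply cont3_ft; auto;
  try apply (is_derive_const (h t)); try apply (is_derive_const 0). apply (derive_cont _ _ H1).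
Qed.

Lemma smooth3_wave (c0 c1 k l p : R) :
  let E t := exp (c0 + c1 * t) in let th x y := k * x + l * y + p in
  smooth3 (fun x y t => E t * cos (th x y)) (fun x y t => - k * E t * sin (th x y))
    (fun x y t => - l * E t * sin (th x y)) (fun x y t => c1 * E t * cos (th x y))
    (fun x y t => - k ^ 2 * E t * cos (th x y)) (fun x y t => - (k * l) * E t * cos (th x y))
    (fun x y t => - l ^ 2 * E t * cos (th x y)).
Proof.
  intros E th.
  assert (DE : forall z, is_derive E z (c1 * E z)).
  { intros z. unfold E. auto_derive; auto. ring. }
  assert (CE : forall z, continuity_pt (fun z => c1 * E z) z).
  { intros z. apply (continuity_pt_scal E c1). apply (derive_cont _ _ DE). }
  assert (Dc : forall k p z, is_derive (fun z => cos (k * z + p)) z (- k * sin (k * z + p))).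
  { intros. auto_derive; auto. ring. }
  assert (Ds : forall k p z, is_derive (fun z => sin (k * z + p)) z (k * cos (k * z + p))).
  { intros. auto_derive; auto. ring. }
  assert (Dc2 : forall k p z, is_derive (fun z => - k * sin (k * z + p)) z (- k ^ 2 * cos (k * z + p))).
  { intros. auto_derive; auto. ring. }
  assert (Ds2 : forall k p z, is_derive (fun z => k * cos (k * z + p)) z (- k ^ 2 * sin (k * z + p))).
  { intros. auto_derive; auto. ring. }
  assert (Cc : forall k p z, continuity_pt (fun z => - k ^ 2 * cos (k * z + p)) z).
  { intros k' p' z. apply (derive_cont _ (fun z => k' ^ 3 * sin (k' * z + p'))). intros; auto_derive; auto. ring. }
  assert (Cs : forall k p z, continuity_pt (fun z => - k ^ 2 * sin (k * z + p)) z).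
  { intros k' p' z. apply (derive_cont _ (fun z => - k' ^ 3 * cos (k' * z + p'))). intros; auto_derive; auto. ring. }
  (* The addition formula writes the wave as a difference of two separated products. *)
  assert (S1 := smooth3_prod _ _ _ _ _ _ _ _ (Dc k 0) (Dc2 k 0) (Cc k 0) (Dc l p) (Dc2 l p) (Cc l p) DE CE).
  assert (S2 := smooth3_prod _ _ _ _ _ _ _ _ (Ds k 0) (Ds2 k 0) (Cs k 0) (Ds l p) (Ds2 l p) (Cs l p) DE CE).
  assert (S3 := smooth3_lin 1 (-1) _ _ _ _ _ _ _ _ _ _ _ _ _ _ S1 S2).
  assert (Eth : forall x y, th x y = (k * x + 0) + (l * y + p)) by (intros; unfold th; ring).
  eapply smooth3_ext; [| | | | | | |exact S3]; intros x y t; cbv beta; rewrite Eth;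
    rewrite ?cos_plus, ?sin_plus; cbv beta; 
    rewrite <- ?(cos_plus (k * x) 0), <- ?(sin_plus (k * x) 0), <- ?(cos_plus (l * y) p), <- ?(sin_plus (l * y) p).
  all: rewrite ?cos_plus, ?sin_plus; ring.
Qed.

(** With the covariance affine in time, each Gaussian factor is the exponential of an affine
    function of [t]; hence [V] solves the backward heat equation with the constant coefficients
    [a1], [a2], [a3]. *)
Lemma smooth3_V (q1 q2 q3 a1 a2 a3 t0 : R) (l : list tm) :
  let Q1 t := q1 + a1 * (t0 - t) in let Q2 t := q2 + a2 * (t0 - t) in let Q3 t := q3 + a3 * (t0 - t) in
  smooth3 (fun x y t => V (Q1 t) (Q2 t) (Q3 t) l x y) (fun x y t => Vx (Q1 t) (Q2 t) (Q3 t) l x y)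
   (fun x y t => Vy (Q1 t) (Q2 t) (Q3 t) l x y)
   (fun x y t => - / 2 * (a1 * Vxx (Q1 t) (Q2 t) (Q3 t) l x y + 2 * a2 * Vxy (Q1 t) (Q2 t) (Q3 t) l x y
        + a3 * Vyy (Q1 t) (Q2 t) (Q3 t) l x y))
   (fun x y t => Vxx (Q1 t) (Q2 t) (Q3 t) l x y) (fun x y t => Vxy (Q1 t) (Q2 t) (Q3 t) l x y)
   (fun x y t => Vyy (Q1 t) (Q2 t) (Q3 t) l x y).
Proof.
  intros Q1 Q2 Q3. induction l as [|e l IH].
  - eapply smooth3_ext; [| | | | | | |exact smooth3_zero]; intros; unfold V, Vx, Vy, Vxx, Vxy, Vyy, wsum; simpl; ring.
  - assert (SW := smooth3_wave (- (qform (q1 + a1 * t0) (q2 + a2 * t0) (q3 + a3 * t0) e / 2))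
       (qform a1 a2 a3 e / 2) (tk e) (tl e) (tp e)).
    cbv zeta in SW.
    assert (S3 := smooth3_lin (ta e) 1 _ _ _ _ _ _ _ _ _ _ _ _ _ _ SW IH).
    assert (EE : forall t, exp (- (qform (q1 + a1 * t0) (q2 + a2 * t0) (q3 + a3 * t0) e / 2) + qform a1 a2 a3 e / 2 * t)
       = hf (Q1 t) (Q2 t) (Q3 t) e).
    { intros t. unfold hf. f_equal. unfold qform, Q1, Q2, Q3. field. }
    eapply smooth3_ext; [| | | | | | |exact S3]; intros x y t; cbv beta; rewrite EE;
      unfold V, Vx, Vy, Vxx, Vxy, Vyy; cbn [wsum fold_right];
      fold (wsum (hf (Q1 t) (Q2 t) (Q3 t)) cos l x y); unfold wsum; simpl; unfold ang.
    all: try ring.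
    unfold qform. field.
Qed.

Lemma smooth3_radial (x0 y0 K : R) (al0 al0' al1 al1' : R -> R) :
  (forall z, is_derive al0 z (al0' z)) -> (forall z, continuity_pt al0' z) ->
  (forall z, is_derive al1 z (al1' z)) -> (forall z, continuity_pt al1' z) ->
  let rho2 x y := (x - x0) ^ 2 + (y - y0) ^ 2 in
  smooth3 (fun x y t => al0 t + al1 t * rho2 x y + K * rho2 x y ^ 2)
   (fun x y t => 2 * al1 t * (x - x0) + 4 * K * rho2 x y * (x - x0))
   (fun x y t => 2 * al1 t * (y - y0) + 4 * K * rho2 x y * (y - y0))
   (fun x y t => al0' t + al1' t * rho2 x y)
   (fun x y t => 2 * al1 t + 4 * K * (3 * (x - x0) ^ 2 + (y - y0) ^ 2))
   (fun x y t => 8 * K * (x - x0) * (y - y0))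
   (fun x y t => 2 * al1 t + 4 * K * ((x - x0) ^ 2 + 3 * (y - y0) ^ 2)).
Proof.
  intros H0 C0 H1 C1 rho2.
  assert (D1 : forall z : R, is_derive (fun _ : R => 1) z 0) by (intros; apply (is_derive_const 1)).
  assert (D0 : forall z : R, is_derive (fun _ : R => 0) z 0) by (intros; apply (is_derive_const 0)).
  assert (Cc : forall (c z : R), continuity_pt (fun _ => c) z) by (intros; apply continuity_pt_const; intros ? ?; auto).
  assert (P2 : forall c z, is_derive (fun z => (z - c) ^ 2) z (2 * (z - c))) by (intros; auto_derive; auto; ring).
  assert (P1 : forall c z, is_derive (fun z => 2 * (z - c)) z 2) by (intros; auto_derive; auto; ring).
  assert (P4 : forall c z, is_derive (fun z => (z - c) ^ 4) z (4 * (z - c) ^ 3)) by (intros; auto_derive; auto; ring).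
  assert (P3 : forall c z, is_derive (fun z => 4 * (z - c) ^ 3) z (12 * (z - c) ^ 2)) by (intros; auto_derive; auto; ring).
  assert (CP : forall c z, continuity_pt (fun z => 12 * (z - c) ^ 2) z).
  { intros c z. apply (derive_cont _ (fun z => 24 * (z - c))). intros; auto_derive; auto; ring. }
  assert (T0 := smooth3_time al0 al0' H0 C0).
  assert (A1 := smooth3_prod _ _ _ _ _ _ _ _ (P2 x0) (P1 x0) (Cc 2) D1 D0 (Cc 0) H1 C1).
  assert (A2 := smooth3_prod _ _ _ _ _ _ _ _ D1 D0 (Cc 0) (P2 y0) (P1 y0) (Cc 2) H1 C1).
  assert (B1 := smooth3_prod _ _ _ _ _ _ _ _ (P4 x0) (P3 x0) (CP x0) D1 D0 (Cc 0) D1 (Cc 0)).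
  assert (B2 := smooth3_prod _ _ _ _ _ _ _ _ D1 D0 (Cc 0) (P4 y0) (P3 y0) (CP y0) D1 (Cc 0)).
  assert (B3 := smooth3_prod _ _ _ _ _ _ _ _ (P2 x0) (P1 x0) (Cc 2) (P2 y0) (P1 y0) (Cc 2) D1 (Cc 0)).
  assert (A := smooth3_lin 1 1 _ _ _ _ _ _ _ _ _ _ _ _ _ _ A1 A2).
  assert (B := smooth3_lin K K _ _ _ _ _ _ _ _ _ _ _ _ _ _ B1 B2).
  assert (B' := smooth3_lin 1 (2 * K) _ _ _ _ _ _ _ _ _ _ _ _ _ _ B B3).
  assert (C := smooth3_lin 1 1 _ _ _ _ _ _ _ _ _ _ _ _ _ _ T0 A).
  assert (D := smooth3_lin 1 1 _ _ _ _ _ _ _ _ _ _ _ _ _ _ C B').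
  eapply smooth3_ext; [| | | | | | |exact D]; intros; cbv beta; unfold rho2; ring.
Qed.

Lemma mult_abs_le (a b A C : R) : Rabs a <= A -> Rabs b <= C -> a * b <= A * C /\ - (A * C) <= a * b.
Proof.
  intros Ha Hb. assert (H : Rabs (a * b) <= A * C).
  { rewrite Rabs_mult. apply Rmult_le_compat; auto; apply Rabs_pos. }
  apply Rabs_le_between in H. lra.
Qed.

(** The pointwise estimate behind the comparison of [w] with [V + bar + N]: at a
    touching point the slope of the time perturbation is controlled by the
    freezing errors, which the barrier absorbs. *)
Lemma touch_algebra (A11 A12 A22 m n k a11 a12 a22 mj nj kj vx vy vxx vxy vyy vx0 vy0
   X Y D e B al0' al1' al1 K p : R) :
  Rabs (A11 - a11) <= e -> Rabs (A12 - a12) <= e -> Rabs (A22 - a22) <= e ->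
  Rabs (m - mj) <= e -> Rabs (n - nj) <= e -> Rabs (k - kj) <= e ->
  Rabs A11 <= B -> Rabs A12 <= B -> Rabs A22 <= B -> Rabs m <= B -> Rabs n <= B -> Rabs k <= B ->
  Rabs mj <= B -> Rabs nj <= B -> Rabs kj <= B ->
  Rabs vx <= D -> Rabs vy <= D -> Rabs vxx <= D -> Rabs vxy <= D -> Rabs vyy <= D ->
  Rabs (vx - vx0) <= (Rabs X + Rabs Y) * D -> Rabs (vy - vy0) <= (Rabs X + Rabs Y) * D ->
  Rabs X <= 1 -> Rabs Y <= 1 -> 0 <= al1 -> 0 <= K ->
  let rho2 := X ^ 2 + Y ^ 2 in
  0 <= (- / 2 * (a11 * vxx + 2 * a12 * vxy + a22 * vyy)
        + - (al0' + (mj * vx0 + nj * vy0 + kj * Rabs vx0) + p + al1' * rho2))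
     + / 2 * (A11 * (vxx + (2 * al1 + 4 * K * (3 * X ^ 2 + Y ^ 2))) + 2 * A12 * (vxy + 8 * K * X * Y)
              + A22 * (vyy + (2 * al1 + 4 * K * (X ^ 2 + 3 * Y ^ 2))))
     + m * (vx + (2 * al1 * X + 4 * K * rho2 * X)) + n * (vy + (2 * al1 * Y + 4 * K * rho2 * Y))
     + k * Rabs (vx + (2 * al1 * X + 4 * K * rho2 * X)) ->
  p <= 5 * e * D + 3 * B * (Rabs X + Rabs Y) * D + 8 * B * al1 + 24 * B * K * rho2 - al0' - al1' * rho2.
Proof.
  intros E1 E2 E3 E4 E5 E6 B1 B2 B3 B4 B5 B6 B7 B8 B9 V1 V2 V3 V4 V5 W1 W2 HX HY Hal HK rho2 H.
  assert (HB : 0 <= B) by (eapply Rle_trans; [apply Rabs_pos|exact B1]).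
  assert (HX2 := pow2_ge_0 X). assert (HY2 := pow2_ge_0 Y).
  assert (Hr : 0 <= rho2) by (unfold rho2; lra).
  assert (F1 := proj1 (mult_abs_le _ _ _ _ E1 V3)).
  assert (F2 := proj1 (mult_abs_le _ _ _ _ E2 V4)).
  assert (F3 := proj1 (mult_abs_le _ _ _ _ E3 V5)).
  assert (F4 := proj1 (mult_abs_le _ _ _ _ E4 V1)).
  assert (F5 := proj1 (mult_abs_le _ _ _ _ E5 V2)).
  assert (V1' : Rabs (Rabs vx) <= D) by (rewrite Rabs_Rabsolu; auto).
  assert (F6 := proj1 (mult_abs_le _ _ _ _ E6 V1')).
  assert (G1 := proj1 (mult_abs_le _ _ _ _ B7 W1)).
  assert (G2 := proj1 (mult_abs_le _ _ _ _ B8 W2)).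
  assert (W1' : Rabs (Rabs vx - Rabs vx0) <= (Rabs X + Rabs Y) * D).
  { eapply Rle_trans; [apply Rabs_triang_inv2|auto]. }
  assert (G3 := proj1 (mult_abs_le _ _ _ _ B9 W1')).
  set (bx := 2 * al1 * X + 4 * K * rho2 * X) in *.
  set (by_ := 2 * al1 * Y + 4 * K * rho2 * Y) in *.
  assert (Kr : 0 <= K * rho2) by nra.
  assert (Hbx : Rabs bx <= 2 * al1 + 4 * K * rho2).
  { unfold bx. replace (2 * al1 * X + 4 * K * rho2 * X) with ((2 * al1 + 4 * K * rho2) * X) by ring.
    rewrite Rabs_mult, Rabs_pos_eq by nra. assert (0 <= Rabs X) by apply Rabs_pos. nra. }
  assert (Hby : Rabs by_ <= 2 * al1 + 4 * K * rho2).
  { unfold by_. replace (2 * al1 * Y + 4 * K * rho2 * Y) with ((2 * al1 + 4 * K * rho2) * Y) by ring.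
    rewrite Rabs_mult, Rabs_pos_eq by nra. assert (0 <= Rabs Y) by apply Rabs_pos. nra. }
  assert (K1 := proj1 (mult_abs_le _ _ _ _ B4 Hbx)).
  assert (K2 := proj1 (mult_abs_le _ _ _ _ B5 Hby)).
  assert (Hd : Rabs (Rabs (vx + bx) - Rabs vx) <= 2 * al1 + 4 * K * rho2).
  { eapply Rle_trans; [apply Rabs_triang_inv2|]. replace (vx + bx - vx) with bx by ring. auto. }
  assert (K3 := proj1 (mult_abs_le _ _ _ _ B6 Hd)).
  assert (HKX : 0 <= K * X ^ 2) by nra. assert (HKY : 0 <= K * Y ^ 2) by nra.
  assert (P1 : Rabs (2 * al1 + 4 * K * (3 * X ^ 2 + Y ^ 2)) <= 2 * al1 + 4 * K * (3 * X ^ 2 + Y ^ 2)).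
  { rewrite Rabs_pos_eq; nra. }
  assert (P2 : Rabs (2 * al1 + 4 * K * (X ^ 2 + 3 * Y ^ 2)) <= 2 * al1 + 4 * K * (X ^ 2 + 3 * Y ^ 2)).
  { rewrite Rabs_pos_eq; nra. }
  assert (P3 : Rabs (8 * K * X * Y) <= 4 * K * rho2).
  { replace (8 * K * X * Y) with (4 * K * (2 * (X * Y))) by ring.
    rewrite Rabs_mult, (Rabs_pos_eq (4 * K)) by lra. apply Rmult_le_compat_l; [lra|].
    assert (S1 := pow2_ge_0 (X + Y)). assert (S2 := pow2_ge_0 (X - Y)). unfold rho2.
    apply Rabs_le. split; nra. }
  assert (Q1 := proj1 (mult_abs_le _ _ _ _ B1 P1)).
  assert (Q2 := proj1 (mult_abs_le _ _ _ _ B3 P2)).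
  assert (Q3 := proj1 (mult_abs_le _ _ _ _ B2 P3)).
  assert (R1 : B * (2 * al1 + 4 * K * (3 * X ^ 2 + Y ^ 2)) + B * (2 * al1 + 4 * K * (X ^ 2 + 3 * Y ^ 2))
     = 4 * (B * al1) + 16 * (B * (K * rho2))) by (unfold rho2; ring).
  assert (0 <= B * (K * rho2)) by nra. assert (0 <= B * al1) by nra.
  set (U := (Rabs X + Rabs Y) * D) in *.
  replace (3 * B * (Rabs X + Rabs Y) * D) with (3 * (B * U)) by (unfold U; ring).
  replace (24 * B * K * rho2) with (24 * (B * (K * rho2))) by ring.
  replace (B * (4 * K * rho2)) with (4 * (B * (K * rho2))) in * by ring.
  replace (B * (2 * al1 + 4 * K * rho2)) with (2 * (B * al1) + 4 * (B * (K * rho2))) in * by ring.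
  replace (5 * e * D) with (5 * (e * D)) by ring. replace (8 * B * al1) with (8 * (B * al1)) by ring.
  match type of H with 0 <= ?Z => replace Z with
    (/ 2 * ((A11 - a11) * vxx) + (A12 - a12) * vxy + / 2 * ((A22 - a22) * vyy)
     + (m - mj) * vx + (n - nj) * vy + (k - kj) * Rabs vx
     + mj * (vx - vx0) + nj * (vy - vy0) + kj * (Rabs vx - Rabs vx0)
     + / 2 * (A11 * (2 * al1 + 4 * K * (3 * X ^ 2 + Y ^ 2))) + A12 * (8 * K * X * Y)
     + / 2 * (A22 * (2 * al1 + 4 * K * (X ^ 2 + 3 * Y ^ 2)))
     + m * bx + n * by_ + k * (Rabs (vx + bx) - Rabs vx) - al0' - p - al1' * rho2) in H by field end.
  lra.
Qed.

Lemma derive_mono (f f' : R -> R) (a b : R) : (forall z, is_derive f z (f' z)) ->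
  (forall z, 0 <= f' z) -> a <= b -> f a <= f b.
Proof.
  intros H H0 Hab. destruct (MVT_gen f a b f') as (c & _ & Hc).
  - intros; apply H.
  - intros. apply (derive_cont _ _ H).
  - assert (0 <= f' c * (b - a)) by (apply Rmult_le_pos; auto; lra). lra.
Qed.

Lemma box_lipschitz (f fx fy : R -> R -> R) (x0 y0 D : R) :
  (forall x y, is_derive (fun x => f x y) x (fx x y)) ->
  (forall x y, is_derive (fun y => f x y) y (fy x y)) ->
  (forall x y, Rabs (x - x0) <= 1 -> Rabs (y - y0) <= 1 -> Rabs (fx x y) <= D /\ Rabs (fy x y) <= D) ->
  forall x y, Rabs (x - x0) <= 1 -> Rabs (y - y0) <= 1 ->
  Rabs (f x y - f x0 y0) <= (Rabs (x - x0) + Rabs (y - y0)) * D.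
Proof.
  intros Hx Hy HD x y Bx By.
  assert (H1 := bounded_variation (fun u => f u y) (fun u => fx u y) D x0 x).
  assert (H2 := bounded_variation (fun u => f x0 u) (fun u => fy x0 u) D y0 y).
  replace (f x y - f x0 y0) with ((f x y - f x0 y) + (f x0 y - f x0 y0)) by ring.
  eapply Rle_trans; [apply Rabs_triang|].
  assert (Rabs (f x y - f x0 y) <= D * Rabs (x - x0)).
  { apply H1. intros t Ht. split; auto. apply HD; auto. lra. }
  assert (Rabs (f x0 y - f x0 y0) <= D * Rabs (y - y0)).
  { apply H2. intros t Ht. split; auto. apply HD; auto. rewrite Rminus_diag, Rabs_R0; lra. lra. }
  lra.
Qed.

(** A coefficient family [cf]: indices 0, 1, 2 are the diffusion matrix entries
    (A11, A12, A22), 3 and 4 the drift, 5 the coefficient of [|w_x|]. *)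
Definition vsubc (T : R) (cf : nat -> R -> R -> R -> R) (w : R -> R -> R -> R) : Prop :=
  vsub T (cf 0%nat) (cf 1%nat) (cf 2%nat) (cf 3%nat) (cf 4%nat) (cf 5%nat) w.

Record coef_ok (T lamb B L : R) (cf : nat -> R -> R -> R -> R) : Prop := {
  ck_lamb : 0 < lamb; ck_B : 0 < B; ck_L : 0 <= L;
  ck_bd : forall i x y t, (i < 6)%nat -> 0 <= t <= T -> Rabs (cf i x y t) <= B;
  ck_lip : forall i x y x' y' t, (i < 6)%nat -> 0 <= t <= T ->
    Rabs (cf i x y t - cf i x' y' t) <= L * (Rabs (x - x') + Rabs (y - y'));
  ck_ell : forall x y t u v, 0 <= t <= T ->
    lamb * (u ^ 2 + v ^ 2) <= cf 0%nat x y t * u ^ 2 + 2 * cf 1%nat x y t * u * v + cf 2%nat x y t * v ^ 2 }.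

Definition derivs_le (q1 q2 q3 : R) (l : list tm) (x y D : R) : Prop :=
  Rabs (Vx q1 q2 q3 l x y) <= D /\ Rabs (Vy q1 q2 q3 l x y) <= D /\ Rabs (Vxx q1 q2 q3 l x y) <= D /\
  Rabs (Vxy q1 q2 q3 l x y) <= D /\ Rabs (Vyy q1 q2 q3 l x y) <= D.

(** Freezing the coefficients in space costs a multiple of [|X| + |Y|], which is not smooth; a
    parabola of width [sqrt tau], the diffusion length of the step, bounds it. *)
Lemma sqrt_barrier (tau X Y : R) : 0 < tau ->
  Rabs X + Rabs Y <= sqrt tau + (X ^ 2 + Y ^ 2) / sqrt tau.
Proof.
  intros Ht. set (s := sqrt tau). assert (Hs : 0 < s) by (apply sqrt_lt_R0; auto).
  apply Rmult_le_reg_r with s; auto.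
  replace ((s + (X ^ 2 + Y ^ 2) / s) * s) with (s ^ 2 + X ^ 2 + Y ^ 2) by (field; lra).
  rewrite <- (pow2_abs X), <- (pow2_abs Y).
  assert (H1 := pow2_ge_0 (Rabs X - s / 2)). assert (H2 := pow2_ge_0 (Rabs Y - s / 2)).
  assert (H3 := pow2_ge_0 s). nra.
Qed.

Lemma freeze_cont (q1 q2 q3 a1 x0 y0 z : R) (lab : nat -> R) (l : list tm) :
  let Q1 a := q1 + lab 0%nat * (a - a1) in let Q2 a := q2 + lab 1%nat * (a - a1) in
  let Q3 a := q3 + lab 2%nat * (a - a1) in
  continuity_pt (fun a => lab 3%nat * Vx (Q1 a) (Q2 a) (Q3 a) l x0 y0
   + lab 4%nat * Vy (Q1 a) (Q2 a) (Q3 a) l x0 y0 + lab 5%nat * Rabs (Vx (Q1 a) (Q2 a) (Q3 a) l x0 y0)) z.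
Proof.
  intros Q1 Q2 Q3.
  assert (SV := smooth3_V q1 q2 q3 (- lab 0%nat) (- lab 1%nat) (- lab 2%nat) a1 l).
  cbv zeta in SV.
  assert (Cv : forall f : R -> R -> R -> R, cont3 f -> continuity_pt (fun a => f x0 y0 a) z).
  { intros f Hf eps He. destruct (Hf x0 y0 z eps He) as (d & Hd & H). exists d. split; auto.
    intros u [_ Hu]. simpl in *. unfold R_dist in *. apply H; auto; rewrite Rminus_diag, Rabs_R0; auto. }
  assert (E : forall (q c u : R), q + - c * (a1 - u) = q + c * (u - a1)) by (intros; ring).
  assert (C1 : continuity_pt (fun a => Vx (Q1 a) (Q2 a) (Q3 a) l x0 y0) z).
  { eapply continuity_pt_ext; [|exact (Cv _ (sm_cx _ _ _ _ _ _ _ SV))]. intros u. cbv beta. rewrite !E. reflexivity. }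
  assert (C2 : continuity_pt (fun a => Vy (Q1 a) (Q2 a) (Q3 a) l x0 y0) z).
  { eapply continuity_pt_ext; [|exact (Cv _ (sm_cy _ _ _ _ _ _ _ SV))]. intros u. cbv beta. rewrite !E. reflexivity. }
  apply continuity_pt_plus; [apply continuity_pt_plus|].
  - apply (continuity_pt_scal (fun a => Vx (Q1 a) (Q2 a) (Q3 a) l x0 y0)); auto.
  - apply (continuity_pt_scal (fun a => Vy (Q1 a) (Q2 a) (Q3 a) l x0 y0)); auto.
  - apply (continuity_pt_scal (fun a => Rabs (Vx (Q1 a) (Q2 a) (Q3 a) l x0 y0))).
    apply (continuity_pt_comp (fun a => Vx (Q1 a) (Q2 a) (Q3 a) l x0 y0) Rabs); auto. apply Rcontinuity_abs.
Qed.

Section Leaf.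
Variables (T lamb B L : R) (cf : nat -> R -> R -> R -> R).
Variables (x0 y0 t0 tau theta K Dm : R) (D Th : R -> R) (l : list tm).
Hypothesis Hok : coef_ok T lamb B L cf.
Hypotheses (Htau : 0 < tau <= 1) (Ht0 : tau <= t0) (HT : t0 <= T) (Hth : 0 < theta).
Hypothesis HDc : forall z, continuity_pt D z.
Hypothesis HTh : forall z, is_derive Th z (D z).
Hypothesis HTh0 : Th 0 = 0.
Hypothesis HD0 : forall z, 0 <= D z <= Dm.
Hypothesis HDm : 0 < Dm.
Hypothesis HK : 0 <= K.
Hypothesis HV : forall q1 q2 q3 a x y, 0 <= a <= tau -> Qb lamb (2 * B) (a + theta) q1 q2 q3 ->
  inbox x0 y0 x y -> derivs_le q1 q2 q3 l x y (D a).

Definition bc1 : R := 2 * (5 * L + 3 * B).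
Definition bal0 (a : R) : R :=
  bc1 / 2 * sqrt tau * Th a + 4 * B * bc1 * (Th tau / sqrt tau) * a + K * (12 * B) ^ 2 * a ^ 2.
Definition bal1 (a : R) : R := bc1 / (2 * sqrt tau) * Th a + 2 * K * (12 * B) * a.
(** Two barriers in one; [a] is the age, the time elapsed backwards from [t0]. The part with [K] is
    [K (r2 + 12 B a)^2] for the squared distance [r2] and keeps maxima away from the sides of the
    box. The rest is the parabola of [sqrt_barrier] weighted with the accumulated derivative bound
    [Th], plus a term linear in [a] that pays for the derivatives of this parabola. *)
Definition bar (x y a : R) : R :=
  bal0 a + bal1 a * ((x - x0) ^ 2 + (y - y0) ^ 2) + K * ((x - x0) ^ 2 + (y - y0) ^ 2) ^ 2.

Lemma bc1_pos : 0 < bc1.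
Proof. destruct Hok. unfold bc1. lra. Qed.

Lemma Th_mono (a b : R) : a <= b -> Th a <= Th b.
Proof. apply (derive_mono Th D); auto. intros z; apply HD0. Qed.

Lemma bal_pos (a : R) : 0 <= a -> 0 <= bal0 a /\ 0 <= bal1 a.
Proof.
  intros Ha. assert (Hc := bc1_pos). destruct Hok.
  assert (Hs : 0 < sqrt tau) by (apply sqrt_lt_R0; lra).
  assert (H0 : 0 <= Th a) by (rewrite <- HTh0; apply Th_mono; auto).
  assert (H1 : 0 <= Th tau) by (rewrite <- HTh0; apply Th_mono; lra).
  assert (0 <= Th tau / sqrt tau) by (apply Rmult_le_pos; auto; left; apply Rinv_0_lt_compat; auto).
  assert (0 < bc1 / (2 * sqrt tau)) by (apply Rdiv_lt_0_compat; lra).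
  assert (0 <= bc1 / 2 * sqrt tau * Th a) by (repeat apply Rmult_le_pos; lra).
  assert (0 <= 4 * B * bc1 * (Th tau / sqrt tau) * a).
  { apply Rmult_le_pos; auto. apply Rmult_le_pos; auto. repeat apply Rmult_le_pos; lra. }
  assert (0 <= K * (12 * B) ^ 2 * a ^ 2) by (repeat apply Rmult_le_pos; try lra; apply pow2_ge_0).
  assert (0 <= bc1 / (2 * sqrt tau) * Th a) by (apply Rmult_le_pos; lra).
  assert (0 <= 2 * K * (12 * B) * a) by (repeat apply Rmult_le_pos; lra).
  unfold bal0, bal1. lra.
Qed.

Definition bal0' (a : R) : R :=
  bc1 / 2 * sqrt tau * D a + 4 * B * bc1 * (Th tau / sqrt tau) + 2 * K * (12 * B) ^ 2 * a.
Definition bal1' (a : R) : R := bc1 / (2 * sqrt tau) * D a + 2 * K * (12 * B).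

Lemma bal0_derive (a : R) : is_derive bal0 a (bal0' a).
Proof.
  unfold bal0, bal0'.
  replace (2 * K * (12 * B) ^ 2 * a) with (K * (12 * B) ^ 2 * (2 * a)) by ring.
  apply (is_derive_plus (fun a => bc1 / 2 * sqrt tau * Th a + 4 * B * bc1 * (Th tau / sqrt tau) * a)
     (fun a => K * (12 * B) ^ 2 * a ^ 2)).
  apply (is_derive_plus (fun a => bc1 / 2 * sqrt tau * Th a) (fun a => 4 * B * bc1 * (Th tau / sqrt tau) * a)).
  - apply (is_derive_scal Th); auto.
  - auto_derive; auto. ring.
  - auto_derive; auto. ring.
Qed.

Lemma bal1_derive (a : R) : is_derive bal1 a (bal1' a).
Proof.
  unfold bal1, bal1'.
  apply (is_derive_plus (fun a => bc1 / (2 * sqrt tau) * Th a) (fun a => 2 * K * (12 * B) * a)).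
  - apply (is_derive_scal Th); auto.
  - auto_derive; auto. ring.
Qed.

Lemma bal_cont : (forall z, continuity_pt bal0' z) /\ (forall z, continuity_pt bal1' z).
Proof.
  assert (Cl : forall c z, continuity_pt (fun z => c * z) z).
  { intros c z. apply (continuity_pt_scal (fun z => z)). apply continuity_pt_id. }
  assert (Cc : forall c z : R, continuity_pt (fun _ => c) z) by (intros; apply continuity_pt_const; intros ? ?; auto).
  split; intros z.
  - unfold bal0'. apply continuity_pt_plus; [|apply Cl]. apply continuity_pt_plus; [|apply Cc].
    apply (continuity_pt_scal D); auto.
  - unfold bal1'. apply continuity_pt_plus; [|apply Cc]. apply (continuity_pt_scal D); auto.
Qed.

(** The choice of [bc1] and of the constants in [bal0], [bal1] is dictated by this lemma. *)
Lemma barrier_absorbs (a X Y : R) : 0 <= a <= tau ->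
  (5 * L + 3 * B) * (Rabs X + Rabs Y) * D a + 8 * B * bal1 a + 24 * B * K * (X ^ 2 + Y ^ 2)
   <= bal0' a + bal1' a * (X ^ 2 + Y ^ 2).
Proof.
  intros Ha. assert (Hc := bc1_pos). assert (HB := ck_B _ _ _ _ _ Hok).
  assert (Hs : 0 < sqrt tau) by (apply sqrt_lt_R0; lra).
  assert (Hb := sqrt_barrier tau X Y (proj1 Htau)).
  assert (HDa := HD0 a).
  assert (HT1 : Th a <= Th tau) by (apply Th_mono; lra).
  assert (H1 : (5 * L + 3 * B) * (Rabs X + Rabs Y) * D a <=
     bc1 / 2 * sqrt tau * D a + bc1 / (2 * sqrt tau) * D a * (X ^ 2 + Y ^ 2)).
  { replace (bc1 / 2 * sqrt tau * D a + bc1 / (2 * sqrt tau) * D a * (X ^ 2 + Y ^ 2)) with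
      (bc1 / 2 * D a * (sqrt tau + (X ^ 2 + Y ^ 2) / sqrt tau)) by (field; lra).
    replace ((5 * L + 3 * B) * (Rabs X + Rabs Y) * D a) with (bc1 / 2 * D a * (Rabs X + Rabs Y)) by (unfold bc1; field).
    apply Rmult_le_compat_l; auto. apply Rmult_le_pos; lra. }
  assert (H2 : 8 * B * (bc1 / (2 * sqrt tau) * Th a) <= 4 * B * bc1 * (Th tau / sqrt tau)).
  { replace (8 * B * (bc1 / (2 * sqrt tau) * Th a)) with (4 * B * bc1 * / sqrt tau * Th a) by (field; lra).
    replace (4 * B * bc1 * (Th tau / sqrt tau)) with (4 * B * bc1 * / sqrt tau * Th tau) by (field; lra).
    apply Rmult_le_compat_l; auto. assert (0 < / sqrt tau) by (apply Rinv_0_lt_compat; auto).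
    assert (0 <= 4 * B * bc1) by nra. apply Rmult_le_pos; lra. }
  assert (H3 : 8 * B * (2 * K * (12 * B) * a) <= 2 * K * (12 * B) ^ 2 * a).
  { assert (0 <= K * B * B * a) by (repeat apply Rmult_le_pos; lra). nra. }
  unfold bal0', bal1', bal1. nra.
Qed.

Section OneLeaf.
Variables (a1 a2 q1 q2 q3 m0 NM eps d : R) (lab : nat -> R) (N : R -> R) (w : R -> R -> R -> R).
Let Q1 a := q1 + lab 0%nat * (a - a1).
Let Q2 a := q2 + lab 1%nat * (a - a1).
Let Q3 a := q3 + lab 2%nat * (a - a1).
Hypotheses (Ha1 : 0 <= a1) (Ha12 : a1 < a2) (Ha2 : a2 <= tau).
Hypothesis HQ : forall a, a1 <= a <= a2 -> Qb lamb (2 * B) (a + theta) (Q1 a) (Q2 a) (Q3 a).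
Hypothesis Hlab : forall i, (i < 6)%nat -> Rabs (lab i) <= B.
Hypothesis HN : forall a, is_derive N a (lab 3%nat * Vx (Q1 a) (Q2 a) (Q3 a) l x0 y0
   + lab 4%nat * Vy (Q1 a) (Q2 a) (Q3 a) l x0 y0 + lab 5%nat * Rabs (Vx (Q1 a) (Q2 a) (Q3 a) l x0 y0)).
Hypothesis HNM : forall a, a1 <= a <= a2 -> Rabs (N a) <= NM.
Hypotheses (Heps : 0 <= eps) (Hm0 : 0 < m0).
Hypothesis Hslope : slope_bound (fun a => forall i, (i < 6)%nat ->
   Rabs (cf i x0 y0 (t0 - a) - lab i) <= eps) a1 a2 d.
Hypotheses (Hw : vsubc T cf w) (Hwc : cont3 w).
Hypothesis Hlat : forall x y a p1 p2 p3, inbox x0 y0 x y -> 0 <= a <= tau ->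
  Qb lamb (2 * B) (a + theta) p1 p2 p3 -> w x y (t0 - a) - V p1 p2 p3 l x y <= K - NM.

(** [N] is left out of [F0]: depending on the age alone, it is handled together with the time
    perturbation at a touching point. *)
Let F0 x y a := V (Q1 a) (Q2 a) (Q3 a) l x y + bar x y a.
Let g x y a := w x y (t0 - a) - F0 x y a.

Lemma age_id (a : R) : t0 - (t0 - a) = a.
Proof. ring. Qed.

Lemma leaf_test (ps dps : R -> R) :
  (forall z, is_derive ps z (dps z)) -> (forall z, continuity_pt dps z) ->
  let Vt f := fun x y t => f (Q1 (t0 - t)) (Q2 (t0 - t)) (Q3 (t0 - t)) l x y in
  let rho2 x y := (x - x0) ^ 2 + (y - y0) ^ 2 in
  smooth3 (fun x y t => F0 x y (t0 - t) + ps (t0 - t))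
   (fun x y t => Vt Vx x y t + (2 * bal1 (t0 - t) * (x - x0) + 4 * K * rho2 x y * (x - x0)))
   (fun x y t => Vt Vy x y t + (2 * bal1 (t0 - t) * (y - y0) + 4 * K * rho2 x y * (y - y0)))
   (fun x y t => - / 2 * (lab 0%nat * Vt Vxx x y t + 2 * lab 1%nat * Vt Vxy x y t + lab 2%nat * Vt Vyy x y t)
      + - (bal0' (t0 - t) + dps (t0 - t) + bal1' (t0 - t) * rho2 x y))
   (fun x y t => Vt Vxx x y t + (2 * bal1 (t0 - t) + 4 * K * (3 * (x - x0) ^ 2 + (y - y0) ^ 2)))
   (fun x y t => Vt Vxy x y t + 8 * K * (x - x0) * (y - y0))
   (fun x y t => Vt Vyy x y t + (2 * bal1 (t0 - t) + 4 * K * ((x - x0) ^ 2 + 3 * (y - y0) ^ 2))).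
Proof.
  intros Hps Hdps Vt rho2. destruct bal_cont as [C0 C1].
  assert (Cr : forall f, (forall z, continuity_pt f z) -> forall z, continuity_pt (fun t => - f (t0 - t)) z).
  { intros f Hf z. apply (continuity_pt_opp (fun t => f (t0 - t))).
    apply (continuity_pt_comp (fun t => t0 - t) f); auto.
    apply continuity_pt_minus. apply continuity_pt_const; intros ? ?; auto. apply continuity_pt_id. }
  assert (Dr : forall f f', (forall z, is_derive f z (f' z)) -> forall z, is_derive (fun t => f (t0 - t)) z (- f' (t0 - z))).
  { intros f f' Hf z. replace (- f' (t0 - z)) with (-1 * f' (t0 - z)) by ring.
    apply (is_derive_comp f (fun t => t0 - t)); auto. auto_derive; auto; ring. }
  assert (D0 : forall z, is_derive (fun a => bal0 a + ps a) z (bal0' z + dps z)).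
  { intros z. apply (is_derive_plus bal0 ps); auto. apply bal0_derive. }
  assert (C0' : forall z, continuity_pt (fun a => bal0' a + dps a) z).
  { intros z. apply continuity_pt_plus; auto. }
  assert (SR := smooth3_radial x0 y0 K _ _ _ _ (Dr _ _ D0) (Cr _ C0') (Dr _ _ bal1_derive) (Cr _ C1)).
  assert (SV := smooth3_V q1 q2 q3 (lab 0%nat) (lab 1%nat) (lab 2%nat) (t0 - a1) l).
  cbv zeta in SR, SV.
  assert (S := smooth3_lin 1 1 _ _ _ _ _ _ _ _ _ _ _ _ _ _ SV SR).
  assert (E1 : forall t, q1 + lab 0%nat * (t0 - a1 - t) = Q1 (t0 - t)) by (intros; unfold Q1; ring).
  assert (E2 : forall t, q2 + lab 1%nat * (t0 - a1 - t) = Q2 (t0 - t)) by (intros; unfold Q2; ring).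
  assert (E3 : forall t, q3 + lab 2%nat * (t0 - a1 - t) = Q3 (t0 - t)) by (intros; unfold Q3; ring).
  eapply smooth3_ext; [| | | | | | |exact S]; intros x y t; cbv beta; rewrite E1, E2, E3;
    unfold F0, bar, Vt, rho2; ring.
Qed.

Lemma leaf_cont : cont3 g /\ forall z, continuity_pt N z.
Proof.
  assert (CN : forall z, continuity_pt N z) by (apply (derive_cont _ _ HN)).
  split; auto. unfold g.
  assert (Cr : forall z, continuity_pt (fun t => t0 - t) z).
  { intros z. apply continuity_pt_minus. apply continuity_pt_const; intros ? ?; auto. apply continuity_pt_id. }
  assert (Ci : forall z : R, continuity_pt (fun t => t) z) by (intros; apply continuity_pt_id).
  assert (S := leaf_test (fun _ => 0) (fun _ => 0) (fun z => is_derive_const 0 z)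
     (fun z => continuity_pt_const (fun _ => 0) z (fun _ _ => eq_refl))).
  assert (CF := cont3_args _ (fun x => x) (fun y => y) (fun t => t0 - t) Ci Ci Cr (sm_c _ _ _ _ _ _ _ S)).
  assert (CW := cont3_args w (fun x => x) (fun y => y) (fun t => t0 - t) Ci Ci Cr Hwc).
  assert (C := cont3_plus _ _ CW (cont3_scal (-1) _ CF)).
  eapply cont3_ext; [|exact C]. intros x y t. cbv beta. rewrite age_id. ring.
Qed.

(** [touch_algebra] bounds the slope, and [barrier_absorbs] cancels everything that stems from the
    distance to the centre or from the barrier itself; only the error of freezing in time remains.
    [e0] is left free, since it is [2 * B] at arbitrary times and [eps] on the chosen set of
    times. *)
Lemma leaf_touch (x y s : R) (ps dps : R -> R) : a1 < s < a2 ->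
  (forall z, is_derive ps z (dps z)) -> (forall z, continuity_pt dps z) ->
  Rabs (x - x0) < 1 -> Rabs (y - y0) < 1 ->
  (exists del, 0 < del /\ forall x' y' s', inbox x0 y0 x' y' -> Rabs (s' - s) < del ->
     g x' y' s' - N s' - ps s' <= g x y s - N s - ps s) ->
  forall e0, (forall i, (i < 6)%nat -> Rabs (cf i x0 y0 (t0 - s) - lab i) <= e0) ->
  dps s <= 5 * e0 * D s.
Proof.
  intros Hs Hps Hdps Hx Hy (del & Hdel & Hloc) e0 He0.
  set (nd := fun a => lab 3%nat * Vx (Q1 a) (Q2 a) (Q3 a) l x0 y0
   + lab 4%nat * Vy (Q1 a) (Q2 a) (Q3 a) l x0 y0 + lab 5%nat * Rabs (Vx (Q1 a) (Q2 a) (Q3 a) l x0 y0)).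
  assert (Cnd : forall z, continuity_pt nd z) by (intros z; apply freeze_cont).
  assert (S := leaf_test (fun a => N a + ps a) (fun a => nd a + dps a)
     (fun z => is_derive_plus N ps z _ _ (HN z) (Hps z))
     (fun z => continuity_pt_plus nd dps z (Cnd z) (Hdps z))).
  assert (Ht : 0 < t0 - s < T) by lra.
  assert (Htouch : exists del, 0 < del /\ forall x' y' t', Rabs (x' - x) < del -> Rabs (y' - y) < del ->
     Rabs (t' - (t0 - s)) < del -> w x' y' t' - (F0 x' y' (t0 - t') + (N (t0 - t') + ps (t0 - t'))) <=
       w x y (t0 - s) - (F0 x y (t0 - (t0 - s)) + (N (t0 - (t0 - s)) + ps (t0 - (t0 - s))))).
  { exists (Rmin del (Rmin (1 - Rabs (x - x0)) (1 - Rabs (y - y0)))).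
    split. repeat apply Rmin_glb_lt; lra.
    assert (M1 := Rmin_l del (Rmin (1 - Rabs (x - x0)) (1 - Rabs (y - y0)))).
    assert (M2 := Rmin_r del (Rmin (1 - Rabs (x - x0)) (1 - Rabs (y - y0)))).
    assert (M3 := Rmin_l (1 - Rabs (x - x0)) (1 - Rabs (y - y0))).
    assert (M4 := Rmin_r (1 - Rabs (x - x0)) (1 - Rabs (y - y0))).
    intros x' y' t' Hx' Hy' Ht'. rewrite !age_id.
    assert (A1 := Rabs_triang (x' - x) (x - x0)). assert (A2 := Rabs_triang (y' - y) (y - y0)).
    replace (x' - x + (x - x0)) with (x' - x0) in A1 by ring.
    replace (y' - y + (y - y0)) with (y' - y0) in A2 by ring.
    specialize (Hloc x' y' (t0 - t') ltac:(split; lra)).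
    unfold g in Hloc. rewrite age_id in Hloc.
    assert (Rabs (t0 - t' - s) < del).
    { replace (t0 - t' - s) with (- (t' - (t0 - s))) by ring. rewrite Rabs_Ropp. lra. }
    specialize (Hloc H). lra. }
  assert (HH := Hw _ _ _ _ _ _ _ x y (t0 - s) S Ht Htouch). cbv beta in HH. rewrite !age_id in HH.
  assert (Hin : inbox x0 y0 x y) by (split; lra).
  assert (Hsr : a1 <= s <= a2) by lra.
  destruct (HV _ _ _ s x y ltac:(lra) (HQ s Hsr) Hin) as (V1 & V2 & V3 & V4 & V5).
  assert (SV0 := smooth3_V (Q1 s) (Q2 s) (Q3 s) 0 0 0 0 l). cbv zeta in SV0.
  assert (EZ : forall z : R, z + 0 * (0 - 0) = z) by (intros; ring).
  assert (Lip1 : Rabs (Vx (Q1 s) (Q2 s) (Q3 s) l x y - Vx (Q1 s) (Q2 s) (Q3 s) l x0 y0) <= (Rabs (x - x0) + Rabs (y - y0)) * D s).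
  { apply (box_lipschitz (Vx (Q1 s) (Q2 s) (Q3 s) l) (Vxx (Q1 s) (Q2 s) (Q3 s) l) (Vxy (Q1 s) (Q2 s) (Q3 s) l)); try lra.
    - intros u v. assert (H := sm_xx _ _ _ _ _ _ _ SV0 u v 0). cbv beta in H. rewrite !EZ in H. exact H.
    - intros u v. assert (H := sm_xy _ _ _ _ _ _ _ SV0 u v 0). cbv beta in H. rewrite !EZ in H. exact H.
    - intros u v Hu Hv. destruct (HV _ _ _ s u v ltac:(lra) (HQ s Hsr) (conj Hu Hv)) as (_ & _ & K3 & K4 & _). auto. }
  (* [smooth3] records the mixed derivative only as the [y]-derivative of [Vx]; the other order is
     read off the sum. *)
  assert (Dyx : forall u v, is_derive (fun u => Vy (Q1 s) (Q2 s) (Q3 s) l u v) u (Vxy (Q1 s) (Q2 s) (Q3 s) l u v)).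
  { intros u v. unfold Vy, Vxy. clear. generalize (hf (Q1 s) (Q2 s) (Q3 s)). intros h.
    induction l as [|e l' IH]; simpl. apply (is_derive_const 0).
    apply (is_derive_plus (fun u => ta e * (- tl e * h e) * sin (ang e u v))
       (fun u => wsum (fun e => - tl e * h e) sin l' u v)); auto.
    unfold ang. auto_derive; auto. ring. }
  assert (Lip2 : Rabs (Vy (Q1 s) (Q2 s) (Q3 s) l x y - Vy (Q1 s) (Q2 s) (Q3 s) l x0 y0) <= (Rabs (x - x0) + Rabs (y - y0)) * D s).
  { apply (box_lipschitz (Vy (Q1 s) (Q2 s) (Q3 s) l) (Vxy (Q1 s) (Q2 s) (Q3 s) l) (Vyy (Q1 s) (Q2 s) (Q3 s) l)); try lra.
    - auto.
    - intros u v. assert (H := sm_yy _ _ _ _ _ _ _ SV0 u v 0). cbv beta in H. rewrite !EZ in H. exact H.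
    - intros u v Hu Hv. destruct (HV _ _ _ s u v ltac:(lra) (HQ s Hsr) (conj Hu Hv)) as (_ & _ & _ & K4 & K5). auto. }
  set (e := L * (Rabs (x - x0) + Rabs (y - y0)) + e0).
  assert (He : forall i, (i < 6)%nat -> Rabs (cf i x y (t0 - s) - lab i) <= e).
  { intros i Hi. replace (cf i x y (t0 - s) - lab i) with
      ((cf i x y (t0 - s) - cf i x0 y0 (t0 - s)) + (cf i x0 y0 (t0 - s) - lab i)) by ring.
    eapply Rle_trans; [apply Rabs_triang|]. apply Rplus_le_compat; auto.
    apply (ck_lip _ _ _ _ _ Hok); auto. lra. }
  assert (Hb : forall i, (i < 6)%nat -> Rabs (cf i x y (t0 - s)) <= B).
  { intros i Hi. apply (ck_bd _ _ _ _ _ Hok); auto. lra. }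
  assert (Hal : 0 <= bal1 s) by (apply bal_pos; lra).
  assert (Hp := fun H => touch_algebra
    (cf 0%nat x y (t0 - s)) (cf 1%nat x y (t0 - s)) (cf 2%nat x y (t0 - s))
    (cf 3%nat x y (t0 - s)) (cf 4%nat x y (t0 - s)) (cf 5%nat x y (t0 - s))
    (lab 0%nat) (lab 1%nat) (lab 2%nat) (lab 3%nat) (lab 4%nat) (lab 5%nat)
    (Vx (Q1 s) (Q2 s) (Q3 s) l x y) (Vy (Q1 s) (Q2 s) (Q3 s) l x y) (Vxx (Q1 s) (Q2 s) (Q3 s) l x y)
    (Vxy (Q1 s) (Q2 s) (Q3 s) l x y) (Vyy (Q1 s) (Q2 s) (Q3 s) l x y)
    (Vx (Q1 s) (Q2 s) (Q3 s) l x0 y0) (Vy (Q1 s) (Q2 s) (Q3 s) l x0 y0)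
    (x - x0) (y - y0) (D s) e B (bal0' s) (bal1' s) (bal1 s) K (dps s)
    (He 0%nat ltac:(lia)) (He 1%nat ltac:(lia)) (He 2%nat ltac:(lia)) (He 3%nat ltac:(lia)) (He 4%nat ltac:(lia)) (He 5%nat ltac:(lia))
    (Hb 0%nat ltac:(lia)) (Hb 1%nat ltac:(lia)) (Hb 2%nat ltac:(lia)) (Hb 3%nat ltac:(lia)) (Hb 4%nat ltac:(lia)) (Hb 5%nat ltac:(lia))
    (Hlab 3%nat ltac:(lia)) (Hlab 4%nat ltac:(lia)) (Hlab 5%nat ltac:(lia)) V1 V2 V3 V4 V5 Lip1 Lip2 (proj1 Hin) (proj2 Hin) Hal HK H).
  cbv zeta in Hp. unfold nd in HH.
  assert (Hp' := Hp ltac:(eapply Rle_trans; [exact HH|right; ring])).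
  assert (Hab := barrier_absorbs s (x - x0) (y - y0) ltac:(lra)).
  unfold e in Hp'.
  replace (5 * (L * (Rabs (x - x0) + Rabs (y - y0)) + e0) * D s) with
    (5 * L * (Rabs (x - x0) + Rabs (y - y0)) * D s + 5 * e0 * D s) in Hp' by ring.
  replace ((5 * L + 3 * B) * (Rabs (x - x0) + Rabs (y - y0)) * D s) with
    (5 * L * (Rabs (x - x0) + Rabs (y - y0)) * D s + 3 * B * (Rabs (x - x0) + Rabs (y - y0)) * D s) in Hab by ring.
  lra.
Qed.

(** A point where the supremum over the box is attained turns a function of time touching [M] into a
    test function for [w]. Arbitrary times allow slopes up to [10 * B * Dm], times in the chosen set
    none beyond the [5 * eps * Dm] already subtracted, and [slope_bound] integrates this. *)
Lemma leaf_bound :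
  (forall x y, inbox x0 y0 x y -> w x y (t0 - a1) <= V q1 q2 q3 l x y + N a1 + bar x y a1 + m0) ->
  forall x y, inbox x0 y0 x y ->
   w x y (t0 - a2) <= V (Q1 a2) (Q2 a2) (Q3 a2) l x y + N a2 + bar x y a2 + m0
      + 5 * eps * Dm * (a2 - a1) + 10 * B * Dm * d.
Proof.
  intros Hinit.
  assert (HB := ck_B _ _ _ _ _ Hok).
  destruct leaf_cont as [Cg CN].
  (* Truncation at [m0 > 0] discards the times at which the maximum could sit on the sides of the
     box; the linear term makes the slopes on the chosen set nonpositive. *)
  set (M := fun a => Rmax (supbox g x0 y0 a - N a) m0 - 5 * eps * Dm * a).
  assert (CM : forall z, continuity_pt M z).
  { intros z. unfold M. apply continuity_pt_minus.
    - assert (C1 : continuity_pt (fun a => supbox g x0 y0 a - N a) z).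
      { apply continuity_pt_minus. apply supbox_cont; auto. auto. }
      intros e He. destruct (C1 e He) as (dd & Hdd & H). exists dd; split; auto.
      intros u Hu. specialize (H u Hu). simpl in *. unfold R_dist in *.
      eapply Rle_lt_trans; [|exact H]. unfold Rmax.
      repeat destruct (Rle_dec _ _); unfold Rabs; repeat destruct (Rcase_abs _); lra.
    - apply (continuity_pt_scal (fun a => a)). apply continuity_pt_id. }
  assert (HE : 0 <= 5 * eps * Dm) by (repeat apply Rmult_le_pos; lra).
  assert (HBD : 0 < 10 * B * Dm) by (repeat apply Rmult_lt_0_compat; lra).
  assert (HM := Hslope M (10 * B * Dm) CM HBD).
  assert (Hres : M a2 - M a1 <= 10 * B * Dm * d).
  { apply HM. clear HM. intros s psi dpsi Hs (P1 & P2 & del & Hdel & P3).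
    assert (P3' : forall a, Rabs (a - s) < del ->
       Rmax (supbox g x0 y0 a - N a) m0 - (psi a + 5 * eps * Dm * a) <=
       Rmax (supbox g x0 y0 s - N s) m0 - (psi s + 5 * eps * Dm * s)).
    { intros a Ha. specialize (P3 a Ha). unfold M in P3. lra. }
    set (ps := fun a => psi a + 5 * eps * Dm * a) in *.
    set (dps := fun a => dpsi a + 5 * eps * Dm).
    assert (Dps : forall z, is_derive ps z (dps z)).
    { intros z. apply (is_derive_plus psi (fun a => 5 * eps * Dm * a)); auto. auto_derive; auto. ring. }
    assert (Cps : forall z, continuity_pt dps z).
    { intros z. apply continuity_pt_plus; auto. apply continuity_pt_const; intros ? ?; auto. }
    destruct (Rle_dec (supbox g x0 y0 s - N s) m0) as [Hle|Hgt].
    (* Here the truncated function takes its least value [m0], so [ps] has a local minimum. *)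
    - assert (dps s <= 0).
      { rewrite (Rmax_right _ _ Hle) in P3'.
        assert (pr : derivable_pt ps s) by (exists (dps s); apply is_derive_Reals; auto).
        assert (E := deriv_minimum ps (s - del) (s + del) s pr ltac:(lra) ltac:(lra)).
        assert (E0 : derive_pt ps s pr = 0).
        { apply E. intros a Ha1' Ha2'. specialize (P3' a ltac:(apply Rabs_def1; lra)).
          assert (m0 <= Rmax (supbox g x0 y0 a - N a) m0) by apply Rmax_r. unfold ps. lra. }
        assert (E1 : derive_pt ps s pr = dps s).
        { apply derive_pt_eq_0. apply is_derive_Reals. auto. }
        lra. }
      unfold dps in H. split; intros; lra.
    - apply Rnot_le_lt in Hgt.
      rewrite (Rmax_left (supbox g x0 y0 s - N s)) in P3' by lra.
      destruct (supbox_spec g x0 y0 s Cg) as [_ (x & y & Hin & Exy)].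
      assert (Hsr : a1 <= s <= a2) by lra.
      (* On the sides of the box the barrier is at least [K], which by [Hlat] forces
         [g - N <= 0 < m0]. *)
      assert (Hint : Rabs (x - x0) < 1 /\ Rabs (y - y0) < 1).
      { apply NNPP. intros Hn.
        assert (Hr2 : 1 <= (x - x0) ^ 2 + (y - y0) ^ 2).
        { destruct Hin as [I1 I2]. rewrite <- (pow2_abs (x - x0)), <- (pow2_abs (y - y0)).
          assert (J1 := pow2_ge_0 (Rabs (x - x0))). assert (J2 := pow2_ge_0 (Rabs (y - y0))).
          destruct (Rlt_dec (Rabs (x - x0)) 1) as [h1|h1].
          - destruct (Rlt_dec (Rabs (y - y0)) 1) as [h2|h2]; [tauto|].
            replace (Rabs (y - y0)) with 1 by lra. lra.
          - replace (Rabs (x - x0)) with 1 by lra. lra. }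
        assert (Hbar : K <= bar x y s).
        { destruct (bal_pos s ltac:(lra)) as [b0 b1]. unfold bar.
          set (r2 := (x - x0) ^ 2 + (y - y0) ^ 2) in *. assert (1 <= r2 ^ 2) by nra.
          assert (0 <= bal1 s * r2) by nra. nra. }
        assert (HL := Hlat x y s _ _ _ Hin ltac:(lra) (HQ s Hsr)).
        assert (HNs := HNM s Hsr). apply Rabs_le_between in HNs.
        rewrite Exy in Hgt. unfold g, F0 in Hgt. lra. }
      assert (Hlt : forall e0, (forall i, (i < 6)%nat -> Rabs (cf i x0 y0 (t0 - s) - lab i) <= e0) ->
         dps s <= 5 * e0 * D s).
      { apply (leaf_touch x y s ps dps); auto; try tauto.
        exists del. split; auto. intros x' y' s' Hin' Hs'. specialize (P3' s' Hs').
        rewrite Exy in P3'. unfold ps. destruct (supbox_spec g x0 y0 s' Cg) as [HS _]. specialize (HS x' y' Hin').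
        assert (supbox g x0 y0 s' - N s' <= Rmax (supbox g x0 y0 s' - N s') m0) by apply Rmax_l. lra. }
      assert (HDs := HD0 s).
      split.
      + assert (H2 : dps s <= 5 * (2 * B) * D s).
        { apply Hlt. intros i Hi. unfold Rminus. eapply Rle_trans; [apply Rabs_triang|]. rewrite Rabs_Ropp.
          assert (Rabs (cf i x0 y0 (t0 - s)) <= B) by (apply (ck_bd _ _ _ _ _ Hok); auto; lra).
          specialize (Hlab i Hi). unfold Rminus in H. lra. }
        assert (5 * (2 * B) * D s <= 10 * B * Dm).
        { replace (5 * (2 * B) * D s) with (10 * B * D s) by ring. apply Rmult_le_compat_l; lra. }
        unfold dps in H2. lra.
      + intros HZ. specialize (Hlt eps HZ).
        assert (5 * eps * D s <= 5 * eps * Dm) by (apply Rmult_le_compat_l; lra).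
        unfold dps in Hlt. lra. }
  assert (HM1 : M a1 <= m0 - 5 * eps * Dm * a1).
  { unfold M. apply Rplus_le_compat_r. apply Rmax_lub; [|lra].
    destruct (supbox_spec g x0 y0 a1 Cg) as [_ (x & y & Hin & Exy)]. rewrite Exy.
    specialize (Hinit x y Hin). unfold g, F0, Q1, Q2, Q3.
    replace (q1 + lab 0%nat * (a1 - a1)) with q1 by ring.
    replace (q2 + lab 1%nat * (a1 - a1)) with q2 by ring.
    replace (q3 + lab 2%nat * (a1 - a1)) with q3 by ring. lra. }
  intros x y Hin.
  destruct (supbox_spec g x0 y0 a2 Cg) as [HS _]. specialize (HS x y Hin).
  assert (HM2 : supbox g x0 y0 a2 - N a2 - 5 * eps * Dm * a2 <= M a2).
  { unfold M. apply Rplus_le_compat_r. apply Rmax_l. }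
  assert (Eg : g x y a2 = w x y (t0 - a2) - (V (Q1 a2) (Q2 a2) (Q3 a2) l x y + bar x y a2)) by reflexivity.
  lra.
Qed.
End OneLeaf.
End Leaf.

(** Index 5 is the coefficient of [|w_x|], the only term that is not odd in [w]: negatives of
    supersolutions are subsolutions for [flip cf]. *)
Definition flip (cf : nat -> R -> R -> R -> R) : nat -> R -> R -> R -> R :=
  fun i x y t => if Nat.eqb i 5 then - cf i x y t else cf i x y t.

Lemma flip_ok (T lamb B L : R) cf : coef_ok T lamb B L cf -> coef_ok T lamb B L (flip cf).
Proof.
  intros [H1 H2 H3 H4 H5 H6]. constructor; auto.
  - intros i x y t Hi Ht. unfold flip. destruct (Nat.eqb i 5); rewrite ?Rabs_Ropp; auto.
  - intros i x y x' y' t Hi Ht. unfold flip. destruct (Nat.eqb i 5); auto.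
    replace (- cf i x y t - - cf i x' y' t) with (- (cf i x y t - cf i x' y' t)) by ring.
    rewrite Rabs_Ropp; auto.
Qed.

Definition negl (l : list tm) : list tm := map (fun e => Tm (- ta e) (tk e) (tl e) (tp e)) l.

Lemma wsum_negl (c : R -> R -> R) (tr : R -> R) (l : list tm) (x y : R) :
  wsum (fun e => c (tk e) (tl e)) tr (negl l) x y = - wsum (fun e => c (tk e) (tl e)) tr l x y.
Proof.
  unfold wsum, negl. induction l as [|e l IH]; simpl. ring. rewrite IH. unfold ang. simpl. ring.
Qed.

Lemma V_negl (q1 q2 q3 : R) (l : list tm) (x y : R) :
  V q1 q2 q3 (negl l) x y = - V q1 q2 q3 l x y /\ Vx q1 q2 q3 (negl l) x y = - Vx q1 q2 q3 l x y /\
  Vy q1 q2 q3 (negl l) x y = - Vy q1 q2 q3 l x y /\ Vxx q1 q2 q3 (negl l) x y = - Vxx q1 q2 q3 l x y /\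
  Vxy q1 q2 q3 (negl l) x y = - Vxy q1 q2 q3 l x y /\ Vyy q1 q2 q3 (negl l) x y = - Vyy q1 q2 q3 l x y.
Proof.
  set (h := fun k m : R => exp (- ((q1 * k ^ 2 + 2 * q2 * k * m + q3 * m ^ 2) / 2))).
  repeat split.
  - exact (wsum_negl h cos l x y).
  - exact (wsum_negl (fun k m => - k * h k m) sin l x y).
  - exact (wsum_negl (fun k m => - m * h k m) sin l x y).
  - exact (wsum_negl (fun k m => - k ^ 2 * h k m) cos l x y).
  - exact (wsum_negl (fun k m => - (k * m) * h k m) cos l x y).
  - exact (wsum_negl (fun k m => - m ^ 2 * h k m) cos l x y).
Qed.

Lemma slope_bound_sub (Z Z' : R -> Prop) (a b d : R) :
  (forall s, a < s < b -> Z s -> Z' s) -> slope_bound Z a b d -> slope_bound Z' a b d.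
Proof.
  intros HZ H M C HM HC HT. apply H; auto. intros s psi dpsi Hs Ht.
  destruct (HT s psi dpsi Hs Ht). split; auto.
Qed.

(** The range [[- B, B]] of each coefficient is cut into cells of length [eps]; the sets of times
    are intersections of preimages and may be arbitrarily irregular. *)
Lemma finite_level_sets (k : nat) (c : nat -> R -> R) (B eps : R) : 0 < eps -> 0 < B ->
  (forall i s, (i < k)%nat -> Rabs (c i s) <= B) ->
  exists l : list (R -> Prop), (forall s, exists Z, In Z l /\ Z s) /\
    forall Z s s', In Z l -> Z s -> Z s' -> forall i, (i < k)%nat -> Rabs (c i s - c i s') <= eps.
Proof.
  intros He HB. induction k as [|k IH]; intros Hc.
  - exists ((fun _ => True) :: nil). split.
    + intros s. exists (fun _ => True). split; [left|]; auto.
    + intros; lia.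
  - destruct IH as (l & H1 & H2). { intros; apply Hc; lia. }
    destruct (nfloor_ex (2 * B / eps)) as (N & HN1 & HN2).
    { apply Rmult_le_pos; [lra|left; apply Rinv_0_lt_compat; auto]. }
    set (I := fun (j : nat) s => - B + INR j * eps <= c k s <= - B + (INR j + 1) * eps).
    exists (flat_map (fun Z => map (fun j s => Z s /\ I j s) (seq 0 (S N))) l). split.
    + intros s. destruct (H1 s) as (Z & HZ & Zs).
      assert (Hck := Hc k s ltac:(lia)). apply Rabs_le_between in Hck.
      destruct (nfloor_ex ((c k s + B) / eps)) as (j & Hj1 & Hj2).
      { apply Rmult_le_pos; [lra|left; apply Rinv_0_lt_compat; auto]. }
      assert (E1 : (c k s + B) / eps * eps = c k s + B) by (field; lra).
      exists (fun s => Z s /\ I j s). split.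
      * apply in_flat_map. exists Z. split; auto. apply in_map_iff. exists j. split; auto.
        apply in_seq. split; [lia|]. simpl. apply INR_lt. rewrite S_INR.
        assert ((c k s + B) / eps <= 2 * B / eps).
        { apply Rmult_le_compat_r; [left; apply Rinv_0_lt_compat; auto|lra]. }
        lra.
      * split; auto. unfold I. nra.
    + intros Z s s' HZ Zs Zs' i Hi. apply in_flat_map in HZ. destruct HZ as (Z0 & HZ0 & HZ).
      apply in_map_iff in HZ. destruct HZ as (j & <- & _). destruct Zs as [Zs Is]. destruct Zs' as [Zs' Is'].
      destruct (Nat.eq_dec i k) as [->|Hn].
      * unfold I in *. apply Rabs_le. lra.
      * apply (H2 Z0); auto. lia.
Qed.

Lemma derive_mono_on (f f' : R -> R) (a b : R) : (forall z, is_derive f z (f' z)) ->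
  (forall z, a <= z <= b -> 0 <= f' z) -> a <= b -> f a <= f b.
Proof.
  intros H H0 Hab. destruct (MVT_gen f a b f') as (c & Hc1 & Hc).
  - intros; apply H.
  - intros. apply (derive_cont _ _ H).
  - rewrite Rmin_left, Rmax_right in Hc1 by lra.
    assert (0 <= f' c * (b - a)) by (apply Rmult_le_pos; [apply H0; lra|lra]). lra.
Qed.

Section Step.
Variables (T lamb B L : R) (cf : nat -> R -> R -> R -> R).
Variables (x0 y0 t0 tau theta K Dm : R) (D Th : R -> R) (l : list tm).
Hypothesis Hok : coef_ok T lamb B L cf.
Hypotheses (Htau : 0 < tau <= 1) (Ht0 : tau <= t0) (HT : t0 <= T) (Hth : 0 < theta).
Hypothesis HDc : forall z, continuity_pt D z.
Hypothesis HTh : forall z, is_derive Th z (D z).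
Hypothesis HTh0 : Th 0 = 0.
Hypothesis HD0 : forall z, 0 <= D z <= Dm.
Hypothesis HDm : 0 < Dm.
Hypothesis HK : 0 <= K.
Hypothesis HV : forall q1 q2 q3 a x y, 0 <= a <= tau -> Qb lamb (2 * B) (a + theta) q1 q2 q3 ->
  inbox x0 y0 x y -> derivs_le q1 q2 q3 l x y (D a).

Let barr := bar B L x0 y0 tau K Th.

Definition lateral (l : list tm) (w : R -> R -> R -> R) : Prop :=
  forall x y a p1 p2 p3, inbox x0 y0 x y -> 0 <= a <= tau ->
  Qb lamb (2 * B) (a + theta) p1 p2 p3 -> w x y (t0 - a) - V p1 p2 p3 l x y <= K - 3 * B * Th tau.

Definition below (l : list tm) (a q1 q2 q3 N m : R) (w : R -> R -> R -> R) : Prop :=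
  forall x y, inbox x0 y0 x y -> w x y (t0 - a) <= V q1 q2 q3 l x y + N + barr x y a + m.

(** The evolved data [p1], [p2], [p3], [N'] are fixed before [w] is quantified, so that all sub- and
    supersolutions are measured against the same function. *)
Definition transfer (cf : nat -> R -> R -> R -> R) (l : list tm) (a q1 q2 q3 N b p1 p2 p3 N' e : R) : Prop :=
  forall w m, vsubc T cf w -> cont3 w -> lateral l w -> 0 < m ->
    below l a q1 q2 q3 N m w -> below l b p1 p2 p3 N' (m + e) w.

Lemma step_partition (eps : R) (lst : list (R -> Prop)) (a b e : R) : 0 < eps ->
  (forall Z s s', In Z lst -> Z s -> Z s' -> forall i, (i < 6)%nat ->
     Rabs (cf i x0 y0 (clamp 0 T (t0 - s)) - cf i x0 y0 (clamp 0 T (t0 - s'))) <= eps) ->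
  Part (fun x y d => 0 <= d /\ exists Z, In Z lst /\ (x < y -> slope_bound Z x y d)) a b e ->
  0 <= a -> b <= tau -> forall q1 q2 q3 N, Qb lamb (2 * B) (a + theta) q1 q2 q3 ->
  Rabs N <= 3 * B * Th a ->
  exists p1 p2 p3 N', Qb lamb (2 * B) (b + theta) p1 p2 p3 /\ Rabs N' <= 3 * B * Th b /\
    transfer cf l a q1 q2 q3 N b p1 p2 p3 N' (5 * eps * Dm * (b - a) + 10 * B * Dm * e) /\
    transfer (flip cf) (negl l) a q1 q2 q3 (- N) b p1 p2 p3 (- N') (5 * eps * Dm * (b - a) + 10 * B * Dm * e).
Proof.
  intros Heps Hlst HP. induction HP as [a b d Hab [Hd (Z & HZ & Hsl)]|a c b d1 d2 H1 IH1 H2 IH2];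
    intros Ha Hb q1 q2 q3 N HQ HNb.
  - assert (HB := ck_B _ _ _ _ _ Hok). assert (Hla := ck_lamb _ _ _ _ _ Hok).
    destruct (Req_dec a b) as [<-|Hne].
    { exists q1, q2, q3, N. split; auto. split; auto.
      assert (He : 0 <= 5 * eps * Dm * (a - a) + 10 * B * Dm * d).
      { rewrite Rminus_diag, Rmult_0_r, Rplus_0_l. repeat apply Rmult_le_pos; lra. }
      split; intros w m _ _ _ _ Hw x y Hin; specialize (Hw x y Hin); lra. }
    assert (Hlt : a < b) by lra. specialize (Hsl Hlt).
    (* The label comes from a time in [Z]; for an empty [Z] the condition is void and any time will
       do. Clamping keeps the label within the bounds of [coef_ok]. *)
    assert (exists s0, forall s, Z s -> forall i, (i < 6)%nat ->
       Rabs (cf i x0 y0 (clamp 0 T (t0 - s)) - cf i x0 y0 (clamp 0 T (t0 - s0))) <= eps) as (s0 & Hs0).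
    { destruct (classic (exists s0, Z s0)) as [(s0 & Zs0)|Hn].
      - exists s0. intros s Zs i Hi. apply (Hlst Z); auto.
      - exists 0. intros s Zs. exfalso. apply Hn. exists s; auto. }
    assert (Hcl : 0 <= clamp 0 T (t0 - s0) <= T) by (apply clamp_in; lra).
    set (lab := fun i => cf i x0 y0 (clamp 0 T (t0 - s0))).
    assert (Hlab : forall i, (i < 6)%nat -> Rabs (lab i) <= B).
    { intros i Hi. apply (ck_bd _ _ _ _ _ Hok); auto. }
    set (Q1 := fun s => q1 + lab 0%nat * (s - a)). set (Q2 := fun s => q2 + lab 1%nat * (s - a)).
    set (Q3 := fun s => q3 + lab 2%nat * (s - a)).
    assert (HQs : forall s, a <= s -> Qb lamb (2 * B) (s + theta) (Q1 s) (Q2 s) (Q3 s)).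
    { intros s Hs u v. specialize (HQ u v).
      assert (El := ck_ell _ _ _ _ _ Hok x0 y0 _ u v Hcl).
      assert (Eu : lab 0%nat * u ^ 2 + 2 * lab 1%nat * u * v + lab 2%nat * v ^ 2 <= 2 * B * (u ^ 2 + v ^ 2)).
      { assert (L0 := Hlab 0%nat ltac:(lia)). assert (L1 := Hlab 1%nat ltac:(lia)). assert (L2 := Hlab 2%nat ltac:(lia)).
        apply Rabs_le_between in L0. apply Rabs_le_between in L1. apply Rabs_le_between in L2.
        assert (U := pow2_ge_0 u). assert (W := pow2_ge_0 v).
        assert (P1 := pow2_ge_0 (u + v)). assert (P2 := pow2_ge_0 (u - v)).
        assert (2 * lab 1%nat * u * v <= B * (u ^ 2 + v ^ 2)).
        { destruct (Rle_dec 0 (u * v)).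
          - assert (lab 1%nat * (u * v) <= B * (u * v)) by (apply Rmult_le_compat_r; lra). nra.
          - assert (lab 1%nat * (u * v) <= - B * (u * v)) by nra. nra. }
        assert (lab 0%nat * u ^ 2 <= B * u ^ 2) by (apply Rmult_le_compat_r; lra).
        assert (lab 2%nat * v ^ 2 <= B * v ^ 2) by (apply Rmult_le_compat_r; lra). nra. }
      unfold Q1, Q2, Q3.
      replace ((q1 + lab 0%nat * (s - a)) * u ^ 2 + 2 * (q2 + lab 1%nat * (s - a)) * u * v + (q3 + lab 2%nat * (s - a)) * v ^ 2)
        with ((q1 * u ^ 2 + 2 * q2 * u * v + q3 * v ^ 2) + (s - a) * (lab 0%nat * u ^ 2 + 2 * lab 1%nat * u * v + lab 2%nat * v ^ 2)) by ring.
      replace (lamb * (s + theta) * (u ^ 2 + v ^ 2)) with (lamb * (a + theta) * (u ^ 2 + v ^ 2) + (s - a) * (lamb * (u ^ 2 + v ^ 2))) by ring.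
      replace (2 * B * (s + theta) * (u ^ 2 + v ^ 2)) with (2 * B * (a + theta) * (u ^ 2 + v ^ 2) + (s - a) * (2 * B * (u ^ 2 + v ^ 2))) by ring.
      split; apply Rplus_le_compat; try lra; apply Rmult_le_compat_l; auto; lra. }
    set (nd := fun s => lab 3%nat * Vx (Q1 s) (Q2 s) (Q3 s) l x0 y0
      + lab 4%nat * Vy (Q1 s) (Q2 s) (Q3 s) l x0 y0 + lab 5%nat * Rabs (Vx (Q1 s) (Q2 s) (Q3 s) l x0 y0)).
    assert (Cnd : forall z, continuity_pt nd z) by (intros z; apply freeze_cont).
    set (N1 := fun s => N + RInt nd a s).
    assert (DN : forall s, is_derive N1 s (nd s)).
    { intros s. unfold N1. replace (nd s) with (0 + nd s) by ring.
      apply (is_derive_plus (fun _ => N) (fun s => RInt nd a s)). apply (is_derive_const N).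
      apply (is_derive_RInt nd (fun z => RInt nd a z) a).
      - exists (mkposreal 1 Rlt_0_1). intros y _. apply (RInt_correct nd).
        apply (ex_RInt_continuous nd). intros z _. apply continuity_pt_filterlim. apply Cnd.
      - apply continuity_pt_filterlim. apply Cnd. }
    assert (N1a : N1 a = N). { unfold N1. rewrite (RInt_point a nd). apply Rplus_0_r. }
    assert (Hnd : forall s, a <= s <= b -> Rabs (nd s) <= 3 * B * D s).
    { intros s Hs. destruct (HV _ _ _ s x0 y0 ltac:(lra) (HQs s ltac:(lra)) (inbox_center x0 y0)) as (V1 & V2 & _).
      assert (M1 := mult_abs_le _ _ _ _ (Hlab 3%nat ltac:(lia)) V1).
      assert (M2 := mult_abs_le _ _ _ _ (Hlab 4%nat ltac:(lia)) V2).
      assert (V1' : Rabs (Rabs (Vx (Q1 s) (Q2 s) (Q3 s) l x0 y0)) <= D s) by (rewrite Rabs_Rabsolu; auto).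
      assert (M3 := mult_abs_le _ _ _ _ (Hlab 5%nat ltac:(lia)) V1').
      unfold nd. apply Rabs_le. lra. }
    assert (HN1 : forall s, a <= s <= b -> Rabs (N1 s) <= 3 * B * Th s).
    { intros s Hs. apply Rabs_le_between in HNb.
      assert (A1 := derive_mono_on (fun s => 3 * B * Th s + (-1) * N1 s) (fun s => 3 * B * D s + (-1) * nd s) a s).
      assert (A2 := derive_mono_on (fun s => 3 * B * Th s + 1 * N1 s) (fun s => 3 * B * D s + 1 * nd s) a s).
      assert (Dl : forall c z, is_derive (fun s => 3 * B * Th s + c * N1 s) z (3 * B * D z + c * nd z)).
      { intros c z. apply (is_derive_plus (fun s => 3 * B * Th s) (fun s => c * N1 s)).
        apply (is_derive_scal Th); auto. apply (is_derive_scal N1); auto. }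
      cbv beta in A1, A2. rewrite N1a in A1, A2. apply Rabs_le.
      assert (Hn' : forall z, a <= z <= s -> - (3 * B * D z) <= nd z <= 3 * B * D z).
      { intros z Hz. apply Rabs_le_between. apply Hnd. lra. }
      specialize (A1 (Dl (-1)) ltac:(intros z Hz; specialize (Hn' z Hz); lra) ltac:(lra)).
      specialize (A2 (Dl 1) ltac:(intros z Hz; specialize (Hn' z Hz); lra) ltac:(lra)). lra. }
    assert (HThm : forall s, s <= tau -> 3 * B * Th s <= 3 * B * Th tau).
    { intros s Hs. apply Rmult_le_compat_l; [lra|]. apply (derive_mono Th D); auto. intros z; apply HD0. }
    assert (Hsl' : slope_bound (fun s => forall i, (i < 6)%nat -> Rabs (cf i x0 y0 (t0 - s) - lab i) <= eps) a b d).
    { eapply slope_bound_sub; [|exact Hsl]. intros s Hs Zs i Hi.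
      specialize (Hs0 s Zs i Hi). rewrite clamp_id in Hs0 by lra. exact Hs0. }
    exists (Q1 b), (Q2 b), (Q3 b), (N1 b).
    split. apply HQs; lra. split. apply HN1; lra. split.
    + intros w m Hw Hwc Hlat Hm Hbel x y Hin. rewrite <- N1a in Hbel.
      assert (HH := leaf_bound T lamb B L cf x0 y0 t0 tau theta K Dm D Th l Hok Htau Ht0 HT HDc HTh HTh0 HD0 HDm HK HV
        a b q1 q2 q3 m (3 * B * Th tau) eps d lab N1 w Ha Hb).
      cbv beta in HH. unfold barr. rewrite <- !Rplus_assoc. apply HH; auto.
      * intros s Hs. apply HQs; lra.
      * intros s Hs. eapply Rle_trans; [apply HN1; auto|]. apply HThm; lra.
      * lra.
    + intros w m Hw Hwc Hlat Hm Hbel x y Hin. rewrite <- N1a in Hbel.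
      set (lab' := fun i => if Nat.eqb i 5 then - lab i else lab i).
      assert (HV' : forall q1 q2 q3 a x y, 0 <= a <= tau -> Qb lamb (2 * B) (a + theta) q1 q2 q3 ->
         inbox x0 y0 x y -> derivs_le q1 q2 q3 (negl l) x y (D a)).
      { intros r1 r2 r3 a' x' y' Ha' HQ' Hin'. destruct (V_negl r1 r2 r3 l x' y') as (_ & E1 & E2 & E3 & E4 & E5).
        unfold derivs_le. rewrite E1, E2, E3, E4, E5, !Rabs_Ropp. apply HV; auto. }
      assert (HH := leaf_bound T lamb B L (flip cf) x0 y0 t0 tau theta K Dm D Th (negl l) (flip_ok _ _ _ _ _ Hok) Htau Ht0 HT HDc HTh HTh0 HD0 HDm HK HV'
        a b q1 q2 q3 m (3 * B * Th tau) eps d lab' (fun s => - N1 s) w Ha Hb).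
      cbv beta in HH. unfold barr. rewrite <- !Rplus_assoc. apply HH; auto.
      * intros s Hs. apply HQs; lra.
      * intros i Hi. unfold lab'. destruct (Nat.eqb i 5); rewrite ?Rabs_Ropp; auto.
      * intros s. unfold lab'. cbn [Nat.eqb].
        destruct (V_negl (Q1 s) (Q2 s) (Q3 s) l x0 y0) as (_ & E1 & E2 & _).
        fold (Q1 s) (Q2 s) (Q3 s). rewrite E1, E2, Rabs_Ropp.
        replace (lab 3%nat * - Vx (Q1 s) (Q2 s) (Q3 s) l x0 y0 + lab 4%nat * - Vy (Q1 s) (Q2 s) (Q3 s) l x0 y0 +
          - lab 5%nat * Rabs (Vx (Q1 s) (Q2 s) (Q3 s) l x0 y0)) with (- nd s) by (unfold nd; ring).
        apply (is_derive_opp N1). apply DN.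
      * intros s Hs. rewrite Rabs_Ropp. eapply Rle_trans; [apply HN1; auto|]. apply HThm; lra.
      * lra.
      * eapply slope_bound_sub; [|exact Hsl']. intros s Hs Zs i Hi. specialize (Zs i Hi).
        unfold flip, lab'. destruct (Nat.eqb i 5); auto.
        replace (- cf i x0 y0 (t0 - s) - - lab i) with (- (cf i x0 y0 (t0 - s) - lab i)) by ring.
        rewrite Rabs_Ropp; auto.
  - assert (B1 := Part_le _ _ _ _ H1). assert (B2 := Part_le _ _ _ _ H2).
    assert (HB := ck_B _ _ _ _ _ Hok).
    destruct (IH1 Ha ltac:(lra) q1 q2 q3 N HQ HNb) as (r1 & r2 & r3 & N1 & HQ1 & HN1 & T1 & T1').
    destruct (IH2 ltac:(lra) Hb r1 r2 r3 N1 HQ1 HN1) as (p1 & p2 & p3 & N2 & HQ2 & HN2 & T2 & T2').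
    exists p1, p2, p3, N2. split; auto. split; auto.
    assert (He1 : forall x y d, Part (fun x y d => 0 <= d /\ exists Z, In Z lst /\ (x < y -> slope_bound Z x y d)) x y d -> 0 <= d).
    { intros x y d HPp. induction HPp as [? ? ? ? [? _]|]; lra. }
    assert (Hd1 := He1 _ _ _ H1).
    assert (Hpos : 0 <= 5 * eps * Dm * (c - a) + 10 * B * Dm * d1).
    { assert (0 <= 5 * eps * Dm * (c - a)) by (repeat apply Rmult_le_pos; lra).
      assert (0 <= 10 * B * Dm * d1) by (repeat apply Rmult_le_pos; lra). lra. }
    replace (5 * eps * Dm * (b - a) + 10 * B * Dm * (d1 + d2)) with
      ((5 * eps * Dm * (c - a) + 10 * B * Dm * d1) + (5 * eps * Dm * (b - c) + 10 * B * Dm * d2)) by ring.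
    split; intros w m Hw Hwc Hlat Hm Hbel; rewrite <- Rplus_assoc.
    + apply T2; auto. lra.
    + apply T2'; auto. lra.
Qed.

(** [q1, q2, q3]: the Gaussian smoothing applied to the data before the step. *)
Theorem step_transfer (q1 q2 q3 eta : R) : 0 < eta -> Qb lamb (2 * B) theta q1 q2 q3 ->
  exists p1 p2 p3 N', Qb lamb (2 * B) (tau + theta) p1 p2 p3 /\
    transfer cf l 0 q1 q2 q3 0 tau p1 p2 p3 N' eta /\
    transfer (flip cf) (negl l) 0 q1 q2 q3 0 tau p1 p2 p3 (- N') eta.
Proof.
  intros Heta HQ. assert (HB := ck_B _ _ _ _ _ Hok).
  (* The two sources of error, the mesh of the level sets and the defect of the partition, receive
     half of [eta] each. *)
  set (eps := eta / (10 * Dm)). set (e0 := eta / (20 * B * Dm)).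
  assert (Heps : 0 < eps) by (apply Rdiv_lt_0_compat; lra).
  assert (HBD : 0 < 20 * B * Dm) by (repeat apply Rmult_lt_0_compat; lra).
  assert (He0 : 0 < e0) by (apply Rdiv_lt_0_compat; auto).
  destruct (finite_level_sets 6 (fun i s => cf i x0 y0 (clamp 0 T (t0 - s))) B eps Heps HB) as (lst & L1 & L2).
  { intros i s Hi. apply (ck_bd _ _ _ _ _ Hok); auto. apply clamp_in. lra. }
  destruct (slope_partition lst 0 tau e0 ltac:(lra) He0 L1) as (e & He & HP).
  assert (HQ0 : Qb lamb (2 * B) (0 + theta) q1 q2 q3) by (rewrite Rplus_0_l; auto).
  destruct (step_partition eps lst 0 tau e Heps L2 HP (Rle_refl 0) (Rle_refl tau) q1 q2 q3 0 HQ0)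
    as (p1 & p2 & p3 & N' & P1 & _ & P3 & P4).
  { rewrite Rabs_R0, HTh0. lra. }
  assert (Hsmall : 5 * eps * Dm * (tau - 0) + 10 * B * Dm * e <= eta).
  { assert (E1 : 5 * eps * Dm = eta / 2) by (unfold eps; field; lra).
    assert (E2 : 10 * B * Dm * e0 = eta / 2) by (unfold e0; field; lra).
    assert (10 * B * Dm * e <= 10 * B * Dm * e0) by (apply Rmult_le_compat_l; lra).
    rewrite E1. nra. }
  exists p1, p2, p3, N'. split; auto. split.
  - intros w m Hw Hwc Hlat Hm Hbel x y Hin. assert (H := P3 w m Hw Hwc Hlat Hm Hbel x y Hin). lra.
  - rewrite Ropp_0 in P4. intros w m Hw Hwc Hlat Hm Hbel x y Hin. assert (H := P4 w m Hw Hwc Hlat Hm Hbel x y Hin). lra.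
Qed.
End Step.

(** * Interior regularity *)

Lemma V_derivs (q1 q2 q3 : R) (l : list tm) (x y : R) :
  is_derive (fun x => V q1 q2 q3 l x y) x (Vx q1 q2 q3 l x y) /\
  is_derive (fun y => V q1 q2 q3 l x y) y (Vy q1 q2 q3 l x y) /\
  is_derive (fun x => Vx q1 q2 q3 l x y) x (Vxx q1 q2 q3 l x y) /\
  is_derive (fun y => Vx q1 q2 q3 l x y) y (Vxy q1 q2 q3 l x y) /\
  is_derive (fun y => Vy q1 q2 q3 l x y) y (Vyy q1 q2 q3 l x y).
Proof.
  assert (SV := smooth3_V q1 q2 q3 0 0 0 0 l). cbv zeta in SV.
  assert (EZ : forall z : R, z + 0 * (0 - 0) = z) by (intros; ring).
  assert (H1 := sm_x _ _ _ _ _ _ _ SV x y 0). assert (H2 := sm_y _ _ _ _ _ _ _ SV x y 0).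
  assert (H3 := sm_xx _ _ _ _ _ _ _ SV x y 0). assert (H4 := sm_xy _ _ _ _ _ _ _ SV x y 0).
  assert (H5 := sm_yy _ _ _ _ _ _ _ SV x y 0). cbv beta in *. rewrite !EZ in *. auto.
Qed.

(** Landau's inequality: some point at distance at most 1 has slope at most [2 * F], and the bound
    on the second derivative carries this over to [x]. *)
Lemma interpolation (f f' f'' : R -> R) (x0 F D : R) :
  (forall x, is_derive f x (f' x)) -> (forall x, is_derive f' x (f'' x)) ->
  (forall x, Rabs (f x) <= F) -> (forall x, Rabs (x - x0) <= 1 -> Rabs (f'' x) <= D) ->
  forall x, Rabs (x - x0) <= 1 -> Rabs (f' x) <= 2 * F + D.
Proof.
  intros H1 H2 HF HD x Hx.
  (* The step of length 1 goes in the direction of [x0], so that it stays where [f''] is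
     controlled. *)
  set (x' := if Rle_dec x x0 then x + 1 else x - 1).
  assert (Hx' : Rabs (x' - x0) <= 1 /\ Rabs (x' - x) = 1).
  { apply Rabs_le_between in Hx. unfold x'. destruct (Rle_dec x x0); split.
    - apply Rabs_le; lra.
    - replace (x + 1 - x) with 1 by ring. apply Rabs_R1.
    - apply Rabs_le; lra.
    - replace (x - 1 - x) with (-1) by ring. rewrite Rabs_left; lra. }
  destruct (MVT_gen f x x' f') as (c & Hc & Hm).
  { intros; auto. } { intros; apply (derive_cont _ _ H1). }
  assert (Hcx : Rabs (c - x) <= 1 /\ Rabs (c - x0) <= 1).
  { destruct Hx' as [Ha Hb]. apply Rabs_le_between in Ha. apply Rabs_le_between in Hx.
    unfold x' in *. destruct (Rle_dec x x0);
    [rewrite Rmin_left, Rmax_right in Hc by lra|rewrite Rmin_right, Rmax_left in Hc by lra];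
    split; apply Rabs_le; lra. }
  assert (Hfc : Rabs (f' c) <= 2 * F).
  { assert (E : Rabs (f x' - f x) = Rabs (f' c)) by (rewrite Hm, Rabs_mult, (proj2 Hx'), Rmult_1_r; auto).
    rewrite <- E. assert (A := HF x). assert (B := HF x').
    unfold Rminus. eapply Rle_trans; [apply Rabs_triang|]. rewrite Rabs_Ropp. lra. }
  destruct (MVT_gen f' c x f'') as (z & Hz & Hm2).
  { intros; auto. } { intros; apply (derive_cont _ _ H2). }
  assert (Hzd : Rabs (f'' z) <= D).
  { apply HD. destruct Hcx as [_ C2]. apply Rabs_le_between in Hx. apply Rabs_le_between in C2.
    assert (M1 := Rmin_glb c x (x0 - 1) ltac:(lra) ltac:(lra)).
    assert (M2 := Rmax_lub c x (x0 + 1) ltac:(lra) ltac:(lra)). apply Rabs_le; lra. }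
  replace (f' x) with (f' c + f'' z * (x - c)) by lra.
  eapply Rle_trans; [apply Rabs_triang|]. apply Rplus_le_compat; auto.
  rewrite Rabs_mult. rewrite Rabs_minus_sym in Hcx.
  assert (A := Rabs_pos (f'' z)). assert (A' := Rabs_pos (x - c)). destruct Hcx as [C1 _]. nra.
Qed.

Lemma Rpower_pos (x y : R) : 0 < Rpower x y.
Proof. apply exp_pos. Qed.

Lemma Rpower_succ (s h : R) : 0 < s -> Rpower s (h - 1) * s = Rpower s h.
Proof.
  intros Hs. rewrite <- (Rpower_1 s) at 2 by auto. rewrite <- Rpower_plus. f_equal; ring.
Qed.

Lemma exp_mono (x y : R) : x <= y -> exp x <= exp y.
Proof. intros [H|H]. left; apply exp_increasing; auto. subst; lra. Qed.

Lemma ln_mono (x y : R) : 0 < x -> x <= y -> ln x <= ln y.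
Proof. intros Hx [H|H]. left; apply ln_increasing; auto. subst; lra. Qed.

Lemma Rpower_anti (s t k : R) : 0 < s -> s <= t -> k <= 0 -> Rpower t k <= Rpower s k.
Proof. intros Hs Hst Hk. apply exp_mono. assert (A := ln_mono s t Hs Hst). nra. Qed.

Lemma Rpower_ge_half (s h : R) : 0 < s <= 2 -> 0 <= h < 1 -> / 2 <= Rpower s (h - 1).
Proof.
  intros Hs Hh. apply Rle_trans with (Rpower 2 (h - 1)); [|apply Rpower_anti; lra].
  replace (/ 2) with (Rpower 2 (- (1))).
  - apply exp_mono. assert (A : 0 < ln 2) by (rewrite <- ln_1; apply ln_increasing; lra). nra.
  - rewrite Rpower_Ropp, Rpower_1; lra.
Qed.

Section StepEstimate.
Variables (T lamb B L : R) (cf : nat -> R -> R -> R -> R).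
Hypothesis Hok : coef_ok T lamb B L cf.

(** A Hoelder bound [(u^2 + v^2)^h] on second differences, relaxed at the scale [s]: by
    [Rpower_split] the right side dominates it, and its form, a constant plus a square, is the one
    that the Gaussian estimates accept. *)
Definition modulus_at (l : list tm) (x y Cm h s : R) : Prop :=
  forall u v, Rabs (ev l (x + u) (y + v) + ev l (x - u) (y - v) - 2 * ev l x y) <=
    Cm * (Rpower s h + Rpower s (h - 1) * (u ^ 2 + v ^ 2)).

(** The constant of [D2V_bound] for [Lam = 2 * B], once both terms of [modulus_at] are written as
    multiples of [s^(h - 1)]. *)
Definition CD : R := 2 * (1 + 2 * B / lamb) ^ 2 * (2 * (1 + 24 * B) / lamb).

Lemma CD_pos : 0 < CD.
Proof.
  destruct Hok. unfold CD.
  assert (0 < 2 * B / lamb) by (apply Rdiv_lt_0_compat; lra).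
  apply Rmult_lt_0_compat; [apply Rmult_lt_0_compat|]; [lra| |].
  - apply pow_lt. lra.
  - apply Rdiv_lt_0_compat; lra.
Qed.

Lemma V_bounded (l : list tm) (F s q1 q2 q3 x y : R) : 0 < s -> Qb lamb (2 * B) s q1 q2 q3 ->
  (forall x y, Rabs (ev l x y) <= F) -> Rabs (V q1 q2 q3 l x y) <= F.
Proof.
  intros Hs HQ HF. assert (Hl := ck_lamb _ _ _ _ _ Hok). apply Rabs_le. split.
  - assert (H := V_lower lamb (2 * B) s q1 q2 q3 l x y Hl Hs HQ (- F) 0 (Rle_refl 0)).
    assert (- F - 6 * 0 * (2 * B * s) <= V q1 q2 q3 l x y); [|lra].
    apply H. intros u v. specialize (HF (x + u) (y + v)). apply Rabs_le_between in HF. lra.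
  - assert (H := V_upper lamb (2 * B) s q1 q2 q3 l x y Hl Hs HQ F 0 (Rle_refl 0)).
    assert (V q1 q2 q3 l x y <= F + 6 * 0 * (2 * B * s)); [|lra].
    apply H. intros u v. specialize (HF (x + u) (y + v)). apply Rabs_le_between in HF. lra.
Qed.

Lemma D2_from_modulus (l : list tm) (x y Cm h s q1 q2 q3 : R) : 0 <= Cm -> 0 < s ->
  Qb lamb (2 * B) s q1 q2 q3 -> modulus_at l x y Cm h s ->
  Rabs (Vxx q1 q2 q3 l x y) <= CD * Cm * Rpower s (h - 1) /\ Rabs (Vxy q1 q2 q3 l x y) <= CD * Cm * Rpower s (h - 1) /\ Rabs (Vyy q1 q2 q3 l x y) <= CD * Cm * Rpower s (h - 1).
Proof.
  intros HC Hs HQ HM. assert (Hl := ck_lamb _ _ _ _ _ Hok). assert (HB := ck_B _ _ _ _ _ Hok).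
  assert (P1 := Rpower_pos s h). assert (P2 := Rpower_pos s (h - 1)).
  assert (H := D2V_bound lamb (2 * B) s q1 q2 q3 l x y (Cm * Rpower s h) (Cm * Rpower s (h - 1)) Hl Hs HQ
    ltac:(nra) ltac:(nra)).
  assert (Hm : forall u v, Rabs (ev l (x + u) (y + v) + ev l (x - u) (y - v) - 2 * ev l x y) <=
     Cm * Rpower s h + Cm * Rpower s (h - 1) * (u ^ 2 + v ^ 2)).
  { intros u v. eapply Rle_trans; [apply HM|]. right; ring. }
  specialize (H Hm). cbv zeta in H.
  assert (E : 2 * (1 + 2 * B / lamb) ^ 2 * (2 * (Cm * Rpower s h + 12 * (Cm * Rpower s (h - 1)) * (2 * B * s)) / (lamb * s))
     = CD * Cm * Rpower s (h - 1)).
  { rewrite <- (Rpower_succ s h Hs). unfold CD. field. split; lra. }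
  rewrite E in H. exact H.
Qed.

Lemma V_initial (l : list tm) (x y Cm h s q1 q2 q3 : R) : 0 <= Cm -> 0 < s ->
  Qb lamb (2 * B) s q1 q2 q3 -> modulus_at l x y Cm h s ->
  Rabs (V q1 q2 q3 l x y - ev l x y) <= (1 + 12 * B) * Cm * Rpower s h.
Proof.
  intros HC Hs HQ HM. assert (Hl := ck_lamb _ _ _ _ _ Hok). assert (HB := ck_B _ _ _ _ _ Hok).
  assert (P1 := Rpower_pos s h). assert (P2 := Rpower_pos s (h - 1)).
  assert (H := V_close lamb (2 * B) s q1 q2 q3 l x y (Cm * Rpower s h) (Cm * Rpower s (h - 1)) Hl Hs HQ
    ltac:(nra)).
  assert (Hm : forall u v, Rabs (ev l (x + u) (y + v) + ev l (x - u) (y - v) - 2 * ev l x y) <=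
     Cm * Rpower s h + Cm * Rpower s (h - 1) * (u ^ 2 + v ^ 2)).
  { intros u v. eapply Rle_trans; [apply HM|]. right; ring. }
  specialize (H Hm). eapply Rle_trans; [exact H|]. rewrite <- (Rpower_succ s h Hs).
  assert (0 <= Cm * (Rpower s (h - 1) * s)) by (repeat apply Rmult_le_pos; lra).
  assert (0 <= B * (Cm * (Rpower s (h - 1) * s))) by (apply Rmult_le_pos; lra). nra.
Qed.

(** Bound for the derivatives of [V] at age [a], when the diffusion time is [a + theta]. The initial
    smoothing [theta > 0] keeps it finite at age 0, and [Rmax 0] makes it continuous on the whole
    line. *)
Definition Dage (C4 h theta a : R) : R := C4 * Rpower (Rmax 0 a + theta) (h - 1).
Definition Thage (C4 h theta a : R) : R := RInt (Dage C4 h theta) 0 a.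

Lemma Dage_props (C4 h theta : R) : 0 < C4 -> 0 < theta -> h < 1 ->
  (forall z, continuity_pt (Dage C4 h theta) z) /\
  (forall z, 0 <= Dage C4 h theta z <= C4 * Rpower theta (h - 1)) /\
  (forall z, is_derive (Thage C4 h theta) z (Dage C4 h theta z)) /\ Thage C4 h theta 0 = 0.
Proof.
  intros HC Hth Hh.
  assert (Cc : forall z, continuity_pt (Dage C4 h theta) z).
  { intros z. unfold Dage.
    apply (continuity_pt_scal (fun a => Rpower (Rmax 0 a + theta) (h - 1))). unfold Rpower.
    assert (Hp : 0 < Rmax 0 z + theta) by (assert (A := Rmax_l 0 z); lra).
    apply (continuity_pt_comp (fun a => (h - 1) * ln (Rmax 0 a + theta)) exp).
    2: apply derivable_continuous_pt, derivable_pt_exp.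
    apply (continuity_pt_scal (fun a => ln (Rmax 0 a + theta))).
    apply (continuity_pt_comp (fun a => Rmax 0 a + theta) ln).
    - apply continuity_pt_plus. apply continuity_pt_Rmax0. apply continuity_pt_const; intros ? ?; auto.
    - apply derivable_continuous_pt. exists (/ (Rmax 0 z + theta)). apply derivable_pt_lim_ln. auto. }
  split; auto. split; [|split].
  - intros z. unfold Dage. assert (P := Rpower_pos (Rmax 0 z + theta) (h - 1)). split; [nra|].
    apply Rmult_le_compat_l; [lra|]. assert (A := Rmax_l 0 z). apply Rpower_anti; lra.
  - intros z. unfold Thage.
    apply (is_derive_RInt (Dage C4 h theta) (fun u => RInt (Dage C4 h theta) 0 u) 0).
    + exists (mkposreal 1 Rlt_0_1). intros y _. apply (RInt_correct (Dage C4 h theta)).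
      apply (ex_RInt_continuous (Dage C4 h theta)). intros u _. apply continuity_pt_filterlim. apply Cc.
    + apply continuity_pt_filterlim. apply Cc.
  - unfold Thage. apply (RInt_point 0 (Dage C4 h theta)).
Qed.

(** Any explicit primitive on [[0, tau]] evaluates the integral: a power for [h > 0], a logarithm
    for [h = 0]. *)
Lemma Thage_bound (C4 h theta tau : R) (G : R -> R) : 0 < C4 -> 0 < theta -> h < 1 -> 0 <= tau ->
  (forall a, 0 <= a <= tau -> is_derive G a (C4 * Rpower (a + theta) (h - 1))) ->
  Thage C4 h theta tau <= G tau - G 0.
Proof.
  intros HC Hth Hh Ht HG. destruct (Dage_props C4 h theta HC Hth Hh) as (_ & _ & HD & H0).
  destruct (Req_dec tau 0) as [->|Hn]; [lra|].
  destruct (MVT_gen (fun a => G a - Thage C4 h theta a) 0 tau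
    (fun a => C4 * Rpower (a + theta) (h - 1) - Dage C4 h theta a)) as (c & Hc & Hm).
  - intros a Ha. rewrite Rmin_left, Rmax_right in Ha by lra.
    apply (is_derive_minus G (Thage C4 h theta)); auto. apply HG; lra.
  - intros a Ha. rewrite Rmin_left, Rmax_right in Ha by lra.
    apply continuity_pt_minus; [|apply (derive_cont _ _ HD)].
    apply derivable_continuous_pt. eexists. apply is_derive_Reals. apply HG; lra.
  - rewrite Rmin_left, Rmax_right in Hc by lra. unfold Dage in Hm. rewrite (Rmax_right 0 c) in Hm by lra.
    rewrite Rminus_diag, Rmult_0_l in Hm. lra.
Qed.

Lemma Thage_pow (C4 h theta tau : R) : 0 < C4 -> 0 < theta -> 0 < h < 1 -> 0 <= tau ->
  Thage C4 h theta tau <= C4 / h * Rpower (tau + theta) h.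
Proof.
  intros HC Hth Hh Ht.
  assert (H := Thage_bound C4 h theta tau (fun a => C4 / h * Rpower (a + theta) h) HC Hth ltac:(lra) Ht).
  assert (P := Rpower_pos (0 + theta) h).
  assert (0 <= C4 / h * Rpower (0 + theta) h).
  { apply Rmult_le_pos; [|lra]. left; apply Rdiv_lt_0_compat; lra. }
  assert (Thage C4 h theta tau <= C4 / h * Rpower (tau + theta) h - C4 / h * Rpower (0 + theta) h); [|lra].
  apply H. intros a Ha.
  replace (C4 * Rpower (a + theta) (h - 1)) with (C4 / h * (1 * (h * Rpower (a + theta) (h - 1)))) by (field; lra).
  apply (is_derive_scal (fun a => Rpower (a + theta) h)).
  apply (is_derive_comp (fun u => Rpower u h) (fun a => a + theta)).
  - apply is_derive_Reals. apply derivable_pt_lim_power. lra.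
  - auto_derive; auto.
Qed.

Lemma Thage_log (C4 theta tau : R) : 0 < C4 -> 0 < theta -> 0 <= tau ->
  Thage C4 0 theta tau <= C4 * (ln (tau + theta) - ln theta).
Proof.
  intros HC Hth Ht.
  assert (H := Thage_bound C4 0 theta tau (fun a => C4 * ln (a + theta)) HC Hth ltac:(lra) Ht).
  cbv beta in H. rewrite Rplus_0_l in H.
  assert (Thage C4 0 theta tau <= C4 * ln (tau + theta) - C4 * ln theta); [|lra].
  apply H. intros a Ha.
  replace (Rpower (a + theta) (0 - 1)) with (1 * / (a + theta)).
  2: { replace (0 - 1) with (- (1)) by ring. rewrite Rpower_Ropp, Rpower_1 by lra. ring. }
  apply (is_derive_scal (fun a => ln (a + theta))).
  apply (is_derive_comp ln (fun a => a + theta)).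
  - apply is_derive_Reals. apply derivable_pt_lim_ln. lra.
  - auto_derive; auto.
Qed.

Lemma derivs_from_modulus (x0 y0 tau theta F Cm h : R) (l : list tm) :
  0 < tau <= 1 -> 0 < theta <= 1 -> 0 <= h < 1 -> 0 <= Cm -> 0 < F ->
  (forall x y, Rabs (ev l x y) <= F) ->
  (forall x y s, inbox x0 y0 x y -> theta <= s <= 2 -> modulus_at l x y Cm h s) ->
  forall q1 q2 q3 a x y, 0 <= a <= tau -> Qb lamb (2 * B) (a + theta) q1 q2 q3 ->
   inbox x0 y0 x y -> derivs_le q1 q2 q3 l x y (Dage (4 * F + CD * Cm) h theta a).
Proof.
  intros Ht Hth Hh HC HF Hev Hmod q1 q2 q3 a x y Ha HQ [Hx Hy].
  assert (HCD := CD_pos).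
  assert (Hs : 0 < a + theta) by lra.
  assert (P := Rpower_pos (a + theta) (h - 1)).
  assert (Hhalf := Rpower_ge_half (a + theta) h ltac:(lra) Hh).
  assert (ED : Dage (4 * F + CD * Cm) h theta a = (4 * F + CD * Cm) * Rpower (a + theta) (h - 1)).
  { unfold Dage. rewrite Rmax_right by lra. auto. }
  assert (D2 : forall x y, Rabs (x - x0) <= 1 -> Rabs (y - y0) <= 1 ->
    Rabs (Vxx q1 q2 q3 l x y) <= CD * Cm * Rpower (a + theta) (h - 1) /\ Rabs (Vxy q1 q2 q3 l x y) <= CD * Cm * Rpower (a + theta) (h - 1) /\ Rabs (Vyy q1 q2 q3 l x y) <= CD * Cm * Rpower (a + theta) (h - 1)).
  { intros u v Hu Hv. apply D2_from_modulus; auto. apply Hmod. split; auto. lra. }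
  assert (Hb : forall x y, Rabs (V q1 q2 q3 l x y) <= F) by (intros; apply (V_bounded l F (a + theta)); auto).
  (* The power is at least one half, so the [2 * F] coming from [interpolation] fits into [4 * F]
     times it. *)
  assert (H2F : 2 * F + CD * Cm * Rpower (a + theta) (h - 1) <= Dage (4 * F + CD * Cm) h theta a).
  { rewrite ED. nra. }
  destruct (D2 x y Hx Hy) as (E1 & E2 & E3).
  assert (Hpos : 0 <= 2 * F) by lra.
  unfold derivs_le. repeat split; try lra.
  - eapply Rle_trans; [|exact H2F].
    apply (interpolation (fun x => V q1 q2 q3 l x y) (fun x => Vx q1 q2 q3 l x y) (fun x => Vxx q1 q2 q3 l x y) x0); auto.
    + intros u. apply (V_derivs q1 q2 q3 l u y).
    + intros u. apply (V_derivs q1 q2 q3 l u y).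
    + intros u Hu. apply D2; auto.
  - eapply Rle_trans; [|exact H2F].
    apply (interpolation (fun y => V q1 q2 q3 l x y) (fun y => Vy q1 q2 q3 l x y) (fun y => Vyy q1 q2 q3 l x y) y0); auto.
    + intros u. apply (V_derivs q1 q2 q3 l x u).
    + intros u. apply (V_derivs q1 q2 q3 l x u).
    + intros u Hu. apply D2; auto.
Qed.

Definition Cb : R := 1 + bc1 B L + 4 * B * bc1 B L + 144 * B ^ 2 + 24 * B.

(** Within the diffusion length [sqrt tau] of the centre the parabola [r2 / sqrt tau] is at most
    [sqrt tau], so the barrier is of the order of the freezing error. *)
Lemma bar_small (x0 y0 tau K Th_tau x y : R) (Th : R -> R) : 0 < tau <= 1 -> 0 <= K ->
  Th tau = Th_tau -> 0 <= Th_tau -> (x - x0) ^ 2 + (y - y0) ^ 2 <= tau ->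
  bar B L x0 y0 tau K Th x y tau <= Cb * (sqrt tau * Th_tau + K * tau ^ 2).
Proof.
  intros Ht HK HT HT0 Hr. assert (HB := ck_B _ _ _ _ _ Hok). assert (HL := ck_L _ _ _ _ _ Hok).
  assert (Hc : 0 < bc1 B L) by (unfold bc1; lra).
  unfold bar, bal0, bal1. rewrite HT. set (r2 := (x - x0) ^ 2 + (y - y0) ^ 2) in *.
  assert (Hr0 : 0 <= r2) by (unfold r2; assert (A := pow2_ge_0 (x - x0)); assert (A' := pow2_ge_0 (y - y0)); lra).
  set (s := sqrt tau). assert (Hs : 0 < s) by (apply sqrt_lt_R0; lra).
  assert (Hss : s * s = tau) by (apply sqrt_sqrt; lra).
  assert (Hn : 0 <= bc1 B L / (2 * s) * Th_tau + 2 * K * (12 * B) * tau).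
  { assert (0 < bc1 B L / (2 * s)) by (apply Rdiv_lt_0_compat; lra).
    assert (0 <= K * B) by nra. assert (0 <= K * B * tau) by nra. nra. }
  assert (H1 : (bc1 B L / (2 * s) * Th_tau + 2 * K * (12 * B) * tau) * r2 <= (bc1 B L / (2 * s) * Th_tau + 2 * K * (12 * B) * tau) * tau).
  { apply Rmult_le_compat_l; auto. }
  assert (H2 : r2 ^ 2 <= tau ^ 2) by (apply pow_incr; lra).
  assert (H3 : K * r2 ^ 2 <= K * tau ^ 2) by (apply Rmult_le_compat_l; auto).
  apply Rle_trans with (bc1 B L / 2 * s * Th_tau + 4 * B * bc1 B L * (Th_tau / s) * tau + K * (12 * B) ^ 2 * tau ^ 2 +
    (bc1 B L / (2 * s) * Th_tau + 2 * K * (12 * B) * tau) * tau + K * tau ^ 2); [lra|].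
  replace (bc1 B L / 2 * s * Th_tau + 4 * B * bc1 B L * (Th_tau / s) * tau + K * (12 * B) ^ 2 * tau ^ 2 +
    (bc1 B L / (2 * s) * Th_tau + 2 * K * (12 * B) * tau) * tau + K * tau ^ 2) with
   ((bc1 B L + 4 * B * bc1 B L) * (s * Th_tau) + (1 + 144 * B ^ 2 + 24 * B) * (K * tau ^ 2)).
  2: { rewrite <- Hss. field. lra. }
  unfold Cb. assert (0 <= s * Th_tau) by nra. assert (0 <= K * tau ^ 2) by (assert (0 <= tau ^ 2) by apply pow2_ge_0; nra).
  assert (0 <= B * bc1 B L) by nra. assert (0 <= B ^ 2) by apply pow2_ge_0. nra.
Qed.

Definition Cs : R := Cb * (1 + 3 * B).
Definition step_err (tau G Theta : R) : R := Cs * (sqrt tau * Theta + G * tau ^ 2).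

Lemma lamb_le : 0 <= T -> lamb <= B.
Proof.
  intros HT.
  assert (E := ck_ell _ _ _ _ _ Hok 0 0 T 1 0 ltac:(lra)).
  assert (E2 := ck_bd _ _ _ _ _ Hok 0%nat 0 0 T ltac:(lia) ltac:(lra)). apply Rabs_le_between in E2. lra.
Qed.

(** Over a time step [tau], sub- and supersolutions with the same terminal data
    [V] are both within [step_err] of one and the same function [V p + N]. *)
Theorem step_estimate (x0 y0 t0 tau theta F K1 Cm h eta : R) (l : list tm) :
  0 < tau <= 1 -> tau <= t0 -> t0 <= T -> 0 < theta <= 1 -> 0 <= h < 1 -> 0 <= Cm -> 0 < F -> 0 <= K1 -> 0 < eta ->
  (forall x y, Rabs (ev l x y) <= F) ->
  (forall x y s, inbox x0 y0 x y -> theta <= s <= 2 -> modulus_at l x y Cm h s) ->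
  let Theta := Thage (4 * F + CD * Cm) h theta tau in
  0 <= Theta /\
  exists p1 p2 p3 N, Qb lamb (2 * B) (tau + theta) p1 p2 p3 /\
   (forall w m, vsubc T cf w -> cont3 w ->
      (forall x y a, inbox x0 y0 x y -> 0 <= a <= tau -> w x y (t0 - a) <= F) -> 0 < m ->
      (forall x y, inbox x0 y0 x y -> w x y t0 <= V (lamb * theta) 0 (lamb * theta) l x y + m + K1 * ((x - x0) ^ 2 + (y - y0) ^ 2) ^ 2) ->
      forall x y, (x - x0) ^ 2 + (y - y0) ^ 2 <= tau ->
      w x y (t0 - tau) <= V p1 p2 p3 l x y + N + m + step_err tau (2 * F + K1) Theta + eta) /\
   (forall w m, vsubc T (flip cf) w -> cont3 w ->
      (forall x y a, inbox x0 y0 x y -> 0 <= a <= tau -> w x y (t0 - a) <= F) -> 0 < m ->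
      (forall x y, inbox x0 y0 x y -> w x y t0 <= - V (lamb * theta) 0 (lamb * theta) l x y + m + K1 * ((x - x0) ^ 2 + (y - y0) ^ 2) ^ 2) ->
      forall x y, (x - x0) ^ 2 + (y - y0) ^ 2 <= tau ->
      w x y (t0 - tau) <= - V p1 p2 p3 l x y - N + m + step_err tau (2 * F + K1) Theta + eta).
Proof.
  intros Ht Ht0 HT Hth Hh HC HF HK1 Heta Hev Hmod Theta.
  assert (HB := ck_B _ _ _ _ _ Hok). assert (Hla := ck_lamb _ _ _ _ _ Hok). assert (HL := ck_L _ _ _ _ _ Hok).
  assert (HCD := CD_pos).
  assert (HC4 : 0 < 4 * F + CD * Cm) by nra.
  destruct (Dage_props (4 * F + CD * Cm) h theta HC4 ltac:(lra) ltac:(lra)) as (Dc & Db & DD & D0).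
  assert (HTh : 0 <= Theta).
  { unfold Theta. rewrite <- D0. apply (derive_mono _ _ 0 tau DD); [intros; apply Db|lra]. }
  split; auto.
  (* On the sides of the box [w - V] is at most [2 * F] and [|N|] at most [3 * B * Theta]; [K1]
     carries the quartic slack allowed in the data. *)
  set (K := 2 * F + 3 * B * Theta + K1).
  assert (HK : 0 <= K) by (unfold K; nra).
  assert (HV := derivs_from_modulus x0 y0 tau theta F Cm h l Ht Hth Hh HC HF Hev Hmod).
  assert (Hll := lamb_le ltac:(lra)).
  assert (HQ : Qb lamb (2 * B) theta (lamb * theta) 0 (lamb * theta)).
  { intros u v. assert (A1 := pow2_ge_0 u). assert (A2 := pow2_ge_0 v).
    assert (0 <= theta * (u ^ 2 + v ^ 2)) by nra.
    replace (lamb * theta * u ^ 2 + 2 * 0 * u * v + lamb * theta * v ^ 2) with (lamb * (theta * (u ^ 2 + v ^ 2))) by ring.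
    split; nra. }
  assert (HDm : 0 < (4 * F + CD * Cm) * Rpower theta (h - 1)) by (apply Rmult_lt_0_compat; auto; apply Rpower_pos).
  destruct (step_transfer T lamb B L cf x0 y0 t0 tau theta K _ _ _ l Hok Ht Ht0 HT Dc DD D0 Db HDm HK HV
     (lamb * theta) 0 (lamb * theta) eta Heta HQ) as (p1 & p2 & p3 & N & HQp & T1 & T2).
  exists p1, p2, p3, N. split; auto.
  assert (Hb0 : forall x y, K1 * ((x - x0) ^ 2 + (y - y0) ^ 2) ^ 2 <= bar B L x0 y0 tau K (Thage (4 * F + CD * Cm) h theta) x y 0).
  { intros x y. unfold bar, bal0, bal1. rewrite D0.
    replace (bc1 B L / 2 * sqrt tau * 0 + 4 * B * bc1 B L * (Thage (4 * F + CD * Cm) h theta tau / sqrt tau) * 0 + K * (12 * B) ^ 2 * 0 ^ 2 +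
     (bc1 B L / (2 * sqrt tau) * 0 + 2 * K * (12 * B) * 0) * ((x - x0) ^ 2 + (y - y0) ^ 2) + K * ((x - x0) ^ 2 + (y - y0) ^ 2) ^ 2)
     with (K * ((x - x0) ^ 2 + (y - y0) ^ 2) ^ 2) by ring.
    apply Rmult_le_compat_r; [apply pow2_ge_0|]. unfold K. nra. }
  assert (Hsm : forall x y, (x - x0) ^ 2 + (y - y0) ^ 2 <= tau ->
     bar B L x0 y0 tau K (Thage (4 * F + CD * Cm) h theta) x y tau <= step_err tau (2 * F + K1) Theta).
  { intros x y Hr. eapply Rle_trans; [apply (bar_small x0 y0 tau K Theta x y); auto|].
    unfold step_err, Cs. rewrite Rmult_assoc.
    assert (Hbc : 0 < bc1 B L) by (unfold bc1; lra).
    assert (HCb : 0 <= Cb) by (unfold Cb; assert (0 <= B ^ 2) by apply pow2_ge_0; nra).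
    apply Rmult_le_compat_l; auto. unfold K.
    assert (Hs : tau ^ 2 <= sqrt tau).
    { assert (Hs0 : 0 < sqrt tau) by (apply sqrt_lt_R0; lra).
      assert (Hss : sqrt tau * sqrt tau = tau) by (apply sqrt_sqrt; lra).
      assert (Hs1 : sqrt tau <= 1) by (rewrite <- sqrt_1; apply sqrt_le_1_alt; lra). nra. }
    assert (Theta * tau ^ 2 <= Theta * sqrt tau) by (apply Rmult_le_compat_l; auto).
    assert (0 <= (2 * F + K1) * tau ^ 2) by (assert (0 <= tau ^ 2) by apply pow2_ge_0; nra). nra. }
  assert (Hin : forall x y, (x - x0) ^ 2 + (y - y0) ^ 2 <= tau -> inbox x0 y0 x y).
  { intros x y Hr. assert (A1 := pow2_ge_0 (x - x0)). assert (A2 := pow2_ge_0 (y - y0)).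
    split; (apply Rsqr_incr_0_var; [|lra]); rewrite <- Rsqr_abs; unfold Rsqr; nra. }
  assert (Hlb : forall x y a q1 q2 q3, 0 <= a <= tau -> Qb lamb (2 * B) (a + theta) q1 q2 q3 -> Rabs (V q1 q2 q3 l x y) <= F).
  { intros x y a q1 q2 q3 Ha HQa. apply (V_bounded l F (a + theta)); auto. lra. }
  split.
  - intros w m Hw Hwc Hwb Hm Hini x y Hr.
    assert (H := T1 w m Hw Hwc). unfold lateral, below in H.
    assert (H' : w x y (t0 - tau) <= V p1 p2 p3 l x y + N + bar B L x0 y0 tau K (Thage (4 * F + CD * Cm) h theta) x y tau + (m + eta)).
    { apply H; auto.
      - intros x' y' a q1 q2 q3 Hi Ha HQa. assert (A1 := Hwb x' y' a Hi Ha).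
        assert (A2 := Hlb x' y' a q1 q2 q3 Ha HQa). apply Rabs_le_between in A2. unfold K, Theta. lra.
      - intros x' y' Hi. rewrite Rminus_0_r. specialize (Hini x' y' Hi). specialize (Hb0 x' y'). lra. }
    specialize (Hsm x y Hr). lra.
  - intros w m Hw Hwc Hwb Hm Hini x y Hr.
    assert (H := T2 w m Hw Hwc). unfold lateral, below in H.
    destruct (V_negl p1 p2 p3 l x y) as [EV _].
    assert (H' : w x y (t0 - tau) <= V p1 p2 p3 (negl l) x y + - N + bar B L x0 y0 tau K (Thage (4 * F + CD * Cm) h theta) x y tau + (m + eta)).
    { apply H; auto.
      - intros x' y' a q1 q2 q3 Hi Ha HQa. assert (A1 := Hwb x' y' a Hi Ha).
        assert (A2 := Hlb x' y' a q1 q2 q3 Ha HQa). apply Rabs_le_between in A2.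
        destruct (V_negl q1 q2 q3 l x' y') as [EV' _]. rewrite EV'. unfold K, Theta. lra.
      - intros x' y' Hi. rewrite Rminus_0_r. specialize (Hini x' y' Hi). specialize (Hb0 x' y').
        destruct (V_negl (lamb * theta) 0 (lamb * theta) l x' y') as [EV' _]. rewrite EV'. lra. }
    specialize (Hsm x y Hr). rewrite EV in H'. lra.
Qed.
End StepEstimate.

Lemma cont3_slice_uniform (u : R -> R -> R -> R) (rad t e : R) : cont3 u -> 0 < e ->
  exists d, 0 < d /\ forall x y x' y', Rabs x <= rad -> Rabs y <= rad ->
     Rabs (x' - x) < d -> Rabs (y' - y) < d -> Rabs (u x' y' t - u x y t) < e.
Proof.
  intros Hu He. assert (A := Rle_abs rad). assert (A' := Rabs_pos t). assert (A'' := Rabs_pos rad).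
  destruct (cont3_uniform u (Rabs rad + Rabs t) e Hu He) as (d & Hd & H).
  exists d. split; auto. intros x y x' y' Hx Hy Hx' Hy'. apply H; auto; try lra.
  rewrite Rminus_diag, Rabs_R0. auto.
Qed.

Lemma Rabs_shift (x u rad d : R) : Rabs x <= rad -> Rabs u <= d -> Rabs (x + u) <= rad + d /\ Rabs (x - u) <= rad + d.
Proof.
  intros Hx Hu. apply Rabs_le_between in Hx. apply Rabs_le_between in Hu. split; apply Rabs_le; lra.
Qed.

Lemma sq_le_abs (u v q : R) : 0 <= q -> u ^ 2 + v ^ 2 <= q ^ 2 -> Rabs u <= q /\ Rabs v <= q.
Proof.
  intros Hq H. assert (A := pow2_ge_0 u). assert (B := pow2_ge_0 v).
  split; (apply Rsqr_incr_0_var; [|lra]); rewrite <- Rsqr_abs; unfold Rsqr; nra.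
Qed.

Lemma Rpower_mono (s t k : R) : 0 < s -> s <= t -> 0 <= k -> Rpower s k <= Rpower t k.
Proof. intros Hs Hst Hk. apply exp_mono. assert (A := ln_mono s t Hs Hst). nra. Qed.

Lemma Rpower_split (Q s h : R) : 0 < Q -> 0 < s -> 0 <= h <= 1 ->
  Rpower Q h <= Rpower s h + Rpower s (h - 1) * Q.
Proof.
  intros HQ Hs Hh. assert (P1 := Rpower_pos s h). assert (P2 := Rpower_pos s (h - 1)).
  destruct (Rle_dec Q s) as [H|H].
  - assert (A := Rpower_mono Q s h HQ H ltac:(lra)). nra.
  - rewrite <- (Rpower_succ Q h HQ). assert (A := Rpower_anti s Q (h - 1) Hs ltac:(lra) ltac:(lra)). nra.
Qed.

Definition second_diff (u : R -> R -> R -> R) (x y t v w : R) : R :=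
  u (x + v) (y + w) t + u (x - v) (y - w) t - 2 * u x y t.

(** The slice is approximated to within [theta^h], hence the polynomial inherits the second
    differences at every scale [s >= theta]. The 4 collects the approximation errors; increments
    longer than 1 are covered by [8 * F], thanks to the bound on the whole plane. *)
Lemma approx_modulus (u : R -> R -> R -> R) (rad F h C t theta : R) : cont3 u ->
  0 < rad -> 0 < F -> 0 <= h < 1 -> 0 <= C -> 0 < theta <= 1 ->
  (forall x y, Rabs x <= rad + 1 -> Rabs y <= rad + 1 -> Rabs (u x y t) <= F) ->
  (forall x y v w, Rabs x <= rad -> Rabs y <= rad -> 0 < v ^ 2 + w ^ 2 <= 1 ->
     Rabs (second_diff u x y t v w) <= C * Rpower (v ^ 2 + w ^ 2) h) ->
  exists l, (forall x y, Rabs (ev l x y) <= F) /\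
    (forall x y, Rabs x <= rad + 1 -> Rabs y <= rad + 1 -> Rabs (ev l x y - u x y t) <= Rpower theta h) /\
    (forall x y s, Rabs x <= rad -> Rabs y <= rad -> theta <= s <= 2 ->
       modulus_at l x y (C + 4 + 8 * F) h s).
Proof.
  intros Hu Hrad HF Hh HC Hth HuF Hreg.
  assert (P := Rpower_pos theta h).
  destruct (trig_approx (fun x y => u x y t) (rad + 1) F (Rpower theta h)) as (l & L1 & L2); try lra; auto.
  { intros e He. destruct (cont3_slice_uniform u (rad + 1) t e Hu He) as (d & Hd & H).
    exists d. split; auto. }
  exists l. split; auto. split; auto.
  intros x y s Hx Hy Hs v w.
  assert (A1 := pow2_ge_0 v). assert (A2 := pow2_ge_0 w).
  assert (P1 := Rpower_pos s h). assert (P2 := Rpower_pos s (h - 1)).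
  assert (P3 := Rpower_mono theta s h ltac:(lra) ltac:(lra) ltac:(lra)).
  set (Q := v ^ 2 + w ^ 2) in *. assert (HQ : 0 <= Q) by (unfold Q; lra).
  assert (HPQ : 0 <= Rpower s (h - 1) * Q) by nra.
  assert (HT : 0 <= Rpower s h + Rpower s (h - 1) * Q) by lra.
  destruct (Rle_dec Q 1) as [H1|H1].
  - destruct (Req_dec Q 0) as [H0|H0].
    + assert (v = 0) by (unfold Q in H0; nra). assert (w = 0) by (unfold Q in H0; nra). subst v w.
      rewrite !Rplus_0_r, !Rminus_0_r.
      replace (ev l x y + ev l x y - 2 * ev l x y) with 0 by ring. rewrite Rabs_R0.
      apply Rmult_le_pos; lra.
    + assert (HR := Hreg x y v w Hx Hy ltac:(fold Q; lra)). fold Q in HR.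
      assert (HS := Rpower_split Q s h ltac:(lra) ltac:(lra) ltac:(lra)).
      destruct (sq_le_abs v w 1 ltac:(lra) ltac:(fold Q; lra)) as [Hv Hw].
      destruct (Rabs_shift x v rad 1 Hx Hv) as [X1 X2]. destruct (Rabs_shift y w rad 1 Hy Hw) as [Y1 Y2].
      assert (E1 := L2 _ _ X1 Y1). assert (E2 := L2 _ _ X2 Y2).
      assert (E3 := L2 x y ltac:(lra) ltac:(lra)).
      apply Rabs_le_between in E1. apply Rabs_le_between in E2. apply Rabs_le_between in E3.
      assert (HR' : C * Rpower Q h <= C * (Rpower s h + Rpower s (h - 1) * Q)) by (apply Rmult_le_compat_l; auto).
      assert (HFT : 0 <= F * (Rpower s h + Rpower s (h - 1) * Q)) by (apply Rmult_le_pos; lra).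
      unfold second_diff in HR. apply Rabs_le_between in HR. apply Rabs_le. lra.
  - assert (G1 := L1 (x + v) (y + w)). assert (G2 := L1 (x - v) (y - w)). assert (G3 := L1 x y).
    apply Rabs_le_between in G1. apply Rabs_le_between in G2. apply Rabs_le_between in G3.
    assert (Hhalf := Rpower_ge_half s h ltac:(lra) Hh).
    assert (H2 : / 2 <= Rpower s (h - 1) * Q) by nra.
    assert (H3 : 4 * F <= 8 * F * (Rpower s h + Rpower s (h - 1) * Q)) by nra.
    assert (H4 : 0 <= (C + 4) * (Rpower s h + Rpower s (h - 1) * Q)) by (apply Rmult_le_pos; lra).
    apply Rabs_le. lra.
Qed.

Section TwoSided.
Variables (T lamb B L : R) (cf : nat -> R -> R -> R -> R) (u : R -> R -> R -> R).
Hypothesis Hok : coef_ok T lamb B L cf.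
Hypotheses (Hu : cont3 u) (Hsub : vsubc T cf u) (Hsup : vsubc T (flip cf) (fun x y t => - u x y t)).

Lemma step_two_sided (x0 y0 t tau theta F K1 Cm h m1 m2 : R) (l : list tm) :
  0 < tau <= 1 -> 0 <= t -> t + tau <= T -> 0 < theta <= 1 -> 0 <= h < 1 -> 0 <= Cm -> 0 < F -> 0 <= K1 ->
  0 < m1 -> 0 < m2 ->
  (forall x y, Rabs (ev l x y) <= F) ->
  (forall x y s, inbox x0 y0 x y -> theta <= s <= 2 -> modulus_at l x y Cm h s) ->
  (forall x y a, inbox x0 y0 x y -> t <= a <= t + tau -> Rabs (u x y a) <= F) ->
  (forall x y, inbox x0 y0 x y ->
     V (lamb * theta) 0 (lamb * theta) l x y - m2 - K1 * ((x - x0) ^ 2 + (y - y0) ^ 2) ^ 2 <= u x y (t + tau)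
       <= V (lamb * theta) 0 (lamb * theta) l x y + m1 + K1 * ((x - x0) ^ 2 + (y - y0) ^ 2) ^ 2) ->
  let E := step_err B L tau (2 * F + K1) (Thage (4 * F + CD lamb B * Cm) h theta tau) + m1 in
  exists p1 p2 p3 N, Qb lamb (2 * B) (tau + theta) p1 p2 p3 /\
    forall x y, (x - x0) ^ 2 + (y - y0) ^ 2 <= tau ->
     V p1 p2 p3 l x y + N - m2 - E <= u x y t <= V p1 p2 p3 l x y + N + m1 + E.
Proof.
  intros Ht Ht0 HT Hth Hh HC HF HK Hm1 Hm2 Hev Hmod Hub Hini E.
  (* The slack [eta] of [step_estimate] is taken equal to [m1], which is the last term of [E]. *)
  destruct (step_estimate T lamb B L cf Hok x0 y0 (t + tau) tau theta F K1 Cm h m1 l) as (HTh & p1 & p2 & p3 & N & HQ & H1 & H2);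
    auto; try lra.
  exists p1, p2, p3, N. split; auto. intros x y Hr. split.
  - assert (A := H2 (fun x y t => - u x y t) m2 Hsup). cbv beta in A.
    assert (A' : - u x y (t + tau - tau) <= - V p1 p2 p3 l x y - N + m2 + step_err B L tau (2 * F + K1) (Thage (4 * F + CD lamb B * Cm) h theta tau) + m1).
    { apply A; auto.
      - apply (cont3_ext (fun x y t => (-1) * u x y t)); [intros; ring|]. apply cont3_scal; auto.
      - intros x' y' a Hi Ha. assert (Hb := Hub x' y' (t + tau - a) Hi ltac:(lra)). apply Rabs_le_between in Hb. lra.
      - intros x' y' Hi. assert (Hb := Hini x' y' Hi). lra. }
    replace (t + tau - tau) with t in A' by ring. unfold E. lra.
  - assert (A := H1 u m1 Hsub Hu).
    assert (A' : u x y (t + tau - tau) <= V p1 p2 p3 l x y + N + m1 + step_err B L tau (2 * F + K1) (Thage (4 * F + CD lamb B * Cm) h theta tau) + m1).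
    { apply A; auto.
      - intros x' y' a Hi Ha. assert (Hb := Hub x' y' (t + tau - a) Hi ltac:(lra)). apply Rabs_le_between in Hb. lra.
      - intros x' y' Hi. assert (Hb := Hini x' y' Hi). lra. }
    replace (t + tau - tau) with t in A' by ring. unfold E. lra.
Qed.
End TwoSided.

(** * Hoelder estimate *)

Definition square_sup (u : R -> R -> R -> R) (rho t x y : R) : R :=
  supbox (fun a b s => u (x + rho * a) (y + rho * b) s) 0 0 t.

Lemma square_sup_spec (u : R -> R -> R -> R) (rho t x y : R) : cont3 u -> 0 < rho ->
  (forall v w, Rabs v <= rho -> Rabs w <= rho -> u (x + v) (y + w) t <= square_sup u rho t x y) /\
  (exists v w, Rabs v <= rho /\ Rabs w <= rho /\ square_sup u rho t x y = u (x + v) (y + w) t).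
Proof.
  intros Hu Hr.
  assert (Hlin : forall c z : R, continuity_pt (fun a => c + rho * a) z).
  { intros c z. apply continuity_pt_plus. apply continuity_pt_const; intros ? ?; auto.
    apply (continuity_pt_scal (fun a => a)). apply continuity_pt_id. }
  assert (Hg : cont3 (fun a b s => u (x + rho * a) (y + rho * b) s)).
  { apply (cont3_args u (fun a => x + rho * a) (fun b => y + rho * b) (fun s => s)); auto.
    intros; apply continuity_pt_id. }
  destruct (supbox_spec _ 0 0 t Hg) as [H1 (a & b & [Ha Hb] & E)]. fold (square_sup u rho t x y) in *.
  split.
  - intros v w Hv Hw. replace (x + v) with (x + rho * (v / rho)) by (field; lra).
    replace (y + w) with (y + rho * (w / rho)) by (field; lra). apply H1.
    assert (Hd : forall z, Rabs z <= rho -> Rabs (z / rho - 0) <= 1).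
    { intros z Hz. rewrite Rminus_0_r. unfold Rdiv. rewrite Rabs_mult, Rabs_inv, (Rabs_right rho) by lra.
      apply Rmult_le_reg_r with rho; auto. rewrite Rmult_assoc, Rinv_l by lra. lra. }
    split; apply Hd; auto.
  - rewrite Rminus_0_r in Ha, Hb. exists (rho * a), (rho * b).
    rewrite !Rabs_mult, (Rabs_right rho) by lra. repeat split; nra.
Qed.

Lemma square_sup_uniform (u : R -> R -> R -> R) (rho t rad e : R) : cont3 u -> 0 < rho -> 0 < e ->
  exists d, 0 < d /\ forall x y x' y', Rabs x <= rad -> Rabs y <= rad -> Rabs x' <= rad -> Rabs y' <= rad ->
    Rabs (x' - x) < d -> Rabs (y' - y) < d -> Rabs (square_sup u rho t x' y' - square_sup u rho t x y) < e.
Proof.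
  intros Hu Hr He. destruct (cont3_slice_uniform u (rad + rho) t e Hu He) as (d & Hd & H).
  exists d. split; auto.
  assert (One : forall x y x' y', Rabs x <= rad -> Rabs y <= rad ->
    Rabs (x' - x) < d -> Rabs (y' - y) < d -> square_sup u rho t x y < square_sup u rho t x' y' + e).
  { intros x y x' y' Hx Hy Hxx Hyy.
    destruct (square_sup_spec u rho t x y Hu Hr) as [_ (v & w & Hv & Hw & E)].
    destruct (square_sup_spec u rho t x' y' Hu Hr) as [H1 _]. specialize (H1 v w Hv Hw).
    assert (A := H (x + v) (y + w) (x' + v) (y' + w) (proj1 (Rabs_shift _ _ _ _ Hx Hv)) (proj1 (Rabs_shift _ _ _ _ Hy Hw))).
    replace (x' + v - (x + v)) with (x' - x) in A by ring. replace (y' + w - (y + w)) with (y' - y) in A by ring.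
    specialize (A Hxx Hyy). apply Rabs_def2 in A. lra. }
  intros x y x' y' Hx Hy Hx' Hy' Hxx Hyy.
  assert (A := One x y x' y' Hx Hy Hxx Hyy). rewrite Rabs_minus_sym in Hxx, Hyy.
  assert (B := One x' y' x y Hx' Hy' Hxx Hyy). apply Rabs_def1; lra.
Qed.

Lemma interpolation_scaled (f f' f'' : R -> R) (F D l : R) : 0 < l ->
  (forall x, is_derive f x (f' x)) -> (forall x, is_derive f' x (f'' x)) ->
  (forall x, Rabs (f x) <= F) -> (forall x, l ^ 2 * Rabs (f'' x) <= D) ->
  forall x, l * Rabs (f' x) <= 2 * F + D.
Proof.
  intros Hl H1 H2 HF HD x.
  assert (Hc : forall z, is_derive (fun z : R => l * z) z l) by (intros; auto_derive; auto; ring).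
  assert (A := interpolation (fun z => f (l * z)) (fun z => l * f' (l * z)) (fun z => l * (l * f'' (l * z))) (x / l) F D).
  assert (B : Rabs (l * f' (l * (x / l))) <= 2 * F + D).
  { apply A.
    - intros z. apply (is_derive_comp f (fun z => l * z)); auto.
    - intros z. apply (is_derive_scal (fun z => f' (l * z))). apply (is_derive_comp f' (fun z => l * z)); auto.
    - intros z. apply HF.
    - intros z _. replace (l * (l * f'' (l * z))) with (l ^ 2 * f'' (l * z)) by ring.
      rewrite Rabs_mult, (Rabs_right (l ^ 2)) by nra. apply HD.
    - rewrite Rminus_diag, Rabs_R0. lra. }
  replace (l * (x / l)) with x in B by (field; lra). rewrite Rabs_mult, (Rabs_right l) in B by lra. exact B.
Qed.

Lemma mvt_abs (f f' : R -> R) (M a b : R) : (forall x, is_derive f x (f' x)) -> (forall x, Rabs (f' x) <= M) ->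
  Rabs (f b - f a) <= M * Rabs (b - a).
Proof.
  intros H HM. destruct (MVT_gen f a b f') as (c & _ & E).
  - intros; auto.
  - intros; apply (derive_cont _ _ H).
  - rewrite E, Rabs_mult. apply Rmult_le_compat_r; auto. apply Rabs_pos.
Qed.

Section Holder.
Variables (T lamb B L : R) (cf : nat -> R -> R -> R -> R) (u : R -> R -> R -> R).
Hypothesis Hok : coef_ok T lamb B L cf.

Lemma bounded_modulus (l : list tm) (F x y s : R) : 0 < F -> 0 < s -> (forall x y, Rabs (ev l x y) <= F) ->
  modulus_at l x y (4 * F) 0 s.
Proof.
  intros HF Hs H v w. rewrite Rpower_O by auto. assert (P := Rpower_pos s (0 - 1)).
  assert (A1 := H (x + v) (y + w)). assert (A2 := H (x - v) (y - w)). assert (A3 := H x y).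
  apply Rabs_le_between in A1. apply Rabs_le_between in A2. apply Rabs_le_between in A3.
  assert (B1 := pow2_ge_0 v). assert (B2 := pow2_ge_0 w).
  assert (0 <= F * (Rpower s (0 - 1) * (v ^ 2 + w ^ 2))) by (repeat apply Rmult_le_pos; lra).
  apply Rabs_le. lra.
Qed.

(** For merely bounded data, that is [h = 0], the second derivatives are of order [F / s], and
    interpolation at length [sqrt s] gives a gradient of order [F / sqrt s]. *)
Lemma V_lipschitz (l : list tm) (F s q1 q2 q3 x y x' y' : R) : 0 < F -> 0 < s ->
  Qb lamb (2 * B) s q1 q2 q3 -> (forall x y, Rabs (ev l x y) <= F) ->
  sqrt s * Rabs (V q1 q2 q3 l x' y' - V q1 q2 q3 l x y) <=
    (2 * F + 4 * F * CD lamb B) * (Rabs (x' - x) + Rabs (y' - y)).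
Proof.
  intros HF Hs HQ Hev. set (r := sqrt s). assert (Hr : 0 < r) by (apply sqrt_lt_R0; auto).
  assert (Hrr : r ^ 2 = s) by (unfold r; rewrite <- Rsqr_pow2; apply Rsqr_sqrt; lra).
  assert (HCD := CD_pos T lamb B L cf Hok).
  assert (D2 := fun x y => D2_from_modulus T lamb B L cf Hok l x y (4 * F) 0 s q1 q2 q3 ltac:(lra) Hs HQ
     (bounded_modulus l F x y s HF Hs Hev)).
  assert (E : s * (CD lamb B * (4 * F) * Rpower s (0 - 1)) = 4 * F * CD lamb B).
  { replace (s * (CD lamb B * (4 * F) * Rpower s (0 - 1))) with (CD lamb B * (4 * F) * (Rpower s (0 - 1) * s)) by ring.
    rewrite Rpower_succ by auto. rewrite Rpower_O by auto. ring. }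
  assert (Hb : forall x y, Rabs (V q1 q2 q3 l x y) <= F).
  { intros. apply (V_bounded T lamb B L cf Hok l F s); auto. }
  set (M := 2 * F + 4 * F * CD lamb B).
  assert (Gx : forall x y, Rabs (Vx q1 q2 q3 l x y) <= M / r).
  { intros a b. apply Rmult_le_reg_l with r; auto. replace (r * (M / r)) with M by (field; lra).
    apply (interpolation_scaled (fun x => V q1 q2 q3 l x b) (fun x => Vx q1 q2 q3 l x b) (fun x => Vxx q1 q2 q3 l x b)); auto.
    - intros z. apply (V_derivs q1 q2 q3 l z b).
    - intros z. apply (V_derivs q1 q2 q3 l z b).
    - intros z. rewrite Hrr, <- E. apply Rmult_le_compat_l; [lra|]. apply D2. }
  assert (Gy : forall x y, Rabs (Vy q1 q2 q3 l x y) <= M / r).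
  { intros a b. apply Rmult_le_reg_l with r; auto. replace (r * (M / r)) with M by (field; lra).
    apply (interpolation_scaled (fun y => V q1 q2 q3 l a y) (fun y => Vy q1 q2 q3 l a y) (fun y => Vyy q1 q2 q3 l a y)); auto.
    - intros z. apply (V_derivs q1 q2 q3 l a z).
    - intros z. apply (V_derivs q1 q2 q3 l a z).
    - intros z. rewrite Hrr, <- E. apply Rmult_le_compat_l; [lra|]. apply D2. }
  assert (I1 := mvt_abs (fun x => V q1 q2 q3 l x y') (fun x => Vx q1 q2 q3 l x y') (M / r) x x'
     (fun z => proj1 (V_derivs q1 q2 q3 l z y')) (fun z => Gx z y')).
  assert (I2 := mvt_abs (fun y => V q1 q2 q3 l x y) (fun y => Vy q1 q2 q3 l x y) (M / r) y y'
     (fun z => proj1 (proj2 (V_derivs q1 q2 q3 l x z))) (fun z => Gy x z)).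
  cbv beta in I1, I2.
  apply Rmult_le_reg_l with (/ r); [apply Rinv_0_lt_compat; auto|].
  rewrite <- Rmult_assoc, Rinv_l, Rmult_1_l by lra.
  replace (/ r * (M * (Rabs (x' - x) + Rabs (y' - y)))) with (M / r * Rabs (x' - x) + M / r * Rabs (y' - y)) by (field; lra).
  replace (V q1 q2 q3 l x' y' - V q1 q2 q3 l x y) with
    ((V q1 q2 q3 l x' y' - V q1 q2 q3 l x y') + (V q1 q2 q3 l x y' - V q1 q2 q3 l x y)) by ring.
  eapply Rle_trans; [apply Rabs_triang|]. lra.
Qed.
End Holder.

Lemma pow_le_base (s : R) (n : nat) : 0 <= s <= 1 -> (0 < n)%nat -> s ^ n <= s.
Proof.
  intros Hs Hn. destruct n as [|n]; [lia|]. simpl.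
  assert (A := pow_incr s 1 n Hs). rewrite pow1 in A. nra.
Qed.

Lemma neg_ln_le (s : R) : 0 < s -> - ln s <= / s.
Proof.
  intros Hs. rewrite <- ln_Rinv by auto. assert (A := exp_ineq1_le (ln (/ s))).
  rewrite exp_ln in A by (apply Rinv_0_lt_compat; auto). lra.
Qed.

Lemma outside_square (v w rho : R) : 0 < rho -> ~ (Rabs v <= rho /\ Rabs w <= rho) -> rho ^ 2 <= v ^ 2 + w ^ 2.
Proof.
  intros Hr Hn. destruct (Rle_dec (rho ^ 2) (v ^ 2 + w ^ 2)) as [H|H]; auto.
  exfalso. apply Hn. apply sq_le_abs; lra.
Qed.

Definition osc (u : R -> R -> R -> R) (rad T' r W : R) : Prop :=
  forall x y x' y' t, Rabs x <= rad -> Rabs y <= rad -> 0 <= t <= T' ->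
    Rabs (x' - x) <= r -> Rabs (y' - y) <= r -> Rabs (u x' y' t - u x y t) <= W.

Section Holder.
Variables (T lamb B L : R) (cf : nat -> R -> R -> R -> R) (u : R -> R -> R -> R).
Hypothesis Hok : coef_ok T lamb B L cf.
Hypotheses (Hu : cont3 u) (Hsub : vsubc T cf u) (Hsup : vsubc T (flip cf) (fun x y t => - u x y t)).

(** Contributions of the gradient of [V], of the data errors with their slack, and of the step error
    on both sides in [holder_step]. *)
Definition holder_const (F : R) : R :=
  2 * (2 * F + 4 * F * CD lamb B) + 4 * (1 + 24 * F * B)
   + 2 * (Cs B L * (24 * (4 * F + CD lamb B * (4 * F)) + 4 * F)).

Lemma Cs_pos : 0 < Cs B L.
Proof.
  assert (HB := ck_B _ _ _ _ _ Hok). assert (HL := ck_L _ _ _ _ _ Hok).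
  unfold Cs, Cb. assert (A : 0 < bc1 B L) by (unfold bc1; lra).
  assert (0 < B * bc1 B L) by nra. assert (0 <= B ^ 2) by apply pow2_ge_0. nra.
Qed.

Lemma holder_const_pos (F : R) : 0 < F -> 0 < holder_const F.
Proof.
  intros HF. assert (HB := ck_B _ _ _ _ _ Hok). assert (A := Cs_pos). assert (HC := CD_pos T lamb B L cf Hok).
  unfold holder_const. assert (0 < F * CD lamb B) by nra. assert (0 < F * B) by nra.
  assert (0 < Cs B L * (24 * (4 * F + CD lamb B * (4 * F)) + 4 * F)) by (apply Rmult_lt_0_compat; lra). lra.
Qed.

(** The supremum over squares of side [2 * s ^ 8] makes the gap between [u] and the
    smoothed data contribute the oscillation [W] exactly once; this is what allows iterating. *)
Lemma holder_step (rad T' s F W : R) : 0 < F -> 0 < rad -> 0 < s <= / 4 -> T' + s ^ 4 <= T -> 0 <= W ->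
  (forall x y a, Rabs x <= rad + 3 -> Rabs y <= rad + 3 -> 0 <= a <= T -> Rabs (u x y a) <= F) ->
  osc u (rad + s) (T' + s ^ 4) (2 * s ^ 8) W -> osc u rad T' (s ^ 4) (holder_const F * s + W).
Proof.
  intros HF Hrad Hs HT HW HuF Hosc x0 y0 x' y' t Hx0 Hy0 Ht Hx' Hy'.
  assert (HB := ck_B _ _ _ _ _ Hok). assert (Hla := ck_lamb _ _ _ _ _ Hok).
  assert (HCD := CD_pos T lamb B L cf Hok). assert (HCs := Cs_pos).
  (* The balance of powers: [theta / rho^2 = s^8] makes the Gaussian tail outside the square
     negligible, [sqrt tau * ln (1 / theta)] is at most [24 s], and over the distance [tau] the
     gradient of order [1 / sqrt tau] produces [s^2]. *)
  set (rho := s ^ 8). set (tau := s ^ 4). set (theta := s ^ 24).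
  assert (Hrho : 0 < rho) by (apply pow_lt; lra). assert (Htau : 0 < tau) by (apply pow_lt; lra).
  assert (Hth : 0 < theta) by (apply pow_lt; lra).
  assert (Hrho1 : rho <= s) by (apply pow_le_base; [lra|lia]).
  assert (Htau1 : tau <= s) by (apply pow_le_base; [lra|lia]).
  assert (Hth1 : theta <= s) by (apply pow_le_base; [lra|lia]).
  assert (HFB : 0 < F * B) by nra.
  set (U := square_sup u rho (t + tau)).
  assert (HUF : forall x y, Rabs x <= rad + 2 -> Rabs y <= rad + 2 -> Rabs (U x y) <= F).
  { intros x y Hx Hy. unfold U. destruct (square_sup_spec u rho (t + tau) x y Hu Hrho) as [_ (v & w & Hv & Hw & ->)].
    apply HuF.
    - assert (A := proj1 (Rabs_shift _ _ _ _ Hx Hv)). lra.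
    - assert (A := proj1 (Rabs_shift _ _ _ _ Hy Hw)). lra.
    - fold tau in HT. lra. }
  destruct (trig_approx U (rad + 2) F s) as (l & L1 & L2); try lra; auto.
  { intros e He. apply square_sup_uniform; auto. }
  (* A parabola of this opening is at least [2 * F] off the square and absorbs the trivial bound
     there. *)
  set (D := 2 * F / rho ^ 2).
  assert (HD : 0 <= D) by (unfold D; left; apply Rdiv_lt_0_compat; [lra|apply pow_lt; auto]).
  assert (Hfar : forall v w, ~ (Rabs v <= rho /\ Rabs w <= rho) -> 2 * F <= D * (v ^ 2 + w ^ 2)).
  { intros v w Hn. assert (A := outside_square v w rho Hrho Hn).
    replace (2 * F) with (D * rho ^ 2) by (unfold D; field; lra). apply Rmult_le_compat_l; auto. }
  assert (Htail : 6 * D * (2 * B * theta) <= 24 * F * B * s).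
  { replace (6 * D * (2 * B * theta)) with (24 * F * B * s ^ 8) by (unfold D, rho, theta; field; lra).
    fold rho. replace (24 * F * B * rho) with (24 * (F * B) * rho) by ring.
    replace (24 * F * B * s) with (24 * (F * B) * s) by ring. apply Rmult_le_compat_l; lra. }
  assert (HB' : 0 <= T) by (fold tau in HT; lra).
  assert (Hll : lamb <= B) by (apply (lamb_le T lamb B L cf Hok); auto).
  assert (HQ : Qb lamb (2 * B) theta (lamb * theta) 0 (lamb * theta)).
  { intros a b. assert (A1 := pow2_ge_0 a). assert (A2 := pow2_ge_0 b).
    assert (0 <= theta * (a ^ 2 + b ^ 2)) by nra.
    replace (lamb * theta * a ^ 2 + 2 * 0 * a * b + lamb * theta * b ^ 2) with (lamb * (theta * (a ^ 2 + b ^ 2))) by ring.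
    replace (2 * B * theta * (a ^ 2 + b ^ 2)) with (2 * B * (theta * (a ^ 2 + b ^ 2))) by ring.
    split; [lra|]. apply Rmult_le_compat_r; lra. }
  assert (Hrad2 : forall x y, inbox x0 y0 x y -> Rabs x <= rad + 1 /\ Rabs y <= rad + 1).
  { intros x y [Hx Hy]. split.
    - replace x with (x0 + (x - x0)) by ring. apply (Rabs_shift x0 (x - x0) rad 1); auto.
    - replace y with (y0 + (y - y0)) by ring. apply (Rabs_shift y0 (y - y0) rad 1); auto. }
  assert (Hsh : forall x y v w, inbox x0 y0 x y -> Rabs v <= rho -> Rabs w <= rho ->
     Rabs (x + v) <= rad + 2 /\ Rabs (y + w) <= rad + 2).
  { intros x y v w Hi Hv Hw. destruct (Hrad2 x y Hi) as [A1 A2].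
    assert (C1 := proj1 (Rabs_shift _ _ _ _ A1 Hv)). assert (C2 := proj1 (Rabs_shift _ _ _ _ A2 Hw)). lra. }
  assert (HuF' : forall x y a, inbox x0 y0 x y -> t <= a <= t + tau -> Rabs (u x y a) <= F).
  { intros x y a Hi Ha. destruct (Hrad2 x y Hi) as [A1 A2]. apply HuF; try lra. fold tau in HT. lra. }
  set (V0 := V (lamb * theta) 0 (lamb * theta) l).
  (* The square about [(x + v, y + w)] contains [(x, y)], so [U] there is at least [u] at [(x, y)]:
     no oscillation is lost on this side. In [Hup] the supremum is attained at distance at most
     [2 * rho] in each coordinate, which costs [W]. *)
  assert (Hlow : forall x y, inbox x0 y0 x y -> u x y (t + tau) <= V0 x y + (1 + 24 * F * B) * s).
  { intros x y Hi. assert (A : u x y (t + tau) - s - 6 * D * (2 * B * theta) <= V0 x y); [|lra].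
    apply V_lower with (lamb := lamb); auto. intros v w.
    destruct (classic (Rabs v <= rho /\ Rabs w <= rho)) as [[Hv Hw]|Hn].
    - destruct (Hsh x y v w Hi Hv Hw) as [Hxv Hyw]. assert (C := L2 _ _ Hxv Hyw). apply Rabs_le_between in C.
      destruct (square_sup_spec u rho (t + tau) (x + v) (y + w) Hu Hrho) as [E _]. fold (U (x + v) (y + w)) in E.
      specialize (E (- v) (- w)). rewrite !Rabs_Ropp in E. specialize (E Hv Hw).
      replace (x + v + - v) with x in E by ring. replace (y + w + - w) with y in E by ring.
      assert (0 <= D * (v ^ 2 + w ^ 2)); [|lra].
      apply Rmult_le_pos; auto. assert (A1 := pow2_ge_0 v). assert (A2 := pow2_ge_0 w). lra.
    - specialize (Hfar v w Hn). assert (C := L1 (x + v) (y + w)). apply Rabs_le_between in C.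
      assert (E := HuF' x y (t + tau) Hi ltac:(lra)). apply Rabs_le_between in E. lra. }
  assert (Hup : forall x y, Rabs (x - x0) <= s -> Rabs (y - y0) <= s ->
     V0 x y <= u x y (t + tau) + W + (1 + 24 * F * B) * s).
  { intros x y Hx Hy. assert (Hi : inbox x0 y0 x y) by (split; lra).
    assert (A : V0 x y <= (u x y (t + tau) + W + s) + 6 * D * (2 * B * theta)); [|lra].
    apply V_upper with (lamb := lamb); auto. intros v w.
    destruct (classic (Rabs v <= rho /\ Rabs w <= rho)) as [[Hv Hw]|Hn].
    - destruct (Hsh x y v w Hi Hv Hw) as [Hxv Hyw]. assert (C := L2 _ _ Hxv Hyw). apply Rabs_le_between in C.
      destruct (square_sup_spec u rho (t + tau) (x + v) (y + w) Hu Hrho) as [_ (v' & w' & Hv' & Hw' & E)].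
      fold (U (x + v) (y + w)) in E.
      assert (Ho : Rabs (u (x + v + v') (y + w + w') (t + tau) - u x y (t + tau)) <= W).
      { apply Hosc.
        - replace x with (x0 + (x - x0)) by ring. apply (Rabs_shift x0 (x - x0) rad s); auto.
        - replace y with (y0 + (y - y0)) by ring. apply (Rabs_shift y0 (y - y0) rad s); auto.
        - fold tau. lra.
        - fold rho. replace (x + v + v' - x) with (v + v') by ring. eapply Rle_trans; [apply Rabs_triang|lra].
        - fold rho. replace (y + w + w' - y) with (w + w') by ring. eapply Rle_trans; [apply Rabs_triang|lra]. }
      apply Rabs_le_between in Ho.
      assert (0 <= D * (v ^ 2 + w ^ 2)); [|lra].
      apply Rmult_le_pos; auto. assert (A1 := pow2_ge_0 v). assert (A2 := pow2_ge_0 w). lra.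
    - specialize (Hfar v w Hn). assert (C := L1 (x + v) (y + w)). apply Rabs_le_between in C.
      assert (E := HuF' x y (t + tau) Hi ltac:(lra)). apply Rabs_le_between in E. lra. }
  (* The oscillation bound is used only for coordinates within [s] of the centre; farther out the
     quartic slack of [step_two_sided] takes over, at the price [K1 * tau^2 = 2 F s^4]. *)
  set (K1 := 2 * F / s ^ 4).
  assert (Hs4 : 0 < s ^ 4) by auto.
  assert (HK1 : 0 <= K1) by (unfold K1; left; apply Rdiv_lt_0_compat; lra).
  assert (HFBs : 0 < (1 + 24 * F * B) * s) by (apply Rmult_lt_0_compat; lra).
  destruct (step_two_sided T lamb B L cf u Hok Hu Hsub Hsup x0 y0 t tau theta F K1 (4 * F) 0
    ((1 + 24 * F * B) * s) (W + (1 + 24 * F * B) * s) l) as (p1 & p2 & p3 & N & HQp & HV);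
    auto; try lra; [fold tau in HT; lra| | |].
  { intros x y a Hi Ha. apply bounded_modulus; auto. lra. }
  { intros x y Hi. fold V0.
    assert (Hz : 0 <= K1 * ((x - x0) ^ 2 + (y - y0) ^ 2) ^ 2) by (apply Rmult_le_pos; auto; apply pow2_ge_0).
    assert (Hl1 := Hlow x y Hi). split; [|lra].
    destruct (classic (Rabs (x - x0) <= s /\ Rabs (y - y0) <= s)) as [[H1 H2]|Hn].
    - assert (Hu1 := Hup x y H1 H2). lra.
    - assert (A := outside_square _ _ s ltac:(lra) Hn).
      assert (A2 : s ^ 4 <= ((x - x0) ^ 2 + (y - y0) ^ 2) ^ 2).
      { replace (s ^ 4) with ((s ^ 2) ^ 2) by ring. apply pow_incr. split; auto. apply pow2_ge_0. }
      assert (A3 : 2 * F <= K1 * ((x - x0) ^ 2 + (y - y0) ^ 2) ^ 2).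
      { replace (2 * F) with (K1 * s ^ 4) by (unfold K1; field; lra). apply Rmult_le_compat_l; auto. }
      assert (A4 : Rabs (V0 x y) <= F) by (apply (V_bounded T lamb B L cf Hok l F theta); auto).
      assert (E := HuF' x y (t + tau) Hi ltac:(lra)). apply Rabs_le_between in E. apply Rabs_le_between in A4. lra. }
  set (E := step_err B L tau (2 * F + K1) (Thage (4 * F + CD lamb B * (4 * F)) 0 theta tau)
     + (1 + 24 * F * B) * s) in *.
  assert (HC4 : 0 < 4 * F + CD lamb B * (4 * F)) by nra.
  assert (HE : E <= Cs B L * (24 * (4 * F + CD lamb B * (4 * F)) + 4 * F) * s + (1 + 24 * F * B) * s).
  { unfold E, step_err. apply Rplus_le_compat_r. rewrite Rmult_assoc. apply Rmult_le_compat_l; [lra|].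
    assert (Hq : sqrt tau = s ^ 2).
    { unfold tau. replace (s ^ 4) with (Rsqr (s ^ 2)) by (unfold Rsqr; ring). apply sqrt_Rsqr. apply pow2_ge_0. }
    rewrite Hq.
    assert (Hlog := Thage_log (4 * F + CD lamb B * (4 * F)) theta tau HC4 Hth ltac:(lra)).
    assert (Hln1 : ln (tau + theta) <= 0) by (rewrite <- ln_1; apply ln_mono; lra).
    assert (Hln2 : - ln theta <= 24 / s).
    { unfold theta. rewrite ln_pow by lra. assert (A := neg_ln_le s ltac:(lra)).
      replace (INR 24) with 24 by (simpl; ring). unfold Rdiv. lra. }
    assert (H1 : Thage (4 * F + CD lamb B * (4 * F)) 0 theta tau <= (4 * F + CD lamb B * (4 * F)) * (24 / s)).
    { eapply Rle_trans; [exact Hlog|]. apply Rmult_le_compat_l; lra. }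
    assert (H2 : s ^ 2 * Thage (4 * F + CD lamb B * (4 * F)) 0 theta tau <= 24 * (4 * F + CD lamb B * (4 * F)) * s).
    { replace (24 * (4 * F + CD lamb B * (4 * F)) * s) with (s ^ 2 * ((4 * F + CD lamb B * (4 * F)) * (24 / s))) by (field; lra).
      apply Rmult_le_compat_l; auto. apply pow2_ge_0. }
    assert (H3 : (2 * F + K1) * tau ^ 2 <= 4 * F * s).
    { unfold K1, tau. replace ((2 * F + 2 * F / s ^ 4) * (s ^ 4) ^ 2) with (2 * F * s ^ 8 + 2 * F * s ^ 4) by (field; lra).
      fold rho. fold tau. assert (F * rho <= F * s) by (apply Rmult_le_compat_l; lra).
      assert (F * tau <= F * s) by (apply Rmult_le_compat_l; lra). lra. }
    lra. }
  assert (Hxb : forall z, Rabs z <= tau -> z ^ 2 <= tau ^ 2).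
  { intros z Hz. rewrite <- (pow2_abs z). apply pow_incr. split; auto. apply Rabs_pos. }
  assert (Hball : (x' - x0) ^ 2 + (y' - y0) ^ 2 <= tau).
  { assert (A1 := Hxb _ Hx'). assert (A2 := Hxb _ Hy'). assert (tau ^ 2 <= tau / 4) by nra. lra. }
  assert (Hball0 : (x0 - x0) ^ 2 + (y0 - y0) ^ 2 <= tau) by (rewrite !Rminus_diag; lra).
  assert (A1 := HV x' y' Hball). assert (A2 := HV x0 y0 Hball0).
  assert (HVl := V_lipschitz T lamb B L cf Hok l F (tau + theta) p1 p2 p3 x0 y0 x' y' HF ltac:(lra) HQp L1).
  assert (Hsq : s ^ 2 <= sqrt (tau + theta)).
  { replace (s ^ 2) with (sqrt tau).
    - apply sqrt_le_1_alt. lra.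
    - unfold tau. replace (s ^ 4) with (Rsqr (s ^ 2)) by (unfold Rsqr; ring). apply sqrt_Rsqr. apply pow2_ge_0. }
  set (dV := Rabs (V p1 p2 p3 l x' y' - V p1 p2 p3 l x0 y0)) in *.
  set (M := 2 * F + 4 * F * CD lamb B) in *.
  assert (HM : 0 < M) by (unfold M; nra).
  assert (HdV : dV <= 2 * M * s).
  { assert (Hs2 : 0 < s ^ 2) by (apply pow_lt; lra).
    assert (A3 : s ^ 2 * dV <= M * (2 * tau)).
    { apply Rle_trans with (sqrt (tau + theta) * dV).
      - apply Rmult_le_compat_r; auto. apply Rabs_pos.
      - eapply Rle_trans; [exact HVl|]. apply Rmult_le_compat_l; [lra|]. fold tau in Hx', Hy'. lra. }
    apply Rmult_le_reg_l with (s ^ 2); auto. eapply Rle_trans; [exact A3|].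
    unfold tau. replace (M * (2 * s ^ 4)) with (s ^ 2 * (2 * M * s ^ 2)) by ring.
    apply Rmult_le_compat_l; [lra|]. apply Rmult_le_compat_l; [lra|]. apply pow_le_base; [lra|lia]. }
  assert (A3 := Rle_abs (V p1 p2 p3 l x' y' - V p1 p2 p3 l x0 y0)).
  assert (A4 := Rle_abs (- (V p1 p2 p3 l x' y' - V p1 p2 p3 l x0 y0))). rewrite Rabs_Ropp in A4. fold dV in A3, A4.
  unfold holder_const. fold M. apply Rabs_le. lra.
Qed.
End Holder.

Lemma osc_mono (u : R -> R -> R -> R) (rad T' r r' W W' : R) :
  osc u rad T' r W -> r' <= r -> W <= W' -> osc u rad T' r' W'.
Proof.
  intros H Hr HW x y x' y' t Hx Hy Ht Hx' Hy'. apply Rle_trans with W; auto. apply H; auto; lra.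
Qed.

(** The exponent refers to the squared length. The constant is local in space and may blow up
    towards [T], where the data are only continuous. *)
Definition reg (u : R -> R -> R -> R) (T h : R) : Prop :=
  forall rad T', 0 < rad -> T' < T -> exists C, 0 <= C /\ forall x y v w t,
    Rabs x <= rad -> Rabs y <= rad -> 0 <= t <= T' -> 0 < v ^ 2 + w ^ 2 <= 1 ->
    Rabs (second_diff u x y t v w) <= C * Rpower (v ^ 2 + w ^ 2) h.

Section HolderReg.
Variables (T lamb B L : R) (cf : nat -> R -> R -> R -> R) (u : R -> R -> R -> R).
Hypothesis Hok : coef_ok T lamb B L cf.
Hypotheses (Hu : cont3 u) (Hsub : vsubc T cf u) (Hsup : vsubc T (flip cf) (fun x y t => - u x y t)).

(** The scale passes from [s] to [s' = 2 * s^2], for which [s'^4 = 16 * s^8] covers the distance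
    [2 * s^8] of [holder_step]. As [s' <= s / 2], the errors and the enlargements of the box and of
    the time interval are bounded by twice their first terms. *)
Lemma holder_iterate (Rad Tm F : R) (n : nat) : 0 < F -> Tm <= T ->
  (forall x y a, Rabs x <= Rad + 3 -> Rabs y <= Rad + 3 -> 0 <= a <= T -> Rabs (u x y a) <= F) ->
  forall rad T' s om, 0 < rad -> 0 < s <= / 4 -> rad + 2 * s <= Rad -> T' + 2 * s <= Tm -> 0 <= om ->
  osc u Rad Tm ((s / 2 ^ n) ^ 4) om ->
  osc u rad T' (s ^ 4) (2 * holder_const lamb B L F * s + om).
Proof.
  intros HF HTm HuF.
  assert (HC := holder_const_pos T lamb B L cf Hok F HF). set (C := holder_const lamb B L F) in *.
  induction n as [|n IH]; intros rad T' s om Hrad Hs H1 H2 Hom Ho.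
  - simpl in Ho. rewrite Rdiv_1_r in Ho. intros x y x' y' t Hx Hy Ht Hx' Hy'.
    apply Rle_trans with om; [|nra]. apply Ho; auto; lra.
  - set (s' := 2 * s ^ 2). assert (Hs' : 0 < s' <= s / 2) by (unfold s'; nra).
    assert (Hs4 : s ^ 4 <= s) by (apply pow_le_base; [lra|lia]).
    assert (HI : osc u (rad + s) (T' + s ^ 4) (s' ^ 4) (2 * C * s' + om)).
    { apply IH; auto; try lra. apply (osc_mono u _ _ _ _ om om Ho); [|lra].
      apply pow_incr. assert (H2n : 0 < 2 ^ n) by (apply pow_lt; lra).
      assert (Hi : 0 < / 2 ^ n) by (apply Rinv_0_lt_compat; auto). split.
      - apply Rmult_le_pos; lra.
      - simpl. replace (s / (2 * 2 ^ n)) with (s / 2 * / 2 ^ n) by (field; lra).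
        apply Rmult_le_compat_r; lra. }
    apply (osc_mono u rad T' (s ^ 4) _ (C * s + (2 * C * s' + om))); [|lra|nra].
    apply (holder_step T lamb B L cf u Hok Hu Hsub Hsup); auto; try lra.
    + assert (0 <= C * s') by (apply Rmult_le_pos; lra). lra.
    + intros x y a Hx Hy. apply HuF; lra.
    + apply (osc_mono u _ _ _ _ _ _ HI); [|lra].
      assert (0 < s ^ 8) by (apply pow_lt; lra). unfold s'. replace ((2 * s ^ 2) ^ 4) with (16 * s ^ 8) by ring. lra.
Qed.

(** Oscillation [O(s)] at distance [s^4] is the Hoelder exponent 1/4, that is 1/8 in the squared
    length. The remaining oscillation [om] is made small by uniform continuity after enough
    iterations. *)
Lemma holder_reg : 0 < T -> reg u T (1 / 8).
Proof.
  intros HT rad T' Hrad HT'. assert (Har := Rle_abs T').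
  set (Rad := rad + 1). set (Tm := (T + T') / 2).
  destruct (cont3_bounded u (Rad + 3 + T) Hu) as (F & HF & HuF).
  assert (HuF' : forall x y a, Rabs x <= Rad + 3 -> Rabs y <= Rad + 3 -> 0 <= a <= T -> Rabs (u x y a) <= F).
  { intros x y a Hx Hy Ha. apply HuF; try lra. rewrite Rabs_right by lra. unfold Rad. lra. }
  assert (HC := holder_const_pos T lamb B L cf Hok F HF). set (C := holder_const lamb B L F) in *.
  set (ds := Rmin (/ 4) ((T - T') / 4)). assert (Hd1 := Rmin_l (/ 4) ((T - T') / 4)).
  assert (Hd2 := Rmin_r (/ 4) ((T - T') / 4)). fold ds in Hd1, Hd2.
  assert (Hds : 0 < ds) by (apply Rmin_glb_lt; lra).
  assert (H4 : 0 < 4 * F / ds) by (apply Rdiv_lt_0_compat; lra).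
  exists (4 * C + 4 * F / ds). split; [lra|].
  intros x y v w t Hx Hy Ht Hq. set (q := v ^ 2 + w ^ 2) in *. set (s := Rpower q (1 / 8)).
  assert (Hs : 0 < s) by apply exp_pos.
  destruct (sq_le_abs v w 1 ltac:(lra) ltac:(fold q; lra)) as [Hv Hw].
  assert (Hp4 : 0 < C * s) by nra.
  destruct (Rle_dec s ds) as [Hsd|Hsd].
  - assert (Hs8 : (s ^ 4) ^ 2 = q).
    { replace ((s ^ 4) ^ 2) with (s ^ 8) by ring. unfold s.
      rewrite <- (Rpower_pow 8) by apply exp_pos. rewrite Rpower_mult.
      replace (1 / 8 * INR 8) with 1 by (simpl; lra). apply Rpower_1. lra. }
    assert (Hs4 : 0 < s ^ 4) by (apply pow_lt; auto).
    destruct (sq_le_abs v w (s ^ 4) ltac:(lra) ltac:(rewrite Hs8; fold q; lra)) as [Hv4 Hw4].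
    assert (Ho : forall om, 0 < om -> osc u rad T' (s ^ 4) (2 * C * s + om)).
    { intros om Hom.
      destruct (cont3_uniform u (Rad + T) om Hu Hom) as (d & Hd & Hun).
      destruct (pow_lt_1_zero (/ 2) ltac:(rewrite Rabs_right; lra) d Hd) as (n & Hn).
      specialize (Hn n (le_n _)). rewrite pow_inv in Hn.
      assert (H2n : 0 < / 2 ^ n) by (apply Rinv_0_lt_compat, pow_lt; lra). rewrite Rabs_right in Hn by lra.
      assert (H2n1 : / 2 ^ n <= 1).
      { rewrite <- Rinv_1. apply Rinv_le_contravar; [lra|]. apply pow_R1_Rle; lra. }
      apply (holder_iterate Rad Tm F n); auto; try lra; try (unfold Rad, Tm; lra).
      intros a b a' b' r Ha Hb Hr Ha' Hb'.
      assert (Hsm : (s / 2 ^ n) ^ 4 < d).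
      { apply Rle_lt_trans with (s / 2 ^ n).
        - apply pow_le_base; [|lia]. unfold Rdiv. split; [apply Rmult_le_pos; lra|].
          assert (s * / 2 ^ n <= 1 * 1) by (apply Rmult_le_compat; lra). lra.
        - unfold Rdiv. assert (s * / 2 ^ n <= 1 * / 2 ^ n) by (apply Rmult_le_compat_r; lra). lra. }
      left. apply Hun; try lra.
      - rewrite Rabs_right by lra. unfold Tm, Rad in *. lra.
      - rewrite Rminus_diag, Rabs_R0. auto. }
    apply Rle_trans with (4 * C * s); [|fold s; assert (0 <= 4 * F / ds * s) by (apply Rmult_le_pos; lra); lra].
    apply le_epsilon. intros e He.
    assert (Ho' := Ho (e / 2) ltac:(lra)).
    assert (E1 := Ho' x y (x + v) (y + w) t Hx Hy Ht).
    assert (E2 := Ho' x y (x - v) (y - w) t Hx Hy Ht).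
    replace (x + v - x) with v in E1 by ring. replace (y + w - y) with w in E1 by ring.
    replace (x - v - x) with (- v) in E2 by ring. replace (y - w - y) with (- w) in E2 by ring.
    rewrite !Rabs_Ropp in E2. specialize (E1 Hv4 Hw4). specialize (E2 Hv4 Hw4).
    apply Rabs_le_between in E1. apply Rabs_le_between in E2. unfold second_diff. apply Rabs_le. lra.
  - assert (Hb : Rabs (second_diff u x y t v w) <= 4 * F).
    { destruct (Rabs_shift x v rad 1 Hx Hv) as [X1 X2]. destruct (Rabs_shift y w rad 1 Hy Hw) as [Y1 Y2].
      assert (E1 := HuF' (x + v) (y + w) t ltac:(unfold Rad; lra) ltac:(unfold Rad; lra) ltac:(lra)).
      assert (E2 := HuF' (x - v) (y - w) t ltac:(unfold Rad; lra) ltac:(unfold Rad; lra) ltac:(lra)).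
      assert (E3 := HuF' x y t ltac:(unfold Rad; lra) ltac:(unfold Rad; lra) ltac:(lra)).
      apply Rabs_le_between in E1. apply Rabs_le_between in E2. apply Rabs_le_between in E3.
      unfold second_diff. apply Rabs_le. lra. }
    fold s. assert (4 * F <= 4 * F / ds * s); [|lra].
    replace (4 * F) with (4 * F / ds * ds) at 1 by (field; lra). apply Rmult_le_compat_l; lra.
Qed.
End HolderReg.

(** * Improvement of the exponent *)

Lemma wsum_line_derive (c : tm -> R) (l : list tm) (x y v w s : R) :
  is_derive (fun s => wsum c cos l (x + s * v) (y + s * w)) s
    (wsum (fun e => - (tk e * v + tl e * w) * c e) sin l (x + s * v) (y + s * w)) /\
  is_derive (fun s => wsum c sin l (x + s * v) (y + s * w)) s
    (wsum (fun e => (tk e * v + tl e * w) * c e) cos l (x + s * v) (y + s * w)).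
Proof.
  unfold wsum. induction l as [|e l [IH1 IH2]]; simpl.
  - split; auto_derive; auto.
  - assert (Ha : is_derive (fun s => ang e (x + s * v) (y + s * w)) s (tk e * v + tl e * w)).
    { unfold ang. auto_derive; auto. ring. }
    split.
    + apply (is_derive_plus (fun s => ta e * c e * cos (ang e (x + s * v) (y + s * w)))); auto.
      replace (ta e * (- (tk e * v + tl e * w) * c e) * sin (ang e (x + s * v) (y + s * w))) with
        (ta e * c e * ((tk e * v + tl e * w) * - sin (ang e (x + s * v) (y + s * w)))) by ring.
      apply (is_derive_scal (fun s => cos (ang e (x + s * v) (y + s * w)))).
      apply (is_derive_comp cos (fun s => ang e (x + s * v) (y + s * w))); auto. apply is_derive_cos.
    + apply (is_derive_plus (fun s => ta e * c e * sin (ang e (x + s * v) (y + s * w)))); auto.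
      replace (ta e * ((tk e * v + tl e * w) * c e) * cos (ang e (x + s * v) (y + s * w))) with
        (ta e * c e * ((tk e * v + tl e * w) * cos (ang e (x + s * v) (y + s * w)))) by ring.
      apply (is_derive_scal (fun s => sin (ang e (x + s * v) (y + s * w)))).
      apply (is_derive_comp sin (fun s => ang e (x + s * v) (y + s * w))); auto. apply is_derive_sin.
Qed.

Lemma V_line_derive2 (q1 q2 q3 : R) (l : list tm) (x y v w s : R) :
  exists g', (forall s, is_derive (fun s => V q1 q2 q3 l (x + s * v) (y + s * w)) s (g' s)) /\
  forall s, is_derive g' s (v ^ 2 * Vxx q1 q2 q3 l (x + s * v) (y + s * w)
    + 2 * v * w * Vxy q1 q2 q3 l (x + s * v) (y + s * w) + w ^ 2 * Vyy q1 q2 q3 l (x + s * v) (y + s * w)).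
Proof.
  exists (fun s => wsum (fun e => - (tk e * v + tl e * w) * hf q1 q2 q3 e) sin l (x + s * v) (y + s * w)).
  split; intros z.
  - apply wsum_line_derive.
  - unfold Vxx, Vxy, Vyy.
    replace (v ^ 2 * wsum (fun e => - tk e ^ 2 * hf q1 q2 q3 e) cos l (x + z * v) (y + z * w) +
       2 * v * w * wsum (fun e => - (tk e * tl e) * hf q1 q2 q3 e) cos l (x + z * v) (y + z * w) +
       w ^ 2 * wsum (fun e => - tl e ^ 2 * hf q1 q2 q3 e) cos l (x + z * v) (y + z * w)) with
     (wsum (fun e => (tk e * v + tl e * w) * (- (tk e * v + tl e * w) * hf q1 q2 q3 e)) cos l (x + z * v) (y + z * w)).
    + apply wsum_line_derive.
    + rewrite <- wsum_lin.
      rewrite <- (Rmult_1_l (wsum (fun e => v ^ 2 * _ + _) cos l _ _)), <- wsum_lin.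
      apply wsum_ext. intros e. ring.
Qed.

(** The mean value theorem for [g s + g (- s)] gives [g' c - g' (- c)], and a second application
    turns this into [2 c] times a value of [g'']. *)
Lemma second_diff_bound (g g' g'' : R -> R) (M : R) :
  (forall s, is_derive g s (g' s)) -> (forall s, is_derive g' s (g'' s)) ->
  (forall s, -1 <= s <= 1 -> Rabs (g'' s) <= M) -> Rabs (g 1 + g (-1) - 2 * g 0) <= 2 * M.
Proof.
  intros H1 H2 HM.
  destruct (MVT_gen (fun s => g s + g (- s)) 0 1 (fun s => g' s - g' (- s))) as (c & Hc & E).
  - intros s _. apply (is_derive_plus g (fun s => g (- s))); auto.
    replace (- g' (- s)) with ((-1) * g' (- s)) by ring.
    apply (is_derive_comp g (fun s => - s)); auto. auto_derive; auto.
  - intros s _. apply continuity_pt_plus. apply (derive_cont _ _ H1).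
    apply (continuity_pt_comp (fun s => - s) g). apply continuity_pt_opp, continuity_pt_id. apply (derive_cont _ _ H1).
  - rewrite Rmin_left, Rmax_right in Hc by lra. rewrite Ropp_0 in E.
    replace (- (1)) with (-1) in E by ring.
    destruct (MVT_gen g' (- c) c g'') as (d & Hd & E2).
    + intros; auto.
    + intros; apply (derive_cont _ _ H2).
    + rewrite Rmin_left, Rmax_right in Hd by lra. specialize (HM d ltac:(lra)).
      replace (g 1 + g (-1) - 2 * g 0) with (g'' d * (2 * c)) by lra.
      rewrite Rabs_mult, (Rabs_right (2 * c)) by lra. assert (A := Rabs_pos (g'' d)). nra.
Qed.

Lemma V_second_diff (q1 q2 q3 D x y v w : R) (l : list tm) :
  (forall x' y', Rabs (x' - x) <= Rabs v -> Rabs (y' - y) <= Rabs w ->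
     Rabs (Vxx q1 q2 q3 l x' y') <= D /\ Rabs (Vxy q1 q2 q3 l x' y') <= D /\ Rabs (Vyy q1 q2 q3 l x' y') <= D) ->
  Rabs (V q1 q2 q3 l (x + v) (y + w) + V q1 q2 q3 l (x - v) (y - w) - 2 * V q1 q2 q3 l x y) <= 4 * D * (v ^ 2 + w ^ 2).
Proof.
  intros H. destruct (V_line_derive2 q1 q2 q3 l x y v w 0) as (g' & G1 & G2).
  assert (A := second_diff_bound _ _ _ (2 * D * (v ^ 2 + w ^ 2)) G1 G2). cbv beta in A.
  replace (x + 1 * v) with (x + v) in A by ring. replace (y + 1 * w) with (y + w) in A by ring.
  replace (x + -1 * v) with (x - v) in A by ring. replace (y + -1 * w) with (y - w) in A by ring.
  rewrite !Rmult_0_l, !Rplus_0_r in A.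
  replace (4 * D * (v ^ 2 + w ^ 2)) with (2 * (2 * D * (v ^ 2 + w ^ 2))) by ring. apply A.
  intros s Hs. assert (Hs' : Rabs s <= 1) by (apply Rabs_le; auto).
  destruct (H (x + s * v) (y + s * w)) as (D1 & D2 & D3).
  - replace (x + s * v - x) with (s * v) by ring. rewrite Rabs_mult. assert (P := Rabs_pos v). nra.
  - replace (y + s * w - y) with (s * w) by ring. rewrite Rabs_mult. assert (P := Rabs_pos w). nra.
  - set (a := Vxx q1 q2 q3 l (x + s * v) (y + s * w)) in *. set (b := Vxy q1 q2 q3 l (x + s * v) (y + s * w)) in *.
    set (c := Vyy q1 q2 q3 l (x + s * v) (y + s * w)) in *.
    eapply Rle_trans; [apply Rabs_triang|]. eapply Rle_trans; [apply Rplus_le_compat_r, Rabs_triang|].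
    rewrite !Rabs_mult, (Rabs_right (v ^ 2)), (Rabs_right (w ^ 2)), (Rabs_right 2) by (try lra; apply Rle_ge, pow2_ge_0).
    rewrite <- (pow2_abs v), <- (pow2_abs w).
    assert (P1 := Rabs_pos v). assert (P2 := Rabs_pos w). set (p := Rabs v) in *. set (q := Rabs w) in *.
    assert (HD : 0 <= D) by (assert (Z := Rabs_pos a); lra).
    assert (B1 : p ^ 2 * Rabs a <= p ^ 2 * D) by (apply Rmult_le_compat_l; auto; apply pow2_ge_0).
    assert (B2 : 2 * p * q * Rabs b <= 2 * p * q * D) by (apply Rmult_le_compat_l; auto; apply Rmult_le_pos; lra).
    assert (B3 : q ^ 2 * Rabs c <= q ^ 2 * D) by (apply Rmult_le_compat_l; auto; apply pow2_ge_0).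
    assert (B4 : 0 <= D * (p - q) ^ 2) by (apply Rmult_le_pos; auto; apply pow2_ge_0).
    replace (2 * D * (p ^ 2 + q ^ 2)) with (D * (p - q) ^ 2 + (p ^ 2 * D + 2 * p * q * D + q ^ 2 * D)) by ring. lra.
Qed.

Lemma Rpower_le1 (q a b : R) : 0 < q <= 1 -> a <= b -> Rpower q b <= Rpower q a.
Proof.
  intros Hq Hab. apply exp_mono. assert (A : ln q <= 0) by (rewrite <- ln_1; apply ln_mono; lra). nra.
Qed.

Section Improve.
Variables (T lamb B L : R) (cf : nat -> R -> R -> R -> R) (u : R -> R -> R -> R).
Hypothesis Hok : coef_ok T lamb B L cf.
Hypothesis Hu : cont3 u.

Definition mod_const (F C : R) : R := C + 4 + 8 * F.
Definition step_const (F C h : R) : R :=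
  (1 + 12 * B) * mod_const F C + 2
   + Cs B L * (2 * (4 * F + CD lamb B * mod_const F C) / h + 2 * F).

(** The initial age [theta = tau ^ ((h + 1/2) / h)] makes the smoothing error [theta ^ h]
    as small as the error [sqrt tau * tau ^ h] of the step itself. *)
Lemma smooth_step (rad F C h tau t x0 y0 : R) : 0 < rad -> 0 < F -> 0 < h < 1 -> 0 <= C -> 0 < tau <= 1 ->
  0 <= t -> t + tau <= T -> Rabs x0 <= rad -> Rabs y0 <= rad ->
  (forall x y, Rabs x <= rad + 2 -> Rabs y <= rad + 2 -> Rabs (u x y (t + tau)) <= F) ->
  (forall x y v w, Rabs x <= rad + 1 -> Rabs y <= rad + 1 -> 0 < v ^ 2 + w ^ 2 <= 1 ->
     Rabs (second_diff u x y (t + tau) v w) <= C * Rpower (v ^ 2 + w ^ 2) h) ->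
  let err := step_const F C h * Rpower tau (h + / 2) in
  exists l p1 p2 p3 N theta, 0 < theta <= tau /\ Qb lamb (2 * B) (tau + theta) p1 p2 p3 /\
    (forall x y s, inbox x0 y0 x y -> theta <= s <= 2 -> modulus_at l x y (mod_const F C) h s) /\
    (forall w m, vsubc T cf w -> cont3 w ->
       (forall x y a, inbox x0 y0 x y -> t <= a <= t + tau -> w x y a <= F) -> 0 <= m ->
       (forall x y, inbox x0 y0 x y -> w x y (t + tau) <= u x y (t + tau) + m) ->
       forall x y, (x - x0) ^ 2 + (y - y0) ^ 2 <= tau -> w x y t <= V p1 p2 p3 l x y + N + m + err) /\
    (forall w m, vsubc T (flip cf) w -> cont3 w ->
       (forall x y a, inbox x0 y0 x y -> t <= a <= t + tau -> w x y a <= F) -> 0 <= m ->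
       (forall x y, inbox x0 y0 x y -> w x y (t + tau) <= - u x y (t + tau) + m) ->
       forall x y, (x - x0) ^ 2 + (y - y0) ^ 2 <= tau -> w x y t <= - V p1 p2 p3 l x y - N + m + err).
Proof.
  intros Hrad HF Hh HC Htau Ht HtT Hx0 Hy0 HuF Hreg err.
  assert (HB := ck_B _ _ _ _ _ Hok). assert (Hla := ck_lamb _ _ _ _ _ Hok).
  assert (HCD := CD_pos T lamb B L cf Hok). assert (HCs := Cs_pos T lamb B L cf Hok).
  assert (HCm : 0 < mod_const F C) by (unfold mod_const; lra). set (Cm := mod_const F C) in *.
  set (k := h + / 2). set (theta := Rpower tau (k / h)).
  assert (Hkh : 1 <= k / h).
  { apply Rmult_le_reg_r with h; [lra|]. unfold Rdiv. rewrite Rmult_assoc, Rinv_l by lra. unfold k. lra. }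
  assert (Hth : 0 < theta) by apply exp_pos.
  assert (Hth1 : theta <= tau).
  { unfold theta. rewrite <- (Rpower_1 tau) at 2 by lra. apply Rpower_le1; auto. }
  assert (Hthh : Rpower theta h = Rpower tau k).
  { unfold theta. rewrite Rpower_mult. f_equal. field. lra. }
  assert (HP : 0 < Rpower tau k) by apply exp_pos. set (P := Rpower tau k) in *.
  destruct (approx_modulus u (rad + 1) F h C (t + tau) theta Hu) as (l & L1 & L2 & L3); try lra; auto.
  { intros x y Hx Hy. apply HuF; lra. }
  fold (mod_const F C) in L3. fold Cm in L3.
  assert (Hrad2 : forall x y, inbox x0 y0 x y -> Rabs x <= rad + 1 /\ Rabs y <= rad + 1).
  { intros x y [Hx Hy]. split.
    - replace x with (x0 + (x - x0)) by ring. apply (Rabs_shift x0 (x - x0) rad 1); auto.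
    - replace y with (y0 + (y - y0)) by ring. apply (Rabs_shift y0 (y - y0) rad 1); auto. }
  assert (Hmod : forall x y s, inbox x0 y0 x y -> theta <= s <= 2 -> modulus_at l x y Cm h s).
  { intros x y s Hi Hs. destruct (Hrad2 x y Hi) as [A1 A2]. apply L3; auto. }
  assert (Hll : lamb <= B) by (apply (lamb_le T lamb B L cf Hok); lra).
  assert (HQ : Qb lamb (2 * B) theta (lamb * theta) 0 (lamb * theta)).
  { intros a b. assert (A1 := pow2_ge_0 a). assert (A2 := pow2_ge_0 b).
    assert (0 <= theta * (a ^ 2 + b ^ 2)) by nra.
    replace (lamb * theta * a ^ 2 + 2 * 0 * a * b + lamb * theta * b ^ 2) with (lamb * (theta * (a ^ 2 + b ^ 2))) by ring.
    replace (2 * B * theta * (a ^ 2 + b ^ 2)) with (2 * B * (theta * (a ^ 2 + b ^ 2))) by ring.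
    split; [lra|]. apply Rmult_le_compat_r; lra. }
  assert (Hini : forall x y, inbox x0 y0 x y ->
    Rabs (V (lamb * theta) 0 (lamb * theta) l x y - u x y (t + tau)) <= ((1 + 12 * B) * Cm + 1) * P).
  { intros x y Hi. destruct (Hrad2 x y Hi) as [A1 A2].
    assert (E1 := V_initial T lamb B L cf Hok l x y Cm h theta _ _ _ ltac:(lra) Hth HQ (Hmod x y theta Hi ltac:(lra))).
    assert (E2 := L2 x y ltac:(lra) ltac:(lra)). rewrite Hthh in E1, E2.
    replace (V (lamb * theta) 0 (lamb * theta) l x y - u x y (t + tau)) with
     ((V (lamb * theta) 0 (lamb * theta) l x y - ev l x y) + (ev l x y - u x y (t + tau))) by ring.
    eapply Rle_trans; [apply Rabs_triang|]. lra. }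
  destruct (step_estimate T lamb B L cf Hok x0 y0 (t + tau) tau theta F 0 Cm h P l) as (HTh & p1 & p2 & p3 & N & HQp & H1 & H2);
    auto; try lra.
  exists l, p1, p2, p3, N, theta. split; [lra|]. split; auto. split; auto.
  set (m0 := ((1 + 12 * B) * Cm + 1) * P) in *.
  assert (Hm0 : 0 < m0) by (apply Rmult_lt_0_compat; auto; nra).
  assert (Herr : m0 + step_err B L tau (2 * F + 0) (Thage (4 * F + CD lamb B * Cm) h theta tau) + P <= err).
  { unfold err, step_const. fold Cm. fold k. fold P.
    assert (HC4 : 0 < 4 * F + CD lamb B * Cm) by nra.
    assert (A := Thage_pow (4 * F + CD lamb B * Cm) h theta tau HC4 Hth Hh ltac:(lra)).
    assert (A2 : Rpower (tau + theta) h <= 2 * Rpower tau h).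
    { apply Rle_trans with (Rpower (2 * tau) h); [apply Rpower_mono; lra|].
      rewrite <- Rpower_mult_distr by lra. apply Rmult_le_compat_r; [left; apply exp_pos|].
      rewrite <- (Rpower_1 2) at 2 by lra. apply exp_mono.
      assert (0 < ln 2) by (rewrite <- ln_1; apply ln_increasing; lra). nra. }
    assert (Hsq : sqrt tau = Rpower tau (/ 2)) by (symmetry; apply Rpower_sqrt; lra).
    assert (HPs : sqrt tau * Rpower tau h = P).
    { rewrite Hsq, <- Rpower_plus. unfold P, k. f_equal. ring. }
    assert (Hsp : 0 < sqrt tau) by (apply sqrt_lt_R0; lra).
    assert (Ht2 : tau ^ 2 <= P).
    { rewrite <- (Rpower_pow 2) by lra. apply Rpower_le1; auto. unfold k. simpl. lra. }
    assert (A3 : sqrt tau * Thage (4 * F + CD lamb B * Cm) h theta tau <= 2 * (4 * F + CD lamb B * Cm) / h * P).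
    { rewrite <- HPs. replace (2 * (4 * F + CD lamb B * Cm) / h * (sqrt tau * Rpower tau h)) with
       (sqrt tau * ((4 * F + CD lamb B * Cm) / h * (2 * Rpower tau h))) by (field; lra).
      apply Rmult_le_compat_l; [lra|]. eapply Rle_trans; [exact A|]. apply Rmult_le_compat_l; auto.
      left; apply Rdiv_lt_0_compat; lra. }
    assert (A4 : (2 * F + 0) * tau ^ 2 <= 2 * F * P) by (rewrite Rplus_0_r; apply Rmult_le_compat_l; lra).
    unfold step_err.
    assert (A5 : Cs B L * (sqrt tau * Thage (4 * F + CD lamb B * Cm) h theta tau + (2 * F + 0) * tau ^ 2)
      <= Cs B L * ((2 * (4 * F + CD lamb B * Cm) / h + 2 * F) * P)).
    { apply Rmult_le_compat_l; [lra|]. rewrite Rmult_plus_distr_r. lra. }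
    unfold m0. lra. }
  assert (Ett : t + tau - tau = t) by ring.
  split.
  - intros w m Hw Hwc Hwb Hm Hwu x y Hr.
    assert (A := H1 w (m + m0) Hw Hwc). rewrite Ett in A.
    assert (A' : w x y t <= V p1 p2 p3 l x y + N + (m + m0) + step_err B L tau (2 * F + 0) (Thage (4 * F + CD lamb B * Cm) h theta tau) + P).
    { apply A; auto; try lra.
      - intros x' y' a Hi Ha. apply Hwb; auto. lra.
      - intros x' y' Hi. assert (E1 := Hini x' y' Hi). assert (E2 := Hwu x' y' Hi). apply Rabs_le_between in E1. lra. }
    lra.
  - intros w m Hw Hwc Hwb Hm Hwu x y Hr.
    assert (A := H2 w (m + m0) Hw Hwc). rewrite Ett in A.
    assert (A' : w x y t <= - V p1 p2 p3 l x y - N + (m + m0) + step_err B L tau (2 * F + 0) (Thage (4 * F + CD lamb B * Cm) h theta tau) + P).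
    { apply A; auto; try lra.
      - intros x' y' a Hi Ha. apply Hwb; auto. lra.
      - intros x' y' Hi. assert (E1 := Hini x' y' Hi). assert (E2 := Hwu x' y' Hi). apply Rabs_le_between in E1. lra. }
    lra.
Qed.

Hypotheses (Hsub : vsubc T cf u) (Hsup : vsubc T (flip cf) (fun x y t => - u x y t)).

(** With [q] the squared length of the increment, the time step [q ^ (2/3)] balances the two errors. *)
Lemma reg_improve (h : R) : 0 < h < 1 -> 0 < T -> reg u T h -> reg u T ((1 + 2 * h) / 3).
Proof.
  intros Hh HT Hreg rad T' Hrad HT'. assert (HB := ck_B _ _ _ _ _ Hok).
  assert (HCD := CD_pos T lamb B L cf Hok).
  set (Tm := (T + T') / 2).
  destruct (Hreg (rad + 1) Tm ltac:(lra) ltac:(unfold Tm; lra)) as (C & HC & HR).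
  destruct (cont3_bounded u (rad + 2 + T) Hu) as (F & HF & HuF).
  assert (HuF' : forall x y a, Rabs x <= rad + 2 -> Rabs y <= rad + 2 -> 0 <= a <= T -> Rabs (u x y a) <= F).
  { intros x y a Hx Hy Ha. apply HuF; try lra. rewrite Rabs_right by lra. lra. }
  set (h' := (1 + 2 * h) / 3). set (tau0 := Rmin 1 ((T - T') / 2)).
  assert (Ht01 := Rmin_l 1 ((T - T') / 2)). assert (Ht02 := Rmin_r 1 ((T - T') / 2)). fold tau0 in Ht01, Ht02.
  assert (Ht0 : 0 < tau0) by (apply Rmin_glb_lt; lra).
  assert (HCm : 0 < mod_const F C) by (unfold mod_const; lra).
  set (P0 := Rpower tau0 (h + / 2)). assert (HP0 : 0 < P0) by apply exp_pos.
  set (Sc := step_const F C h).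
  assert (HSc : 0 <= Sc).
  { unfold Sc, step_const. assert (HCs := Cs_pos T lamb B L cf Hok).
    assert (0 < (4 * F + CD lamb B * mod_const F C)) by nra.
    assert (0 < 2 * (4 * F + CD lamb B * mod_const F C) / h) by (apply Rdiv_lt_0_compat; lra).
    assert (0 < (1 + 12 * B) * mod_const F C) by (apply Rmult_lt_0_compat; lra).
    assert (0 <= Cs B L * (2 * (4 * F + CD lamb B * mod_const F C) / h + 2 * F)) by (apply Rmult_le_pos; lra). lra. }
  assert (H4P : 0 < 4 * F / P0) by (apply Rdiv_lt_0_compat; lra).
  assert (HCC : 0 < CD lamb B * mod_const F C) by nra.
  exists (4 * (CD lamb B * mod_const F C) + 4 * Sc + 4 * F / P0). split; [lra|].
  intros x y v w t Hx Hy Ht Hq. set (q := v ^ 2 + w ^ 2) in *.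
  destruct (sq_le_abs v w 1 ltac:(lra) ltac:(fold q; lra)) as [Hv Hw].
  (* For this choice [tau^(h + 1/2)] and [tau^(h - 1) * q] both equal [q^h']. *)
  set (tau := Rpower q (2 / 3)). assert (Htau : 0 < tau) by apply exp_pos.
  assert (Htau1 : tau <= 1).
  { unfold tau. rewrite <- (Rpower_O q) by lra. apply Rpower_le1; lra. }
  assert (HP : Rpower tau (h + / 2) = Rpower q h').
  { unfold tau. rewrite Rpower_mult. f_equal. unfold h'. field. }
  assert (HPq : 0 < Rpower q h') by apply exp_pos.
  destruct (Rle_dec tau tau0) as [Htt|Htt].
  - assert (HtT : t + tau <= Tm) by (unfold Tm; lra).
    assert (HtT2 : t + tau <= T) by (unfold Tm in HtT; lra).
    destruct (smooth_step rad F C h tau t x y) as (l & p1 & p2 & p3 & N & theta & Hth & HQp & Hmod & S1 & S2);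
      auto; try lra.
    { intros x' y' Hx' Hy'. apply HuF'; auto. unfold Tm in HtT. lra. }
    { intros x' y' v' w' Hx' Hy' Hvw. apply HR; auto. lra. }
    rewrite HP in S1, S2. fold Sc in S1, S2.
    assert (Hbox : forall x' y' a, inbox x y x' y' -> t <= a <= t + tau -> Rabs (u x' y' a) <= F).
    { intros x' y' a [Hx' Hy'] Ha. apply HuF'.
      - replace x' with (x + (x' - x)) by ring. assert (Z := proj1 (Rabs_shift x (x' - x) rad 1 Hx Hx')). lra.
      - replace y' with (y + (y' - y)) by ring. assert (Z := proj1 (Rabs_shift y (y' - y) rad 1 Hy Hy')). lra.
      - unfold Tm in HtT. lra. }
    assert (Hup : forall x' y', (x' - x) ^ 2 + (y' - y) ^ 2 <= tau -> u x' y' t <= V p1 p2 p3 l x' y' + N + 0 + Sc * Rpower q h').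
    { apply S1; auto; try lra.
      - intros x' y' a Hi Ha. assert (Z := Hbox x' y' a Hi Ha). apply Rabs_le_between in Z. lra.
      - intros; cbv beta; lra. }
    assert (Hlo : forall x' y', (x' - x) ^ 2 + (y' - y) ^ 2 <= tau -> - u x' y' t <= - V p1 p2 p3 l x' y' - N + 0 + Sc * Rpower q h').
    { apply (S2 (fun x y t => - u x y t)); auto; try lra.
      - apply (cont3_ext (fun x y t => (-1) * u x y t)); [intros; ring|]. apply cont3_scal; auto.
      - intros x' y' a Hi Ha. assert (Z := Hbox x' y' a Hi Ha). apply Rabs_le_between in Z. lra.
      - intros; cbv beta; lra. }
    assert (Hqt : q <= tau).
    { unfold tau. rewrite <- (Rpower_1 q) at 1 by lra. apply Rpower_le1; lra. }
    assert (B1 : (x + v - x) ^ 2 + (y + w - y) ^ 2 <= tau).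
    { replace ((x + v - x) ^ 2 + (y + w - y) ^ 2) with q by (unfold q; ring). auto. }
    assert (B2 : (x - v - x) ^ 2 + (y - w - y) ^ 2 <= tau).
    { replace ((x - v - x) ^ 2 + (y - w - y) ^ 2) with q by (unfold q; ring). auto. }
    assert (B3 : (x - x) ^ 2 + (y - y) ^ 2 <= tau) by (rewrite !Rminus_diag; lra).
    assert (HV := V_second_diff p1 p2 p3 (CD lamb B * mod_const F C * Rpower tau (h - 1)) x y v w l).
    assert (HVb : Rabs (V p1 p2 p3 l (x + v) (y + w) + V p1 p2 p3 l (x - v) (y - w) - 2 * V p1 p2 p3 l x y)
       <= 4 * (CD lamb B * mod_const F C) * Rpower q h').
    { replace (4 * (CD lamb B * mod_const F C) * Rpower q h') with
        (4 * (CD lamb B * mod_const F C * Rpower tau (h - 1)) * (v ^ 2 + w ^ 2)).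
      - apply HV. intros x' y' Hx' Hy'.
        assert (Hi : inbox x y x' y') by (split; lra).
        assert (Hs : 0 < tau + theta) by lra.
        destruct (D2_from_modulus T lamb B L cf Hok l x' y' (mod_const F C) h (tau + theta) p1 p2 p3 ltac:(lra) Hs HQp
          (Hmod x' y' (tau + theta) Hi ltac:(lra))) as (E1 & E2 & E3).
        assert (E4 : CD lamb B * mod_const F C * Rpower (tau + theta) (h - 1) <= CD lamb B * mod_const F C * Rpower tau (h - 1)).
        { apply Rmult_le_compat_l; [lra|]. apply Rpower_anti; lra. }
        repeat split; lra.
      - fold q. assert (Eq : Rpower q h' = Rpower tau (h - 1) * q).
        { unfold tau. rewrite Rpower_mult. rewrite <- (Rpower_1 q) at 3 by lra. rewrite <- Rpower_plus.
          f_equal. unfold h'. field. }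
        rewrite Eq. ring. }
    assert (U1 := Hup _ _ B1). assert (U2 := Hup _ _ B2). assert (U3 := Hup _ _ B3).
    assert (O1 := Hlo _ _ B1). assert (O2 := Hlo _ _ B2). assert (O3 := Hlo _ _ B3).
    assert (0 <= 4 * F / P0 * Rpower q h') by (apply Rmult_le_pos; lra).
    apply Rabs_le_between in HVb. unfold second_diff. apply Rabs_le. lra.
  (* Here [q] is bounded below, so the trivial bound suffices at the expense of [4 * F / P0] in the
     constant. *)
  - assert (Hb : Rabs (second_diff u x y t v w) <= 4 * F).
    { destruct (Rabs_shift x v rad 1 Hx Hv) as [X1 X2]. destruct (Rabs_shift y w rad 1 Hy Hw) as [Y1 Y2].
      assert (E1 := HuF' (x + v) (y + w) t ltac:(lra) ltac:(lra) ltac:(lra)).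
      assert (E2 := HuF' (x - v) (y - w) t ltac:(lra) ltac:(lra) ltac:(lra)).
      assert (E3 := HuF' x y t ltac:(lra) ltac:(lra) ltac:(lra)).
      apply Rabs_le_between in E1. apply Rabs_le_between in E2. apply Rabs_le_between in E3.
      unfold second_diff. apply Rabs_le. lra. }
    assert (HPP : P0 <= Rpower q h') by (rewrite <- HP; apply Rpower_mono; lra).
    assert (4 * F <= 4 * F / P0 * Rpower q h').
    { replace (4 * F) with (4 * F / P0 * P0) at 1 by (field; lra). apply Rmult_le_compat_l; lra. }
    assert (0 <= (4 * (CD lamb B * mod_const F C) + 4 * Sc) * Rpower q h') by (apply Rmult_le_pos; lra).
    lra.
Qed.
End Improve.

(** The map [h -> (1 + 2 h) / 3] sends 1/8 to 5/12 and 5/12 to 11/18, the first value above the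
    threshold 1/2. *)
Lemma reg_c1alpha (T lamb B L : R) (cf : nat -> R -> R -> R -> R) (u : R -> R -> R -> R) :
  coef_ok T lamb B L cf -> cont3 u -> vsubc T cf u -> vsubc T (flip cf) (fun x y t => - u x y t) -> 0 < T ->
  reg u T (11 / 18).
Proof.
  intros Hok Hu H1 H2 HT.
  assert (R0 := holder_reg T lamb B L cf u Hok Hu H1 H2 HT).
  assert (R1 := reg_improve T lamb B L cf u Hok Hu H1 H2 (1 / 8) ltac:(lra) HT R0).
  replace ((1 + 2 * (1 / 8)) / 3) with (5 / 12) in R1 by field.
  assert (R2 := reg_improve T lamb B L cf u Hok Hu H1 H2 (5 / 12) ltac:(lra) HT R1).
  replace ((1 + 2 * (5 / 12)) / 3) with (11 / 18) in R2 by field. exact R2.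
Qed.

(** * Comparison *)

Definition log_coef (r rho alpha : R) (mu sigma a b : R -> R -> R) (i : nat) (x y t : R) : R :=
  match i with
  | 0 => (sigma (exp x) t) ^ 2
  | 1 => rho * sigma (exp x) t * b (exp y) t
  | 2 => (b (exp y) t) ^ 2
  | 3 => mut r rho mu sigma a b (exp x) (exp y) t - / 2 * (sigma (exp x) t) ^ 2
  | 4 => r - / 2 * (b (exp y) t) ^ 2
  | _ => alpha * sqrt (1 - rho ^ 2) * sigma (exp x) t
  end.

Lemma product_abs_le (p q P Q : R) : Rabs p <= P -> Rabs q <= Q -> Rabs (p * q) <= P * Q.
Proof. intros H1 H2. rewrite Rabs_mult. apply Rmult_le_compat; auto; apply Rabs_pos. Qed.

Lemma product_diff_le (p q p' q' M d e : R) : Rabs p <= M -> Rabs q' <= M ->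
  Rabs (p - p') <= d -> Rabs (q - q') <= e -> Rabs (p * q - p' * q') <= M * (d + e).
Proof.
  intros H1 H2 H3 H4. replace (p * q - p' * q') with (p * (q - q') + (p - p') * q') by ring.
  eapply Rle_trans; [apply Rabs_triang|].
  assert (A := product_abs_le _ _ _ _ H1 H4). assert (B := product_abs_le _ _ _ _ H3 H2). lra.
Qed.

Lemma log_coef_ok (T r rho alpha : R) (mu sigma a b : R -> R -> R) (g : R -> R) :
  0 < T -> 0 <= r -> -1 <= rho <= 1 -> 0 <= alpha -> standing T r rho mu sigma a b g ->
  exists lamb B L, coef_ok T lamb B L (log_coef r rho alpha mu sigma a b).
Proof.
  intros HT Hr Hrho Hal ((C1 & C2 & C3 & C4 & HC1 & HC2 & HC3 & HC4 & Ls & _ & Lb & _) & (K & C5 & HK & HC5 & _ & Lm & _) & _ &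
    (M & HM & Hbd) & (delta & Hdel & Hell)).
  assert (HG : forall x y t, 0 <= t <= T -> inG T (exp x) (exp y) t) by (intros; split; [|split]; auto; apply exp_pos).
  assert (Bd : forall x y t, 0 <= t <= T -> Rabs (mu (exp x) t) <= M /\ Rabs (sigma (exp x) t) <= M /\
    Rabs (a (exp y) t) <= M /\ Rabs (b (exp y) t) <= M) by (intros; apply Hbd; auto).
  (* Ellipticity tested at [(0, 1)] gives [b^2 >= delta], which controls the quotient in the
     drift. *)
  set (be := sqrt delta). assert (Hbe : 0 < be) by (apply sqrt_lt_R0; auto).
  assert (Hb : forall y t, 0 <= t <= T -> be <= Rabs (b (exp y) t)).
  { intros y t Ht. assert (E := Hell _ _ _ 0 1 (HG 0 y t Ht)). unfold be.
    rewrite <- sqrt_Rsqr_abs. apply sqrt_le_1_alt. unfold Rsqr. lra. }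
  assert (Hc : 0 <= sqrt (1 - rho ^ 2) <= 1).
  { split; [apply sqrt_pos|]. apply Rle_trans with (sqrt 1); [|rewrite sqrt_1; lra].
    apply sqrt_le_1_alt. assert (Z := pow2_ge_0 rho). lra. }
  assert (Hrho' : Rabs rho <= 1) by (apply Rabs_le; lra).
  assert (Hmut : forall x y t, 0 <= t <= T -> Rabs (mut r rho mu sigma a b (exp x) (exp y) t) <= M + (M + r) * M / be).
  { intros x y t Ht. destruct (Bd x y t Ht) as (B1 & B2 & B3 & B4). unfold mut.
    unfold Rminus at 1. eapply Rle_trans; [apply Rabs_triang|]. rewrite Rabs_Ropp. apply Rplus_le_compat; auto.
    assert (E1 : Rabs (a (exp y) t - r) <= M + r).
    { unfold Rminus. eapply Rle_trans; [apply Rabs_triang|]. rewrite Rabs_Ropp, (Rabs_right r) by lra. lra. }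
    assert (E2 := product_abs_le _ _ _ _ (product_abs_le _ _ _ _ E1 Hrho') B2).
    rewrite Rmult_1_r in E2. unfold Rdiv. apply product_abs_le; auto. rewrite Rabs_inv.
    apply Rinv_le_contravar; auto. }
  assert (HMb : 0 <= (M + r) * M / be).
  { apply Rmult_le_pos; [apply Rmult_le_pos; lra|]. left; apply Rinv_0_lt_compat; auto. }
  assert (HMM : 0 <= M * M) by nra.
  assert (HaM : 0 <= alpha * M) by nra.
  assert (Hsq : forall p, Rabs p <= M -> Rabs (p ^ 2) <= M * M).
  { intros p Hp. replace (p ^ 2) with (p * p) by ring. apply product_abs_le; auto. }
  assert (HMC1 : 0 < M * C1) by nra. assert (HMC3 : 0 < M * C3) by nra. assert (HaC : 0 <= alpha * C1) by nra.
  (* Each constant is a sum large enough for all six coefficients at once. *)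
  exists delta, (M + (M + r) * M / be + M * M + r + alpha * M), (2 * (M * C1) + 2 * (M * C3) + C5 + alpha * C1).
  constructor; auto; try lra.
  - intros i x y t Hi Ht. destruct (Bd x y t Ht) as (B1 & B2 & B3 & B4).
    assert (Q1 := Hsq _ B2). assert (Q2 := Hsq _ B4). assert (Q3 := Hmut x y t Ht).
    apply Rabs_le_between in Q3.
    assert (Q1' := Q1). assert (Q2' := Q2). apply Rabs_le_between in Q1', Q2'.
    destruct i as [|[|[|[|[|[|i]]]]]]; try lia; cbn [log_coef].
    + lra.
    + assert (E := product_abs_le _ _ _ _ (product_abs_le _ _ _ _ Hrho' B2) B4). lra.
    + lra.
    + apply Rabs_le. lra.
    + apply Rabs_le. lra.
    + assert (E1 : Rabs (alpha * sqrt (1 - rho ^ 2)) <= alpha * 1).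
      { rewrite Rabs_right; [|apply Rle_ge, Rmult_le_pos; lra]. apply Rmult_le_compat_l; lra. }
      assert (E := product_abs_le _ _ _ _ E1 B2). lra.
  - intros i x y x' y' t Hi Ht. destruct (Bd x y t Ht) as (B1 & B2 & B3 & B4).
    destruct (Bd x' y' t Ht) as (B1' & B2' & B3' & B4').
    assert (D1 := Ls (exp x) (exp x') t (exp_pos _) (exp_pos _) Ht).
    assert (D2 := Lb (exp y) (exp y') t (exp_pos _) (exp_pos _) Ht).
    assert (D3 := Lm _ _ _ _ _ (HG x y t Ht) (HG x' y' t Ht)). rewrite (ln_exp x), (ln_exp x') in D1, D3. rewrite (ln_exp y), (ln_exp y') in D2, D3.
    assert (X := Rabs_pos (x - x')). assert (Y := Rabs_pos (y - y')).
    set (dx := Rabs (x - x')) in *. set (dy := Rabs (y - y')) in *.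
    assert (Q1 : Rabs (sigma (exp x) t ^ 2 - sigma (exp x') t ^ 2) <= 2 * (M * C1 * dx)).
    { replace (sigma (exp x) t ^ 2 - sigma (exp x') t ^ 2) with (sigma (exp x) t * sigma (exp x) t - sigma (exp x') t * sigma (exp x') t) by ring.
      assert (Z := product_diff_le _ _ _ _ _ _ _ B2 B2' D1 D1). lra. }
    assert (Q2 : Rabs (b (exp y) t ^ 2 - b (exp y') t ^ 2) <= 2 * (M * C3 * dy)).
    { replace (b (exp y) t ^ 2 - b (exp y') t ^ 2) with (b (exp y) t * b (exp y) t - b (exp y') t * b (exp y') t) by ring.
      assert (Z := product_diff_le _ _ _ _ _ _ _ B4 B4' D2 D2). lra. }
    assert (P1 : 0 <= M * C1 * dx) by nra. assert (P2 : 0 <= M * C1 * dy) by nra.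
    assert (P3 : 0 <= M * C3 * dx) by nra. assert (P4 : 0 <= M * C3 * dy) by nra.
    assert (P5 : 0 <= C5 * dx) by nra. assert (P6 : 0 <= C5 * dy) by nra.
    assert (P7 : 0 <= alpha * C1 * dx) by nra. assert (P8 : 0 <= alpha * C1 * dy) by nra.
    assert (Q1' := Q1). assert (Q2' := Q2). apply Rabs_le_between in Q1', Q2'. apply Rabs_le_between in D3.
    destruct i as [|[|[|[|[|[|i]]]]]]; try lia; cbn [log_coef].
    + lra.
    + replace (rho * sigma (exp x) t * b (exp y) t - rho * sigma (exp x') t * b (exp y') t) with
        (rho * (sigma (exp x) t * b (exp y) t - sigma (exp x') t * b (exp y') t)) by ring.
      assert (Z := product_abs_le _ _ _ _ Hrho' (product_diff_le _ _ _ _ _ _ _ B2 B4' D1 D2)). lra.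
    + lra.
    + apply Rabs_le. lra.
    + apply Rabs_le. lra.
    + rewrite <- Rmult_minus_distr_l.
      assert (E1 : Rabs (alpha * sqrt (1 - rho ^ 2)) <= alpha * 1).
      { rewrite Rabs_right; [|apply Rle_ge, Rmult_le_pos; lra]. apply Rmult_le_compat_l; lra. }
      assert (E := product_abs_le _ _ _ _ E1 D1). lra.
  - intros x y t u v Ht. cbn [log_coef]. assert (E := Hell _ _ _ u v (HG x y t Ht)). lra.
Qed.

(** The ordering of the parameters enters here: [sigma] is positive, so raising [alpha] adds a
    nonnegative term to the right side of the subsolution inequality. *)
Lemma log_sub_coef (T r rho alpha1 alpha2 : R) (mu sigma a b : R -> R -> R) (g : R -> R) (P : R -> R -> R -> R) :
  (forall S t, 0 < S -> 0 <= t <= T -> 0 < sigma S t) -> alpha1 <= alpha2 ->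
  visc_solution T r rho mu sigma a b g alpha1 P ->
  vsubc T (log_coef r rho alpha2 mu sigma a b) (logw T r P).
Proof.
  intros Hs Hal (_ & Hsub & _) F Fx Fy Ft Fxx Fxy Fyy x y t HF Ht Htouch.
  assert (H := log_sub T r rho alpha1 mu sigma a b P Hsub F Fx Fy Ft Fxx Fxy Fyy x y t HF Ht Htouch).
  cbn [log_coef]. cbv beta in H. eapply Rle_trans; [exact H|]. apply Rplus_le_compat_l.
  apply Rmult_le_compat_r; [apply Rabs_pos|].
  apply Rmult_le_compat_r; [left; apply Hs; [apply exp_pos|lra]|].
  apply Rmult_le_compat_r; auto. apply sqrt_pos.
Qed.

Lemma log_super_coef (T r rho alpha : R) (mu sigma a b : R -> R -> R) (g : R -> R) (P : R -> R -> R -> R) :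
  visc_solution T r rho mu sigma a b g alpha P ->
  vsubc T (flip (log_coef r rho alpha mu sigma a b)) (fun x y t => - logw T r P x y t).
Proof. intros (_ & _ & Hsup & _). exact (log_super T r rho alpha mu sigma a b P Hsup). Qed.

(** Hyperbolic cosines outgrow every power of [|x| + |y|], whatever the exponent [k] in [classC];
    their derivatives are bounded by the functions themselves, which an exponential rate in time can
    compensate. *)
Definition growth (K T x y t : R) : R := exp (K * (T - t)) * ((exp x + exp (- x)) + (exp y + exp (- y))).

Lemma growth_smooth (K T : R) :
  smooth3 (growth K T) (fun x y t => exp (K * (T - t)) * (exp x - exp (- x)))
    (fun x y t => exp (K * (T - t)) * (exp y - exp (- y))) (fun x y t => - K * growth K T x y t)
    (fun x y t => exp (K * (T - t)) * (exp x + exp (- x))) (fun _ _ _ => 0)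
    (fun x y t => exp (K * (T - t)) * (exp y + exp (- y))).
Proof.
  assert (D1 : forall z : R, is_derive (fun _ : R => 1) z 0) by (intros; apply (is_derive_const 1)).
  assert (D0 : forall z : R, is_derive (fun _ : R => 0) z 0) by (intros; apply (is_derive_const 0)).
  assert (C0 : forall z : R, continuity_pt (fun _ => 0) z) by (intros; apply continuity_pt_const; intros ? ?; auto).
  assert (Dc : forall z, is_derive (fun z => exp z + exp (- z)) z (exp z - exp (- z))) by (intros; auto_derive; auto; ring).
  assert (Ds : forall z, is_derive (fun z => exp z - exp (- z)) z (exp z + exp (- z))) by (intros; auto_derive; auto; ring).
  assert (De : forall z, is_derive (fun t => exp (K * (T - t))) z (- K * exp (K * (T - z)))) by (intros; auto_derive; auto; unfold Rminus; ring).
  assert (Ce : forall z, continuity_pt (fun t => - K * exp (K * (T - t))) z).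
  { intros z. apply (continuity_pt_scal (fun t => exp (K * (T - t)))). apply (derive_cont _ _ De). }
  assert (A1 := smooth3_prod _ _ _ _ _ _ _ _ Dc Ds (derive_cont _ _ Dc) D1 D0 C0 De Ce).
  assert (A2 := smooth3_prod _ _ _ _ _ _ _ _ D1 D0 C0 Dc Ds (derive_cont _ _ Dc) De Ce).
  assert (A := smooth3_lin 1 1 _ _ _ _ _ _ _ _ _ _ _ _ _ _ A1 A2).
  eapply smooth3_ext; [| | | | | | |exact A]; intros; cbv beta; unfold growth; ring.
Qed.

Lemma growth_ge (K T x y t : R) : 0 <= K -> t <= T -> exp x + exp (- x) + (exp y + exp (- y)) <= growth K T x y t.
Proof.
  intros HK Ht. unfold growth. assert (A := exp_ineq1_le (K * (T - t))). assert (0 <= K * (T - t)) by nra.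
  assert (E1 := exp_pos x). assert (E2 := exp_pos (- x)). assert (E3 := exp_pos y). assert (E4 := exp_pos (- y)). nra.
Qed.

(** The rate [3 * B] makes [growth] a supersolution of the linear bound of the operator. *)
Lemma vsubc_growth (T lamb B L eta : R) (cf : nat -> R -> R -> R -> R) (w : R -> R -> R -> R) :
  coef_ok T lamb B L cf -> 0 <= eta -> vsubc T cf w ->
  vsubc T cf (fun x y t => w x y t - eta * growth (3 * B) T x y t).
Proof.
  intros Hok Heta Hw F Fx Fy Ft Fxx Fxy Fyy x y t HF Ht (del & Hdel & Hm).
  assert (HB := ck_B _ _ _ _ _ Hok).
  assert (HS := smooth3_lin 1 eta _ _ _ _ _ _ _ _ _ _ _ _ _ _ HF (growth_smooth (3 * B) T)).
  assert (H := Hw _ _ _ _ _ _ _ x y t HS Ht). cbv beta in H.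
  assert (H' : exists del, 0 < del /\ forall x' y' t', Rabs (x' - x) < del -> Rabs (y' - y) < del ->
     Rabs (t' - t) < del -> w x' y' t' - (1 * F x' y' t' + eta * growth (3 * B) T x' y' t') <=
       w x y t - (1 * F x y t + eta * growth (3 * B) T x y t)).
  { exists del. split; auto. intros x' y' t' Hx' Hy' Ht'. specialize (Hm x' y' t' Hx' Hy' Ht'). cbv beta in Hm. lra. }
  specialize (H H'). clear H' Hm HS.
  assert (E0 : 0 < exp (3 * B * (T - t))) by apply exp_pos. unfold growth in H. set (e := exp (3 * B * (T - t))) in *.
  assert (E1 := exp_pos x). assert (E2 := exp_pos (- x)). assert (E3 := exp_pos y). assert (E4 := exp_pos (- y)).
  set (cx := exp x + exp (- x)) in *. set (sx := exp x - exp (- x)) in *.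
  set (cy := exp y + exp (- y)) in *. set (sy := exp y - exp (- y)) in *.
  assert (Sx : Rabs sx <= cx) by (apply Rabs_le; unfold sx, cx; lra).
  assert (Sy : Rabs sy <= cy) by (apply Rabs_le; unfold sy, cy; lra).
  assert (Hcx : 0 < cx) by (unfold cx; lra). assert (Hcy : 0 < cy) by (unfold cy; lra).
  assert (Hcb : forall i, (i < 6)%nat -> Rabs (cf i x y t) <= B) by (intros; apply (ck_bd _ _ _ _ _ Hok); auto; lra).
  assert (K0 := Hcb 0%nat ltac:(lia)). assert (K2 := Hcb 2%nat ltac:(lia)). assert (K3 := Hcb 3%nat ltac:(lia)).
  assert (K4 := Hcb 4%nat ltac:(lia)). assert (K5 := Hcb 5%nat ltac:(lia)).
  assert (M0 : cf 0%nat x y t * cx <= B * cx) by (apply Rabs_le_between in K0; apply Rmult_le_compat_r; lra).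
  assert (M2 : cf 2%nat x y t * cy <= B * cy) by (apply Rabs_le_between in K2; apply Rmult_le_compat_r; lra).
  assert (M3 : cf 3%nat x y t * sx <= B * cx).
  { eapply Rle_trans; [apply Rle_abs|]. apply product_abs_le; auto. }
  assert (M4 : cf 4%nat x y t * sy <= B * cy).
  { eapply Rle_trans; [apply Rle_abs|]. apply product_abs_le; auto. }
  assert (M5 : cf 5%nat x y t * Rabs (1 * Fx x y t + eta * (e * sx)) <= cf 5%nat x y t * Rabs (Fx x y t) + eta * e * (B * cx)).
  { rewrite Rmult_1_l.
    assert (Z : cf 5%nat x y t * (Rabs (Fx x y t + eta * (e * sx)) - Rabs (Fx x y t)) <= B * (eta * e * cx)).
    { eapply Rle_trans; [apply Rle_abs|]. apply product_abs_le; auto.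
      eapply Rle_trans; [apply Rabs_triang_inv2|].
      replace (Fx x y t + eta * (e * sx) - Fx x y t) with (eta * e * sx) by ring.
      assert (0 <= eta * e) by nra. rewrite Rabs_mult, (Rabs_right (eta * e)) by lra. apply Rmult_le_compat_l; auto. }
    lra. }
  assert (Hee : 0 <= eta * e) by nra.
  assert (HBx : 0 < B * cx) by nra. assert (HBy : 0 < B * cy) by nra.
  assert (N : eta * e * (- (3 * B) * (cx + cy) + / 2 * (cf 0%nat x y t * cx + cf 2%nat x y t * cy)
     + cf 3%nat x y t * sx + cf 4%nat x y t * sy + B * cx) <= eta * e * 0) by (apply Rmult_le_compat_l; lra).
  lra.
Qed.

(** It follows from [ln rho <= 2 sqrt rho] and [8 k <= sqrt rho]. *)
Lemma Rpower_exp_bound (k rho : R) : 0 < k -> 1 <= rho -> 64 * k ^ 2 <= rho -> Rpower rho k <= exp (rho / 4).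
Proof.
  intros Hk H1 Hr. apply exp_mono. set (s := sqrt rho).
  assert (Hs : 0 < s) by (apply sqrt_lt_R0; lra). assert (Hss : s * s = rho) by (apply sqrt_sqrt; lra).
  assert (Hln : ln rho <= 2 * s).
  { rewrite <- Hss, ln_mult by auto. assert (A := exp_ineq1_le (ln s)). rewrite exp_ln in A by auto. lra. }
  assert (H8 : 8 * k <= s) by (apply Rsqr_incr_0_var; [unfold Rsqr; nra|lra]).
  assert (k * ln rho <= k * (2 * s)) by (apply Rmult_le_compat_l; lra). nra.
Qed.

Lemma exp_abs_le (x : R) : exp (Rabs x) <= exp x + exp (- x).
Proof.
  assert (A := exp_pos x). assert (B := exp_pos (- x)). unfold Rabs. destruct (Rcase_abs x); lra.
Qed.

Lemma logw_growth (T r : R) (P : R -> R -> R -> R) : 0 < T -> 0 <= r -> classC T P ->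
  exists R0, 1 <= R0 /\ forall x y t, 0 <= t <= T -> R0 <= Rabs x + Rabs y ->
    Rabs (logw T r P x y t) <= 2 * exp ((Rabs x + Rabs y) / 4).
Proof.
  intros HT Hr (_ & k & Hk & HC). destruct (HC 1 Rlt_0_1) as (M & HM).
  exists (Rmax (Rmax 1 M) (64 * k ^ 2)). assert (A1 := Rmax_l (Rmax 1 M) (64 * k ^ 2)).
  assert (A2 := Rmax_r (Rmax 1 M) (64 * k ^ 2)). assert (A3 := Rmax_l 1 M). assert (A4 := Rmax_r 1 M).
  split; [lra|]. intros x y t Ht Hxy. set (q := Rabs x + Rabs y) in *.
  unfold logw. rewrite clamp_id by lra. rewrite Rabs_mult, (Rabs_right (exp _)) by (left; apply exp_pos).
  assert (HG : inG T (exp x) (exp y) t) by (split; [|split]; auto; apply exp_pos).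
  assert (H := HM _ _ _ HG). rewrite (ln_exp x), (ln_exp y) in H. fold q in H.
  specialize (H ltac:(lra)).
  assert (Hp : rpow q k = Rpower q k) by (unfold rpow; destruct (Rle_dec q 0); lra).
  rewrite Hp in H. assert (Pp := Rpower_pos q k).
  assert (HB := Rpower_exp_bound k q Hk ltac:(lra) ltac:(lra)).
  assert (H2 : Rabs (P (exp x) (exp y) t) <= 1 + Rpower q k).
  { apply Rmult_le_reg_r with (/ (1 + Rpower q k)); [apply Rinv_0_lt_compat; lra|].
    rewrite Rinv_r by lra. exact H. }
  assert (H3 : exp (- r * t) <= 1).
  { rewrite <- exp_0. apply exp_mono. assert (0 <= r * t) by (apply Rmult_le_pos; lra). lra. }
  assert (H4 := exp_pos (- r * t)). assert (H5 := Rabs_pos (P (exp x) (exp y) t)).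
  assert (H6 := exp_ineq1_le (q / 4)). nra.
Qed.

Lemma growth_dominates (T r K eta : R) (P1 P2 : R -> R -> R -> R) : 0 < T -> 0 <= r -> 0 <= K -> 0 < eta ->
  classC T P1 -> classC T P2 ->
  exists rad, 0 < rad /\ forall x y t, 0 <= t <= T -> rad <= Rabs x \/ rad <= Rabs y ->
    logw T r P1 x y t - eta * growth K T x y t <= logw T r P2 x y t.
Proof.
  intros HT Hr HK Heta HC1 HC2.
  destruct (logw_growth T r P1 HT Hr HC1) as (R1 & HR1 & H1).
  destruct (logw_growth T r P2 HT Hr HC2) as (R2 & HR2 & H2).
  assert (Hi : 0 < 16 / eta) by (apply Rdiv_lt_0_compat; lra).
  exists (R1 + R2 + 16 / eta). split; [lra|]. intros x y t Ht Hxy.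
  assert (X := Rabs_pos x). assert (Y := Rabs_pos y). set (q := Rabs x + Rabs y).
  assert (Hq : R1 + R2 + 16 / eta <= q) by (unfold q; destruct Hxy; lra).
  assert (B1 := H1 x y t Ht ltac:(fold q; lra)). assert (B2 := H2 x y t Ht ltac:(fold q; lra)). fold q in B1, B2.
  assert (G := growth_ge K T x y t HK ltac:(lra)).
  assert (Ex := exp_abs_le x). assert (Ey := exp_abs_le y).
  (* The larger of [|x|] and [|y|] is at least [q / 2]; growth of order [exp (q / 2)] beats the
     [exp (q / 4)] of [logw_growth] as soon as [q >= 16 / eta]. *)
  assert (Eq : exp (q / 2) <= exp (Rabs x) + exp (Rabs y)).
  { assert (P1' := exp_pos (Rabs x)). assert (P2' := exp_pos (Rabs y)).
    destruct (Rle_dec (Rabs x) (Rabs y)).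
    - apply Rle_trans with (exp (Rabs y)); [apply exp_mono; unfold q|]; lra.
    - apply Rle_trans with (exp (Rabs x)); [apply exp_mono; unfold q|]; lra. }
  assert (E4 : exp (q / 2) = exp (q / 4) * exp (q / 4)) by (rewrite <- exp_plus; f_equal; field).
  assert (E5 := exp_ineq1_le (q / 4)). assert (E6 := exp_pos (q / 4)).
  assert (E7 : 4 <= eta * exp (q / 4)).
  { apply Rle_trans with (eta * (4 / eta)); [right; field; lra|]. apply Rmult_le_compat_l; [lra|].
    assert (16 / eta = 4 * (4 / eta)) by (field; lra). lra. }
  assert (E8 : 4 * exp (q / 4) <= eta * exp (q / 4) * exp (q / 4)) by (apply Rmult_le_compat_r; lra).
  assert (E9 : eta * exp (q / 2) <= eta * growth K T x y t) by (apply Rmult_le_compat_l; lra).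
  rewrite E4 in E9. apply Rabs_le_between in B1. apply Rabs_le_between in B2. lra.
Qed.

Section Comparison.
Variables (T lamb B L rad : R) (cf : nat -> R -> R -> R -> R) (u v : R -> R -> R -> R).
Hypothesis Hok : coef_ok T lamb B L cf.
Hypotheses (HT : 0 < T) (Hrad : 0 < rad).
Hypotheses (Hu : cont3 u) (Hsub : vsubc T cf u) (Hsup : vsubc T (flip cf) (fun x y t => - u x y t)).
Hypotheses (Hv : cont3 v) (Hvsub : vsubc T cf v).
Hypothesis Hfar : forall x y t, 0 <= t <= T -> rad <= Rabs x \/ rad <= Rabs y -> v x y t <= u x y t.

(** The data of the step are smoothed from [u], which is regular because it is both a sub- and a
    supersolution; at the start of the step [v] enters only through [v <= u + m]. Adding the two
    estimates of [smooth_step] at the centre cancels [V + N]. Outside the square [Hfar] decides. *)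
Lemma comparison_step (T' : R) : T' < T -> exists C, 0 <= C /\ forall t tau m, 0 < tau <= 1 -> 0 <= t -> t + tau <= T' -> 0 <= m ->
  (forall x y, v x y (t + tau) <= u x y (t + tau) + m) ->
  forall x y, v x y t <= u x y t + m + C * Rpower tau (10 / 9).
Proof.
  intros HT'.
  assert (Hreg := reg_c1alpha T lamb B L cf u Hok Hu Hsub Hsup HT).
  destruct (Hreg (rad + 1) T' ltac:(lra) HT') as (C & HC & HR).
  destruct (cont3_bounded u (rad + 2 + T) Hu) as (F1 & HF1 & Hu1).
  destruct (cont3_bounded v (rad + 2 + T) Hv) as (F2 & HF2 & Hv2).
  set (F := F1 + F2).
  assert (HF : forall x y a, Rabs x <= rad + 2 -> Rabs y <= rad + 2 -> 0 <= a <= T ->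
    Rabs (u x y a) <= F /\ v x y a <= F).
  { intros x y a Hx Hy Ha. assert (Hra : Rabs a <= rad + 2 + T) by (rewrite Rabs_right; lra).
    assert (E1 := Hu1 x y a ltac:(lra) ltac:(lra) Hra). assert (E2 := Hv2 x y a ltac:(lra) ltac:(lra) Hra).
    apply Rabs_le_between in E2. unfold F. lra. }
  set (Sc := step_const lamb B L F C (11 / 18)).
  exists (2 * Rabs Sc). assert (HSc := Rabs_pos Sc). assert (HSc' := Rle_abs Sc). split; [lra|].
  intros t tau m Htau Ht HtT Hm Hini x0 y0.
  assert (HP : 0 < Rpower tau (10 / 9)) by apply exp_pos.
  assert (HSP : 0 <= Rabs Sc * Rpower tau (10 / 9)) by (apply Rmult_le_pos; lra).
  destruct (classic (rad <= Rabs x0 \/ rad <= Rabs y0)) as [Hf|Hn].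
  { assert (Z := Hfar x0 y0 t ltac:(lra) Hf). lra. }
  assert (Hx0 : Rabs x0 <= rad) by (apply Rnot_lt_le; intros Hc; apply Hn; lra).
  assert (Hy0 : Rabs y0 <= rad) by (apply Rnot_lt_le; intros Hc; apply Hn; lra).
  assert (Hbox : forall x y a, inbox x0 y0 x y -> t <= a <= t + tau -> Rabs (u x y a) <= F /\ v x y a <= F).
  { intros x y a [Hx Hy] Ha. apply HF; [| |lra].
    - replace x with (x0 + (x - x0)) by ring. assert (Z := proj1 (Rabs_shift x0 (x - x0) rad 1 Hx0 Hx)). lra.
    - replace y with (y0 + (y - y0)) by ring. assert (Z := proj1 (Rabs_shift y0 (y - y0) rad 1 Hy0 Hy)). lra. }
  destruct (smooth_step T lamb B L cf u Hok Hu rad F C (11 / 18) tau t x0 y0)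
    as (l & p1 & p2 & p3 & N & theta & _ & _ & _ & S1 & S2); auto; try lra.
  { unfold F; lra. }
  { intros x y Hx Hy. apply HF; auto. lra. }
  { intros x y a b Hx Hy Hab. apply HR; auto. lra. }
  replace (11 / 18 + / 2) with (10 / 9) in S1, S2 by field. fold Sc in S1, S2.
  assert (Hc : (x0 - x0) ^ 2 + (y0 - y0) ^ 2 <= tau) by (rewrite !Rminus_diag; lra).
  assert (A1 : v x0 y0 t <= V p1 p2 p3 l x0 y0 + N + m + Sc * Rpower tau (10 / 9)).
  { apply S1; auto. intros x y a Hi Ha. apply (Hbox x y a Hi Ha). }
  assert (A2 : - u x0 y0 t <= - V p1 p2 p3 l x0 y0 - N + 0 + Sc * Rpower tau (10 / 9)).
  { apply (S2 (fun x y t => - u x y t)); auto; try lra.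
    - apply (cont3_ext (fun x y t => (-1) * u x y t)); [intros; ring|]. apply cont3_scal; auto.
    - intros x y a Hi Ha. destruct (Hbox x y a Hi Ha) as [Z _]. apply Rabs_le_between in Z. lra.
    - intros x y Hi. cbv beta. lra. }
  assert (HSS : Sc * Rpower tau (10 / 9) <= Rabs Sc * Rpower tau (10 / 9)) by (apply Rmult_le_compat_r; lra).
  lra.
Qed.

(** Over [n] steps the errors add up to a multiple of [n tau^(10/9) = (T' - t) tau^(1/9)], which
    tends to 0. *)
Lemma comparison_interval (T' m t : R) : 0 <= t -> t < T' -> T' < T -> 0 <= m ->
  (forall x y, v x y T' <= u x y T' + m) -> forall x y, v x y t <= u x y t + m.
Proof.
  intros Ht HtT HT' Hm Hini. destruct (comparison_step T' HT') as (C & HC & Hstep).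
  assert (Hn : forall n, (0 < n)%nat -> (T' - t) / INR n <= 1 ->
    forall x y, v x y t <= u x y t + (m + C * (T' - t) * Rpower ((T' - t) / INR n) (1 / 9))).
  { intros n Hn Hn1. assert (Hpn : 0 < INR n) by (apply lt_0_INR; auto). set (tau := (T' - t) / INR n) in *.
    assert (Htau : 0 < tau) by (apply Rdiv_lt_0_compat; lra).
    assert (Hnt : INR n * tau = T' - t) by (unfold tau; field; lra).
    assert (HP : 0 < Rpower tau (10 / 9)) by apply exp_pos.
    assert (HCP : 0 <= C * Rpower tau (10 / 9)) by (apply Rmult_le_pos; lra).
    assert (H : forall j, (j <= n)%nat -> forall x y,
      v x y (T' - INR j * tau) <= u x y (T' - INR j * tau) + (m + INR j * (C * Rpower tau (10 / 9)))).
    { induction j as [|j IH]; intros Hj x y.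
      - simpl. rewrite !Rmult_0_l, Rminus_0_r, Rplus_0_r. auto.
      - assert (Hjn : INR (S j) <= INR n) by (apply le_INR; auto). assert (Hj0 := pos_INR j).
        assert (Hjt : INR (S j) * tau <= INR n * tau) by (apply Rmult_le_compat_r; lra).
        assert (HjP : 0 <= INR j * (C * Rpower tau (10 / 9))) by (apply Rmult_le_pos; auto).
        assert (Hjt0 : 0 <= INR j * tau) by (apply Rmult_le_pos; lra).
        rewrite S_INR in *.
        assert (A := Hstep (T' - (INR j + 1) * tau) tau (m + INR j * (C * Rpower tau (10 / 9)))).
        replace (T' - (INR j + 1) * tau + tau) with (T' - INR j * tau) in A by ring.
        specialize (A ltac:(lra) ltac:(lra) ltac:(lra) ltac:(lra) (IH ltac:(lia)) x y). lra. }
    intros x y. specialize (H n (le_n n) x y). rewrite Hnt in H.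
    replace (T' - (T' - t)) with t in H by ring.
    replace (INR n * (C * Rpower tau (10 / 9))) with (C * (T' - t) * Rpower tau (1 / 9)) in H; auto.
    replace (10 / 9) with (1 + 1 / 9) by field. rewrite Rpower_plus, Rpower_1, <- Hnt by auto. ring. }
  intros x y. apply le_epsilon. intros e He.
  (* For [tau <= (e / K)^9] the accumulated error is at most [e]; the added 1 allows division by
     [K]. *)
  set (K := C * (T' - t) + 1). assert (HK : 0 < K) by (unfold K; assert (0 <= C * (T' - t)) by (apply Rmult_le_pos; lra); lra).
  set (d := Rmin 1 (Rpower (e / K) 9)). assert (Hd1 := Rmin_l 1 (Rpower (e / K) 9)).
  assert (Hd2 := Rmin_r 1 (Rpower (e / K) 9)). fold d in Hd1, Hd2.
  assert (Hd : 0 < d) by (apply Rmin_glb_lt; [lra|apply exp_pos]).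
  destruct (INR_unbounded ((T' - t) / d)) as (n & Hnn).
  assert (HTd : 0 < (T' - t) / d) by (apply Rdiv_lt_0_compat; lra).
  assert (Hpn : 0 < INR n) by lra.
  assert (Hsm : (T' - t) / INR n <= d).
  { apply Rmult_le_reg_r with (INR n); auto. unfold Rdiv. rewrite Rmult_assoc, Rinv_l, Rmult_1_r by lra.
    replace (T' - t) with ((T' - t) / d * d) by (field; lra). rewrite Rmult_comm. apply Rmult_le_compat_l; lra. }
  assert (A := Hn n ltac:(apply INR_lt; simpl; auto) ltac:(lra) x y).
  assert (Htp : 0 < (T' - t) / INR n) by (apply Rdiv_lt_0_compat; lra).
  assert (Hek : 0 < e / K) by (apply Rdiv_lt_0_compat; lra).
  assert (Hr : Rpower ((T' - t) / INR n) (1 / 9) <= e / K).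
  { apply Rle_trans with (Rpower (Rpower (e / K) 9) (1 / 9)); [apply Rpower_mono; lra|].
    rewrite Rpower_mult. replace (9 * (1 / 9)) with 1 by field. rewrite Rpower_1; lra. }
  assert (HCT : 0 <= C * (T' - t)) by (apply Rmult_le_pos; lra).
  assert (Hfin : C * (T' - t) * Rpower ((T' - t) / INR n) (1 / 9) <= e).
  { apply Rle_trans with (K * (e / K)); [|right; field; lra].
    apply Rmult_le_compat; auto. left; apply exp_pos. unfold K; lra. }
  lra.
Qed.

(** Regularity of [u] is available only strictly before [T], so the terminal inequality is carried
    to [T - s] with a loss [e], by uniform continuity on the square and by [Hfar] outside it. *)
Theorem comparison : (forall x y, v x y T <= u x y T) -> forall x y t, 0 <= t <= T -> v x y t <= u x y t.
Proof.
  intros Hini x y t Ht. destruct (Req_dec t T) as [->|Hne]; auto.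
  apply le_epsilon. intros e He.
  destruct (cont3_uniform u (rad + T) (e / 2) Hu ltac:(lra)) as (d1 & Hd1 & U1).
  destruct (cont3_uniform v (rad + T) (e / 2) Hv ltac:(lra)) as (d2 & Hd2 & U2).
  set (s := Rmin (Rmin d1 d2) (T - t) / 2).
  assert (M1 := Rmin_l (Rmin d1 d2) (T - t)). assert (M2 := Rmin_r (Rmin d1 d2) (T - t)).
  assert (M3 := Rmin_l d1 d2). assert (M4 := Rmin_r d1 d2).
  assert (M5 : 0 < Rmin (Rmin d1 d2) (T - t)) by (apply Rmin_glb_lt; [apply Rmin_glb_lt|]; lra).
  apply (comparison_interval (T - s) e t); try (unfold s; lra).
  intros a b. destruct (classic (rad <= Rabs a \/ rad <= Rabs b)) as [Hf|Hn].
  - assert (Z := Hfar a b (T - s) ltac:(unfold s; lra) Hf). lra.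
  - assert (Ha : Rabs a <= rad) by (apply Rnot_lt_le; intros Hc; apply Hn; lra).
    assert (Hb : Rabs b <= rad) by (apply Rnot_lt_le; intros Hc; apply Hn; lra).
    assert (HRT : Rabs T <= rad + T) by (rewrite Rabs_right; lra).
    assert (Hs : Rabs (T - s - T) < d1 /\ Rabs (T - s - T) < d2).
    { replace (T - s - T) with (- s) by ring. rewrite Rabs_Ropp, Rabs_right; unfold s; lra. }
    assert (E1 := U1 a b T a b (T - s)). assert (E2 := U2 a b T a b (T - s)).
    rewrite !Rminus_diag, Rabs_R0 in E1, E2.
    specialize (E1 ltac:(lra) ltac:(lra) HRT Hd1 Hd1 (proj1 Hs)). specialize (E2 ltac:(lra) ltac:(lra) HRT Hd2 Hd2 (proj2 Hs)).
    apply Rabs_def2 in E1, E2. assert (Z := Hini a b). lra.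
Qed.
End Comparison.

Theorem theorem2p7 (T r rho : R) (mu sigma a b : R -> R -> R) (g : R -> R)
    (alpha1 alpha2 : R) (P1 P2 : R -> R -> R -> R) :
  0 < T -> 0 <= r -> -1 <= rho <= 1 ->
  standing T r rho mu sigma a b g ->
  (forall S t, 0 < S -> 0 <= t <= T -> 0 < sigma S t) ->
  0 <= alpha1 -> alpha1 < alpha2 ->
  visc_solution T r rho mu sigma a b g alpha1 P1 -> classC T P1 ->
  visc_solution T r rho mu sigma a b g alpha2 P2 -> classC T P2 ->
  forall S H t, inG T S H t -> P1 S H t <= P2 S H t.
Proof.
  intros HT Hr Hrho Hst Hsig Ha1 Ha2 HP1 HC1 HP2 HC2 S H t (HS & HH & Ht).
  destruct (log_coef_ok T r rho alpha2 mu sigma a b g HT Hr Hrho ltac:(lra) Hst) as (lamb & B & L & Hok).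
  assert (W1 := log_sub_coef T r rho alpha1 alpha2 mu sigma a b g P1 Hsig ltac:(lra) HP1).
  assert (W2 := log_sub_coef T r rho alpha2 alpha2 mu sigma a b g P2 Hsig ltac:(lra) HP2).
  assert (W3 := log_super_coef T r rho alpha2 mu sigma a b g P2 HP2).
  assert (K1 := logw_cont T r P1 HT (proj1 HP1)). assert (K2 := logw_cont T r P2 HT (proj1 HP2)).
  assert (HB := ck_B _ _ _ _ _ Hok).
  assert (Hgc : cont3 (growth (3 * B) T)) by apply (sm_c _ _ _ _ _ _ _ (growth_smooth (3 * B) T)).
  (* Subtracting a small multiple of [growth] secures the inequality far out and preserves both the
     subsolution property and the order at [T]; [eta] is arbitrary, which removes the correction
     afterwards. *)
  assert (Hmain : forall eta x y s, 0 < eta -> 0 <= s <= T ->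
    logw T r P1 x y s - eta * growth (3 * B) T x y s <= logw T r P2 x y s).
  { intros eta x y s Heta Hs.
    destruct (growth_dominates T r (3 * B) eta P1 P2 HT Hr ltac:(lra) Heta HC1 HC2) as (rad & Hrad & Hfar).
    apply (comparison T lamb B L rad (log_coef r rho alpha2 mu sigma a b) (logw T r P2)
      (fun x y s => logw T r P1 x y s - eta * growth (3 * B) T x y s)); auto.
    - apply (cont3_ext (fun x y s => logw T r P1 x y s + (- eta) * growth (3 * B) T x y s)); [intros; ring|].
      apply cont3_plus; auto. apply cont3_scal; auto.
    - apply (vsubc_growth T lamb B L); auto. lra.
    - intros x' y'. assert (G := growth_ge (3 * B) T x' y' T ltac:(lra) (Rle_refl T)).
      assert (E1 := exp_pos x'). assert (E2 := exp_pos (- x')). assert (E3 := exp_pos y'). assert (E4 := exp_pos (- y')).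
      assert (0 <= eta * growth (3 * B) T x' y' T) by (apply Rmult_le_pos; lra).
      unfold logw. rewrite clamp_id by lra.
      destruct HP1 as (_ & _ & _ & ->); try apply exp_pos. destruct HP2 as (_ & _ & _ & ->); try apply exp_pos. lra. }
  assert (Hle : logw T r P1 (ln S) (ln H) t <= logw T r P2 (ln S) (ln H) t).
  { apply le_epsilon. intros e He. assert (G := growth_ge (3 * B) T (ln S) (ln H) t ltac:(lra) (proj2 Ht)).
    assert (E1 := exp_pos (ln S)). assert (E2 := exp_pos (- ln S)). assert (E3 := exp_pos (ln H)). assert (E4 := exp_pos (- ln H)).
    set (q := growth (3 * B) T (ln S) (ln H) t) in *.
    assert (A := Hmain (e / q) (ln S) (ln H) t ltac:(apply Rdiv_lt_0_compat; lra) Ht). fold q in A.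
    replace (e / q * q) with e in A by (field; lra). lra. }
  unfold logw in Hle. rewrite clamp_id, !exp_ln in Hle by auto.
  apply Rmult_le_reg_l in Hle; auto. apply exp_pos.
Qed.
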